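(* Let $0<\beta<1$, $0\le\alpha<n$ with $\alpha+\beta<n$, $1<p,q<\infty$, $1/q=1/p-(\alpha+\beta)/n$, $-n/p\le\lambda<0$, $\alpha+\beta+\lambda<0$, and set $\nu=\alpha+\beta+\lambda$. Let $b\in L^1_{loc}(\mathbb{R}^n)$. Suppose $\Omega\in L^\infty(\mathbb{S}^{n-1})$ is a nonzero function homogeneous of degree $0$, with $\int_{\mathbb{S}^{n-1}}\Omega(x')\,d\sigma(x')=0$ if $\alpha=0$. If there exist a nonempty open subset $E\subset\mathbb{S}^{n-1}$ and constants $c,C$ with $0<c<C$ or $c<C<0$ such that $c\le\Omega(x')\le C$ for all $x'\in E$, then the following statements are equivalent: (1) $b\in\mathrm{Lip}_\beta(\mathbb{R}^n)$; (2) $[b,T_\alpha]$ is bounded from $L^p(\mathbb{R}^n)$ to $L^q(\mathbb{R}^n)$; (3) $[b,T_\alpha]$ is bounded from $M^{p,\lambda}(\mathbb{R}^n)$ to $M^{q,\nu}(\mathbb{R}^n)$. In particular, if $\Omega\in C(\mathbb{S}^{n-1})$ is a nonzero function homogeneous of degree $0$, with $\int_{\mathbb{S}^{n-1}}\Omega(x')\,d\sigma(x')=0$ if $\alpha=0$, then the three statements $b\in\mathrm{Lip}_\beta(\mathbb{R}^n)$, $[b,T_\alpha]$ is bounded from $L^p(\mathbb{R}^n)$ to $L^q(\mathbb{R}^n)$, and $[b,T_\alpha]$ is bounded from $M^{p,\lambda}(\mathbb{R}^n)$ to $M^{q,\nu}(\mathbb{R}^n)$ are equivalent.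
   Context: $T_\alpha f(x)=\int_{\mathbb{R}^n}\frac{\Omega(x-y)}{|x-y|^{n-\alpha}}f(y)\,dy$ (principal value when $\alpha=0$); $[b,T_\alpha]f=bT_\alpha f-T_\alpha(bf)$. For $0<p<\infty$, $-n/p\le\lambda<0$, the Morrey space $M^{p,\lambda}(\mathbb{R}^n)$ consists of $f\in L^p_{loc}$ with $\|f\|_{M^{p,\lambda}}:=\sup_Q\frac1{|Q|^{\lambda/n}}\left(\frac1{|Q|}\int_Q|f(y)|^p\,dy\right)^{1/p}<\infty$, supremum over all cubes. $\mathrm{Lip}_\beta(\mathbb{R}^n)$ is the space of Hölder continuous functions of order $\beta$ (equivalently, up to null sets, $\sup_Q|Q|^{-1-\beta/n}\int_Q|b-b_Q|<\infty$). *)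

(* Defs.v *)
From HB Require Import structures.
From mathcomp Require Import all_boot all_order all_algebra.
From mathcomp Require Import all_classical all_reals all_analysis.
From mathcomp Require Import measurable_realfun ess_sup_inf.

Set Implicit Arguments.
Unset Strict Implicit.
Unset Printing Implicit Defensive.

Import Order.TTheory GRing.Theory Num.Theory.
Import numFieldNormedType.Exports.

Local Open Scope classical_set_scope.
Local Open Scope ring_scope.

(* The Borel sigma-algebra of R^n, as the product sigma-algebra (the row-vector
   analogue of the library's instance on n.-tuple T). *)
Section measurable_rV.
Context {R : realType} (n : nat).

Let coors : 'I_n -> 'rV[R]_n -> measurableTypeR R := fun i x => x ord0 i.

Let rV_set0 : g_sigma_preimage coors set0.
Proof. exact: sigma_algebra0. Qed.

Let rV_setC A : g_sigma_preimage coors A -> g_sigma_preimage coors (~` A).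
Proof. exact: sigma_algebraC. Qed.

Let rV_bigcup (F : _^nat) : (forall i, g_sigma_preimage coors (F i)) ->
  g_sigma_preimage coors (\bigcup_i (F i)).
Proof. exact: sigma_algebra_bigcup. Qed.

HB.instance Definition _ := @isMeasurable.Build
  (measure_tuple_display R.-ocitv.-measurable.-sigma)
  'rV[R]_n (g_sigma_preimage coors) rV_set0 rV_setC rV_bigcup.

End measurable_rV.

Lemma measurable_fun_rVP {R : realType} n d (T : measurableType d)
    (f : T -> 'rV[R]_n) :
  measurable_fun [set: T] f <->
  forall i, measurable_fun [set: T] (fun t => f t ord0 i : measurableTypeR R).
Proof.
pose coors := fun (i : 'I_n) (x : 'rV[R]_n) => x ord0 i : measurableTypeR R.
apply: (@iff_trans _ (g_sigma_preimage (fun i => coors i \o f) `<=` measurable)).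
  rewrite g_sigma_preimage_comp; split=> [mf A [/= C preC <-]|prefS].
    exact: mf.
  by move=> _ A mA; apply: prefS; exists A.
split=> [fS i|mf].
- move=> _ A mA.
  apply: fS; apply: sub_sigma_algebra.
  case: n i => [[] []//|n i] in f coors *.
  rewrite -bigcup_mkord_ord.
  exists i; first exact: ltn_ord.
  by exists A => //; rewrite inord_val.
- apply: smallest_sub; first exact: sigma_algebra_measurable.
  case: n => [|n] in f coors mf *; first by rewrite big_ord0.
  rewrite -bigcup_mkord_ord; apply: bigcup_sub => i Ii.
  by move=> A [B mB <-]; exact: mf.
Qed.

Lemma measurable_coord {R : realType} n (i : 'I_n) :
  measurable_fun [set: 'rV[R]_n] (fun x => x ord0 i : measurableTypeR R).
Proof. by move: i; apply/measurable_fun_rVP; exact: measurable_id. Qed.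

(* Lebesgue measure on R^n, as the n-fold product of the one on R. *)
Section lebesgue_rV.
Context {R : realType}.
Local Open Scope ereal_scope.

Definition cons_rV n (u : measurableTypeR R * 'rV[R]_n) : 'rV[R]_n.+1 :=
  \row_(i < n.+1) oapp (u.2 ord0) u.1 (unlift ord0 i).

Lemma measurable_cons_rV n :
  measurable_fun [set: measurableTypeR R * 'rV[R]_n] (@cons_rV n).
Proof.
apply/measurable_fun_rVP => i.
case: (unliftP ord0 i) => [j ->|->].
- under eq_fun do rewrite mxE liftK /=.
  apply: (@measurableT_comp _ _ _ _ _ _ (fun x : 'rV[R]_n => x ord0 j)).
    exact: measurable_coord.
  exact: measurable_snd.
- under eq_fun do rewrite mxE unlift_none /=.
  exact: measurable_fst.
Qed.

Section succ.
Context (n : nat) (m : {sigma_finite_measure set 'rV[R]_n -> \bar R}).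

Definition lebesgue_rVS : set 'rV[R]_n.+1 -> \bar R :=
  pushforward ((@lebesgue_measure R) \x m) (@cons_rV n).

HB.instance Definition _ := Measure.copy lebesgue_rVS
  (measure_function_pushforward__canonical__measure_function_Measure
     ((@lebesgue_measure R) \x m) (@measurable_cons_rV n)).

Let uncons (x : 'rV[R]_n.+1) : measurableTypeR R * 'rV[R]_n :=
  (x ord0 ord0, \row_j x ord0 (lift ord0 j)).

Let measurable_uncons : measurable_fun [set: 'rV[R]_n.+1] uncons.
Proof.
apply: measurable_fun_pair; first exact: measurable_coord.
apply/measurable_fun_rVP => j; under eq_fun do rewrite mxE.
exact: measurable_coord.
Qed.

Let cons_rVK u : uncons (@cons_rV n u) = u.
Proof.
case: u => x v; rewrite /uncons /cons_rV mxE unlift_none /=; congr pair.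
by apply/rowP => j; rewrite !mxE liftK.
Qed.

Let sigma_finite_lebesgue_rVS : sigma_finite setT lebesgue_rVS.
Proof.
have /sigma_finiteP[F [TF ndF Foo]] := sigma_finiteT (@lebesgue_measure R).
have /sigma_finiteP[G [TG ndG Goo]] := sigma_finiteT m.
exists (fun k => uncons @^-1` (F k `*` G k)) => [|k].
  rewrite -preimage_bigcup (_ : \bigcup_k _ = setT) ?preimage_setT//.
  rewrite -setXTT TF TG predeqE => -[x y]; split.
    by move=> [i _ []/= ? ?]; split; exists i.
  move=> [/= [i _ Fix] [k _ Gky]]; exists (maxn i k) => //; split.
  - by move: x Fix; exact/subsetPset/ndF/leq_maxl.
  - by move: y Gky; exact/subsetPset/ndG/leq_maxr.
have [? ?] := Foo k; have [? ?] := Goo k.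
have mFG : measurable (F k `*` G k) by exact: measurableX.
split; first by rewrite -[X in measurable X]setTI; exact: measurable_uncons.
rewrite /lebesgue_rVS /pushforward -comp_preimage.
rewrite (_ : uncons \o @cons_rV n = id); last by apply/funext => u /=.
by rewrite preimage_id product_measure1E// lte_mul_pinfty// ge0_fin_numE.
Qed.

HB.instance Definition _ := Measure_isSigmaFinite.Build _ _ _
  lebesgue_rVS sigma_finite_lebesgue_rVS.

End succ.

Let sigma_finite_dirac_rV0 : sigma_finite setT (@dirac _ 'rV[R]_0 0%R R).
Proof. by apply: fin_num_fun_sigma_finite; [rewrite measure0|exact: fin_num_measure]. Qed.

HB.instance Definition _ := Measure_isSigmaFinite.Build _ _ _
  (@dirac _ 'rV[R]_0 0%R R) sigma_finite_dirac_rV0.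

Fixpoint lebesgue_rV n : {sigma_finite_measure set 'rV[R]_n -> \bar R} :=
  match n with
  | 0 => @dirac _ 'rV[R]_0 0%R R
  | n'.+1 => lebesgue_rVS (lebesgue_rV n')
  end.

End lebesgue_rV.
Arguments lebesgue_rV {R} n.

(* The library's norm on 'rV[R]_n is the sup norm (it induces the usual
   topology); |x| in R^n is the Euclidean one. *)
Definition enorm {R : realType} n (x : 'rV[R]_n) : R :=
  Num.sqrt (\sum_(i < n) x ord0 i ^+ 2).

Definition unit_sphere {R : realType} n : set 'rV[R]_n := [set x | enorm x = 1].
Arguments unit_sphere {R} n.

Section sphere_measure.
Context {R : realType} (n : nat).

Lemma measurable_enorm :
  measurable_fun [set: 'rV[R]_n] (@enorm R n).
Proof.
apply: (@measurableT_comp _ _ _ _ _ _ (@Num.sqrt R)).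
  exact: (continuous_measurable_fun (@sqrt_continuous R)).
apply: measurable_sum => i; apply: measurable_funX; exact: measurable_coord.
Qed.

Definition normalize (x : 'rV[R]_n) : 'rV[R]_n := (enorm x)^-1 *: x.

Lemma measurable_normalize : measurable_fun [set: 'rV[R]_n] normalize.
Proof.
apply/measurable_fun_rVP => i; under eq_fun do rewrite mxE.
apply: measurable_funM; last exact: measurable_coord.
under eq_fun do rewrite -powR_inv1 ?sqrtr_ge0//.
apply: (@measurableT_comp _ _ _ _ _ _ (fun r : R => r `^ (-1))).
  exact: measurable_powR.
exact: measurable_enorm.
Qed.

Lemma measurable_punctured_ball :
  measurable [set x : 'rV[R]_n | 0 < enorm x <= 1].
Proof.
rewrite (_ : [set _ | _] = setT `&` (@enorm R n) @^-1` `]0, 1]); last first.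
  by rewrite setTI; apply/seteqP; split => x /=; rewrite in_itv.
by apply: measurable_enorm => //; exact: measurable_itv.
Qed.

(* Surface measure: sigma(A) = n |{x : 0 < |x| <= 1, x/|x| \in A}|, i.e. the
   measure such that dx = r^(n-1) dr dsigma in polar coordinates (counting
   measure on {-1, 1} when n = 1). It lives on R^n, carried by the sphere. *)
Definition sphere_measure : {measure set 'rV[R]_n -> \bar R} :=
  mscale (n%:R)%:nng
    (measure_function_pushforward__canonical__measure_function_Measure
      (mrestr (lebesgue_rV n) measurable_punctured_ball) measurable_normalize).

End sphere_measure.
Arguments sphere_measure {R} n.

Section function_spaces.
Context {R : realType} {n : nat}.
Implicit Types (f b : 'rV[R]_n -> R) (p lambda beta : R).

Definition Lp_loc p f :=
  measurable_fun [set: 'rV[R]_n] f /\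
  forall K : set 'rV[R]_n, compact K ->
    (\int[lebesgue_rV n]_(x in K) (`|f x| `^ p)%:E < +oo)%E.

Definition cube (c : 'rV[R]_n) (r : R) : set 'rV[R]_n :=
  [set y | forall i, `|y ord0 i - c ord0 i| <= r].

Definition volume (Q : set 'rV[R]_n) : R := fine (lebesgue_rV n Q).

Definition morrey_norm p lambda f : \bar R :=
  ereal_sup [set N | exists (c : 'rV[R]_n) (r : R), 0 < r /\
    N = (((volume (cube c r) `^ (lambda / n%:R))^-1)%:E *
         (((volume (cube c r))^-1)%:E *
          \int[lebesgue_rV n]_(y in cube c r) (`|f y| `^ p)%:E) `^ p^-1)%E].

Definition morrey p lambda : set ('rV[R]_n -> R) :=
  [set f | Lp_loc p f /\ (morrey_norm p lambda f < +oo)%E].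

Definition holder beta f :=
  exists C : R, forall x y, `|f x - f y| <= C * enorm (x - y) `^ beta.

(* Locally integrable functions are classes modulo null sets: the class of b
   is in Lip_beta when it has a Hoelder continuous representative. *)
Definition Lip beta b :=
  exists2 g, holder beta g & b = g %[ae lebesgue_rV n].

End function_spaces.

Section singular_integral.
Context {R : realType} {n : nat}.
Implicit Types (f b Omega : 'rV[R]_n -> R) (alpha : R) (x y : 'rV[R]_n).

Definition homogeneous0 Omega :=
  forall (t : R) x, 0 < t -> x != 0 -> Omega (t *: x) = Omega x.

Definition integrand alpha Omega f x y : R :=
  Omega (x - y) / enorm (x - y) `^ (n%:R - alpha) * f y.

Definition T_truncated alpha Omega f x (eps : R) : R :=
  Rintegral (lebesgue_rV n) [set y | eps < enorm (x - y)]
    (integrand alpha Omega f x).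

Definition T_op alpha Omega f x : R :=
  if alpha == 0 then lim (T_truncated alpha Omega f x eps @[eps --> 0^'+])
  else Rintegral (lebesgue_rV n) setT (integrand alpha Omega f x).

(* T_op is total; T_defined says that its value at x is meaningful, i.e. that
   the integrals converge absolutely and, if alpha = 0, that the principal value
   exists. *)
Definition T_defined alpha Omega f x : Prop :=
  if alpha == 0 then
    (forall eps : R, 0 < eps ->
      (lebesgue_rV n).-integrable [set y | eps < enorm (x - y)]
        (EFin \o integrand alpha Omega f x)) /\
    cvg (T_truncated alpha Omega f x eps @[eps --> 0^'+])
  else (lebesgue_rV n).-integrable setT (EFin \o integrand alpha Omega f x).

Definition commutator b alpha Omega f x : R :=
  b x * T_op alpha Omega f x - T_op alpha Omega (b \* f) x.

(* [b, T_alpha] is defined a.e. on each f in X, its class modulo null sets is in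
   Y, and the operator norm is finite. *)
Definition commutator_bounded b alpha Omega
    (X : set ('rV[R]_n -> R)) (normX : ('rV[R]_n -> R) -> \bar R)
    (Y : set ('rV[R]_n -> R)) (normY : ('rV[R]_n -> R) -> \bar R) : Prop :=
  exists C : R, forall f, X f ->
    (\forall x \ae lebesgue_rV n,
      T_defined alpha Omega f x /\ T_defined alpha Omega (b \* f) x) /\
    exists g, [/\ Y g, commutator b alpha Omega f = g %[ae lebesgue_rV n]
                & (normY g <= C%:E * normX f)%E].

Definition commutator_bounded_Lp b alpha Omega (p q : R) : Prop :=
  commutator_bounded b alpha Omega
    [set f | f \in Lfun (lebesgue_rV n) p%:E]
    (fun f => 'N[lebesgue_rV n]_(p%:E) [EFin \o f])%E
    [set f | f \in Lfun (lebesgue_rV n) q%:E]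
    (fun f => 'N[lebesgue_rV n]_(q%:E) [EFin \o f])%E.

Definition commutator_bounded_morrey b alpha Omega (p lambda q nu : R) : Prop :=
  commutator_bounded b alpha Omega
    (morrey p lambda) (morrey_norm p lambda)
    (morrey q nu) (morrey_norm q nu).

End singular_integral.

(* Main.v *)
Require Import Defs.
From HB Require Import structures.
From mathcomp Require Import all_boot all_order all_algebra.
From mathcomp Require Import all_classical all_reals all_analysis.
From mathcomp Require Import measurable_realfun ess_sup_inf ring lra zify.

Set Implicit Arguments.
Unset Strict Implicit.
Unset Printing Implicit Defensive.

Import Order.TTheory GRing.Theory Num.Theory.
Import numFieldNormedType.Exports.

Local Open Scope classical_set_scope.
Local Open Scope ring_scope.

(** Write [T] for the operator, [K(u) = Omega(u) / |u|^(n - alpha)] for its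
    kernel and [gamma = alpha + beta].  The space [L^p] is the Morrey space of
    exponent [- n / p], so both notions of boundedness are instances of one
    estimate, [mor_bounded], and it is enough to prove that a Hoelder [b] gives
    this estimate for every exponent and that the estimate for one exponent
    makes [b] Hoelder.

    If [b] is Hoelder, the commutator is almost everywhere the absolutely
    convergent integral of [(b x - b y) K(x - y) f y], which is dominated by the
    Riesz potential of order [gamma] of [|f|] ([commutator_bound]).  The
    potential is bounded from [L^p] to [L^q] by Hedberg's pointwise argument and
    the weak type (1,1) bound for averages ([hls]); in Morrey spaces one applies
    this to the part of [f] near a cube and sums the rest over dyadic annuli
    ([riesz_mor]).

    The delicate point is that for [alpha = 0] the operator itself must be
    defined, that is, the principal value of a rough kernel applied to [f] in
    [L^p] must exist almost everywhere ([pv_exists]).  The kernel is cut into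
    shells whose radii decrease geometrically with a very large ratio.  A shell
    piece has mean zero and is smoothing: averaging it over many dilations close
    to 1 turns its quadratic form into averages over cubes, which almost ignore
    a small translation, and this needs no regularity of [Omega]
    ([smoothing]).  Hence the pieces are almost orthogonal to each other, to
    averages at finer scales and to differences from coarser averages; a
    Cotlar type argument gives square function bounds ([square_A],
    [square_P_A], [square_sub_P]), which yield a maximal inequality for the
    partial sums ([max_series]), hence their convergence for [f] in [L^2].  For [f] in
    [L^1] with [|f|^p] integrable one performs a Calderon-Zygmund decomposition
    on dyadic cells; on a bad part living [j] scales below it a shell
    piece gains [2^(-4 j)] in [L^2], which pays for a truncation at height [2^j],
    and what is above that height is summable in [L^1] because [p > 1]
    ([cz_oscillation]).  This gives convergence along the scales
    ([lacunary_cvg]); Lebesgue points fill in the radii between two scales.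

    Conversely, choose a direction in which [Omega] keeps its sign.  Given a
    cube [Q], translate it in that direction to a cube [P] at a distance
    comparable with its side, and let [m] be a median of [b] on [P].  For [x] in
    [Q] the commutator applied to the indicator of the part of [P] where
    [b <= m], or where [b >= m], has a fixed sign and controls [|b x - m|].  Its
    boundedness therefore bounds the mean of [|b - m|] over [Q] by the power
    [beta] of the side ([star_osc]), and this implies Hoelder continuity on the
    Lebesgue points of [b], then everywhere after extension
    ([campanato_Lip]). *)

(** * Measurability and changes of variables on row vectors *)

Section row_vectors.
Context {R : realType} {n : nat}.
Local Notation V := 'rV[R]_n.
Local Notation mu := (@lebesgue_rV R n).
Implicit Types (x y h : V) (r a : R).

Lemma measurable_boolR d (T : measurableType d) (P : T -> bool) :
  measurable_fun setT P -> measurable_fun setT (fun t => (P t)%:R : R).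
Proof.
move=> mP; rewrite (_ : (fun t => _) = (fun t => if P t then 1 else 0)).
  exact: measurable_fun_ifT.
by apply/funext => t; case: (P t).
Qed.

Lemma rVnorm_le x r : 0 <= r -> (`|x| <= r) = [forall i, `|x ord0 i| <= r].
Proof.
move=> r0; rewrite /Num.norm/= mx_normrE; apply/bigmax_leP/forallP => [[_ h] i|h].
  exact: (h (ord0, i)).
by split=> // -[i j] _; rewrite (ord1 i)/=; exact: h.
Qed.

Lemma rVnorm_coord x i : `|x ord0 i| <= `|x|.
Proof. by have := lexx `|x|; rewrite {1}rVnorm_le// => /forallP/(_ i). Qed.

Lemma measurable_rVnorm : measurable_fun setT (fun x => `|x|).
Proof.
rewrite (_ : (fun x => _) =
    fun x => \big[Num.max/0]_(i <- enum 'I_n) `|x ord0 i|); last first.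
  apply/funext => x; apply/eqP; rewrite eq_le; apply/andP; split.
    rewrite rVnorm_le; last exact: bigmax_ge_id.
    by apply/forallP => i; rewrite big_enum/=; exact: le_bigmax.
  by rewrite big_enum/=; apply/bigmax_leP; split => // i _; exact: rVnorm_coord.
elim: (enum 'I_n) => [|i s ih]; [rewrite (_ : (fun x => _) = cst 0)//; by apply/funext => x; rewrite big_nil|].
under eq_fun do rewrite big_cons.
apply: measurable_maxr => //; apply: measurableT_comp => //.
exact: measurable_coord.
Qed.

Lemma measurable_rVD d (T : measurableType d) (f g : T -> V) :
  measurable_fun setT f -> measurable_fun setT g ->
  measurable_fun setT (fun t => f t + g t).
Proof.
move=> /measurable_fun_rVP mf /measurable_fun_rVP mg.
apply/measurable_fun_rVP => i.
rewrite (_ : (fun t => _) = fun t => f t ord0 i + g t ord0 i).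
  by apply: measurable_funD; [exact: mf|exact: mg].
by apply/funext => t; rewrite mxE.
Qed.

Lemma measurable_rVN d (T : measurableType d) (f : T -> V) :
  measurable_fun setT f -> measurable_fun setT (fun t => - f t).
Proof.
move=> /measurable_fun_rVP mf.
apply/measurable_fun_rVP => i.
rewrite (_ : (fun t => _) = fun t => - f t ord0 i).
  by apply: measurableT_comp; last exact: mf.
by apply/funext => t; rewrite mxE.
Qed.

Lemma measurable_rVZ d (T : measurableType d) (k : T -> R) (f : T -> V) :
  measurable_fun setT k -> measurable_fun setT f ->
  measurable_fun setT (fun t => k t *: f t).
Proof.
move=> mk /measurable_fun_rVP mf.
apply/measurable_fun_rVP => i.
rewrite (_ : (fun t => _) = fun t => k t * f t ord0 i).
  by apply: measurable_funM; last exact: mf.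
by apply/funext => t; rewrite mxE.
Qed.

End row_vectors.

(** Hypotheses are tried before decomposing, so that a local fact about a
    compound function takes precedence over its syntactic shape. *)
Ltac mfun :=
  repeat first
  [ match goal with |- _ =>
      match goal with |- @measurable_fun _ _ ?T _ _ ?f =>
      lazymatch f with
      | (fun _ => _) => fail
      | @comp _ _ _ _ _ => fail
      | @fst _ _ => exact measurable_fst
      | @snd _ _ => exact measurable_snd
      | _ => first [assumption | change (measurable_fun setT (fun x : T => f x))]
      end end end
  | assumption
  | match goal with
    | |- measurable_fun _ (fun x => ?c) => exact (measurable_cst c)
    | |- measurable_fun _ (fun x => x) => exact measurable_id
    | |- measurable_fun _ (fun x => fst x) => exact measurable_fst
    | |- measurable_fun _ (fun x => snd x) => exact measurable_snd
    | |- measurable_fun _ (fun x => (_ x)%:E) => apply/measurable_EFinP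
    | |- measurable_fun _ (fun x => (@?f x)%:E) => apply/measurable_EFinP
    | |- measurable_fun _ (EFin \o _) => apply/measurable_EFinP
    | |- measurable_fun _ (fun x => GRing.mul _ _) => apply: measurable_funM
    | |- measurable_fun _ (fun x => GRing.exp _ _) => apply: measurable_funX
    | |- measurable_fun _ (fun x => (_ `^ _)%R) =>
        apply: (measurableT_comp (measurable_powR _))
    | |- measurable_fun _ (fun x => (nat_of_bool _)%:R) =>
        apply: measurable_boolR
    | |- measurable_fun _ (fun x => andb _ _) => apply: measurable_and
    | |- measurable_fun _ (fun x => orb _ _) => apply: measurable_or
    | |- measurable_fun _ (fun x => negb _) => apply: measurable_neg
    | |- measurable_fun _ (fun x => (_ <= _)%R) => apply: measurable_fun_ler
    | |- measurable_fun _ (fun x => (_ < _)%R) => apply: measurable_fun_ltr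
    | |- measurable_fun _ (fun x => Num.norm (_ : 'rV[_]_(_))) =>
        apply: (measurableT_comp measurable_rVnorm)
    | |- measurable_fun _ (fun x => enorm _) =>
        apply: (measurableT_comp (@measurable_enorm _ _))
    | |- measurable_fun _ (fun x => Num.norm _) =>
        apply: (measurableT_comp (@normr_measurable _ setT))
    | |- measurable_fun _ (fun x => (_ : 'rV[_]_(_)) + _)%R => apply: measurable_rVD
    | |- measurable_fun _ (fun x => - (_ : 'rV[_]_(_)))%R => apply: measurable_rVN
    | |- measurable_fun _ (fun x => _ *: _)%R => apply: measurable_rVZ
    | |- measurable_fun _ (fun x => (_ : 'rV[_]_(_)) ord0 ?i) =>
        apply: (measurableT_comp (@measurable_coord _ _ i))
    | |- measurable_fun _ (fun x => GRing.add _ (- _)) => apply: measurable_funB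
    | |- measurable_fun _ (fun x => GRing.add _ _) => apply: measurable_funD
    | |- measurable_fun _ (fun x => - _)%R => apply: measurableT_comp
    | |- measurable_fun _ (fun x => pair _ _) => apply: measurable_fun_pair
    | H : measurable_fun setT ?F |- measurable_fun _ (fun x => ?F _) =>
        apply: (measurableT_comp H)
    end
  | exact: measurable_cst
  | exact: measurable_id
  | exact: measurable_fst
  | exact: measurable_snd ].

Section change_of_variables.
Context {R : realType}.
Local Open Scope ereal_scope.

Lemma ge0_integral_affine1 (f : measurableTypeR R -> \bar R) (a h : R) :
  a != 0%R -> measurable_fun setT f -> (forall t, 0 <= f t) ->
  \int[lebesgue_measure]_t f (a * t + h)%R =
  `|a|^-1%:E * \int[lebesgue_measure]_t f t.
Proof.
move=> a0 mf f0.
pose phi (t : measurableTypeR R) : measurableTypeR R := (a * t + h)%R.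
have mphi : measurable_fun setT phi by apply: measurable_funD => //; exact: measurable_funM.
have a1 : (0 <= `|a|)%R by [].
pose pf := measure_function_pushforward__canonical__measure_function_Measure
     lebesgue_measure mphi.
pose m : {measure set _ -> \bar R} := mscale (NngNum a1) pf.
have lm : forall A, measurable A -> lebesgue_measure A = m A.
  apply: lebesgue_measure_unique => _ [[x y]] /= xy <-.
  rewrite /m/= /mscale/= /pushforward.
  have [ap|an|a00] := ltgtP 0%R a; last by rewrite -a00 eqxx in a0.
    rewrite (_ : phi @^-1` _ = [set` `](x - h) / a, (y - h) / a]%R]); last first.
      apply/seteqP; split => t /=; rewrite !in_itv/= /phi;
    by rewrite ltr_pdivrMr// ler_pdivlMr// !(mulrC t) ltrBlDr lerBrDr.
    rewrite !lebesgue_measure_itv/= !lte_fin ltr_pM2r ?invr_gt0// ltrD2r.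
    case: ltP => _; last by rewrite mule0.
    by rewrite -!EFinB -EFinM gtr0_norm//; congr EFin; field.
  rewrite (_ : phi @^-1` _ = [set` `[(y - h) / a, (x - h) / a[%R]); last first.
    apply/seteqP; split => t /=; rewrite !in_itv/= /phi;
    by rewrite ler_ndivrMr// ltr_ndivlMr// !(mulrC t) lerBrDr ltrBlDr andbC.
  rewrite !lebesgue_measure_itv/= !lte_fin ltr_nM2r ?invr_lt0// ltrD2r.
  case: ltP => _; last by rewrite mule0.
  by rewrite -!EFinB -EFinM ltr0_norm//; congr EFin; field.
have -> : \int[lebesgue_measure]_t f t = \int[m]_t f t.
  by apply: eq_measure_integral => A mA _; exact: lm.
rewrite ge0_integral_mscale// muleA -EFinM/= mulVf ?normr_eq0// mul1e.
by rewrite ge0_integral_pushforward.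
Qed.

Lemma integral_rVS n (f : 'rV[R]_n.+1 -> \bar R) :
  measurable_fun setT f -> (forall x, 0 <= f x) ->
  \int[lebesgue_rV n.+1]_x f x =
  \int[lebesgue_measure]_t \int[lebesgue_rV n]_v f (cons_rV (t, v)).
Proof.
move=> mf f0.
have mc := @measurable_cons_rV R n.
transitivity (\int[lebesgue_measure \x lebesgue_rV n]_p (f \o @cons_rV R n) p).
  exact: (ge0_integral_pushforward mc).
rewrite (fubini_tonelli1 (f \o @cons_rV R n)) => [//||p]; last exact: f0.
exact: (measurableT_comp mf mc).
Qed.

Lemma cons_rV_affine n (a t : R) (h : 'rV[R]_n.+1) (v : 'rV[R]_n) :
  (a *: cons_rV (t, v) + h = cons_rV (a * t + h ord0 ord0,
     a *: v + \row_j h ord0 (lift ord0 j)))%R.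
Proof.
apply/rowP => i; rewrite !mxE; case: (unliftP ord0 i) => [j ->|->] /=.
  by rewrite !mxE.
by [].
Qed.

Lemma ge0_integral_affine n (f : 'rV[R]_n -> \bar R) (a : R) h :
  a != 0%R -> measurable_fun setT f -> (forall x, 0 <= f x) ->
  \int[lebesgue_rV n]_x f (a *: x + h)%R =
  (`|a| ^- n)%:E * \int[lebesgue_rV n]_x f x.
Proof.
move=> a0; elim: n f h => [|n ih] f h mf f0.
  rewrite expr0 invr1 mul1e; apply: eq_integral => x _.
  by congr f; apply/rowP => -[].
have maff : measurable_fun setT (fun x : 'rV[R]_n.+1 => f (a *: x + h)%R) by mfun.
rewrite integral_rVS//.
pose g (t : R) := \int[lebesgue_rV n]_v f (cons_rV (t, v)).
have mg : measurable_fun setT (g : measurableTypeR R -> _).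
  apply: (measurable_fun_fubini_tonelli_F (fun p => f (cons_rV p))) => //.
  apply: measurableT_comp => //; exact: measurable_cons_rV.
have g0 t : 0 <= g t by apply: integral_ge0.
transitivity (\int[lebesgue_measure]_t
   ((`|a| ^- n)%:E * g (a * t + h ord0 ord0)%R)).
  apply: eq_integral => t _; rewrite /g -(ih _ (\row_j h ord0 (lift ord0 j)))//; last first.
    apply: measurableT_comp => //.
    apply: (measurableT_comp (@measurable_cons_rV R n)).
    by apply: measurable_fun_pair => //; exact: measurable_id.
  by apply: eq_integral => v _; rewrite cons_rV_affine.
rewrite ge0_integralZl_EFin ?invr_ge0 ?exprn_ge0//; last first.
  by apply: (measurableT_comp mg); apply: measurable_funD => //; exact: measurable_funM.
rewrite ge0_integral_affine1// muleA -EFinM -invfM -exprSr.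
by rewrite integral_rVS.
Qed.

(** Applied to the positive and negative parts separately. *)
Lemma integral_affine n (f : 'rV[R]_n -> \bar R) (a : R) h :
  a != 0%R -> measurable_fun setT f ->
  \int[lebesgue_rV n]_x f (a *: x + h)%R =
  (`|a| ^- n)%:E * \int[lebesgue_rV n]_x f x.
Proof.
move=> a0 mf; rewrite integralE [in RHS]integralE.
have c0 : (0 < `|a| ^- n)%R by rewrite invr_gt0 exprn_gt0// normr_gt0.
have e1 : (fun x : 'rV[R]_n => f (a *: x + h)%R)^\+ = (fun x => f^\+ (a *: x + h)%R) by exact: (funepos_comp f (fun x => a *: x + h)%R).
have e2 : (fun x : 'rV[R]_n => f (a *: x + h)%R)^\- = (fun x => f^\- (a *: x + h)%R) by exact: (funeneg_comp f (fun x => a *: x + h)%R).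
rewrite e1 e2 !ge0_integral_affine//; first last.
- exact: measurable_funepos.
- exact: measurable_funeneg.
have e : forall u v : \bar R, 0 <= u -> 0 <= v ->
    (`|a| ^- n)%:E * u - (`|a| ^- n)%:E * v = (`|a| ^- n)%:E * (u - v).
  move=> [u| |] [v| |] // _ _.
  - by rewrite muleBr.
  - by rewrite gt0_muley// !addeNy gt0_muleNy.
  - by rewrite gt0_muley// -EFinM !addye// gt0_muley.
  - by rewrite gt0_muley// !addeNy gt0_muleNy.
by rewrite e//; apply: integral_ge0.
Qed.

End change_of_variables.

(** * Cubes, Euclidean norm, grid cells *)

Section cubes.
Context {R : realType} {n : nat}.
Local Notation V := 'rV[R]_n.
Local Notation mu := (@lebesgue_rV R n).
Implicit Types (x y z : V) (r a l : R).

(** The recursive product measure is peeled off one coordinate at a time. *)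
Lemma lebesgue_box m (A : 'I_m -> set R) :
  (forall i, measurable (A i : set (measurableTypeR R))) ->
  measurable [set y : 'rV[R]_m | forall i, A i (y ord0 i)] /\
  lebesgue_rV m [set y : 'rV[R]_m | forall i, A i (y ord0 i)] =
    (\prod_(i < m) lebesgue_measure (A i))%E.
Proof.
move=> mA; split.
  rewrite (_ : [set _ | _] = \bigcap_(i in [set: 'I_m])
      (setT `&` (fun x : 'rV[R]_m => x ord0 i) @^-1` A i)); last first.
    by apply/seteqP; split => x /= h i; [move=> _; split|case: (h i)] => //; exact: h.
  apply: fin_bigcap_measurable => [|i _]; first exact: finite_finset.
  by apply: (@measurable_coord R m i).
elim: m A mA => [|m ih] A mA.
  by rewrite big_ord0/= /dirac indicE mem_set// => -[].
rewrite big_ord_recl -ih//.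
rewrite (_ : lebesgue_rV m.+1 _ = (lebesgue_measure \x lebesgue_rV m)%E
   (A ord0 `*` [set v : 'rV[R]_m | forall i, A (lift ord0 i) (v ord0 i)])).
  rewrite product_measure1E//.
  rewrite (_ : [set _ | _] = \bigcap_(i in [set: 'I_m])
      (setT `&` (fun x : 'rV[R]_m => x ord0 i) @^-1` A (lift ord0 i))).
    apply: fin_bigcap_measurable => [|i _]; first exact: finite_finset.
    by apply: (@measurable_coord R m i).
  by apply/seteqP; split => x /= h i; [move=> _; split|case: (h i)] => //; exact: h.
rewrite [LHS]/= /lebesgue_rVS /pushforward; congr (product_measure1 _ _ _).
apply/seteqP; split=> [[t v] /= h|[t v] [/= h1 h2] i].
  split=> [|j]; first by have := h ord0; rewrite mxE unlift_none.
  by have := h (lift ord0 j); rewrite mxE liftK.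
by rewrite mxE; case: (unliftP ord0 i) => [j ->|->]/=; [exact: h2|exact: h1].
Qed.

Lemma normB_box x r : 0 <= r -> [set y | `|x - y| <= r] =
  [set y | forall i, [set` `[x ord0 i - r, x ord0 i + r]] (y ord0 i)].
Proof.
move=> r0; apply/seteqP; split => y /=; rewrite rVnorm_le//.
  by move=> /forallP h i; have := h i; rewrite !mxE/= distrC ler_distl in_itv/= => /andP[-> ->].
move=> h; apply/forallP => i; have := h i.
by rewrite !mxE/= in_itv/= distrC ler_distl => /andP[-> ->].
Qed.

Lemma measurable_normB_le x r : measurable [set y | `|x - y| <= r].
Proof.
have -> : [set y | `|x - y| <= r] = setT `&` (fun y => `|x - y| <= r) @^-1` [set true].
  by apply/seteqP; split => y //= [].
have h : measurable_fun setT (fun y : V => `|x - y| <= r) by mfun.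
exact: h.
Qed.

Lemma lebesgue_normB_le x r : 0 <= r ->
  mu [set y | `|x - y| <= r] = ((2 * r) ^+ n)%:E.
Proof.
move=> r0; rewrite normB_box//.
have [_ ->] := @lebesgue_box n (fun i => [set` `[x ord0 i - r, x ord0 i + r]])
  (fun=> measurable_itv _).
under eq_bigr.
  move=> i _; rewrite lebesgue_measure_itv/= lte_fin -EFinB.
  rewrite (_ : (if _ then _ else _) = (2 * r)%:E); last first.
    case: ltP => h; first by congr EFin; ring.
    by congr EFin; lra.
  over.
rewrite prodEFin; congr EFin.
by rewrite prodr_const card_ord.
Qed.

Lemma cubeE x r : 0 <= r -> cube x r = [set y | `|x - y| <= r].
Proof.
move=> r0; apply/seteqP; split => y /=; rewrite rVnorm_le//.
  by move=> h; apply/forallP => i; rewrite !mxE distrC; exact: h.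
by move=> /forallP h i; have := h i; rewrite !mxE distrC.
Qed.

Lemma volume_cube x r : 0 <= r -> volume (cube x r) = (2 * r) ^+ n.
Proof. by move=> r0; rewrite /volume cubeE// lebesgue_normB_le. Qed.

Lemma enorm_ge0 x : 0 <= enorm x. Proof. exact: sqrtr_ge0. Qed.

Lemma enormZ a x : enorm (a *: x) = `|a| * enorm x.
Proof.
rewrite /enorm -sqrtr_sqr -sqrtrM ?sqr_ge0//; congr Num.sqrt.
by rewrite mulr_sumr; apply: eq_bigr => i _; rewrite !mxE exprMn.
Qed.

Lemma enormN x : enorm (- x) = enorm x.
Proof. by rewrite -scaleN1r enormZ normrN1 mul1r. Qed.

Lemma norm_le_enorm x : `|x| <= enorm x.
Proof.
rewrite rVnorm_le ?enorm_ge0//; apply/forallP => i.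
rewrite -sqrtr_sqr ler_sqrt; last by apply: sumr_ge0 => j _; rewrite sqr_ge0.
by rewrite (bigD1 i)//= lerDl; apply: sumr_ge0 => j _; rewrite sqr_ge0.
Qed.

Lemma enorm_le_norm x : enorm x <= n%:R * `|x|.
Proof.
rewrite -[leRHS]ger0_norm ?mulr_ge0// -sqrtr_sqr ler_sqrt ?sqr_ge0//.
apply: (@le_trans _ _ (\sum_(i < n) `|x| ^+ 2)).
  apply: ler_sum => i _; rewrite -(real_normK (num_real (x ord0 i))).
  by rewrite ler_pXn2r ?nnegrE//; exact: rVnorm_coord.
rewrite sumr_const card_ord exprMn -[leLHS]mulr_natl; apply: ler_wpM2r => //.
by rewrite -natrX ler_nat; case: n => // m; rewrite -{1}(expn1 m.+1) leq_pexp2l.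
Qed.

Lemma enorm_gt0 x : (0 < enorm x) = (x != 0).
Proof.
apply/idP/idP => [|x0].
  by apply: contraTneq => ->; rewrite -(scale0r (0 : V)) enormZ normr0 mul0r ltxx.
by rewrite (lt_le_trans _ (norm_le_enorm x))// normr_gt0.
Qed.

Lemma measurable_forallb d (T : measurableType d) m (P : 'I_m -> T -> bool) :
  (forall i, measurable_fun setT (P i)) ->
  measurable_fun setT (fun t => [forall i, P i t]).
Proof.
move=> mP.
rewrite (_ : (fun t => _) = fun t => all (fun i => P i t) (enum 'I_m)).
  elim: (enum 'I_m) => //= i s ih; exact: measurable_and.
apply/funext => t; apply/forallP/allP => [h i _|h i]; first exact: h.
by apply: h; rewrite mem_enum.
Qed.

(** The half-open grid cells of side [l] are the classes of [same l]. *)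
Definition cell_index l x i : R := (Num.floor (x ord0 i / l))%:~R.
Definition same l x y := [forall i, cell_index l x i == cell_index l y i].

Lemma same_refl l x : same l x x.
Proof. by apply/forallP => i. Qed.

Lemma same_sym l x y : same l x y = same l y x.
Proof. by apply: eq_forallb => i; rewrite eq_sym. Qed.

Lemma same_eq l x y z : same l x y -> same l x z = same l y z.
Proof. by move/forallP => h; apply: eq_forallb => i; rewrite (eqP (h i)). Qed.

Lemma measurable_cell_index l i : measurable_fun setT (cell_index l ^~ i).
Proof.
have h : measurable_fun setT (fun t : R => (Num.floor t)%:~R : R).
  by apply: nondecreasing_measurable => // s t st; rewrite ler_int; exact: le_floor.
by apply: (measurableT_comp h); apply: measurable_funM => //; exact: measurable_coord.
Qed.

Lemma measurable_same l d (T : measurableType d) (f g : T -> V) :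
  measurable_fun setT f -> measurable_fun setT g ->
  measurable_fun setT (fun t => same l (f t) (g t)).
Proof.
move=> mf mg; apply: measurable_forallb => i; apply: measurable_fun_eqr.
- by apply: (measurableT_comp (measurable_cell_index l i)).
- by apply: (measurableT_comp (measurable_cell_index l i)).
Qed.

Lemma same_norm l x y : 0 < l -> same l x y -> `|x - y| <= l.
Proof.
move=> l0 /forallP h; rewrite rVnorm_le ?ltW//; apply/forallP => i.
have /eqP := h i; rewrite /cell_index => /eqP; rewrite eqr_int => /eqP e.
rewrite !mxE ler_distl.
have := floor_le_tmp (x ord0 i / l); have := floor_le_tmp (y ord0 i / l).
have := floorD1_gt (x ord0 i / l); have := floorD1_gt (y ord0 i / l).
rewrite e !intrD1 !ler_pdivlMr// !ltr_pdivrMr//.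
set t := (Num.floor _)%:~R.
by move=> h1 h2 h3 h4; apply/andP; split; nra.
Qed.

Lemma lebesgue_cell l x : 0 < l -> mu [set y | same l x y] = (l ^+ n)%:E.
Proof.
move=> l0; pose k i := Num.floor (x ord0 i / l).
rewrite (_ : [set y | _] =
    [set y : V | forall i, [set` `[(k i)%:~R * l, ((k i)%:~R + 1) * l[] (y ord0 i)]).
  have [_ ->] := @lebesgue_box n (fun i => [set` `[(k i)%:~R * l, ((k i)%:~R + 1) * l[])
    (fun=> measurable_itv _).
  under eq_bigr.
    move=> i _; rewrite lebesgue_measure_itv/= lte_fin -EFinB ifT; last first.
      by rewrite ltr_pM2r// ltrDl.
    rewrite (_ : (_ - _)%R = l); last by ring.
    over.
  by rewrite prodEFin prodr_const card_ord.
apply/seteqP; split => y /=.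
  move/forallP => h i; have := h i.
  rewrite /cell_index eqr_int -/(k i) => /eqP ->; rewrite in_itv/=.
  by rewrite -ler_pdivlMr// -ltr_pdivrMr// floor_le_tmp -intrD1 floorD1_gt.
move=> h; apply/forallP => i; have := h i.
rewrite in_itv/= -ler_pdivlMr// -ltr_pdivrMr// => h1.
by rewrite /cell_index eqr_int -/(k i) eq_sym; apply/eqP/floor_def; rewrite intrD1.
Qed.

(** The grid of side [l] refines that of side [k * l], for a natural [k]. *)
Lemma same_mul (k : nat) l x y : (0 < k)%N -> 0 < l -> same l x y ->
  same (k%:R * l) x y.
Proof.
move=> k0 l0 /forallP h; apply/forallP => i; have := h i.
rewrite /cell_index !eqr_int => /eqP.
have k0' : 0 < k%:R :> R by rewrite ltr0n.
suff H (s : R) : Num.floor (s / (k%:R * l)) = (Num.floor (s / l) %/ k)%Z.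
  by move=> e; rewrite !H e.
apply: floor_def; rewrite intrD1.
rewrite !ltr_pdivrMr ?mulr_gt0// ler_pdivlMr ?mulr_gt0//.
rewrite !mulrA -ler_pdivlMr// -ltr_pdivrMr//.
set f := Num.floor (s / l).
have hk : (k%:Z != 0)%R by rewrite -lt0n.
have e := divz_eq f k.
have m0 := modz_ge0 f hk; have m1 : (f %% k < k)%Z by rewrite ltz_pmod.
apply/andP; split.
  apply: le_trans (floor_le_tmp _); rewrite -/f.
  rewrite -[k%:R]/((k%:Z)%:~R) -intrM ler_int.
  by rewrite {2}e lerDl.
apply: lt_le_trans (floorD1_gt _) _; rewrite -/f intrD1.
rewrite -[k%:R]/((k%:Z)%:~R) -[1]/((1%:Z)%:~R) -!intrD -intrM ler_int.
by rewrite {1}e mulrDl mul1r -addrA lerD2l lezD1.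
Qed.

End cubes.

(** * Square integrable functions and integral operators *)

Module Hilbert.

Section L2.
Context {d : measure_display} {T : measurableType d} {R : realType}.
Variable mu : {sigma_finite_measure set T -> \bar R}.
Implicit Types (f g h : T -> R) (c t : R).

Lemma nnZ c f : 0 <= c -> measurable_fun setT f -> (forall x, 0 <= f x) ->
  (\int[mu]_x (c * f x)%:E = c%:E * \int[mu]_x (f x)%:E)%E.
Proof.
move=> c0 mf f0; under eq_integral do rewrite EFinM.
by rewrite ge0_integralZl_EFin// => [x _|]; [rewrite lee_fin|mfun].
Qed.

Lemma nnD f g : measurable_fun setT f -> measurable_fun setT g ->
  (forall x, 0 <= f x) -> (forall x, 0 <= g x) ->
  (\int[mu]_x (f x + g x)%:E = \int[mu]_x (f x)%:E + \int[mu]_x (g x)%:E)%E.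
Proof.
move=> mf mg f0 g0; under eq_integral do rewrite EFinD.
by rewrite ge0_integralD// => [x _||x _|]; rewrite ?lee_fin//; mfun.
Qed.

Lemma nn_le f g : measurable_fun setT f -> measurable_fun setT g ->
  (forall x, 0 <= f x <= g x) ->
  (\int[mu]_x (f x)%:E <= \int[mu]_x (g x)%:E)%E.
Proof.
move=> mf mg fg; apply: ge0_le_integral => //; try by mfun.
  by move=> x _; rewrite lee_fin; case/andP: (fg x).
by move=> x _; rewrite lee_fin; case/andP: (fg x).
Qed.

Definition L2 f := measurable_fun setT f /\
  (\int[mu]_x (f x ^+ 2)%:E < +oo)%E.
Definition dot f g : R := fine (\int[mu]_x (f x * g x)%:E).
Definition N2 f := dot f f.

Lemma L2_int f g : L2 f -> L2 g ->
  mu.-integrable setT (fun x => (f x * g x)%:E).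
Proof.
move=> [mf f2] [mg g2]; apply/integrableP; split; first by mfun.
have h : (\int[mu]_x ((f x ^+ 2)%:E + (g x ^+ 2)%:E) < +oo)%E.
  rewrite ge0_integralD//; [exact: lte_add_pinfty| | | |];
    by [mfun | move=> x _; rewrite lee_fin sqr_ge0].
apply: le_lt_trans h; under eq_integral do rewrite abse_EFin.
apply: ge0_le_integral => //; first by mfun.
- apply: emeasurable_funD; by mfun.
move=> x _; rewrite -EFinD lee_fin normrM.
by rewrite -(real_normK (num_real (f x))) -(real_normK (num_real (g x))); nra.
Qed.

Lemma N2E f : L2 f -> (N2 f)%:E = (\int[mu]_x (f x ^+ 2)%:E)%E.
Proof.
move=> [mf f2]; rewrite /N2 /dot fineK//.
rewrite ge0_fin_numE; first by under eq_integral do rewrite -expr2.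
by apply: integral_ge0 => x _; rewrite lee_fin -expr2 sqr_ge0.
Qed.

Lemma N2_ge0 f : 0 <= N2 f.
Proof. by apply/fine_ge0/integral_ge0 => x _; rewrite lee_fin -expr2 sqr_ge0. Qed.

Lemma L2_le f c : measurable_fun setT f ->
  (\int[mu]_x (f x ^+ 2)%:E <= c%:E)%E -> L2 f /\ N2 f <= c.
Proof.
move=> mf fc; have Lf : L2 f by split=> //; exact: le_lt_trans fc (ltry _).
by split=> //; rewrite -lee_fin N2E.
Qed.

Lemma L2D f g : L2 f -> L2 g -> L2 (fun x => f x + g x).
Proof.
move=> Lf Lg; have [mf f2] := Lf; have [mg g2] := Lg.
split; first by mfun.
have h : (\int[mu]_x ((2 * f x ^+ 2)%:E + (2 * g x ^+ 2)%:E) < +oo)%E.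
  rewrite ge0_integralD//;
    [|by move=> x _; rewrite lee_fin mulr_ge0// sqr_ge0|by mfun
     |by move=> x _; rewrite lee_fin mulr_ge0// sqr_ge0|by mfun].
  under eq_integral do rewrite EFinM.
  under [X in (_ + X)%E]eq_integral do rewrite EFinM.
  rewrite !ge0_integralZl_EFin//;
    [|by move=> x _; rewrite lee_fin sqr_ge0|by mfun
     |by move=> x _; rewrite lee_fin sqr_ge0|by mfun].
  by rewrite lte_add_pinfty// lte_mul_pinfty.
apply: le_lt_trans h; apply: ge0_le_integral => //.
- by move=> x _; rewrite lee_fin sqr_ge0.
- by mfun.
- by apply: emeasurable_funD; mfun.
by move=> x _; rewrite -EFinD lee_fin; have := sqr_ge0 (f x - g x); nra.
Qed.

Lemma L2Z c f : L2 f -> L2 (fun x => c * f x).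
Proof.
move=> [mf f2]; split; first by mfun.
under eq_integral do rewrite exprMn EFinM.
rewrite ge0_integralZl_EFin ?sqr_ge0//; last by mfun.
  by rewrite lte_mul_pinfty// lee_fin sqr_ge0.
by move=> x _; rewrite lee_fin sqr_ge0.
Qed.

Lemma L2B f g : L2 f -> L2 g -> L2 (fun x => f x - g x).
Proof.
move=> Lf Lg; have := L2D Lf (L2Z (-1) Lg).
by congr L2; apply/funext => x; rewrite mulN1r.
Qed.

Lemma L2_0 : L2 (fun=> 0).
Proof.
split=> //; rewrite integral0_eq// => x _; by rewrite expr0n.
Qed.

Lemma L2_sum I (s : seq I) (P : pred I) (F : I -> T -> R) :
  (forall i, P i -> L2 (F i)) -> L2 (fun x => \sum_(i <- s | P i) F i x).
Proof.
move=> LF; elim: s => [|i s ih].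
  by under eq_fun do rewrite big_nil; exact: L2_0.
under eq_fun do rewrite big_cons.
by case: (boolP (P i)) => // Pi; apply: L2D => //; exact: LF.
Qed.

Lemma dotC f g : dot f g = dot g f.
Proof. by congr fine; apply: eq_integral => x _; rewrite mulrC. Qed.

Lemma dotDl f g h : L2 f -> L2 g -> L2 h ->
  dot (fun x => f x + g x) h = dot f h + dot g h.
Proof.
move=> Lf Lg Lh; rewrite /dot -fineD ?integrable_fin_num//; try exact: L2_int.
rewrite -integralD//; try exact: L2_int.
by congr fine; apply: eq_integral => x _; rewrite -EFinD mulrDl.
Qed.

Lemma dotZl c f h : L2 f -> L2 h -> dot (fun x => c * f x) h = c * dot f h.
Proof.
move=> Lf Lh; rewrite /dot -[c in RHS]/(fine c%:E) -fineM ?integrable_fin_num//;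
  try exact: L2_int.
rewrite -integralZl//; try exact: L2_int.
by congr fine; apply: eq_integral => x _; rewrite -EFinM mulrA.
Qed.

Lemma dotBl f g h : L2 f -> L2 g -> L2 h ->
  dot (fun x => f x - g x) h = dot f h - dot g h.
Proof.
move=> Lf Lg Lh; rewrite -mulN1r -dotZl// -dotDl//; last exact: L2Z.
by congr dot; apply/funext => x; rewrite mulN1r.
Qed.

Lemma dot_suml I (s : seq I) (P : pred I) (F : I -> T -> R) h :
  (forall i, P i -> L2 (F i)) -> L2 h ->
  dot (fun x => \sum_(i <- s | P i) F i x) h = \sum_(i <- s | P i) dot (F i) h.
Proof.
move=> LF Lh; elim: s => [|i s ih].
  rewrite big_nil /dot integral0_eq// => x _; by rewrite big_nil mul0r.
rewrite big_cons; under [X in dot X]eq_fun do rewrite big_cons.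
case: (boolP (P i)) => // Pi; rewrite -ih dotDl//; first exact: LF.
exact: L2_sum.
Qed.

Lemma N2D f g : L2 f -> L2 g ->
  N2 (fun x => f x + g x) = N2 f + 2 * dot f g + N2 g.
Proof.
move=> Lf Lg; rewrite /N2 dotDl//; last exact: L2D.
rewrite (dotC f) (dotC g) !dotDl// (dotC g f); ring.
Qed.

Lemma N2Z c f : L2 f -> N2 (fun x => c * f x) = c ^+ 2 * N2 f.
Proof.
move=> Lf; rewrite /N2 dotZl//; last exact: L2Z.
by rewrite dotC dotZl// mulrA.
Qed.

Lemma cauchy_schwarz f g : L2 f -> L2 g -> dot f g ^+ 2 <= N2 f * N2 g.
Proof.
move=> Lf Lg.
have q t : 0 <= N2 f + 2 * t * dot f g + t ^+ 2 * N2 g.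
  have := N2_ge0 (fun x => f x + t * g x).
  rewrite N2D//; last exact: L2Z.
  by rewrite N2Z// (dotC f) dotZl// (dotC g) mulrA.
have [g0|g0] := eqVneq (N2 g) 0; last first.
  have gp : 0 < N2 g by rewrite lt_def g0 N2_ge0.
  have := q (- (dot f g / N2 g)).
  rewrite (_ : _ + _ = N2 f - dot f g ^+ 2 / N2 g); last by field.
  by rewrite subr_ge0 ler_pdivrMr.
rewrite g0 mulr0 in q *; have [->|d0] := eqVneq (dot f g) 0; first by rewrite expr0n.
have := q (- (N2 f + 1) / (2 * dot f g)).
rewrite mulr0 addr0 (_ : _ + _ = -1); last by field.
by rewrite ler0N1.
Qed.

Lemma dot_le f g t : L2 f -> L2 g -> 0 < t ->
  `|dot f g| <= (t * N2 f + t^-1 * N2 g) / 2.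
Proof.
move=> Lf Lg t0.
have ti : 0 < t^-1 by rewrite invr_gt0.
have := N2_ge0 (fun x => t * f x + g x); have := N2_ge0 (fun x => t * f x + -1 * g x).
rewrite !N2D ?N2Z//; try exact: L2Z.
rewrite (dotC _ (fun x => -1 * g x)) !dotZl ?(dotC g)//; try exact: L2Z.
rewrite dotZl//.
have e : t * (t^-1 * N2 g) = N2 g by rewrite mulrA mulfV ?mul1r// gt_eqF.
move=> h1 h2; rewrite ler_norml; apply/andP.
by split; rewrite -(ler_pM2l t0); nra.
Qed.

Lemma N2_sum2 f g : L2 f -> L2 g ->
  N2 (fun x => f x + g x) <= 2 * N2 f + 2 * N2 g.
Proof.
move=> Lf Lg; rewrite N2D//.
have := dot_le Lf Lg ltr01; rewrite invr1 !mul1r => h.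
by have := ler_norm (dot f g); lra.
Qed.

Lemma N2_sub2 f g : L2 f -> L2 g ->
  N2 (fun x => f x - g x) <= 2 * N2 f + 2 * N2 g.
Proof.
move=> Lf Lg; have := N2_sum2 Lf (L2Z (-1) Lg).
rewrite N2Z// sqrrN expr1n mul1r; congr (N2 _ <= _).
by apply/funext => x; rewrite mulN1r.
Qed.

Lemma eq_N2 f g : f =1 g -> N2 f = N2 g.
Proof. by move=> /funext ->. Qed.

(** Cauchy-Schwarz against a bounded function supported in a set of finite
    measure; the right-hand side may be infinite. *)
Lemma sqr_integral_le (a h : T -> R) (P : T -> bool) c m :
  measurable_fun setT a -> measurable_fun setT h -> measurable_fun setT P ->
  0 <= c -> 0 < m -> (forall y, `|a y| <= c * (P y)%:R) ->
  (\int[mu]_y (P y)%:R%:E <= m%:E)%E ->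
  (((fine (\int[mu]_y (a y * h y)%:E)) ^+ 2)%:E <=
    (c ^+ 2 * m)%:E * \int[mu]_y (h y ^+ 2 * (P y)%:R)%:E)%E.
Proof.
move=> ma mh mP c0 m0 aP Pm.
have I0 : (0 <= \int[mu]_y (h y ^+ 2 * (P y)%:R)%:E)%E.
  by apply: integral_ge0 => y _; rewrite lee_fin mulr_ge0// sqr_ge0.
have [c00|cn0] := eqVneq c 0.
  rewrite c00 expr0n mul0r mul0e.
  rewrite integral0_eq ?expr0n// => y _.
  suff -> : a y = 0 by rewrite mul0r.
  apply/eqP; rewrite -normr_le0; apply: le_trans (aP y) _.
  by rewrite c00 mul0r.
have [Ioo|Ioo] := leP +oo%E (\int[mu]_y (h y ^+ 2 * (P y)%:R)%:E)%E.
  move: Ioo; rewrite leye_eq => /eqP ->.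
  by rewrite gt0_muley ?leey// lte_fin mulr_gt0// exprn_gt0// lt_def cn0.
have [La Na] : L2 a /\ N2 a <= c ^+ 2 * m.
  apply: L2_le => //.
  apply: (@le_trans _ _ (\int[mu]_y (c ^+ 2 * (P y)%:R)%:E)%E).
    apply: ge0_le_integral => //.
    - by move=> x _; rewrite lee_fin sqr_ge0.
    - by mfun.
    - by mfun.
    move=> y _; rewrite lee_fin -(real_normK (num_real (a y))).
    have := aP y; case: (P y) => /=; rewrite ?mulr1 ?mulr0 => h1.
      by rewrite ler_pXn2r// nnegrE.
    by rewrite (le_anti (y := 0) (x := `|a y|)) ?h1 ?expr0n//=.
  rewrite nnZ ?sqr_ge0//; last by mfun.
  by rewrite (EFinM _ m); apply: lee_wpmul2l => //; rewrite lee_fin sqr_ge0.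
pose g y := h y * (P y)%:R.
have Lg : L2 g.
  split; first by rewrite /g; mfun.
  rewrite (eq_integral (fun y => (h y ^+ 2 * (P y)%:R)%:E)) => [//|y _].
  by rewrite /g exprMn; case: (P y); rewrite ?expr1n ?expr0n.
have -> : fine (\int[mu]_y (a y * h y)%:E) = dot a g.
  congr fine; apply: eq_integral => y _; congr EFin; rewrite /g.
  have := aP y; case: (P y); rewrite ?mulr1 // !mulr0 normr_le0 => /eqP ->.
  by rewrite mul0r.
have <- : (N2 g)%:E = (\int[mu]_y (h y ^+ 2 * (P y)%:R)%:E)%E.
  rewrite N2E//; apply: eq_integral => y _; congr EFin; rewrite /g exprMn.
  by case: (P y); rewrite ?expr1n ?expr0n.
rewrite -EFinM lee_fin; apply: le_trans (cauchy_schwarz La Lg) _.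
by rewrite ler_wpM2r// N2_ge0.
Qed.

End L2.

End Hilbert.
Import Hilbert.

(** * Integral operators with localized bounded kernels *)

Section operators.
Context {R : realType} {n : nat}.
Local Notation V := 'rV[R]_n.
Local Notation mu := (@lebesgue_rV R n).
Local Notation L2 := (L2 mu).
Local Notation dot := (dot mu).
Local Notation N2 := (N2 mu).
Implicit Types (x y u : V) (F G : V -> R) (a : V -> V -> R) (P : V -> V -> bool)
  (C c m k e l : R).

(** The integral operator of kernel [a]; the value is 0 where the integral is infinite. *)
Definition op a F x : R := fine (\int[mu]_y (a x y * F y)%:E).
Definition mker a := measurable_fun setT (fun p : V * V => a p.1 p.2).

Lemma mker1 a x : mker a -> measurable_fun setT (a x).
Proof. by move=> ma; exact: (measurableT_comp ma (pair1_measurable x)). Qed.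

Lemma mker2 a y : mker a -> measurable_fun setT (a ^~ y).
Proof. by move=> ma; exact: (measurableT_comp ma (pair2_measurable y)). Qed.

Lemma mkerM a F : mker a -> measurable_fun setT F ->
  mker (fun x y => a x y * F y).
Proof. by rewrite /mker => ma mF; mfun. Qed.

Lemma measurable_fine_integral a : mker a ->
  measurable_fun setT (fun x => fine (\int[mu]_y (a x y)%:E)).
Proof.
move=> ma; apply: (measurableT_comp (@fine_measurable R setT measurableT)) => //.
pose f (p : V * V) := (a p.1 p.2)%:E.
have mf : measurable_fun setT f by apply/measurable_EFinP.
rewrite (_ : (fun x => _) = fun x =>
   (\int[mu]_y (f^\+ (x, y)) - \int[mu]_y (f^\- (x, y)))%E); last first.
  apply/funext => x; rewrite integralE.
  rewrite (_ : (fun y => (a x y)%:E) = f \o pair x)// funepos_comp funeneg_comp.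
  by [].
apply: emeasurable_funB.
  have h := @measurable_fun_fubini_tonelli_F _ _ _ _ _ mu (f^\+)%E (measurable_funepos mf).
  exact: h.
have h := @measurable_fun_fubini_tonelli_F _ _ _ _ _ mu (f^\-)%E (measurable_funeneg mf).
exact: h.
Qed.

Lemma measurable_op a F : mker a -> measurable_fun setT F ->
  measurable_fun setT (op a F).
Proof. by move=> ma mF; apply: measurable_fine_integral; exact: mkerM. Qed.

Lemma tonelli a : mker a -> (forall x y, 0 <= a x y) ->
  (\int[mu]_x \int[mu]_y (a x y)%:E = \int[mu]_y \int[mu]_x (a x y)%:E)%E.
Proof.
move=> ma a0; have := @fubini_tonelli _ _ _ _ _ mu mu (fun p => (a p.1 p.2)%:E).
by apply => [|p]; [apply/measurable_EFinP|rewrite lee_fin].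
Qed.

Lemma measurable_inner a : mker a -> (forall x y, 0 <= a x y) ->
  measurable_fun setT (fun x => \int[mu]_y (a x y)%:E)%E.
Proof.
move=> ma a0.
apply: (measurable_fun_fubini_tonelli_F (fun p => (a p.1 p.2)%:E)).
  exact/measurable_EFinP.
by move=> p; rewrite lee_fin.
Qed.

Lemma mkerP P : measurable_fun setT (fun p : V * V => P p.1 p.2) ->
  mker (fun x y => (P x y)%:R).
Proof. exact: measurable_boolR. Qed.

(** Squared form of a Schur bound: [H] may be any measurable function of two
    variables, which covers both [F y] and the differences [F y - F x]. *)
Lemma schur_sqr a (H : V -> V -> R) P c m : mker a -> mker H ->
  measurable_fun setT (fun p : V * V => P p.1 p.2) ->
  0 <= c -> 0 < m -> (forall x y, `|a x y| <= c * (P x y)%:R) ->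
  (forall x, (\int[mu]_y (P x y)%:R%:E <= m%:E)%E) ->
  (\int[mu]_x ((fine (\int[mu]_y (a x y * H x y)%:E)) ^+ 2)%:E <=
   (c ^+ 2 * m)%:E * \int[mu]_x \int[mu]_y (H x y ^+ 2 * (P x y)%:R)%:E)%E.
Proof.
move=> ma mH mP c0 m0 aP Pm.
have cm : 0 <= c ^+ 2 * m by rewrite mulr_ge0// ?sqr_ge0// ltW.
have mHP : mker (fun x y => H x y ^+ 2 * (P x y)%:R).
  by apply: measurable_funM; [exact: measurable_funX|exact: mkerP].
have HP0 x y : 0 <= H x y ^+ 2 * (P x y)%:R by rewrite mulr_ge0// sqr_ge0.
rewrite -ge0_integralZl_EFin//; first last.
- exact: measurable_inner.
- by move=> x _; apply: integral_ge0 => y _; rewrite lee_fin.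
apply: ge0_le_integral => //.
- by move=> x _; rewrite lee_fin sqr_ge0.
- apply/measurable_EFinP/measurable_funX.
  by apply: (@measurable_fine_integral (fun x y => a x y * H x y)); exact: measurable_funM.
- by apply: measurable_funeM; exact: measurable_inner.
move=> x _; apply: sqr_integral_le => //; [exact: mker1|exact: mker1|].
exact: (measurableT_comp mP (pair1_measurable x)).
Qed.

Lemma schur a F P c m : mker a -> L2 F ->
  measurable_fun setT (fun p : V * V => P p.1 p.2) ->
  0 <= c -> 0 < m -> (forall x y, `|a x y| <= c * (P x y)%:R) ->
  (forall x, (\int[mu]_y (P x y)%:R%:E <= m%:E)%E) ->
  (forall y, (\int[mu]_x (P x y)%:R%:E <= m%:E)%E) ->
  L2 (op a F) /\ N2 (op a F) <= (c * m) ^+ 2 * N2 F.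
Proof.
move=> ma LF mP c0 m0 aP Pm Pm'; have [mF _] := LF.
have mF2 : mker (fun x y => F y) by rewrite /mker; mfun.
apply: L2_le; first exact: measurable_op.
apply: le_trans (schur_sqr ma mF2 mP c0 m0 aP Pm) _.
rewrite tonelli; last 2 first.
- by apply: measurable_funM; [exact: measurable_funX|exact: mkerP].
- by move=> x y; rewrite mulr_ge0// sqr_ge0.
rewrite (_ : (c * m) ^+ 2 * N2 F = (c ^+ 2 * m) * (m * N2 F)); last by ring.
rewrite [leRHS]EFinM.
apply: lee_wpmul2l; first by rewrite lee_fin mulr_ge0// ?sqr_ge0// ltW.
rewrite EFinM N2E// -ge0_integralZl_EFin//; last 3 first.
- by move=> x _; rewrite lee_fin sqr_ge0.
- by mfun.
- exact: ltW.
apply: ge0_le_integral => //.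
- by move=> y _; apply: integral_ge0 => x _; rewrite lee_fin mulr_ge0// sqr_ge0.
- apply: (@measurable_inner (fun y x => F y ^+ 2 * (P x y)%:R)).
    have mP' : measurable_fun setT (fun p : V * V => P p.2 p.1).
      have mS : measurable_fun setT (fun p : V * V => (p.2, p.1)) by mfun.
      exact: (measurableT_comp mP mS).
    by rewrite /mker; mfun.
  by move=> x y; rewrite mulr_ge0// sqr_ge0.
- by apply: measurable_funeM; mfun.
move=> y _; rewrite nnZ ?sqr_ge0//; last first.
  by apply: measurable_boolR; exact: (measurableT_comp mP (pair2_measurable y)).
by rewrite muleC; apply: lee_wpmul2r => //; rewrite lee_fin sqr_ge0.
Qed.

(** The scale invariant class used throughout: a kernel of size [l^-n] living within
    distance [l] of the diagonal.  Schur's bound for it does not depend on [l]. *)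
Definition lkern C l a := [/\ mker a, 0 < l, 0 <= C &
  forall x y, `|a x y| <= C * l ^- n * (`|x - y| <= l)%R%:R].

Lemma mnear l : measurable_fun setT (fun p : V * V => `|p.1 - p.2| <= l).
Proof. by mfun. Qed.

Lemma int_bool (Q : V -> bool) : measurable_fun setT Q ->
  (\int[mu]_y (Q y)%:R%:E = mu [set y | Q y])%E.
Proof.
move=> mQ; have mS : measurable [set y | Q y].
  rewrite (_ : [set y | _] = setT `&` Q @^-1` [set true]); first exact: mQ.
  by apply/seteqP; split => y //= [].
rewrite -[[set y | Q y]]setIT -integral_indic//; apply: eq_integral => y _.
by rewrite indicE; case: (boolP (Q y)) => h; [rewrite mem_set|rewrite memNset//; exact/negP].
Qed.

Lemma int_near l x : 0 <= l ->
  (\int[mu]_y (`|x - y| <= l)%R%:R%:E = ((2 * l) ^+ n)%:E)%E.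
Proof. by move=> l0; rewrite int_bool ?lebesgue_normB_le//; mfun. Qed.

Lemma int_near2 l y : 0 <= l ->
  (\int[mu]_x (`|x - y| <= l)%R%:R%:E = ((2 * l) ^+ n)%:E)%E.
Proof.
by move=> l0; rewrite -(int_near y l0); apply: eq_integral => x _; rewrite distrC.
Qed.

Lemma lkern_N2 C l a F : lkern C l a -> L2 F ->
  L2 (op a F) /\ N2 (op a F) <= (C * 2 ^+ n) ^+ 2 * N2 F.
Proof.
move=> [ma l0 C0 aP] LF.
have ln : 0 < l ^+ n by rewrite exprn_gt0.
have := @schur a F (fun x y => `|x - y| <= l) (C * l ^- n) ((2 * l) ^+ n) ma LF.
rewrite (_ : C * l ^- n * _ = C * 2 ^+ n); last first.
  by rewrite exprMn; field; rewrite gt_eqF.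
apply => //.
- exact: mnear.
- by rewrite mulr_ge0// invr_ge0 ltW.
- by rewrite exprn_gt0// mulr_gt0.
- by move=> x; rewrite int_near// ltW.
- by move=> y; rewrite int_near2// ltW.
Qed.

Lemma lkern_L2 C l a x : lkern C l a -> L2 (a x).
Proof.
move=> [ma l0 C0 aP].
have c0 : 0 <= C * l ^- n by rewrite mulr_ge0// invr_ge0 exprn_ge0// ltW.
apply: (@L2_le _ _ _ _ _ ((C * l ^- n) ^+ 2 * (2 * l) ^+ n) _ _).1.
  exact: mker1.
apply: (@le_trans _ _ (\int[mu]_y ((C * l ^- n) ^+ 2 * (`|x - y| <= l)%R%:R)%:E)%E).
  apply: nn_le => [||y].
  - by have h := mker1 x ma; mfun.
  - by mfun.
  rewrite sqr_ge0/= -(real_normK (num_real (a x y))).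
  have := aP x y; case: (`|x - y| <= l); rewrite ?mulr1 ?mulr0 => h.
    by rewrite ler_pXn2r// nnegrE.
  by rewrite (le_anti (y := 0) (x := `|a x y|)) ?h ?expr0n//=.
rewrite nnZ ?sqr_ge0//; last by mfun.
by rewrite int_near ?EFinM// ltW.
Qed.

Lemma L2_near l x : 0 <= l -> L2 (fun y => (`|x - y| <= l)%R%:R).
Proof.
move=> l0; split; first by mfun.
rewrite (eq_integral (fun y => (`|x - y| <= l)%R%:R%:E)) => [|y _].
  by rewrite int_near// ltry.
by case: (_ <= _); rewrite ?expr1n ?expr0n.
Qed.

Lemma lkern_int1 C l a x : lkern C l a ->
  mu.-integrable setT (fun y => (a x y)%:E).
Proof.
move=> ka; have [_ l0 _ aP] := ka.
have := L2_int (lkern_L2 x ka) (L2_near x (ltW l0)).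
congr (integrable _ _ _); apply/funext => y.
have := aP x y; case: (`|x - y| <= l); rewrite ?mulr1// !mulr0 normr_le0.
by move=> /eqP ->.
Qed.

Lemma op_B C l a F G x : lkern C l a -> L2 F -> L2 G ->
  op a (fun y => F y - G y) x = op a F x - op a G x.
Proof.
move=> ka LF LG; rewrite /op.
have := dotBl LF LG (lkern_L2 x ka); rewrite /dot => e.
rewrite (eq_integral (fun y => ((F y - G y) * a x y)%:E)) => [|y _]; last by rewrite mulrC.
by rewrite e; congr (_ - _); congr fine; apply: eq_integral => y _; rewrite mulrC.
Qed.

Lemma op_sum C l a I (s : seq I) (Q : pred I) (F : I -> V -> R) x :
  lkern C l a -> (forall i, Q i -> L2 (F i)) ->
  op a (fun y => \sum_(i <- s | Q i) F i y) x = \sum_(i <- s | Q i) op a (F i) x.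
Proof.
move=> ka LF; rewrite /op.
have := dot_suml s LF (lkern_L2 x ka); rewrite /dot => e.
rewrite (eq_integral (fun y => ((\sum_(i <- s | Q i) F i y) * a x y)%:E)) => [|y _];
  last by rewrite mulrC.
rewrite e; apply: eq_bigr => i _.
by congr fine; apply: eq_integral => y _; rewrite mulrC.
Qed.

Definition tr u F x := F (x - u).
Definition dif u F x := F (x - u) - F x.

Lemma integral_shift (f : V -> \bar R) u : measurable_fun setT f ->
  (\int[mu]_x f (x - u)%R = \int[mu]_x f x)%E.
Proof.
move=> mf; have := @integral_affine R n f 1 (- u) (oner_neq0 _) mf.
rewrite normr1 expr1n invr1 mul1e => <-.
by apply: eq_integral => x _; rewrite scale1r.
Qed.

Lemma dot_tr u F G : measurable_fun setT F -> measurable_fun setT G ->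
  dot (tr u F) (tr u G) = dot F G.
Proof.
move=> mF mG; congr fine.
by rewrite -[RHS](integral_shift u)//; mfun.
Qed.

Lemma L2_tr u F : L2 F -> L2 (tr u F).
Proof.
move=> [mF F2]; split; first by rewrite /tr; mfun.
by rewrite (integral_shift u (f := fun x => (F x ^+ 2)%:E))//; mfun.
Qed.

Lemma N2_tr u F : L2 F -> N2 (tr u F) = N2 F.
Proof. by move=> [mF _]; exact: dot_tr. Qed.

Lemma L2_dif u F : L2 F -> L2 (dif u F).
Proof. by move=> LF; apply: L2B => //; exact: L2_tr. Qed.

(** [op a F - k F] is an average of increments of [F] over distances at most [l],
    so it is small when [F] hardly changes under such translations. *)
Lemma lkern_dif C l a F k e : lkern C l a -> L2 F ->
  (forall x, fine (\int[mu]_y (a x y)%:E) = k) ->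
  (forall u, `|u| <= l -> N2 (dif u F) <= e) ->
  N2 (fun x => op a F x - k * F x) <= (C * 2 ^+ n) ^+ 2 * e.
Proof.
move=> ka LF ak Fe; have [ma l0 C0 aP] := ka; have [mF _] := LF.
pose H x y := F y - F x.
have mH : mker H by rewrite /mker /H; mfun.
have -> : (fun x => op a F x - k * F x) =
    fun x => fine (\int[mu]_y (a x y * H x y)%:E).
  apply/funext => x.
  have i1 := L2_int (lkern_L2 x ka) LF.
  have i2 := integrableZl measurableT (F x) (lkern_int1 x ka).
  rewrite -(ak x) /op mulrC -[F x]/(fine (F x)%:E) -fineM//; last first.
    exact: integrable_fin_num (lkern_int1 x ka).
  rewrite -integralZl ?(lkern_int1 x ka)// -fineB ?integrable_fin_num//.
  rewrite -integralB//.
  by congr fine; apply: eq_integral => y _; rewrite /H -EFinM -EFinB; congr EFin; ring.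
have e0 : 0 <= e.
  by apply: (le_trans (N2_ge0 mu (dif 0 F))) (Fe 0 _); rewrite normr0 ltW.
have ln : 0 < l ^+ n by rewrite exprn_gt0.
have c0 : 0 <= C * l ^- n by rewrite mulr_ge0// invr_ge0 ltW.
have l2 : 0 < (2 * l) ^+ n by rewrite exprn_gt0// mulr_gt0.
apply: (@L2_le _ _ _ _ _ _ _ _).2.
  by apply: measurable_fine_integral; exact: measurable_funM.
apply: le_trans (schur_sqr ma mH (mnear l) c0 l2 aP _) _.
  by move=> x; rewrite int_near// ltW.
pose D u x := dif u F x ^+ 2 * (`|u| <= l)%R%:R.
have mD : mker D by rewrite /mker /D /dif; mfun.
have D0 u x : 0 <= D u x by rewrite mulr_ge0// sqr_ge0.
have -> : (\int[mu]_x \int[mu]_y (H x y ^+ 2 * (`|x - y| <= l)%R%:R)%:E =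
    \int[mu]_u \int[mu]_x (D u x)%:E)%E.
  rewrite (tonelli mD D0); apply: eq_integral => x _.
  pose f y := (H x y ^+ 2 * (`|x - y| <= l)%R%:R)%:E.
  have mf : measurable_fun setT f by rewrite /f /H; mfun.
  have := @integral_affine R n f (-1) x _ mf.
  rewrite normrN1 expr1n invr1 mul1e => <-; last by rewrite oppr_eq0 oner_eq0.
  apply: eq_integral => u _; rewrite /f /H /D /dif scaleN1r (addrC _ x) opprB.
  by rewrite addrCA subrr addr0.
apply: (@le_trans _ _ (((C * l ^- n) ^+ 2 * (2 * l) ^+ n)%:E *
    \int[mu]_u (e * (`|u| <= l)%R%:R)%:E)%E).
  apply: lee_wpmul2l; first by rewrite lee_fin mulr_ge0// ?sqr_ge0// ltW.
  apply: ge0_le_integral => //.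
  - by move=> u _; apply: integral_ge0 => x _; rewrite lee_fin.
  - exact: measurable_inner.
  - by mfun.
  move=> u _; rewrite /D; case: (boolP (`|u| <= l)) => ul.
    under eq_integral do rewrite mulr1.
    by rewrite mulr1 -N2E ?lee_fin; [exact: Fe|exact: L2_dif].
  by rewrite mulr0 integral0_eq// => x _; rewrite mulr0.
have -> : (\int[mu]_u (e * (`|u| <= l)%R%:R)%:E = (e * (2 * l) ^+ n)%:E)%E.
  rewrite nnZ//; last by mfun.
  by rewrite EFinM -(int_near2 0 (ltW l0)); congr (_ * _)%E;
     apply: eq_integral => u _; rewrite subr0.
rewrite -EFinM lee_fin !exprMn le_eqVlt; apply/orP; left; apply/eqP.
by field; rewrite gt_eqF.
Qed.

Lemma lkern_tr C l a : lkern C l a -> lkern C l (fun x y => a y x).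
Proof.
move=> [ma l0 C0 aP]; split => // [|x y]; last by rewrite distrC.
have mS : measurable_fun setT (fun p : V * V => (p.2, p.1)) by mfun.
exact: (measurableT_comp ma mS).
Qed.

Lemma adjoint C l a F G : lkern C l a -> L2 F -> L2 G ->
  dot (op a F) G = dot F (op (fun x y => a y x) G).
Proof.
move=> ka LF LG; have [ma l0 C0 aP] := ka; have [mF _] := LF; have [mG _] := LG.
pose f (p : V * V) := (a p.1 p.2 * F p.2 * G p.1)%:E.
have ma' : measurable_fun setT (fun p : V * V => a p.1 p.2) := ma.
have mf : measurable_fun setT f by rewrite /f; mfun.
have If : (mu \x mu)%E.-integrable setT f.
  apply/integrable12ltyP => //.
  pose b x y := `|a x y|.
  have kb : lkern C l b by split=> // [|x y]; [rewrite /mker /b; mfun|rewrite normr_id].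
  have LF' : L2 (fun x => `|F x|).
    split; first by mfun.
    by under eq_integral do rewrite real_normK ?num_real//; case: LF.
  have LG' : L2 (fun x => `|G x|).
    split; first by mfun.
    by under eq_integral do rewrite real_normK ?num_real//; case: LG.
  have [Lb _] := lkern_N2 kb LF'.
  have I := integrable_lty measurableT (L2_int Lb LG').
  apply: le_lt_trans I.
  apply: ge0_le_integral => //.
  - by move=> x _; apply: integral_ge0.
  - apply: (@measurable_inner (fun x y => `|a x y * F y * G x|)) => //.
    by rewrite /mker; mfun.
  - by apply/measurable_EFinP/measurable_funM; [case: Lb|mfun].
  move=> x _; rewrite [leRHS]EFinM /op fineK; last first.
    exact: integrable_fin_num (L2_int (lkern_L2 x kb) LF').
  rewrite -ge0_integralZr//; last 2 first.
  - by apply/measurable_EFinP/measurable_funM; [case: kb => kb _ _ _; exact: (mker1 x kb)|mfun].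
  - by move=> y _; rewrite lee_fin mulr_ge0// normr_ge0.
  rewrite le_eqVlt; apply/orP; left; apply/eqP/eq_integral => y _.
  by rewrite -EFinM /f /= !normrM.
have := Fubini If; rewrite /f /= => e.
rewrite /dot.
transitivity (fine (\int[mu]_x \int[mu]_y (a x y * F y * G x)%:E)).
  congr fine; apply: eq_integral => x _.
  have i := L2_int (lkern_L2 x ka) LF.
  rewrite EFinM /op fineK ?integrable_fin_num// -integralZr//.
transitivity (fine (\int[mu]_y \int[mu]_x (a x y * F y * G x)%:E)).
  by rewrite e.
congr fine; apply: eq_integral => y _.
have i := L2_int (lkern_L2 y (lkern_tr ka)) LG.
rewrite EFinM /op fineK ?integrable_fin_num// -integralZl//.
by apply: eq_integral => x _; rewrite -EFinM; congr EFin; ring.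
Qed.

End operators.

(** * Averages over cubes and cells, and the smoothing estimate *)

Module Averages.

Section averages.
Context {R : realType} {n : nat}.
Local Notation V := 'rV[R]_n.
Local Notation mu := (@lebesgue_rV R n).
Local Notation L2 := (L2 mu).
Local Notation dot := (dot mu).
Local Notation N2 := (N2 mu).
Implicit Types (x y u : V) (F G : V -> R) (r l t : R).

(** Average over the cube of radius [r] around the point. *)
Definition pk r x y : R := (2 * r) ^- n * (`|x - y| <= r)%R%:R.
(** Average over the grid cell of side [l] that contains the point. *)
Definition qk l x y : R := l ^- n * (same l x y)%:R.

Lemma lkern_pk r : 0 < r -> lkern 1 r (pk r).
Proof.
move=> r0; split => // [|x y]; first by rewrite /mker /pk; mfun.
rewrite mul1r ger0_norm; last by rewrite mulr_ge0// invr_ge0 exprn_ge0// mulr_ge0// ltW.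
rewrite ler_wpM2r// lef_pV2 ?posrE ?exprn_gt0// ?mulr_gt0//.
by rewrite lerXn2r ?nnegrE ?mulr_ge0 ?ltW// ltr_pMl// ltr1n.
Qed.

Lemma lkern_qk l : 0 < l -> lkern 1 l (qk l).
Proof.
move=> l0; split => // [|x y].
  by rewrite /mker /qk; apply: measurable_funM => //; apply: measurable_boolR;
    apply: measurable_same; mfun.
rewrite mul1r ger0_norm; last by rewrite mulr_ge0// invr_ge0 exprn_ge0// ltW.
apply: ler_wpM2l; first by rewrite invr_ge0 exprn_ge0// ltW.
by rewrite ler_nat; case: (boolP (same l x y)) => // /(same_norm l0) ->.
Qed.

Lemma pk_sym r x y : pk r x y = pk r y x.
Proof. by rewrite /pk distrC. Qed.

Lemma qk_sym l x y : qk l x y = qk l y x.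
Proof. by rewrite /qk same_sym. Qed.

Lemma int_pk r x : 0 < r -> (\int[mu]_y (pk r x y)%:E = 1)%E.
Proof.
move=> r0; have r2 : 0 < (2 * r) ^+ n by rewrite exprn_gt0// mulr_gt0.
rewrite nnZ ?invr_ge0 ?ltW//; last by mfun.
by rewrite int_near ?ltW// -EFinM mulVf// gt_eqF.
Qed.

Lemma int_same l x : 0 < l -> (\int[mu]_y (same l x y)%:R%:E = (l ^+ n)%:E)%E.
Proof.
move=> l0; rewrite int_bool ?lebesgue_cell//.
by apply: measurable_same; mfun.
Qed.

Lemma int_qk l x : 0 < l -> (\int[mu]_y (qk l x y)%:E = 1)%E.
Proof.
move=> l0; have ln : 0 < l ^+ n by rewrite exprn_gt0.
rewrite nnZ ?invr_ge0 ?ltW//; last first.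
  by apply: measurable_boolR; apply: measurable_same; mfun.
by rewrite int_same// -EFinM mulVf// gt_eqF.
Qed.

Lemma adjoint_pk r F G : 0 < r -> L2 F -> L2 G ->
  dot (op (pk r) F) G = dot F (op (pk r) G).
Proof.
move=> r0 LF LG; have -> := adjoint (lkern_pk r0) LF LG; congr (Hilbert.dot _ _ _).
by apply/funext => x; congr fine; apply: eq_integral => y _; rewrite pk_sym.
Qed.

Lemma adjoint_qk l F G : 0 < l -> L2 F -> L2 G ->
  dot (op (qk l) F) G = dot F (op (qk l) G).
Proof.
move=> r0 LF LG; have -> := adjoint (lkern_qk r0) LF LG; congr (Hilbert.dot _ _ _).
by apply/funext => x; congr fine; apply: eq_integral => y _; rewrite qk_sym.
Qed.

(** The form in which an estimate for an operator passes to its adjoint: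
    [F] is the adjoint applied to [g], and [s] the operator applied to [F]. *)
Lemma dual_le F (g s : V -> R) e : 0 <= e -> L2 F -> L2 g -> L2 s ->
  N2 F = dot g s -> N2 s <= e * N2 F -> N2 F <= e * N2 g.
Proof.
move=> e0 LF Lg Ls e1 e2; have F0 := N2_ge0 mu F; have g0 := N2_ge0 mu g.
have [F00|Fn0] := eqVneq (N2 F) 0.
  by rewrite F00 mulr_ge0.
have Fp : 0 < N2 F by rewrite lt_def Fn0.
have := cauchy_schwarz Lg Ls; rewrite -e1 => h.
rewrite -(ler_pM2r Fp) -expr2; apply: le_trans h _.
by rewrite mulrAC [leRHS]mulrC ler_wpM2l.
Qed.

Lemma dif_op C l (a : V -> V -> R) F u x : lkern C l a -> L2 F ->
  (forall y z, a (y - u) (z - u) = a y z) ->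
  dif u (op a F) x = op a (dif u F) x.
Proof.
move=> ka LF au; have [ma _ _ _] := ka; have [mF _] := LF.
rewrite {2}/dif (op_B _ ka (L2_tr u LF) LF) /dif; congr (_ - _).
congr fine; rewrite -(integral_shift u); last first.
  by have h := mker1 (x - u) ma; mfun.
by apply: eq_integral => y _; rewrite au.
Qed.

Lemma expr_sub_le t m : 0 <= t <= 1 ->
  (1 + t) ^+ m - (1 - t) ^+ m <= 2 * m%:R * t * 2 ^+ m.
Proof.
move=> /andP[t0 t1]; elim: m => [|m ih]; first by rewrite !expr0; lra.
have h1 : (1 - t) ^+ m <= 1 by rewrite exprn_ile1//; lra.
have h2 : 0 <= (1 - t) ^+ m by rewrite exprn_ge0//; lra.
have h3 : 0 <= (1 + t) ^+ m - (1 - t) ^+ m.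
  by rewrite subr_ge0 lerXn2r ?nnegrE//; lra.
have h4 : 1 <= 2 ^+ m :> R by rewrite exprn_ege1// ler1n.
rewrite [X in X - _]exprS [X in _ - X]exprS [in leRHS]exprS -natr1.
nra.
Qed.

Definition cP : R := 2 * n.+1%:R * 2 ^+ n.

Lemma cP_gt0 : 0 < cP.
Proof. by rewrite /cP !mulr_gt0// exprn_gt0. Qed.

(** Translating a cube average only changes it on a thin cubic annulus. *)
Lemma N2_dif_pk r u G : 0 < r -> `|u| <= r -> L2 G ->
  N2 (dif u (op (pk r) G)) <= (cP * (`|u| / r)) ^+ 2 * N2 G.
Proof.
move=> r0 ur LG; have [LP NP] := lkern_N2 (lkern_pk r0) LG.
have [->|u0] := eqVneq u 0.
  rewrite (_ : dif 0 _ = fun=> 0); last by apply/funext => x; rewrite /dif subr0 subrr.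
  rewrite [leLHS](_ : _ = 0); first by rewrite mulr_ge0 ?sqr_ge0 ?N2_ge0.
  by rewrite /Hilbert.N2 /Hilbert.dot integral0_eq// => x _; rewrite mul0r.
have up : 0 < `|u| by rewrite normr_gt0.
set t := `|u| / r; have t0 : 0 < t by rewrite divr_gt0.
have t1 : t <= 1 by rewrite ler_pdivrMr// mul1r.
have tr : `|u| = t * r by rewrite /t divfK// gt_eqF.
pose P x y := (`|x - y| <= r + `|u|) && ~~ (`|x - y| <= r - `|u|).
pose a x y := pk r (x - u) y - pk r x y.
have r2 : 0 < (2 * r) ^+ n by rewrite exprn_gt0// mulr_gt0.
have ma : mker a by rewrite /mker /a /pk; mfun.
have mP : measurable_fun setT (fun p : V * V => P p.1 p.2) by rewrite /P; mfun.
have aP x y : `|a x y| <= (2 * r) ^- n * (P x y)%:R.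
  rewrite /a /pk -mulrBr normrM gtr0_norm ?invr_gt0// ler_pM2l ?invr_gt0// /P.
  have d1 : `|x - y| <= `|x - u - y| + `|u|.
    by rewrite -{1}(subrK u (x - y)) (le_trans (ler_normD _ _))// addrAC.
  have d2 : `|x - u - y| <= `|x - y| + `|u|.
    by rewrite addrAC (le_trans (ler_normB _ _)).
  case: (leP `|x - u - y| r) => h1; case: (leP `|x - y| r) => h2;
    rewrite ?subrr ?normr0 ?subr0 ?sub0r ?normrN ?normr1//= ler1n lt0b.
  - by apply/andP; split; [lra|rewrite -ltNge; lra].
  - by apply/andP; split; [lra|rewrite -ltNge; lra].
pose m := (2 * r) ^+ n * (cP * t).
have m0 : 0 < m by apply: mulr_gt0 => //; apply: mulr_gt0 => //; exact: cP_gt0.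
have Pm x : (\int[mu]_y (P x y)%:R%:E <= m%:E)%E.
  have mP1 := measurableT_comp mP (pair1_measurable x).
  have ru : 0 <= r - `|u| by rewrite subr_ge0.
  have e : (\int[mu]_y (P x y)%:R%:E + ((2 * (r - `|u|)) ^+ n)%:E =
      ((2 * (r + `|u|)) ^+ n)%:E :> \bar R)%E.
    rewrite -(int_near x ru) -(int_near x (l := r + `|u|)); last by lra.
    rewrite -nnD//; [|exact: measurable_boolR|by mfun].
    apply: eq_integral => y _; congr EFin; rewrite /P.
    case: (leP `|x - y| (r - `|u|)) => h; last by rewrite andbT addr0.
    by rewrite andbF add0r (_ : `|x - y| <= r + `|u|)//; lra.
  have -> : (\int[mu]_y (P x y)%:R%:E =
      ((2 * (r + `|u|)) ^+ n - (2 * (r - `|u|)) ^+ n)%:E)%E by rewrite EFinB -e addeK.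
  rewrite lee_fin tr (_ : r + t * r = (1 + t) * r); last by ring.
  rewrite (_ : r - t * r = (1 - t) * r); last by ring.
  rewrite (mulrCA 2) (mulrCA 2) [X in X - _]exprMn [X in _ - X]exprMn -mulrBl.
  rewrite mulrC /m ler_pM2l//.
  have h := @expr_sub_le t n _.
  apply: le_trans (h _) _; first by rewrite ltW.
  rewrite /cP -natr1; set w := 2 ^+ n.
  have w0 : 0 < t * w by rewrite mulr_gt0// exprn_gt0.
  nra.
have Pm' y : (\int[mu]_x (P x y)%:R%:E <= m%:E)%E.
  rewrite (eq_integral (fun x => (P y x)%:R%:E)) => [|x _]; last by rewrite /P distrC.
  exact: Pm.
have c0 : 0 <= (2 * r) ^- n by rewrite invr_ge0 ltW.
have := (schur ma LG mP c0 m0 aP Pm Pm').2.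
rewrite (_ : (2 * r) ^- n * m = cP * t); last by rewrite /m; field; rewrite gt_eqF.
apply: le_trans; rewrite le_eqVlt; apply/orP; left; apply/eqP/eq_N2 => x.
rewrite /dif /op /a -fineB ?integrable_fin_num//; try exact: L2_int (lkern_L2 _ (lkern_pk r0)) LG.
rewrite -integralB//; try exact: L2_int (lkern_L2 _ (lkern_pk r0)) LG.
by congr fine; apply: eq_integral => y _; rewrite -EFinB mulrBl.
Qed.

(** The triangle inequality for [m] functions, in squared form. *)
Lemma N2_sum_le m (f : nat -> V -> R) b : (forall i, (i < m)%N -> L2 (f i)) ->
  (forall i, (i < m)%N -> N2 (f i) <= b) ->
  N2 (fun x => \sum_(i < m) f i x) <= m%:R ^+ 2 * b.
Proof.
move=> Lf fb; rewrite /Hilbert.N2 dot_suml//; [|by move=> i _; exact: Lf|]; last first.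
  by apply: L2_sum => i _; exact: Lf.
apply: (@le_trans _ _ (\sum_(i < m) \sum_(j < m) b)).
  apply: ler_sum => i _; rewrite dotC dot_suml//; [|by move=> j _; exact: Lf|exact: Lf].
  apply: ler_sum => j _; apply: le_trans (ler_norm _) _.
  have := dot_le (Lf j (ltn_ord j)) (Lf i (ltn_ord i)) ltr01; rewrite invr1 !mul1r.
  have := fb i (ltn_ord i); have := fb j (ltn_ord j) => h1 h2 h3.
  by apply: le_trans h3 _; lra.
by rewrite !sumr_const !card_ord -mulrnA -[_ *+ _]mulr_natl natrM expr2.
Qed.

End averages.

End Averages.
Import Averages.

(** * Dyadic pieces of a rough singular kernel are smoothing *)

Section rough.
Context {R : realType} {n : nat}.
Local Notation V := 'rV[R]_n.
Local Notation mu := (@lebesgue_rV R n).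
Local Notation L2 := (L2 mu).
Local Notation dot := (dot mu).
Local Notation N2 := (N2 mu).
Local Notation cP := (@cP R n).
Implicit Types (x y u v : V) (F G K : V -> R) (r s t a M : R) (B L : nat).

(** A rough Calderon-Zygmund kernel: homogeneous of degree [- n], with a size bound
    and mean zero on spherical shells. *)
Definition czk M K := [/\ measurable_fun setT K, 0 <= M,
  forall u, u != 0 -> `|K u| <= M * enorm u ^- n,
  forall t u, 0 < t -> u != 0 -> K (t *: u) = t ^- n * K u &
  forall r s, 0 < r ->
    fine (\int[mu]_u (K u * (r < enorm u <= s)%R%:R)%:E) = 0].

(** The part of the kernel between the radii [r] and [s]. *)
Definition sk K r s x y : R := K (x - y) * (r < enorm (x - y) <= s)%R%:R.

Lemma czk_refl M K : czk M K -> czk M (fun u => K (- u)).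
Proof.
move=> [mK M0 KM Kt K0]; split => //.
- by mfun.
- by move=> u u0; rewrite -enormN KM// oppr_eq0.
- by move=> t u t0 u0; rewrite -scalerN Kt// oppr_eq0.
move=> r s r0; rewrite -(K0 r s r0).
pose f u := (K u * (r < enorm u <= s)%R%:R)%:E.
have mf : measurable_fun setT f by rewrite /f; mfun.
have := @integral_affine R n f (-1) 0 _ mf.
rewrite normrN1 expr1n invr1 mul1e => <-; last by rewrite oppr_eq0 oner_eq0.
by congr fine; apply: eq_integral => u _; rewrite /f addr0 scaleN1r enormN.
Qed.

Lemma sk_tr K r s x y : sk K r s y x = sk (fun u => K (- u)) r s x y.
Proof. by rewrite /sk opprB -(enormN (x - y)) opprB. Qed.

Lemma mker_sk M K r s : czk M K -> mker (sk K r s).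
Proof. by move=> [mK _ _ _ _]; rewrite /mker /sk; mfun. Qed.

Lemma czk_shell M K r s u : czk M K -> 0 < r -> r < enorm u <= s ->
  `|K u| <= M * r ^- n.
Proof.
move=> [_ M0 KM _ _] r0 /andP[ru _].
have e0 : 0 < enorm u by exact: lt_trans r0 ru.
apply: le_trans (KM u _) _; first by rewrite -enorm_gt0.
rewrite ler_wpM2l// lef_pV2 ?posrE ?exprn_gt0//.
by rewrite lerXn2r ?nnegrE ?ltW.
Qed.

Lemma lkern_sk M K r s : czk M K -> 0 < r -> r <= s ->
  lkern (M * (s / r) ^+ n) s (sk K r s).
Proof.
move=> cK r0 rs; have [_ M0 _ _ _] := cK.
have s0 : 0 < s by exact: lt_le_trans rs.
split=> //; first exact: mker_sk cK.
  by rewrite mulr_ge0// exprn_ge0// divr_ge0// ltW.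
move=> x y; rewrite /sk.
rewrite (_ : M * _ * s ^- n = M * r ^- n); last first.
  by rewrite exprMn exprVn; field; rewrite !gt_eqF// exprn_gt0.
rewrite normrM; case: (boolP (r < enorm (x - y) <= s)) => h.
  rewrite (_ : `|x - y| <= s); last first.
    by case/andP: h => _; apply: le_trans; exact: norm_le_enorm.
  by rewrite normr1 !mulr1; exact: czk_shell cK r0 h.
by rewrite normr0 mulr0 !mulr_ge0// invr_ge0 exprn_ge0// ltW.
Qed.

Lemma int_sk M K r s x : czk M K -> 0 < r ->
  fine (\int[mu]_y (sk K r s x y)%:E) = 0.
Proof.
move=> cK r0; have [mK _ _ _ K0] := cK; rewrite -(K0 r s r0).
pose f u := (K u * (r < enorm u <= s)%R%:R)%:E.
have mf : measurable_fun setT f by rewrite /f; mfun.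
have := @integral_affine R n f (-1) x _ mf.
rewrite normrN1 expr1n invr1 mul1e => <-; last by rewrite oppr_eq0 oner_eq0.
by congr fine; apply: eq_integral => y _; rewrite /f scaleN1r addrC.
Qed.

(** By homogeneity all dilates of a shell piece act through one fixed function on
    a fixed shell, evaluated along dilated translates of [F]. *)
Lemma op_sk_scale M K r1 r2 s F x : czk M K -> 0 < r1 -> r1 <= r2 -> 0 < s ->
  L2 F ->
  op (sk K (s * r1) (s * r2)) F x =
  fine (\int[mu]_u (K u * (r1 < enorm u <= r2)%R%:R * F (x - s *: u))%:E).
Proof.
move=> cK r10 r12 s0 LF; have [mK _ _ Kt _] := cK; have [mF _] := LF.
pose f y := (sk K (s * r1) (s * r2) x y * F y)%:E.
have sr : 0 < s * r1 by rewrite mulr_gt0.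
have sr12 : s * r1 <= s * r2 by rewrite ler_pM2l.
have If : mu.-integrable setT f := L2_int (lkern_L2 x (lkern_sk cK sr sr12)) LF.
have mf : measurable_fun setT (fun y => (s ^+ n)%:E * f y)%E.
  by apply: measurable_funeM; exact: measurable_int If.
have sn : 0 < s ^+ n by rewrite exprn_gt0.
have := @integral_affine R n _ (- s) x _ mf.
rewrite oppr_eq0 gt_eqF// normrN gtr0_norm// (integralZl measurableT If) => /(_ isT).
rewrite muleA -EFinM mulVf ?gt_eqF// mul1e /op -/(f _) => <-.
congr fine; apply: eq_integral => u _; rewrite /f /sk -EFinM; congr EFin.
rewrite scaleNr (addrC _ x) subKr enormZ gtr0_norm// ltr_pM2l// ler_pM2l//.
case: (boolP (r1 < enorm u <= r2)) => h; last by rewrite !(mulr0, mul0r).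
rewrite Kt//; last by rewrite -enorm_gt0; case/andP: h => h _; exact: lt_trans h.
by rewrite !mulr1; field; rewrite gt_eqF.
Qed.

Definition shell_vol : R := fine (\int[mu]_u (enorm u <= 1)%R%:R%:E).

Lemma int_ball r : 0 < r ->
  (\int[mu]_u (enorm u <= r)%R%:R%:E = (r ^+ n * shell_vol)%:E)%E /\
  0 <= shell_vol <= 2 ^+ n.
Proof.
move=> r0; pose f u : \bar R := (enorm u <= 1)%R%:R%:E.
have mf : measurable_fun setT f by rewrite /f; mfun.
have f1 : (\int[mu]_u f u <= (2 ^+ n)%:E)%E.
  rewrite -[2 in leRHS]mulr1 -(int_near 0 ler01); apply: nn_le => [||u].
  - by mfun.
  - by mfun.
  rewrite ler0n ler_nat sub0r normrN; case: (boolP (enorm u <= 1)) => // h.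
  by rewrite (le_trans (norm_le_enorm _) h).
have f0 : (0 <= \int[mu]_u f u)%E by apply: integral_ge0 => u _; rewrite lee_fin.
have ff : (\int[mu]_u f u)%E \is a fin_num.
  by rewrite ge0_fin_numE// (le_lt_trans f1)// ltry.
split; last first.
  by rewrite fine_ge0//= -lee_fin fineK.
have := @integral_affine R n f r^-1 0 _ mf.
rewrite invr_eq0 gt_eqF// normfV gtr0_norm// exprVn invrK => /(_ isT).
rewrite EFinM fineK// => <-; apply: eq_integral => u _.
rewrite /f addr0 enormZ normfV gtr0_norm// mulrC.
by rewrite ler_pdivrMr// mul1r.
Qed.

(** A thin shell has measure proportional to its relative thickness. *)
Lemma int_shell r s x : 0 < r -> 1 <= s <= 2 ->
  (\int[mu]_y (r < enorm (x - y) <= s * r)%R%:R%:E <=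
    (r ^+ n * 2 ^+ n * cP * (s - 1))%:E)%E.
Proof.
move=> r0 /andP[s1 s2].
have sr : 0 < s * r by rewrite mulr_gt0//; lra.
have [e1 /andP[w0 w2]] := int_ball r0; have [e2 _] := int_ball sr.
have -> : (\int[mu]_y (r < enorm (x - y) <= s * r)%R%:R%:E =
    \int[mu]_u (r < enorm u <= s * r)%R%:R%:E)%E.
  pose f u : \bar R := (r < enorm u <= s * r)%R%:R%:E.
  have mf : measurable_fun setT f by rewrite /f; mfun.
  have := @integral_affine R n f (-1) x _ mf.
  rewrite normrN1 expr1n invr1 mul1e => <-; last by rewrite oppr_eq0 oner_eq0.
  by apply: eq_integral => y _; rewrite /f scaleN1r addrC.
have e : (\int[mu]_u (r < enorm u <= s * r)%R%:R%:E + (r ^+ n * shell_vol)%:E =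
    ((s * r) ^+ n * shell_vol)%:E :> \bar R)%E.
  rewrite -e1 -e2 -nnD//; [|by mfun|by mfun].
  apply: eq_integral => u _; congr EFin.
  case: (leP (enorm u) r) => h; last by rewrite /= addr0.
  by rewrite add0r (_ : enorm u <= s * r)// (le_trans h)// ler_peMl// ltW.
have -> : (\int[mu]_u (r < enorm u <= s * r)%R%:R%:E =
    ((s * r) ^+ n * shell_vol - r ^+ n * shell_vol)%:E)%E by rewrite EFinB -e addeK.
rewrite lee_fin exprMn -mulrBl (_ : s ^+ n * r ^+ n - r ^+ n = (s ^+ n - 1) * r ^+ n);
  last by ring.
have h := @expr_sub_le R (s - 1) n _.
have h1 : s ^+ n - 1 <= cP * (s - 1).
  have /h : 0 <= s - 1 <= 1 by lra.
  rewrite (_ : 1 + (s - 1) = s); last by ring.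
  have k1 : (1 - (s - 1)) ^+ n <= 1 by rewrite exprn_ile1//; lra.
  move=> k2; apply: (@le_trans _ _ (2 * n%:R * (s - 1) * 2 ^+ n)); first by lra.
  rewrite /Averages.cP -natr1; set w := 2 ^+ n.
  have w0' : 0 <= (s - 1) * w by rewrite mulr_ge0// ?exprn_ge0//; lra.
  nra.
rewrite (_ : r ^+ n * 2 ^+ n * cP * (s - 1) = (cP * (s - 1)) * r ^+ n * 2 ^+ n);
  last by ring.
have rn : 0 <= r ^+ n by rewrite exprn_ge0// ltW.
have s0 : 0 <= s ^+ n - 1 by rewrite subr_ge0 exprn_ege1.
apply: ler_pM => //; first by rewrite mulr_ge0.
by rewrite ler_wpM2r.
Qed.

Lemma integrable_ball (f : V -> R) x b r : 0 <= b -> 0 <= r ->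
  measurable_fun setT f -> (forall u, `|f u| <= b * (`|x - u| <= r)%R%:R) ->
  mu.-integrable setT (fun u => (f u)%:E).
Proof.
move=> b0 r0 mf fb; apply/integrableP; split; first exact/measurable_EFinP.
apply: (@le_lt_trans _ _ (\int[mu]_u (b * (`|x - u| <= r)%R%:R)%:E)%E).
  under eq_integral do rewrite abse_EFin.
  by apply: nn_le => [||u]; [by mfun|by mfun|rewrite normr_ge0 fb].
by rewrite nnZ ?int_near// -?EFinM ?ltry//; mfun.
Qed.

Lemma fine_integralZ (f : V -> R) b : mu.-integrable setT (fun x => (f x)%:E) ->
  b * fine (\int[mu]_x (f x)%:E) = fine (\int[mu]_x (b * f x)%:E).
Proof.
move=> If; rewrite -[b in LHS]/(fine b%:E) -fineM; last 2 first.
- by [].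
- exact: integrable_fin_num If.
by rewrite -(integralZl measurableT If).
Qed.

Definition corr F v : R := dot F (tr v F).

Lemma corr_le F v : L2 F -> `|corr F v| <= N2 F.
Proof.
move=> LF; have := dot_le LF (L2_tr v LF) ltr01.
by rewrite N2_tr// invr1 !mul1r /corr => h; apply: le_trans h _; lra.
Qed.

Lemma measurable_corr F : L2 F -> measurable_fun setT (corr F).
Proof.
move=> [mF _]; apply: (@measurable_fine_integral R n (fun v x => F x * tr v F x)).
by rewrite /mker /tr; mfun.
Qed.

(** Averaging the autocorrelation of [F] over a cube gives the quadratic form of
    the averaging operator. *)
Lemma int_corr F a : 0 < a -> L2 F ->
  fine (\int[mu]_v ((`|v| <= a)%R%:R * corr F v)%:E) =
  (2 * a) ^+ n * dot F (op (pk a) F).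
Proof.
move=> a0 LF; have [mF _] := LF.
have w0 : (2 * a) ^+ n != 0 by rewrite gt_eqF// exprn_gt0// mulr_gt0.
pose f (p : V * V) := ((`|p.1| <= a)%R%:R * (F p.2 * F (p.2 - p.1)))%:E.
have mf : measurable_fun setT f by rewrite /f; mfun.
have LF' : L2 (fun x => `|F x|).
  split; first by mfun.
  by under eq_integral do rewrite real_normK ?num_real//; case: LF.
have nF : N2 (fun x => `|F x|) = N2 F.
  by congr fine; apply: eq_integral => x _; rewrite -!expr2 real_normK ?num_real.
have If : (mu \x mu)%E.-integrable setT f.
  apply/integrable12ltyP => //.
  apply: (@le_lt_trans _ _ (\int[mu]_v (N2 F * (`|v| <= a)%R%:R)%:E)%E); last first.
    rewrite nnZ ?N2_ge0//; last by mfun.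
    rewrite (eq_integral (fun v => (`|0 - v| <= a)%R%:R%:E)) => [|v _].
      by rewrite int_near ?ltW// -EFinM ltry.
    by rewrite sub0r normrN.
  apply: ge0_le_integral => //.
  - by move=> v _; apply: integral_ge0.
  - apply: (@measurable_inner R n (fun v x => `|(`|v| <= a)%R%:R * (F x * F (x - v))|)) => //.
    by rewrite /mker; mfun.
  - by mfun.
  move=> v _; rewrite (eq_integral (fun x =>
      ((`|v| <= a)%R%:R * (`|F x| * tr v (fun x => `|F x|) x))%:E)) => [|x _]; last first.
    by rewrite /f abse_EFin /= /tr !normrM normr_nat.
  rewrite nnZ//; [|by rewrite /tr; mfun|by move=> x; rewrite mulr_ge0// normr_ge0].
  case: (`|v| <= a) => /=; last by rewrite mul0e mulr0.
  rewrite mul1e mulr1 -[leLHS]fineK; last first.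
    exact: integrable_fin_num (L2_int LF' (L2_tr v LF')).
  by rewrite lee_fin -nF; apply: le_trans (ler_norm _) (corr_le v LF').
have := Fubini If; rewrite /f /= => e.
have -> : fine (\int[mu]_v ((`|v| <= a)%R%:R * corr F v)%:E) =
    fine (\int[mu]_v \int[mu]_x ((`|v| <= a)%R%:R * (F x * F (x - v)))%:E).
  congr fine; apply: eq_integral => v _.
  have i := L2_int LF (L2_tr v LF).
  rewrite EFinM fineK; last exact: integrable_fin_num i.
  by rewrite -(integralZl measurableT i).
have [L _] := lkern_N2 (lkern_pk a0) LF.
rewrite e /Hilbert.dot (fine_integralZ _ (L2_int LF L)).
congr fine; apply: eq_integral => x _.
have i := L2_int (lkern_L2 x (lkern_pk a0)) LF.
rewrite mulrA EFinM /op fineK; last exact: integrable_fin_num i.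
rewrite -(integralZl measurableT i).
pose g y := ((`|x - y| <= a)%R%:R * (F x * F y))%:E.
have mg : measurable_fun setT g by rewrite /g; mfun.
have := @integral_affine R n g (-1) x _ mg.
rewrite normrN1 expr1n invr1 mul1e oppr_eq0 oner_eq0 => /(_ isT) eg.
transitivity (\int[mu]_y g y)%E.
  rewrite -eg; apply: eq_integral => v _; rewrite /g scaleN1r (addrC _ x) opprB.
  by rewrite addrCA subrr addr0.
apply: eq_integral => y _; rewrite /g /pk -!EFinM; congr EFin.
by rewrite -!mulrA (mulrCA (F x)) (mulVKf w0) mulrCA.
Qed.

Lemma ler_of_sqr a b : 0 <= b -> a ^+ 2 <= b ^+ 2 -> a <= b.
Proof.
move=> b0; have [a0|a0 _] := leP 0 a; first by rewrite ler_pXn2r.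
exact: le_trans (ltW a0) b0.
Qed.

(** An average over a cube of radius [a] almost annihilates a difference of
    translates by [y] as soon as [|y|] is much smaller than [a]. *)
Lemma corr_dif_le y G a t : 0 < a -> L2 G -> `|y| <= a -> `|y| / a <= t ->
  `|dot (dif y G) (op (pk a) (dif y G))| <= 2 * cP * t * N2 G.
Proof.
move=> a0 LG ya yt; have LF := L2_dif y LG.
have t0 : 0 <= t by apply: le_trans yt; rewrite divr_ge0// ltW.
have cP0 : 0 <= cP by rewrite ltW// cP_gt0.
have [LP _] := lkern_N2 (lkern_pk a0) LF.
have nF : N2 (dif y G) <= 4 * N2 G.
  have := N2_sub2 (L2_tr y LG) LG; rewrite N2_tr// => h.
  by apply: le_trans h _; lra.
have nP : N2 (op (pk a) (dif y G)) <= (cP * t) ^+ 2 * N2 G.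
  have := N2_dif_pk a0 ya LG.
  rewrite (eq_N2 mu (g := op (pk a) (dif y G))) => [h|x]; last first.
    apply: (dif_op _ (lkern_pk a0) LG) => u v.
    by rewrite /pk (_ : u - y - (v - y) = u - v)// opprB addrA subrK.
  apply: le_trans h _; rewrite ler_wpM2r ?N2_ge0//.
  have h1 : 0 <= cP * (`|y| / a) by rewrite mulr_ge0// divr_ge0// ltW.
  have h2 : cP * (`|y| / a) <= cP * t by rewrite ler_wpM2l.
  by rewrite ler_pXn2r ?nnegrE// (le_trans h1 h2).
have g0 := N2_ge0 mu G.
apply: ler_of_sqr; first by rewrite !mulr_ge0.
rewrite real_normK ?num_real//; apply: le_trans (cauchy_schwarz LF LP) _.
apply: (@le_trans _ _ ((4 * N2 G) * ((cP * t) ^+ 2 * N2 G))).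
  by apply: ler_pM => //; exact: N2_ge0.
by rewrite le_eqVlt; apply/orP; left; apply/eqP; ring.
Qed.

(** Averaging over the dilates [s i] turns the rough kernel into a sum of
    correlations of [F], which decay off the diagonal when the [s i] are
    well separated. *)
Lemma N2_dilates M K r1 r (s : nat -> R) L F e :
  czk M K -> 0 < r1 -> r1 <= r -> L2 F ->
  (forall i, (i < L)%N -> 0 < s i) ->
  (forall i j, (i < L)%N -> (j < L)%N -> i != j ->
    s i != s j /\ `|dot F (op (pk (`|s i - s j| * r)) F)| <= e) -> 0 <= e ->
  N2 (fun x => \sum_(i < L) op (sk K (s i * r1) (s i * r)) F x) <=
  (M * r1 ^- n * (2 * r) ^+ n) ^+ 2 * (L%:R * N2 F + L%:R ^+ 2 * e).
Proof.
move=> cK r10 r1r LF s0 sij e0; have [mK M0 _ _ _] := cK; have [mF _] := LF.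
have r0 : 0 < r by exact: lt_le_trans r1r.
have rn : 0 < (2 * r) ^+ n by rewrite exprn_gt0// mulr_gt0.
have c0 : 0 <= M * r1 ^- n by rewrite mulr_ge0// invr_ge0 exprn_ge0// ltW.
pose a x u := K u * (r1 < enorm u <= r)%R%:R.
pose H x u := \sum_(i < L) F (x - s i *: u).
have LH u : L2 (H ^~ u) by apply: L2_sum => i _; exact: (L2_tr (s i *: u) LF).
have ma : mker a by rewrite /mker /a; mfun.
have mH : mker H.
  by apply: measurable_sum => i; rewrite /mker; mfun.
have -> : (fun x => \sum_(i < L) op (sk K (s i * r1) (s i * r)) F x) =
    fun x => fine (\int[mu]_u (a x u * H x u)%:E).
  apply/funext => x.
  have La : L2 (a x).
    have := lkern_L2 0 (lkern_sk (czk_refl cK) r10 r1r); congr L2; apply/funext => u.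
    by rewrite /sk sub0r opprK enormN.
  have LFi i : L2 (fun u => F (x - s (nat_of_ord (i : 'I_L)) *: u)).
    split; first by mfun.
    have h := @integral_affine R n (fun v => (F v ^+ 2)%:E) (- s i) x.
    rewrite (eq_integral (fun u => (F (- s i *: u + x) ^+ 2)%:E)) => [|u _]; last first.
      by rewrite scaleNr addrC.
    rewrite h; [|by rewrite oppr_eq0 gt_eqF// s0|by mfun].
    by rewrite lte_mul_pinfty ?lee_fin ?invr_ge0 ?exprn_ge0//; case: LF.
  have := dot_suml (index_enum 'I_L) (P := predT) (fun i _ => LFi i) La.
  rewrite /Hilbert.dot => h.
  rewrite (eq_integral (fun u => (H x u * a x u)%:E)) => [|u _]; last by rewrite mulrC.
  rewrite /H h; apply: eq_bigr => i _.
  rewrite (op_sk_scale _ cK)// ?s0//; congr fine.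
  by apply: eq_integral => u _; rewrite mulrC.
apply: (@L2_le _ _ _ _ _ _ _ _).2.
  by apply: measurable_fine_integral; exact: measurable_funM.
pose P x u := `|u : V| <= r.
have mP : measurable_fun setT (fun p : V * V => P p.1 p.2) by rewrite /P; mfun.
have Pm (x : V) : (\int[mu]_u (P x u)%:R%:E = ((2 * r) ^+ n)%:E)%E.
  rewrite -(int_near 0 (ltW r0)); apply: eq_integral => u _.
  by rewrite /P sub0r normrN.
have aP x u : `|a x u| <= M * r1 ^- n * (P x u)%:R.
  rewrite /a normrM; case: (boolP (r1 < enorm u <= r)) => h; last first.
    by rewrite normr0 mulr0 mulr_ge0.
  rewrite /P (_ : `|u| <= r); last first.
    by case/andP: h => _; apply: le_trans; exact: norm_le_enorm.
  by rewrite normr1 !mulr1; exact: czk_shell cK r10 h.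
apply: le_trans (schur_sqr ma mH mP c0 rn aP _) _; first by move=> x; rewrite Pm.
rewrite tonelli; last 2 first.
- by apply: measurable_funM; [exact: measurable_funX|exact: measurable_boolR].
- by move=> x u; rewrite mulr_ge0// sqr_ge0.
pose J (i j : 'I_L) u := (`|u| <= r)%R%:R * corr F ((s j - s i) *: u).
have mJ i j : measurable_fun setT (J i j).
  by have h := measurable_corr LF; rewrite /J; mfun.
have nF := N2_ge0 mu F.
have IJ i j : mu.-integrable setT (EFin \o J i j).
  apply: (integrable_ball (x := 0) (b := N2 F) (r := r)) => // [|u]; first exact: ltW.
  by rewrite normrM normr_nat mulrC sub0r normrN ler_wpM2r// corr_le.
have -> : (\int[mu]_u \int[mu]_x (H x u ^+ 2 * (P x u)%:R)%:E =
    \int[mu]_u (\sum_(i < L) \sum_(j < L) (J i j u)%:E))%E.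
  apply: eq_integral => u _.
  transitivity ((`|u| <= r)%R%:R * N2 (H ^~ u))%:E.
    rewrite EFinM N2E// -ge0_integralZl_EFin//; last 2 first.
    - by move=> x _; rewrite lee_fin sqr_ge0.
    - by have [h _] := LH u; mfun.
    by apply: eq_integral => x _; rewrite -EFinM mulrC.
  have Lt i : L2 (fun x => F (x - s i *: u)) := L2_tr (s i *: u) LF.
  rewrite /H /Hilbert.N2 dot_suml//; last by apply: L2_sum => i _; exact: Lt.
  rewrite mulr_sumr -sumEFin; apply: eq_bigr => i _.
  rewrite dotC dot_suml// mulr_sumr -sumEFin; apply: eq_bigr => j _.
  congr ((_ * _)%:E); rewrite dotC /corr -[RHS](dot_tr (s i *: u))//; last by rewrite /tr; mfun.
  congr (Hilbert.dot _ _ _); apply/funext => x; rewrite /tr scalerBl; congr F.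
  by rewrite opprB addrA subrK.
have IJ2 i : mu.-integrable setT (fun u => \sum_(j < L) (J i j u)%:E)%E.
  by apply: integrable_sum => // j _; exact: IJ.
rewrite (integral_sum measurableT IJ2).
under eq_bigr => i _ do rewrite (integral_sum measurableT (IJ i)).
have JE i j : (\int[mu]_u (J i j u)%:E <=
    ((2 * r) ^+ n * (if i == j then N2 F else e))%:E)%E.
  have fJ : (\int[mu]_u (J i j u)%:E)%E \is a fin_num.
    exact: integrable_fin_num (IJ i j).
  rewrite -(fineK fJ) lee_fin.
  case: eqVneq => [->|ij].
    rewrite (eq_integral (fun u => ((N2 F * (P 0 u)%:R)%:E))) => [|u _]; last first.
      rewrite /J subrr scale0r mulrC; congr (_ * _)%:E; congr fine.
      by apply: eq_integral => x _; rewrite /tr subr0.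
    rewrite nnZ//; last by rewrite /P; mfun.
    by rewrite Pm /= mulrC.
  have [sn0 he] := sij i j (ltn_ord i) (ltn_ord j) ij.
  have d0 : s j - s i != 0 by rewrite subr_eq0 eq_sym.
  have dn : 0 < `|s i - s j| by rewrite distrC normr_gt0.
  pose g v := ((`|v| <= `|s i - s j| * r)%R%:R * corr F v)%:E.
  have mg : measurable_fun setT g by have h := measurable_corr LF; rewrite /g; mfun.
  have := @integral_affine R n g _ 0 d0 mg.
  rewrite (eq_integral (fun u => (J i j u)%:E)) => [->|u _]; last first.
    rewrite /g /J addr0; congr ((_)%:R * _)%:E; congr nat_of_bool.
    by rewrite normrZ (distrC (s i)) ler_pM2l// distrC.
  have ar : 0 < `|s i - s j| * r by rewrite mulr_gt0.
  have gf : (\int[mu]_x g x)%E \is a fin_num.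
    apply: integrable_fin_num => //.
    apply: (integrable_ball (x := 0) (b := N2 F) (r := `|s i - s j| * r)) => // [||u].
    - exact: ltW.
    - exact/measurable_EFinP.
    by rewrite normrM normr_nat mulrC sub0r normrN ler_wpM2r// corr_le.
  rewrite fineM//= int_corr// (distrC (s j)).
  have e1 : `|s i - s j| ^- n * (2 * (`|s i - s j| * r)) ^+ n = (2 * r) ^+ n.
    by rewrite (mulrCA 2) exprMn mulKf// gt_eqF// exprn_gt0.
  by rewrite mulrA e1 ler_pM2l//; apply: le_trans (ler_norm _) he.
apply: (@le_trans _ _ (((M * r1 ^- n) ^+ 2 * (2 * r) ^+ n)%:E *
   (\sum_(i < L) \sum_(j < L)
     ((2 * r) ^+ n * (if i == j then N2 F else e))%:E))%E).
  apply: lee_wpmul2l; first by rewrite lee_fin mulr_ge0// ?sqr_ge0// ltW.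
  by apply: lee_sum => i _; apply: lee_sum => j _; exact: JE.
under eq_bigr do rewrite sumEFin.
rewrite sumEFin -EFinM lee_fin; set w := (2 * r) ^+ n.
have SL : \sum_(i < L) \sum_(j < L) w * (if i == j then N2 F else e) <=
    w * (L%:R * N2 F + L%:R ^+ 2 * e).
  under eq_bigr do rewrite -mulr_sumr.
  rewrite -mulr_sumr ler_pM2l//.
  apply: (@le_trans _ _ (\sum_(i < L) (N2 F + L%:R * e))).
    apply: ler_sum => i _; rewrite (bigD1 i)//= eqxx lerD2l.
    rewrite (eq_bigr (fun=> e)) => [|j ji]; last by rewrite eq_sym (negPf ji).
    rewrite sumr_const -[leLHS]mulr_natl ler_wpM2r// ler_nat.
    by rewrite -[X in (_ <= X)%N](card_ord L) max_card.
  by rewrite sumr_const card_ord -[leLHS]mulr_natl mulrDr mulrA -expr2.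
apply: (@le_trans _ _ ((M * r1 ^- n) ^+ 2 * w * (w * (L%:R * N2 F + L%:R ^+ 2 * e)))).
  by rewrite ler_wpM2l// mulr_ge0// ?sqr_ge0// ltW.
by rewrite le_eqVlt; apply/orP; left; apply/eqP; rewrite -/w exprMn; ring.
Qed.

(** A small dilation changes the shell piece only on two thin shells. *)
Lemma N2_dilate_sub M K B r t T F : czk M K -> (0 < B)%N -> 0 < r ->
  0 <= t <= T -> 0 < T <= 1 -> L2 F ->
  N2 (fun x => op (sk K (r / B%:R) r) F x -
               op (sk K ((1 + t) * (r / B%:R)) ((1 + t) * r)) F x) <=
  (2 * M * B%:R ^+ n * 2 ^+ n * cP * T) ^+ 2 * N2 F.
Proof.
move=> cK B0 r0 /andP[t0 tT] /andP[T0 T1] LF; have [mK M0 _ _ _] := cK.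
have cP0 := @cP_gt0 R n; have [mF _] := LF.
have B1 : 1 <= B%:R :> R by rewrite ler1n.
have Bp : 0 < B%:R :> R by rewrite ltr0n.
set r1 := r / B%:R; have r10 : 0 < r1 by rewrite divr_gt0.
have r1r : r1 <= r by rewrite ler_pdivrMr// ler_peMr// ltW.
have s1 : 1 <= 1 + t by rewrite lerDl.
have s0 : 0 < 1 + t by rewrite (lt_le_trans ltr01).
pose k1 := sk K r1 r; pose k2 := sk K ((1 + t) * r1) ((1 + t) * r).
have l1 : lkern _ _ k1 := lkern_sk cK r10 r1r.
have sr1 : 0 < (1 + t) * r1 by rewrite mulr_gt0.
have sr : (1 + t) * r1 <= (1 + t) * r by rewrite ler_pM2l.
have l2 := lkern_sk cK sr1 sr; rewrite -/k2 in l2.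
pose P x y := (r1 < enorm (x - y) <= (1 + t) * r1) ||
              (r < enorm (x - y) <= (1 + t) * r).
have mP : measurable_fun setT (fun p : V * V => P p.1 p.2) by rewrite /P; mfun.
pose a x y := k1 x y - k2 x y.
have ma : mker a by rewrite /a /k1 /k2 /mker /sk; mfun.
pose m := 2 * (r ^+ n * 2 ^+ n * cP * T).
have rn : 0 < r ^+ n by rewrite exprn_gt0.
have m0 : 0 < m by rewrite !mulr_gt0// exprn_gt0.
have c0 : 0 <= M * r1 ^- n by rewrite mulr_ge0// invr_ge0 exprn_ge0// ltW.
have mono : M * r ^- n <= M * r1 ^- n.
  rewrite ler_wpM2l// lef_pV2 ?posrE ?exprn_gt0//.
  by rewrite lerXn2r// nnegrE ltW.
have aP x y : `|a x y| <= M * r1 ^- n * (P x y)%:R.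
  rewrite /a /k1 /k2 /sk -mulrBr normrM /P; set e := enorm _.
  have [h1|h1] := boolP (r1 < e <= r); have [h2|h2] := boolP ((1 + t) * r1 < e <= (1 + t) * r).
  - by rewrite subrr normr0 mulr0 mulr_ge0.
  - rewrite subr0 normr1 mulr1 (_ : r1 < e <= (1 + t) * r1); last first.
      case/andP: h1 => h1 h3; rewrite h1/=; move: h2; rewrite negb_and -leNgt => /orP[//|].
      by rewrite -ltNge => h2; have := lt_le_trans h2 h3; rewrite ltNge ler_peMl// ltW.
    by rewrite mulr1; exact: czk_shell cK r10 h1.
  - rewrite sub0r normrN1 mulr1.
    have h3 : r < e <= (1 + t) * r.
      case/andP: h2 => h2 ->; rewrite andbT; move: h1; rewrite negb_and -leNgt.
      case/orP => [h1|]; last by rewrite -ltNge.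
      by have := lt_le_trans h2 h1; rewrite ltNge ler_peMl// ltW.
    by rewrite h3 orbT mulr1; apply: le_trans mono; exact: czk_shell cK r0 h3.
  by rewrite subr0 normr0 mulr0 mulr_ge0.
have Pm x : (\int[mu]_y (P x y)%:R%:E <= m%:E)%E.
  apply: (@le_trans _ _ (\int[mu]_y ((r1 < enorm (x - y) <= (1 + t) * r1)%R%:R +
     (r < enorm (x - y) <= (1 + t) * r)%R%:R)%:E)%E).
    apply: nn_le => [||y]; [by rewrite /P; mfun|by mfun|].
    by rewrite ler0n/= -natrD ler_nat /P; case: (_ && _); case: (_ && _).
  rewrite nnD//; [|by mfun|by mfun].
  have s12 : 1 <= 1 + t <= 2 by lra.
  apply: (le_trans (leeD (int_shell x r10 s12) (int_shell x r0 s12))).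
  rewrite -EFinD lee_fin /m.
  have k1' : r1 ^+ n <= r ^+ n by rewrite lerXn2r// nnegrE ltW.
  set w := 2 ^+ n * cP; have w0 : 0 <= w by rewrite mulr_ge0 ?exprn_ge0 ?ltW.
  have wt : w * t <= w * T by rewrite ler_wpM2l.
  have a1 : r1 ^+ n * (w * t) <= r ^+ n * (w * T).
    by apply: ler_pM => //; [rewrite exprn_ge0// ltW|rewrite mulr_ge0].
  have a2 : r ^+ n * (w * t) <= r ^+ n * (w * T) by rewrite ler_pM2l.
  rewrite [leLHS](_ : _ = r1 ^+ n * (w * t) + r ^+ n * (w * t)); last by rewrite /w; ring.
  rewrite (_ : r ^+ n * 2 ^+ n * cP * T = r ^+ n * (w * T)); last by rewrite /w; ring.
  lra.
have Pm' y : (\int[mu]_x (P x y)%:R%:E <= m%:E)%E.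
  rewrite (eq_integral (fun x => (P y x)%:R%:E)) => [|x _]; first exact: Pm.
  by rewrite /P -(enormN (x - y)) opprB.
have := (schur ma LF mP c0 m0 aP Pm Pm').2.
rewrite (_ : M * r1 ^- n * m = 2 * M * B%:R ^+ n * 2 ^+ n * cP * T); last first.
  by rewrite /m /r1 exprMn exprVn; field; rewrite !gt_eqF// exprn_gt0.
apply: le_trans; rewrite le_eqVlt; apply/orP; left; apply/eqP/eq_N2 => x.
have i1 := L2_int (lkern_L2 x l1) LF; have i2 := L2_int (lkern_L2 x l2) LF.
rewrite /op -fineB; last 2 first.
- exact: integrable_fin_num i1.
- exact: integrable_fin_num i2.
rewrite -(integralB measurableT i1 i2).
by congr fine; apply: eq_integral => y _; rewrite -EFinB mulrBl.
Qed.

Definition smooth_cst M B : R :=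
  let c1 := 2 * M * B%:R ^+ n * 2 ^+ n * cP in
  let c2 := (M * (2 * B%:R) ^+ n) ^+ 2 in 8 * c1 ^+ 2 + 8 * c2 + 4 * c2 * cP.

(** The rough piece at scale [r] turns the translation by [y], at a much
    smaller scale, into a small operator: it is an average over [L] dilates up
    to an error of order [1 / L]. *)
Lemma smoothing M K B L r y G : czk M K -> (0 < B)%N -> (0 < L)%N -> 0 < r ->
  L2 G -> `|y| <= r / L%:R ^+ 3 ->
  N2 (op (sk K (r / B%:R) r) (dif y G)) <= smooth_cst M B / L%:R * N2 G.
Proof.
move=> cK B0 L0 r0 LG yr; have [mK M0 _ _ _] := cK.
have cP0 := @cP_gt0 R n; have g0 := N2_ge0 mu G.
have Bp : 0 < B%:R :> R by rewrite ltr0n.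
have B1 : 1 <= B%:R :> R by rewrite ler1n.
have Lp : 0 < L%:R :> R by rewrite ltr0n.
have L1 : 1 <= L%:R :> R by rewrite ler1n.
have Li : 0 < L%:R^-1 :> R by rewrite invr_gt0.
set F := dif y G; have LF : L2 F := L2_dif y LG.
have nF : N2 F <= 4 * N2 G.
  have := N2_sub2 (L2_tr y LG) LG; rewrite N2_tr// => h.
  by apply: le_trans h _; lra.
set r1 := r / B%:R; have r10 : 0 < r1 by rewrite divr_gt0.
have r1r : r1 <= r by rewrite ler_pdivrMr// ler_peMr// ltW.
pose s (i : nat) : R := 1 + i%:R / L%:R ^+ 2.
have s0 i : 0 < s i by rewrite (lt_le_trans ltr01)// lerDl divr_ge0// exprn_ge0// ltW.
set c1 := 2 * M * B%:R ^+ n * 2 ^+ n * cP.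
set c2 := (M * (2 * B%:R) ^+ n) ^+ 2.
pose A := op (sk K r1 r) F.
pose D (i : nat) x := A x - op (sk K (s i * r1) (s i * r)) F x.
have LA : L2 A := (lkern_N2 (lkern_sk cK r10 r1r) LF).1.
have LAi i : L2 (op (sk K (s i * r1) (s i * r)) F).
  have h1 : 0 < s i * r1 by rewrite mulr_gt0.
  have h2 : s i * r1 <= s i * r by rewrite ler_pM2l.
  exact: (lkern_N2 (lkern_sk cK h1 h2) LF).1.
have L2p : 0 < L%:R ^+ 2 :> R by rewrite exprn_gt0.
have nD i : (i < L)%N -> N2 (D i) <= (c1 / L%:R) ^+ 2 * N2 F.
  move=> iL; apply: N2_dilate_sub => //; last by rewrite Li invf_le1.
  rewrite divr_ge0//= ?exprn_ge0// ler_pdivrMr// expr2 mulrA mulVf ?gt_eqF// mul1r.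
  by rewrite ler_nat ltnW.
have nsD := N2_sum_le (f := D) (fun i _ => L2B LA (LAi i)) nD.
have e0 : 0 <= 2 * cP * L%:R^-1 * N2 G by rewrite !mulr_ge0// ltW.
have sij i j : (i < L)%N -> (j < L)%N -> i != j ->
    s i != s j /\ `|dot F (op (pk (`|s i - s j| * r)) F)| <= 2 * cP * L%:R^-1 * N2 G.
  move=> iL jL ij.
  have h : L%:R ^- 2 <= `|s i - s j|.
    rewrite /s opprD addrACA subrr add0r -mulrBl normrM.
    rewrite [X in _ * X]gtr0_norm ?invr_gt0// ler_pMl ?invr_gt0//.
    have := ij; rewrite neq_ltn => /orP[] k; [rewrite distrC|];
      by rewrite -natrB ?(ltnW k)// normr_nat ler1n subn_gt0.
  have dn : 0 < `|s i - s j| by apply: lt_le_trans h; rewrite invr_gt0.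
  split; first by rewrite -subr_eq0 -normr_gt0.
  have ar : 0 < `|s i - s j| * r by rewrite mulr_gt0.
  have yL : `|y| / (`|s i - s j| * r) <= L%:R^-1.
    rewrite ler_pdivrMr//; apply: le_trans yr _.
    rewrite mulrC mulrA ler_pM2r// exprSr invfM mulrC ler_wpM2l// ltW//.
  apply: corr_dif_le => //.
  rewrite -[leRHS]mul1r -ler_pdivrMr//; apply: le_trans yL _.
  by rewrite invf_le1.
have nS := N2_dilates cK r10 r1r LF (fun i _ => s0 i) sij e0.
have LD : L2 (fun x => \sum_(i < L) D i x).
  by apply: L2_sum => i _; exact: (L2B LA (LAi i)).
have LS : L2 (fun x => \sum_(i < L) op (sk K (s i * r1) (s i * r)) F x).
  by apply: L2_sum => i _; exact: (LAi i).
have AE : N2 A = L%:R ^- 2 * N2 (fun x => \sum_(i < L) D i x +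
    \sum_(i < L) op (sk K (s i * r1) (s i * r)) F x).
  rewrite -exprVn -(N2Z _ (L2D LD LS)).
  apply: eq_N2 => x; rewrite -big_split/= (eq_bigr (fun=> A x)) => [|i _]; last first.
    by rewrite /D subrK.
  by rewrite sumr_const card_ord -[X in _ * X]mulr_natl mulrA mulVf ?mul1r// gt_eqF.
rewrite -/A AE.
have h := N2_sum2 LD LS.
rewrite ler_pdivrMl//; apply: le_trans h _.
rewrite -/A in nsD *.
apply: (@le_trans _ _ (2 * (L%:R ^+ 2 * ((c1 / L%:R) ^+ 2 * N2 F)) +
   2 * (c2 * (L%:R * N2 F + L%:R ^+ 2 * (2 * cP / L%:R * N2 G))))).
  apply: lerD; rewrite ler_pM2l//.
  rewrite /c2 [in leRHS](_ : M * (2 * B%:R) ^+ n = M * r1 ^- n * (2 * r) ^+ n)//.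
  by rewrite /r1 !exprMn exprVn; field; rewrite !gt_eqF// exprn_gt0.
rewrite (_ : 2 * _ + _ = 2 * c1 ^+ 2 * N2 F + 2 * c2 * L%:R * N2 F + 4 * c2 * cP * L%:R * N2 G);
  last by field; rewrite gt_eqF.
rewrite (_ : L%:R ^+ 2 * _ = smooth_cst M B * L%:R * N2 G); last by field; rewrite gt_eqF.
rewrite /smooth_cst -/c1 -/c2.
have c10 : 0 <= c1 ^+ 2 := sqr_ge0 _; have c20 : 0 <= c2 := sqr_ge0 _.
have k1 : c1 ^+ 2 * N2 F <= c1 ^+ 2 * (4 * (L%:R * N2 G)).
  rewrite ler_wpM2l//; apply: le_trans nF _; rewrite ler_pM2l// ler_peMl//.
have k2 : c2 * L%:R * N2 F <= c2 * L%:R * (4 * N2 G).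
  by rewrite ler_wpM2l// mulr_ge0// ltW.
lra.
Qed.

End rough.

(** * Almost orthogonality of the pieces *)

Section scales.
Context {R : realType} {n : nat}.
Local Notation V := 'rV[R]_n.
Local Notation mu := (@lebesgue_rV R n).
Local Notation L2 := (L2 mu).
Local Notation dot := (dot mu).
Local Notation N2 := (N2 mu).
Local Notation cP := (@cP R n).
Implicit Types (x y u v : V) (F G K : V -> R) (M : R) (i j k : nat).
Variable L0 : nat.
Hypothesis L0E : L0%:R = 2 ^+ 8 :> R.

Let B := (L0 ^ 3)%N.
(** The lacunary scales.  The ratio [B = L0 ^ 3] is so large that the gain [kap] per
    scale beats all powers of 2 lost in the summations below; the cube
    matches [smoothing], which gains a factor [L] for translations by [r / L ^ 3]. *)
Definition sc k : R := B%:R ^- k.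
(** The gain per scale, equal to [1 / L0]. *)
Definition kap : R := 2 ^- 8.
Definition shell_op K k := op (sk K (sc k / B%:R) (sc k)).
Definition avg_op k : (V -> R) -> V -> R := op (pk (sc k)).
Definition cell_op k : (V -> R) -> V -> R := op (qk (sc k)).
Definition refl K : V -> R := fun u => K (- u).
Local Notation A := shell_op.
Local Notation P := avg_op.
Local Notation E := cell_op.

Let B_gt0 : (0 < B)%N.
Proof.
rewrite /B expn_gt0; case: L0 L0E => //=.
by move=> h; have := exprn_gt0 8 (ltr0n R 2); rewrite -h ltxx.
Qed.

Lemma BR_gt0 : 0 < B%:R :> R. Proof. by rewrite ltr0n. Qed.

Lemma BRE : B%:R = L0%:R ^+ 3 :> R. Proof. by rewrite natrX. Qed.

Lemma sc_gt0 k : 0 < sc k.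
Proof. by rewrite /sc invr_gt0 exprn_gt0// BR_gt0. Qed.

Lemma scD k j : sc (k + j) = sc k * sc j.
Proof. by rewrite /sc exprD invfM. Qed.

Lemma L0_gt0 : (0 < L0)%N.
Proof. by move: B_gt0; rewrite /B expn_gt0 orbF. Qed.

Lemma scE j : sc j = (L0 ^ j)%:R ^- 3.
Proof. by rewrite /sc BRE natrX -!exprM mulnC. Qed.

Lemma kapE j : kap ^+ j = (L0 ^ j)%:R^-1.
Proof. by rewrite natrX L0E /kap exprVn. Qed.

Lemma kap_gt0 : 0 < kap. Proof. by rewrite /kap invr_gt0 exprn_gt0. Qed.

Lemma kap_le1 : kap <= 1.
Proof. by rewrite /kap invf_le1 ?exprn_gt0// exprn_ege1// ler1n. Qed.

Lemma sc_le_kap j : sc j <= kap ^+ j.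
Proof.
rewrite scE kapE lef_pV2 ?posrE ?exprn_gt0 ?ltr0n ?expn_gt0 ?L0_gt0//.
by apply: ler_eXnr => //; rewrite ler1n expn_gt0 L0_gt0.
Qed.

Lemma sc_le1 j : sc j <= 1.
Proof. by apply: le_trans (sc_le_kap j) _; rewrite exprn_ile1 ?kap_le1// ltW// kap_gt0. Qed.

Lemma reflK K : refl (refl K) = K.
Proof. by apply/funext => u; rewrite /refl opprK. Qed.

Let c0 M : R := (M * B%:R ^+ n * 2 ^+ n) ^+ 2.
Let C1 M : R := smooth_cst (n := n) M B.

Lemma lkern_A M K k : czk M K ->
  lkern (M * B%:R ^+ n) (sc k) (sk K (sc k / B%:R) (sc k)).
Proof.
move=> cK; have s0 := sc_gt0 k; have b0 := BR_gt0.
have := @lkern_sk R n M K (sc k / B%:R) (sc k) cK.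
rewrite (_ : sc k / (sc k / B%:R) = B%:R); last by field; rewrite !gt_eqF.
apply; first by rewrite divr_gt0.
by rewrite ler_pdivrMr// ler_peMr//; [exact: ltW|rewrite ler1n].
Qed.

Lemma L2_A M K k G : czk M K -> L2 G -> L2 (A K k G).
Proof. by move=> cK LG; exact: (lkern_N2 (lkern_A k cK) LG).1. Qed.

Lemma L2_P k G : L2 G -> L2 (P k G).
Proof. by move=> LG; exact: (lkern_N2 (lkern_pk (sc_gt0 k)) LG).1. Qed.

Lemma L2_E k G : L2 G -> L2 (E k G).
Proof. by move=> LG; exact: (lkern_N2 (lkern_qk (sc_gt0 k)) LG).1. Qed.

Lemma N2_P k G : L2 G -> N2 (P k G) <= (2 ^+ n) ^+ 2 * N2 G.
Proof. by move=> LG; have := (lkern_N2 (lkern_pk (sc_gt0 k)) LG).2; rewrite mul1r. Qed.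

Lemma adjoint_A M K k F G : czk M K -> L2 F -> L2 G ->
  dot (A K k F) G = dot F (A (refl K) k G).
Proof.
move=> cK LF LG; rewrite /A (adjoint (lkern_A k cK) LF LG).
congr (Hilbert.dot _ _ (op _ G)); apply/funext => x; apply/funext => y.
by rewrite sk_tr.
Qed.

Lemma N2_A M K k G : czk M K -> L2 G -> N2 (A K k G) <= c0 M * N2 G.
Proof. by move=> cK LG; exact: (lkern_N2 (lkern_A k cK) LG).2. Qed.

Lemma N2_dif_A M K k j y G : czk M K -> L2 G -> `|y| <= sc (k + j) ->
  N2 (dif y (A K k G)) <= C1 M * kap ^+ j * N2 G.
Proof.
move=> cK LG yk; rewrite kapE.
have := smoothing (L := L0 ^ j) (r := sc k) cK B_gt0 _ (sc_gt0 k) LG.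
rewrite expn_gt0 L0_gt0 => /(_ y isT).
rewrite -scE -scD => /(_ yk); apply: le_trans.
rewrite le_eqVlt; apply/orP; left; apply/eqP/eq_N2 => x.
apply: (dif_op _ (lkern_A k cK) LG) => u v.
by rewrite /sk (_ : u - y - (v - y) = u - v)// opprB addrA subrK.
Qed.

Lemma C1_ge0 M : 0 <= M -> 0 <= C1 M.
Proof.
move=> M0; have h := @cP_gt0 R n.
by rewrite /C1 /smooth_cst !addr_ge0 ?mulr_ge0 ?sqr_ge0// ltW.
Qed.

Let pows j : 0 <= kap ^+ j. Proof. by rewrite exprn_ge0// ltW// kap_gt0. Qed.

Lemma sub_P_A M K k j G : czk M K -> L2 G ->
  N2 (fun x => A K k G x - P (k + j) (A K k G) x) <=
  (2 ^+ n) ^+ 2 * (C1 M * kap ^+ j * N2 G).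
Proof.
move=> cK LG; have LA := L2_A k cK LG.
have := @lkern_dif R n _ _ _ _ 1 (C1 M * kap ^+ j * N2 G) (lkern_pk (sc_gt0 (k + j))) LA.
rewrite mul1r => h; rewrite (eq_N2 mu
  (g := fun x => -1 * (op (pk (sc (k + j))) (A K k G) x - 1 * A K k G x))); last first.
  by move=> x; rewrite /P; ring.
rewrite N2Z ?sqrrN ?expr1n ?mul1r; last first.
  by apply: L2B; [exact: L2_P|exact: L2Z].
apply: h => [x|u uk]; first by rewrite int_pk// sc_gt0.
exact: N2_dif_A.
Qed.

Lemma sub_E_A M K k j G : czk M K -> L2 G ->
  N2 (fun x => A K k G x - E (k + j) (A K k G) x) <=
  (2 ^+ n) ^+ 2 * (C1 M * kap ^+ j * N2 G).
Proof.
move=> cK LG; have LA := L2_A k cK LG.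
have := @lkern_dif R n _ _ _ _ 1 (C1 M * kap ^+ j * N2 G) (lkern_qk (sc_gt0 (k + j))) LA.
rewrite mul1r => h; rewrite (eq_N2 mu
  (g := fun x => -1 * (op (qk (sc (k + j))) (A K k G) x - 1 * A K k G x))); last first.
  by move=> x; rewrite /E; ring.
rewrite N2Z ?sqrrN ?expr1n ?mul1r; last first.
  by apply: L2B; [exact: L2_E|exact: L2Z].
apply: h => [x|u uk]; first by rewrite int_qk// sc_gt0.
exact: N2_dif_A.
Qed.

Lemma A_dif M K k F e : czk M K -> L2 F ->
  (forall u, `|u| <= sc k -> N2 (dif u F) <= e) -> N2 (A K k F) <= c0 M * e.
Proof.
move=> cK LF Fe; have := @lkern_dif R n _ _ _ _ 0 e (lkern_A k cK) LF.
rewrite (eq_N2 mu (g := A K k F)) => [h|x]; last by rewrite mul0r subr0.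
apply: h => // x; apply: (int_sk _ _ cK).
by rewrite divr_gt0 ?sc_gt0// BR_gt0.
Qed.

Lemma A_A M M' K K' k j G : czk M K -> czk M' K' -> L2 G ->
  N2 (A K (k + j) (A K' k G)) <= c0 M * (C1 M' * kap ^+ j * N2 G).
Proof.
by move=> cK cK' LG; apply: A_dif => // [|u uk]; [exact: (L2_A k cK')|exact: N2_dif_A].
Qed.

Lemma A_P M K k j G : czk M K -> L2 G ->
  N2 (A K (k + j) (P k G)) <= c0 M * (cP ^+ 2 * kap ^+ j * N2 G).
Proof.
move=> cK LG; apply: A_dif => // [|u uk]; first exact: L2_P.
have s0 := sc_gt0 k; have sj := sc_gt0 j.
have ukj : `|u| / sc k <= sc j by rewrite ler_pdivrMr// mulrC -scD.
have us : `|u| <= sc k.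
  by apply: le_trans uk _; rewrite scD ler_piMr ?sc_le1// ltW.
apply: le_trans (N2_dif_pk s0 us LG) _.
rewrite ler_wpM2r ?N2_ge0// exprMn ler_wpM2l ?sqr_ge0//.
apply: (@le_trans _ _ (sc j ^+ 2)).
  by rewrite ler_pXn2r ?nnegrE ?divr_ge0 ?(ltW s0) ?(ltW sj).
by apply: le_trans (sc_le_kap j); rewrite expr2 ler_piMr ?sc_le1// ltW.
Qed.

Lemma P_A M K k j G : czk M K -> L2 G ->
  N2 (P k (A K (k + j) G)) <= c0 M * (cP ^+ 2 * kap ^+ j) * N2 G.
Proof.
move=> cK LG; have LA := L2_A (k + j) cK LG; have LP := L2_P k LA.
have LPP := L2_P k LP; have cR : czk M (refl K) := czk_refl cK.
apply: (dual_le _ LP LG (L2_A (k + j) cR LPP)).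
- by rewrite mulr_ge0 ?sqr_ge0// mulr_ge0 ?sqr_ge0.
- by rewrite {1}/Hilbert.N2 {1}/P (adjoint_pk (sc_gt0 k) LA LP) (adjoint_A _ cK).
by have := A_P k j cR LP; rewrite mulrA.
Qed.

(** One constant that dominates all those of the individual estimates. *)
Definition CM M : R := 1 + c0 M + (2 ^+ n) ^+ 2 + c0 M * C1 M + c0 M * cP ^+ 2
  + (2 ^+ n) ^+ 2 * C1 M.

Lemma CM_parts M : 0 <= M -> [/\ 1 <= CM M, c0 M <= CM M, c0 M * C1 M <= CM M,
  c0 M * cP ^+ 2 <= CM M & (2 ^+ n) ^+ 2 * C1 M <= CM M] /\ 1 + (2 ^+ n) ^+ 2 <= CM M.
Proof.
move=> M0; have h1 := C1_ge0 M0.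
have h0 : 0 <= c0 M by exact: sqr_ge0.
have h2 : 0 <= (2 ^+ n) ^+ 2 :> R by exact: sqr_ge0.
have h3 : 0 <= cP ^+ 2 by exact: sqr_ge0.
have := mulr_ge0 h0 h1; have := mulr_ge0 h0 h3; have := mulr_ge0 h2 h1.
rewrite /CM; set x1 := _ * C1 M; set x2 := _ * cP ^+ 2; set x3 := c0 M * C1 M.
by move: h0 h2; move: (c0 M) ((2 ^+ n) ^+ 2 : R) => y1 y2 *; do !split; lra.
Qed.

Lemma CM_ge1 M : 0 <= M -> 1 <= CM M. Proof. by case/CM_parts => -[]. Qed.
Lemma CM_c0 M : 0 <= M -> c0 M <= CM M. Proof. by case/CM_parts => -[]. Qed.
Lemma CM_c0C1 M : 0 <= M -> c0 M * C1 M <= CM M. Proof. by case/CM_parts => -[]. Qed.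
Lemma CM_c0cP M : 0 <= M -> c0 M * cP ^+ 2 <= CM M. Proof. by case/CM_parts => -[]. Qed.
Lemma CM_nC1 M : 0 <= M -> (2 ^+ n) ^+ 2 * C1 M <= CM M. Proof. by case/CM_parts => -[]. Qed.
Lemma CM_n M : 0 <= M -> 1 + (2 ^+ n) ^+ 2 <= CM M. Proof. by case/CM_parts. Qed.

Local Opaque op pk qk sk.

Lemma dot_subl F G QF QG : L2 F -> L2 G -> L2 QF -> L2 QG -> dot QF G = dot F QG ->
  dot (fun x => F x - QF x) G = dot F (fun x => G x - QG x).
Proof.
move=> LF LG LQF LQG h; rewrite (dotBl LF LQF LG) [in RHS]dotC (dotBl LG LQG LF) h.
by rewrite (dotC mu G) (dotC mu QG).
Qed.

(** Adjoint form of the fact that a shell piece is nearly constant on much smaller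
    cells. *)
Lemma A_sub_E M K k j G : czk M K -> L2 G ->
  N2 (A K k (fun x => G x - E (k + j) G x)) <= CM M * kap ^+ j * N2 G.
Proof.
move=> cK LG; have M0 : 0 <= M by case: cK.
have LE := L2_E (k + j) LG; have LH := L2B LG LE.
have cR : czk M (refl K) := czk_refl cK.
set F := A K k _; have LF : L2 F := L2_A k cK LH.
have LRF := L2_A k cR LF; have LERF := L2_E (k + j) LRF.
apply: (dual_le _ LF LG (L2B LRF LERF)).
- by rewrite mulr_ge0// (le_trans ler01)// CM_ge1.
- rewrite {1}/Hilbert.N2 {1}/F (adjoint_A _ cK)//.
  exact: (dot_subl LG LRF LE LERF (adjoint_qk (sc_gt0 _) LG LRF)).
apply: le_trans (sub_E_A k j cR LF) _.
by rewrite !mulrA ler_wpM2r ?N2_ge0// ler_wpM2r// CM_nC1.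
Qed.

Lemma A_sub_P M K k j G : czk M K -> L2 G ->
  N2 (A K k (fun x => G x - P (k + j) G x)) <= CM M * kap ^+ j * N2 G.
Proof.
move=> cK LG; have M0 : 0 <= M by case: cK.
have LE := L2_P (k + j) LG; have LH := L2B LG LE.
have cR : czk M (refl K) := czk_refl cK.
set F := A K k _; have LF : L2 F := L2_A k cK LH.
have LRF := L2_A k cR LF; have LERF := L2_P (k + j) LRF.
apply: (dual_le _ LF LG (L2B LRF LERF)).
- by rewrite mulr_ge0// (le_trans ler01)// CM_ge1.
- rewrite {1}/Hilbert.N2 {1}/F (adjoint_A _ cK)//.
  exact: (dot_subl LG LRF LE LERF (adjoint_pk (sc_gt0 _) LG LRF)).
apply: le_trans (sub_P_A k j cR LF) _.
by rewrite !mulrA ler_wpM2r ?N2_ge0// ler_wpM2r// CM_nC1.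
Qed.

Lemma geo_dist N k :
  \sum_(l < N) (2 : R) ^- ((k - l) + (l - k)) <= 3.
Proof.
have h2 d : 0 < (2 : R) ^- d by rewrite invr_gt0 exprn_gt0.
have hS d : (2 : R) ^- d = 2 * 2 ^- d.+1 by rewrite exprS; field; rewrite expf_neq0.
have lo m : (m <= k)%N ->
    \sum_(l < m) (2 : R) ^- ((k - l) + (l - k)) <= 2 ^- (k - m).
  elim: m => [_|m IH mk]; first by rewrite big_ord0 ltW.
  rewrite big_ord_recr /= (_ : (m - k = 0)%N) ?addn0; last first.
    by apply/eqP; rewrite subn_eq0 ltnW.
  apply: le_trans (lerD (IH (ltnW mk)) (lexx _)) _.
  rewrite (_ : (k - m)%N = (k - m.+1).+1); last by rewrite subnSK.
  by rewrite [leRHS]hS mulr_natl.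
have hi m : \sum_(l < (k + m)%N.+1) (2 : R) ^- ((k - l) + (l - k)) <= 3 - 2 ^- m.
  elim: m => [|m IH].
    rewrite addn0 big_ord_recr /= subnn addn0 expr0 invr1.
    have := lo k (leqnn k); rewrite subnn expr0 invr1 => h.
    by apply: le_trans (lerD h (lexx _)) _; lra.
  rewrite addnS big_ord_recr /= (_ : (k - (k + m).+1 = 0)%N); last first.
    by apply/eqP; rewrite subn_eq0 leqW// leq_addr.
  rewrite add0n -[(k + m).+1]addnS addKn addnS.
  apply: le_trans (lerD IH (lexx _)) _; rewrite (hS m).
  by have := h2 m.+1; lra.
have [Nk|kN] := leqP N k.
  apply: le_trans (lo N Nk) _; apply: (@le_trans _ _ 1); last by lra.
  by rewrite invf_le1 ?exprn_gt0// exprn_ege1// ler1n.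
rewrite -(prednK (leq_ltn_trans (leq0n k) kN)) -(subnKC (_ : (k <= N.-1)%N)); last first.
  by rewrite -ltnS (prednK (leq_ltn_trans (leq0n k) kN)).
by apply: le_trans (hi _) _; have := h2 (N.-1 - k)%N; lra.
Qed.

(** The quadratic form of almost orthogonality: testing [g] against the single
    function [\sum_k t' k] turns decay of the pairwise products into a bound for
    the whole square function. *)
Lemma cotlar N g (t t' : nat -> V -> R) (e : R) : L2 g ->
  (forall k, L2 (t' k)) -> 0 <= e ->
  (forall k, N2 (t k) = dot g (t' k)) ->
  (forall k d, `|dot (t' k) (t' (k + d)%N)| <=
     e * 2 ^- d * (N2 (t k) + N2 (t (k + d)%N))) ->
  \sum_(k < N) N2 (t k) <= 6 * e * N2 g.
Proof.
move=> Lg Lt' e0 tE tt'.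
pose F x := \sum_(k < N) t' k x.
have LF : L2 F by apply: L2_sum => k _; exact: Lt'.
set S := \sum_(k < N) _.
have S0 : 0 <= S by apply: sumr_ge0 => k _; exact: N2_ge0.
have SE : S = dot g F.
  rewrite dotC /F dot_suml//; apply: eq_bigr => k _; by rewrite tE dotC.
have dtt k l : `|dot (t' k) (t' l)| <=
    e * 2 ^- ((k - l) + (l - k)) * (N2 (t k) + N2 (t l)).
  have [kl|/ltnW lk] := leqP k l.
    rewrite (_ : (k - l = 0)%N) ?add0n; last by apply/eqP; rewrite subn_eq0.
    by have := tt' k (l - k)%N; rewrite subnKC.
  rewrite (_ : (l - k = 0)%N) ?addn0; last by apply/eqP; rewrite subn_eq0.
  by have := tt' l (k - l)%N; rewrite subnKC// dotC addrC.
have FS : N2 F <= 6 * e * S.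
  rewrite {1}/Hilbert.N2 {1}/F dot_suml//.
  apply: (@le_trans _ _ (\sum_(k < N) \sum_(l < N)
    (e * 2 ^- ((k - l) + (l - k)) * N2 (t k) + e * 2 ^- ((l - k) + (k - l)) * N2 (t l)))).
    apply: ler_sum => k _; rewrite dotC dot_suml//; apply: ler_sum => l _.
    apply: le_trans (ler_norm _) _; rewrite dotC; apply: le_trans (dtt k l) _.
    by rewrite mulrDr [X in _ * 2 ^- X * N2 (t l)]addnC.
  rewrite (eq_bigr (fun k : 'I_N => \sum_(l < N) e * 2 ^- ((k - l) + (l - k)) * N2 (t k)
     + \sum_(l < N) e * 2 ^- ((l - k) + (k - l)) * N2 (t l))); last first.
    by move=> k _; rewrite big_split.
  rewrite big_split /= [X in _ + X]exchange_big /=.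
  set X := (X in X + _); suff XS : X <= 3 * (e * S).
    by apply: le_trans (lerD XS XS) _; lra.
  rewrite /X /S !mulr_sumr; apply: ler_sum => k _.
  rewrite (eq_bigr (fun l : 'I_N => e * N2 (t k) * 2 ^- ((k - l) + (l - k)))); last first.
    by move=> l _; ring.
  rewrite -mulr_sumr (_ : 3 * _ = e * N2 (t k) * 3); last by ring.
  by rewrite ler_wpM2l ?geo_dist// mulr_ge0 ?N2_ge0.
have [S00|Sp] := leP S 0.
  by apply: le_trans S00 _; rewrite !mulr_ge0 ?N2_ge0.
rewrite -(ler_pM2l Sp) -expr2 {1}SE; apply: le_trans (cauchy_schwarz Lg LF) _.
rewrite mulrC (_ : S * _ = 6 * e * S * N2 g); last by ring.
by rewrite ler_wpM2r ?N2_ge0.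
Qed.

Let geo_min i d : (4 * i + d <= 8 * i)%N \/ (4 * i + d <= 4 * d)%N.
Proof. lia. Qed.

Lemma kap2 j : kap ^+ j = 2 ^- (8 * j).
Proof. by rewrite /kap exprVn -exprM. Qed.

Let le2 a b : (b <= a)%N -> (2 : R) ^- a <= 2 ^- b.
Proof. by move=> ba; rewrite lef_pV2 ?posrE ?exprn_gt0// ler_eXn2l// ltr1n. Qed.

Let arith1 (y z c a b : R) : y <= c * a -> z <= c * b -> 0 <= c -> 0 <= a + b ->
  (1 * y + 1^-1 * z) / 2 <= c * (a + b).
Proof.
move=> ha hb c0' e0; rewrite invr1 !mul1r ler_pdivrMr//.
by have := mulr_ge0 c0' e0; lra.
Qed.

Let arith2 (x y c C a b : R) d : x <= c * b -> y <= C * 2 ^- (8 * d) * (c * a) ->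
  0 <= c -> 1 <= C -> 0 <= a -> 0 <= b ->
  (2 ^- (4 * d) * x + (2 ^- (4 * d))^-1 * y) / 2 <= c * C * 2 ^- (4 * d) * (a + b).
Proof.
move=> hu hv c0' C1' a0 b0; have CM0 := le_trans ler01 C1'.
have p2 e : 0 < (2 : R) ^- e by rewrite invr_gt0 exprn_gt0.
  rewrite ler_pdivrMr//.
  apply: (@le_trans _ _ (2 ^- (4 * d) * (c * b) +
     (2 ^- (4 * d))^-1 * (C * 2 ^- (8 * d) * (c * a)))).
    by rewrite lerD// ler_wpM2l ?invr_ge0 ?(ltW (p2 _)).
  rewrite (_ : (8 * d = 4 * d + 4 * d)%N); last by lia.
  rewrite (exprD _ (4 * d) (4 * d)).
  set q := (2 : R) ^+ (4 * d); have q0 : q != 0 by rewrite expf_neq0.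
  rewrite (_ : _ + _ = c * q^-1 * (b + C * a)); last by field.
  rewrite (_ : c * C * _ * _ * _ = c * q^-1 * (2 * C * (a + b))); last by ring.
  rewrite ler_wpM2l ?mulr_ge0 ?(ltW (p2 _))//.
  by have := mulr_ge0 CM0 a0; have := mulr_ge0 CM0 b0;
    have : b <= C * b; [rewrite ler_peMl|lra].
Qed.

Let arith3 (z c C e : R) i d : z <= c * 2 ^- (8 * i) * e ->
  z <= c * C * 2 ^- (4 * d) * e -> 0 <= c -> 1 <= C -> 0 <= e ->
  z <= 2 * c * C * 2 ^- (4 * i) * 2 ^- d * e.
Proof.
move=> h1 h2 c0' C1' e0; have C0 := le_trans ler01 C1'.
have p2 k : 0 <= (2 : R) ^- k by rewrite invr_ge0 exprn_ge0.
rewrite -[2 * c * C * _ * _]mulrA -invfM -exprD.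
suff zz : z <= c * C * 2 ^- (4 * i + d) * e.
  apply: le_trans zz _; rewrite -!mulrA ler_peMl ?ler1n// !mulrA !mulr_ge0//.
case: (geo_min i d) => hh.
- apply: le_trans h1 _; rewrite ler_wpM2r// -mulrA ler_wpM2l//.
  by apply: le_trans (le2 hh) _; rewrite ler_peMl.
- by apply: le_trans h2 _; rewrite ler_wpM2r// ler_wpM2l ?mulr_ge0// le2.
Qed.

(** The common core of the three square functions: [R' k] is the adjoint of [Rk k], and
    the gain [kap ^ i] is shared between the index [i] and the distance of two
    pieces. *)
Lemma square_function M K (s : nat -> nat) i N (c : R) (Rk R' : nat -> (V -> R) -> V -> R) g :
  (forall k d, s (k + d)%N = (s k + d)%N) ->
  czk M K -> 0 <= c -> L2 g ->
  (forall k F, L2 F -> L2 (Rk k F)) -> (forall k F, L2 F -> L2 (R' k F)) ->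
  (forall k F G, L2 F -> L2 G -> dot (Rk k F) G = dot F (R' k G)) ->
  (forall k F, L2 F -> N2 (R' k F) <= c * N2 F) ->
  (forall k F, L2 F -> N2 (A (refl K) (s k) (R' k F)) <= c * kap ^+ i * N2 F) ->
  \sum_(k < N) N2 (Rk k (A K (s k) g)) <= 6 * (2 * c * CM M * 2 ^- (4 * i)) * N2 g.
Proof.
move=> sE cK c0' Lg LR LR' adj h1 h2.
have M0 : 0 <= M by case: cK.
have CM1 := CM_ge1 M0; have CM0 := le_trans ler01 CM1.
have cR : czk M (refl K) := czk_refl cK.
pose t k := Rk k (A K (s k) g).
have Lt k : L2 (t k) by apply: LR; exact: (L2_A _ cK).
pose t' k := A (refl K) (s k) (R' k (t k)).
have Lt' k : L2 (t' k) by apply: (L2_A _ cR); exact: LR'.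
have p2 d : 0 < (2 : R) ^- d by rewrite invr_gt0 exprn_gt0.
apply: (@cotlar N g t t' _ Lg Lt').
- by rewrite !mulr_ge0// ltW.
- move=> k; rewrite {1}/Hilbert.N2 {1}/t adj//; last exact: (L2_A _ cK).
  by rewrite (adjoint_A _ cK)//; exact: LR'.
move=> k d; set a := N2 (t k); set b := N2 (t (k + d)%N).
have a0 : 0 <= a by exact: N2_ge0.
have b0 : 0 <= b by exact: N2_ge0.
have alpha : `|dot (t' k) (t' (k + d)%N)| <= c * kap ^+ i * (a + b).
  apply: le_trans (dot_le (Lt' k) (Lt' (k + d)%N) ltr01) _.
  exact: (arith1 (h2 _ _ (Lt k)) (h2 _ _ (Lt _)) (mulr_ge0 c0' (pows i)) (addr_ge0 a0 b0)).
have beta : `|dot (t' k) (t' (k + d)%N)| <= c * CM M * 2 ^- (4 * d) * (a + b).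
  rewrite dotC {1}/t' (adjoint_A _ cR) ?reflK//; last exact: LR'.
  set u := R' _ _; set v := A _ _ _.
  have Lu : L2 u by exact: LR'.
  have Lv : L2 v by exact: (L2_A _ cK).
  apply: le_trans (dot_le Lu Lv (p2 (4 * d)%N)) _.
  have hu : N2 u <= c * b by exact: h1.
  have hv : N2 v <= CM M * 2 ^- (8 * d) * (c * a).
    have hv0 : N2 v <= c0 M * (C1 M * kap ^+ d * N2 (R' k (t k))).
      by rewrite /v sE; exact: (A_A _ _ cK cR (LR' _ _ (Lt k))).
    apply: le_trans hv0 _; rewrite mulrA mulrA -(kap2 d); apply: (@le_trans _ _ (CM M * kap ^+ d * N2 (R' k (t k)))).
      by rewrite ler_wpM2r ?N2_ge0// ler_wpM2r// CM_c0C1.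
    by rewrite ler_wpM2l ?h1// mulr_ge0.
  exact: arith2 hu hv c0' CM1 a0 b0.
rewrite kap2 in alpha.
exact: (arith3 alpha beta c0' CM1 (addr_ge0 a0 b0)).
Qed.

Definition CQ M : R := 6 * (2 * (2 * CM M) * CM M).

Lemma CQ_ge1 M : 0 <= M -> 1 <= CQ M.
Proof.
move=> /CM_ge1 h; rewrite /CQ.
by have : 1 <= CM M * CM M; [rewrite mulr_ege1|lra].
Qed.

Lemma square_A M K g N : czk M K -> L2 g ->
  \sum_(k < N) N2 (A K k g) <= CQ M * N2 g.
Proof.
move=> cK Lg; have M0 : 0 <= M by case: cK.
have CM1 := CM_ge1 M0; have CM0 := le_trans ler01 CM1.
have cR : czk M (refl K) := czk_refl cK.
have := @square_function M K id 0 N (2 * CM M) (fun=> id) (fun=> id) g (fun=> fun=> erefl) cK.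
rewrite muln0 expr0 invr1 mulr1.
have c2 : 0 <= 2 * CM M by rewrite mulr_ge0.
move=> h; rewrite /CQ -[X in 6 * X]mulr1; apply: h => // k F LF.
  by rewrite ler_peMl ?N2_ge0//; lra.
apply: le_trans (N2_A k cR LF) _.
by rewrite ler_wpM2r ?N2_ge0//; have := CM_c0 M0; lra.
Qed.

Lemma square_P_A M K g i N : czk M K -> L2 g ->
  \sum_(k < N) N2 (P k (A K (k + i) g)) <= CQ M * 2 ^- (4 * i) * N2 g.
Proof.
move=> cK Lg; have M0 : 0 <= M by case: cK.
have CM1 := CM_ge1 M0; have CM0 := le_trans ler01 CM1.
have cR : czk M (refl K) := czk_refl cK.
have := @square_function M K (addn^~ i) i N (2 * CM M) P P g (fun k d => addnAC k d i) cK.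
have c2 : 0 <= 2 * CM M by rewrite mulr_ge0.
move=> h; rewrite (_ : CQ M * _ = 6 * (2 * (2 * CM M) * CM M * 2 ^- (4 * i))); last first.
  by rewrite /CQ -!mulrA.
apply: h => //; [exact: L2_P|exact: L2_P| | |] => k F.
- by move=> G; exact: (adjoint_pk (sc_gt0 k)).
- move=> LF; apply: le_trans (N2_P k LF) _; rewrite ler_wpM2r ?N2_ge0//.
  by have := CM_n M0; have := CM0; lra.
- move=> LF; apply: le_trans (A_P k i cR LF) _.
  rewrite [_ * (_ * _ * _)]mulrA ler_wpM2r ?N2_ge0// [_ * (_ * _)]mulrA ler_wpM2r//.
  by have := CM_c0cP M0; lra.
Qed.

Lemma square_sub_P M K g i N : czk M K -> L2 g ->
  \sum_(k < N) N2 (fun x => A K k g x - P (k + i) (A K k g) x) <=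
    CQ M * 2 ^- (4 * i) * N2 g.
Proof.
move=> cK Lg; have M0 : 0 <= M by case: cK.
have CM1 := CM_ge1 M0; have CM0 := le_trans ler01 CM1.
have cR : czk M (refl K) := czk_refl cK.
pose Q k F : V -> R := fun x => F x - P (k + i) F x.
have LQ k F : L2 F -> L2 (Q k F) by move=> LF; exact: L2B (L2_P _ LF).
have := @square_function M K id i N (2 * CM M) Q Q g (fun=> fun=> erefl) cK.
have c2 : 0 <= 2 * CM M by rewrite mulr_ge0.
move=> h; rewrite (_ : CQ M * _ = 6 * (2 * (2 * CM M) * CM M * 2 ^- (4 * i))); last first.
  by rewrite /CQ -!mulrA.
apply: h => // k F.
- move=> G LF LG; have LPF := L2_P (k + i) LF; have LPG := L2_P (k + i) LG.
  exact: (dot_subl LF LG LPF LPG (adjoint_pk (sc_gt0 _) LF LG)).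
- move=> LF; apply: le_trans (N2_sub2 LF (L2_P (k + i) LF)) _.
  have h := N2_P (k + i) LF; have h' := CM_n M0.
  apply: (@le_trans _ _ ((2 * (1 + (2 ^+ n) ^+ 2)) * N2 F)); first by lra.
  by rewrite ler_wpM2r ?N2_ge0//; lra.
- move=> LF; apply: le_trans (A_sub_P k i cR LF) _.
  rewrite ler_wpM2r ?N2_ge0// ler_wpM2r//; lra.
Qed.

Lemma N2_P_le M k G : 0 <= M -> L2 G -> N2 (P k G) <= CM M * N2 G.
Proof.
move=> M0 LG; apply: le_trans (N2_P k LG) _; rewrite ler_wpM2r ?N2_ge0//.
by have := CM_n M0; lra.
Qed.

Lemma N2_sub_E_le M k G : 0 <= M -> L2 G ->
  N2 (fun x => G x - E k G x) <= 2 * CM M * N2 G.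
Proof.
move=> M0 LG; apply: le_trans (N2_sub2 LG (L2_E k LG)) _.
have h := (lkern_N2 (lkern_qk (sc_gt0 k)) LG).2; have h' := CM_n M0.
rewrite mul1r -/(E k G) in h.
apply: (@le_trans _ _ ((2 * (1 + (2 ^+ n) ^+ 2)) * N2 G)); first by lra.
by rewrite ler_wpM2r ?N2_ge0//; lra.
Qed.

Lemma N2_sub_P_le M k G : 0 <= M -> L2 G ->
  N2 (fun x => G x - P k G x) <= 2 * CM M * N2 G.
Proof.
move=> M0 LG; apply: le_trans (N2_sub2 LG (L2_P k LG)) _.
have h := N2_P k LG; have h' := CM_n M0.
apply: (@le_trans _ _ ((2 * (1 + (2 ^+ n) ^+ 2)) * N2 G)); first by lra.
by rewrite ler_wpM2r ?N2_ge0//; lra.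
Qed.

Lemma P_A_le M K k j G : czk M K -> L2 G ->
  N2 (P k (A K (k + j) G)) <= CM M * kap ^+ j * N2 G.
Proof.
move=> cK LG; have M0 : 0 <= M by case: cK.
apply: le_trans (P_A k j cK LG) _.
by rewrite ler_wpM2r ?N2_ge0// mulrA ler_wpM2r// CM_c0cP.
Qed.

Lemma sub_P_A_le M K k j G : czk M K -> L2 G ->
  N2 (fun x => A K k G x - P (k + j) (A K k G) x) <= CM M * kap ^+ j * N2 G.
Proof.
move=> cK LG; have M0 : 0 <= M by case: cK.
apply: le_trans (sub_P_A k j cK LG) _.
by rewrite !mulrA ler_wpM2r ?N2_ge0// ler_wpM2r// CM_nC1.
Qed.

End scales.

(** * Stopping cells and the weak type (1,1) bound *)

Section nonneg_sums.
Context {d : measure_display} {T : measurableType d} {R : realType}.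
Variable mu : {measure set T -> \bar R}.

Lemma markov_ge (S : set T) (c : R) (f : T -> \bar R) : measurable S ->
  measurable_fun setT f -> (forall x, (0 <= f x)%E) -> (forall x, S x -> (c%:E <= f x)%E) ->
  (c%:E * mu S <= \int[mu]_x f x)%E.
Proof.
move=> mS mf f0 Sf; rewrite -integral_cst//.
apply: (@le_trans _ _ (\int[mu]_(x in S) f x)%E); last first.
  exact: ge0_subset_integral.
have [c0|c0] := leP 0 c.
  apply: ge0_le_integral => //; exact: measurable_funTS.
apply: (@le_trans _ _ 0%E); last by apply: integral_ge0.
by rewrite integral_cst// mule_le0_ge0// lee_fin ltW.
Qed.

Lemma nneseries_le_bound (u : nat -> \bar R) c : (forall m, (0 <= u m)%E) ->
  (forall N, (\sum_(m < N) u m <= c)%E) -> (\sum_(m <oo) u m <= c)%E.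
Proof.
move=> u0 uc; apply: lime_le; first by apply: is_cvg_nneseries.
by near=> N; rewrite big_mkord; exact: uc.
Unshelve. all: by end_near. Qed.

End nonneg_sums.

Section stopping.
Context {R : realType} {n : nat}.
Local Notation V := 'rV[R]_n.
Local Notation mu := (@lebesgue_rV R n).
Implicit Types (x y z : V) (a : V -> V -> R).
Variables (B : nat) (s t M : R) (h : V -> R).
Hypotheses (B0 : (0 < B)%N) (s0 : 0 < s) (t0 : 0 < t).
Hypotheses (mh : measurable_fun setT h) (h0 : forall x, 0 <= h x).
Hypothesis hM : (\int[mu]_x (h x)%:E <= M%:E)%E.
Hypothesis Mt : M <= t * s ^+ n.

Lemma nn_op_fin a c x : mker a -> 0 <= c -> (forall y, 0 <= a x y <= c) ->
  (\int[mu]_y (a x y * h y)%:E)%E = (op a h x)%:E /\ 0 <= op a h x.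
Proof.
move=> ma c0 ac; have max := mker1 x ma.
have i0 : (0 <= \int[mu]_y (a x y * h y)%:E)%E.
  by apply: integral_ge0 => y _; rewrite lee_fin mulr_ge0//; case/andP: (ac y).
have i1 : (\int[mu]_y (a x y * h y)%:E <= (c * M)%:E)%E.
  rewrite EFinM; apply: (@le_trans _ _ (c%:E * \int[mu]_y (h y)%:E)%E).
    rewrite -nnZ//; apply: nn_le => [||y]; [by mfun|by mfun|].
    by have /andP[a1 a2] := ac y; rewrite mulr_ge0//= ler_wpM2r.
  by apply: lee_wpmul2l => //; rewrite lee_fin.
split; last by rewrite /op fine_ge0.
by rewrite /op fineK// ge0_fin_numE// (le_lt_trans i1)// ltry.
Qed.

(** Side of the cells of generation [m]. *)
Definition len m : R := s * B%:R ^- m.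
(** The conditional expectation of [h] at generation [m]. *)
Definition em m x : R := op (qk (len m)) h x.
(** Generation [m] is the first at which the cell average exceeds [t]. *)
Definition om m x : bool := (t < em m x) && [forall k : 'I_m, em k x <= t].

Let BR : 0 < B%:R :> R. Proof. by rewrite ltr0n. Qed.

Lemma len_gt0 m : 0 < len m.
Proof. by rewrite /len mulr_gt0// invr_gt0 exprn_gt0. Qed.

Lemma len_anti m k : (m <= k)%N -> len k <= len m.
Proof.
move=> mk; rewrite /len ler_pM2l// lef_pV2 ?posrE ?exprn_gt0//.
by rewrite ler_weXn2l// ler1n.
Qed.

Lemma same_len m k x y : (m <= k)%N -> same (len k) x y -> same (len m) x y.
Proof.
move=> mk sxy; have : same ((B ^ (k - m))%:R * len k) x y.
  by apply: same_mul; rewrite ?expn_gt0 ?B0 ?len_gt0.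
congr same; rewrite /len natrX -{2}(subnK mk) exprD.
by field; rewrite !expf_neq0// gt_eqF.
Qed.

Let mq m : mker (qk (len m) : V -> V -> R).
Proof. by case: (lkern_qk (n := n) (len_gt0 m)). Qed.

Let q0 m x y : 0 <= qk (len m) x y.
Proof. by rewrite /qk mulr_ge0// invr_ge0 exprn_ge0// ltW// len_gt0. Qed.

Lemma em_fin m x : (\int[mu]_y (qk (len m) x y * h y)%:E)%E = (em m x)%:E /\ 0 <= em m x.
Proof.
apply: (@nn_op_fin _ (len m ^- n)) => //.
  by rewrite invr_ge0 exprn_ge0// ltW// len_gt0.
move=> y; rewrite q0/= /qk ler_piMr//.
  by rewrite invr_ge0 exprn_ge0// ltW// len_gt0.
by case: (same _ _ _).
Qed.

Lemma measurable_em m : measurable_fun setT (em m).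
Proof. by apply: measurable_op. Qed.

Lemma em_same m x y : same (len m) x y -> em m x = em m y.
Proof.
move=> sxy; rewrite /em /op; congr fine; apply: eq_integral => z _.
by rewrite /qk (same_eq _ sxy).
Qed.

Lemma em0_le x : em 0 x <= t.
Proof.
rewrite -lee_fin -(em_fin 0 x).1.
have s1 : 0 <= s ^- n by rewrite invr_ge0 exprn_ge0// ltW.
apply: (@le_trans _ _ ((s ^- n)%:E * \int[mu]_y (h y)%:E)%E).
  rewrite -nnZ//; apply: nn_le => [||y]; [by have := mker1 x (mq 0) => ?; mfun|by mfun|].
  rewrite mulr_ge0//= ler_wpM2r// /qk /len expr0 invr1 mulr1 ler_piMr//.
  by case: (same _ _ _).
apply: le_trans (lee_wpmul2l _ hM) _; first by rewrite lee_fin.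
by rewrite -EFinM lee_fin mulrC ler_pdivrMr ?exprn_gt0.
Qed.

Lemma emS_le m x : em m.+1 x <= B%:R ^+ n * em m x.
Proof.
rewrite -lee_fin EFinM -(em_fin m x).1 -(em_fin m.+1 x).1.
have mx k := mker1 x (mq k).
have BN : 0 <= B%:R ^+ n :> R by rewrite exprn_ge0.
rewrite -nnZ//; [|by have := mx m => ?; mfun|by move=> y; rewrite mulr_ge0].
apply: nn_le => [||y]; [by have := mx m.+1 => ?; mfun|by have := mx m => ?; mfun|].
rewrite mulr_ge0//= mulrA ler_wpM2r// /qk mulrA.
have -> : B%:R ^+ n / len m ^+ n = len m.+1 ^- n.
  rewrite -expr_div_n -exprVn; congr (_ ^+ n).
  rewrite /len exprS; field; rewrite expf_neq0 ?gt_eqF//.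
rewrite ler_wpM2l ?invr_ge0 ?exprn_ge0 ?(ltW (len_gt0 _))//.
by case: (boolP (same _ x y)) => [/(same_len (leqnSn m))->|].
Qed.

Lemma measurable_om m : measurable_fun setT (om m).
Proof.
have me k := measurable_em k.
apply: measurable_and; first by apply: measurable_fun_ltr => //; exact: measurable_cst.
apply: measurable_forallb => i.
by apply: measurable_fun_ler => //; exact: measurable_cst.
Qed.

Lemma om_same m x y : same (len m) x y -> om m x = om m y.
Proof.
move=> sxy; rewrite /om (em_same sxy); congr (_ && _).
by apply: eq_forallb => k; rewrite (em_same (same_len (ltnW (ltn_ord k)) sxy)).
Qed.

Lemma om_disj m k x : om m x -> om k x -> m = k.
Proof.
wlog mk : m k / (m <= k)%N => [H|] o1 o2.
  by case/orP: (leq_total m k) => mk; [exact: H|apply/esym/H].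
case: (ltngtP m k) mk => // mk _; case/andP: o1 => h1 _.
by case/andP: o2 => _ /forallP/(_ (Ordinal mk)) /=; rewrite leNgt h1.
Qed.

Lemma om_bounds m x : om m x -> t < em m x <= B%:R ^+ n * t.
Proof.
move=> /andP[h1 h2]; rewrite h1/=; case: m h1 h2 => [|m] h1 /forallP h2.
  by have := em0_le x; rewrite leNgt h1.
apply: le_trans (emS_le m x) _; rewrite ler_wpM2l ?exprn_ge0//.
exact: (h2 ord_max).
Qed.

Lemma em_le m x : (forall k, (k <= m)%N -> ~~ om k x) -> em m x <= t.
Proof.
move=> H; rewrite leNgt; apply/negP => tm.
have ex : exists k, t < em k x by exists m.
case: (ex_minnP ex) => k tk kmin.
have km := kmin _ tm; have := H k km; rewrite /om tk /= => /negP; apply.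
apply/forallP => -[i ik] /=; rewrite leNgt; apply/negP => /kmin.
by rewrite leqNgt ik.
Qed.

(** Averaging over cells does not change the integral over a union of cells. *)
Lemma int_em m (Q : V -> bool) (g : V -> R) : measurable_fun setT Q ->
  (forall x y, same (len m) x y -> Q x = Q y) ->
  measurable_fun setT g -> (forall x, 0 <= g x) ->
  (\int[mu]_x \int[mu]_y (qk (len m) x y * ((Q x)%:R * g y))%:E =
   \int[mu]_y ((Q y)%:R * g y)%:E)%E.
Proof.
move=> mQ Qs mg g0.
have mq' : measurable_fun setT (fun p : V * V => qk (len m) p.1 p.2) := mq m.
rewrite (tonelli (a := fun x y => qk (len m) x y * ((Q x)%:R * g y))); last first.
- by move=> x y; rewrite mulr_ge0// mulr_ge0.
- by rewrite /mker; mfun.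
apply: eq_integral => y _.
rewrite (eq_integral (fun x => (((Q y)%:R * g y) * qk (len m) y x)%:E)) => [|x _].
  rewrite nnZ ?mulr_ge0//; last by exact: mker1.
  by rewrite int_qk ?len_gt0// mule1.
rewrite qk_sym; congr EFin; rewrite [RHS]mulrC /qk.
by case: (boolP (same _ y x)) => [/Qs->//|_]; rewrite mulr0 !mul0r.
Qed.

Lemma om_mass m : (t%:E * \int[mu]_x (om m x)%:R%:E <=
  \int[mu]_x ((om m x)%:R * h x)%:E)%E.
Proof.
have mo := measurable_om m; have me := measurable_em m.
rewrite -(int_em (m := m) mo (om_same (m := m)) mh h0) -nnZ; [|exact: ltW|by mfun|by []].
under [leRHS]eq_integral => x _.
  rewrite (eq_integral (fun y => ((om m x)%:R * (qk (len m) x y * h y))%:E)); last first.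
    by move=> y _; congr EFin; ring.
  rewrite nnZ//; last 2 first.
  - by have := mker1 x (mq m) => ?; mfun.
  - by move=> y; rewrite mulr_ge0.
  rewrite (em_fin m x).1 -EFinM; over.
apply: nn_le => [||x]; [by mfun|by mfun|].
rewrite mulr_ge0 ?(ltW t0)//=.
case: (boolP (om m x)) => [/om_bounds/andP[/ltW h1 _]|_]; first by rewrite mulr1 mul1r.
by rewrite mulr0 mul0r.
Qed.

Lemma om_sum N (g : V -> R) : measurable_fun setT g -> (forall x, 0 <= g x) ->
  (\sum_(m < N) \int[mu]_x ((om m x)%:R * g x)%:E <= \int[mu]_x (g x)%:E)%E.
Proof.
move=> mg g0; have mo := measurable_om.
rewrite -ge0_integral_sum//; last 2 first.
- by move=> m; have := mo m => ?; mfun.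
- by move=> m x _; rewrite lee_fin mulr_ge0.
under eq_integral do rewrite sumEFin -mulr_suml.
have ms : measurable_fun setT (fun x => \sum_(m < N) (om m x)%:R : R).
  by apply: measurable_sum => i; have := mo i => ?; mfun.
apply: nn_le => [||x]; [by mfun|by mfun|].
rewrite mulr_ge0 ?sumr_ge0//= ler_piMl//.
have [[m om1]|no] := pselect (exists m : 'I_N, om m x).
  rewrite (bigD1 m)//= om1 big1 ?addr0// => k km.
  case: (boolP (om k x)) => // ok; have := om_disj om1 ok => mk.
  by case/eqP: km; apply/val_inj.
rewrite big1// => k _; case: (boolP (om k x)) => // ok.
by case: no; exists k.
Qed.

(** A set of points close to stopping cells of generation [m], described by the
    measure of these cells in a cube: this makes it measurable at once, and any
    point at distance at most [len m] of a stopping cell belongs to it. *)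
Definition nb m : set V :=
  [set x | (len m ^+ n)%:E <= \int[mu]_y ((`|x - y| <= 2 * len m)%R%:R * (om m y)%:R)%:E]%E.
Definition nbhd_om : set V := \bigcup_m nb m.

Let near_mker m : mker (fun x y => (`|x - y| <= 2 * len m)%R%:R * (om m y)%:R : R).
Proof. by rewrite /mker; have := measurable_om m => ?; mfun. Qed.

Let near_ge0 m x y : 0 <= (`|x - y| <= 2 * len m)%R%:R * (om m y)%:R :> R.
Proof. by rewrite mulr_ge0. Qed.

Lemma measurable_nb m : measurable (nb m).
Proof.
rewrite /nb -[X in measurable X]setTI.
by apply: emeasurable_fun_c_infty => //; exact: measurable_inner.
Qed.

Lemma measurable_nbhd_om : measurable nbhd_om.
Proof. by apply: bigcup_measurable => m _; exact: measurable_nb. Qed.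

Lemma nb_om m x y : om m y -> `|x - y| <= len m -> nb m x.
Proof.
move=> oy xy; rewrite /nb/= -(int_same y (len_gt0 m)).
apply: nn_le => [||z]; [by apply: measurable_boolR; apply: measurable_same; mfun
  |exact: mker1 x (near_mker m)|].
rewrite ler0n /=; case: (boolP (same _ y z)) => // sz.
have xz : `|x - z| <= 2 * len m.
  rewrite -(subrK y x) -addrA (le_trans (ler_normD _ _))// mulrDl mul1r lerD//.
  exact: same_norm (len_gt0 m) sz.
by rewrite -(om_same sz) oy xz mulr1.
Qed.

Lemma nb_mass m : (t%:E * mu (nb m) <=
  (4 ^+ n)%:E * \int[mu]_x ((om m x)%:R * h x)%:E)%E.
Proof.
have l0 := len_gt0 m; have mo := measurable_om m.
have ln : 0 < len m ^+ n by rewrite exprn_gt0.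
have c4 : (0 <= (4 ^+ n)%:E :> \bar R)%E by rewrite lee_fin exprn_ge0.
suff H : (mu (nb m) <= (4 ^+ n)%:E * \int[mu]_x (om m x)%:R%:E)%E.
  apply: le_trans (lee_wpmul2l c4 (om_mass m)).
  rewrite muleCA; apply: lee_wpmul2l H; by rewrite lee_fin ltW.
pose Wf x := (\int[mu]_y ((`|x - y| <= 2 * len m)%R%:R * (om m y)%:R)%:E)%E.
have mW : measurable_fun setT Wf by exact: measurable_inner.
have W0 x : (0 <= Wf x)%E by apply: integral_ge0 => y _; rewrite lee_fin.
have WE : (\int[mu]_x Wf x = ((4 * len m) ^+ n)%:E * \int[mu]_x (om m x)%:R%:E)%E.
  have l4 : 0 <= (4 * len m) ^+ n by rewrite exprn_ge0// mulr_ge0// ltW.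
  rewrite /Wf (tonelli (near_mker m) (near_ge0 m)) -nnZ//; last by mfun.
  apply: eq_integral => y _.
  under eq_integral do rewrite mulrC.
  rewrite nnZ//; last by mfun.
  have l2 : 0 <= 2 * len m by rewrite mulr_ge0// ltW.
  by rewrite int_near2// -EFinM mulrC (_ : 2 * (2 * len m) = 4 * len m)//; ring.
have := @markov_ge _ _ _ mu (nb m) (len m ^+ n) Wf (measurable_nb m) mW W0 (fun x => id).
rewrite WE (_ : ((4 * len m) ^+ n)%:E = (len m ^+ n)%:E * (4 ^+ n)%:E)%E.
  by rewrite -muleA lee_pmul2l.
by rewrite -EFinM mulrC -exprMn.
Qed.

(** Only a set of measure [O(M / t)] is close to the stopping cells. *)
Lemma mu_nbhd_om : (mu nbhd_om <= (4 ^+ n * M / t)%:E)%E.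
Proof.
apply: le_trans (generalized_Boole_inequality mu measurable_nb measurable_nbhd_om) _.
apply: nneseries_le_bound => [m|N]; first exact: measure_ge0.
rewrite -(@lee_pmul2l _ t%:E)// ge0_sume_distrr// -EFinM.
rewrite (_ : t * _ = 4 ^+ n * M); last by field; rewrite gt_eqF.
apply: (@le_trans _ _ ((4 ^+ n)%:E * \int[mu]_x (h x)%:E)%E); last first.
  by rewrite EFinM; apply: lee_wpmul2l => //; rewrite lee_fin exprn_ge0.
have c4 : (0 <= (4 ^+ n)%:E :> \bar R)%E by rewrite lee_fin exprn_ge0.
apply: le_trans (lee_wpmul2l c4 (om_sum N mh h0)).
rewrite ge0_sume_distrr; last first.
  by move=> m _; apply: integral_ge0 => x _; rewrite lee_fin mulr_ge0.
by apply: lee_sum => m _; exact: nb_mass.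
Qed.

Lemma off_nbhd x y m k : ~ nbhd_om x -> `|x - y| <= len m -> (k <= m)%N -> ~~ om k y.
Proof.
move=> nx xy km; apply/negP => oy; apply: nx; exists k => //.
by apply: nb_om oy _; apply: le_trans xy (len_anti km).
Qed.

(** Away from the stopping cells, averages over cubes are bounded like those over
    cells: the mass in the cube is averaged over the cells it meets, which lie in a
    cube of comparable size. *)
Lemma nbhd_avg x m r : ~ nbhd_om x -> 0 <= r -> r <= len m ->
  (\int[mu]_y ((`|x - y| <= r)%R%:R * h y)%:E <= (t * (4 * len m) ^+ n)%:E)%E.
Proof.
move=> nx r0 rl; have l0 := len_gt0 m.
pose Hf z := (\int[mu]_y (qk (len m) z y * ((`|x - y| <= r)%R%:R * h y))%:E)%E.
have mQ : measurable_fun setT (fun y => (`|x - y| <= r)%R%:R * h y) by mfun.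
have Q0 y : 0 <= (`|x - y| <= r)%R%:R * h y by rewrite mulr_ge0.
have := int_em (m := m) (Q := xpredT) (measurable_cst _) (fun _ _ _ => erefl) mQ Q0.
under eq_integral do under eq_integral do rewrite mul1r.
under [RHS]eq_integral do rewrite mul1r.
move=> <-.
have mk : mker (fun z y => qk (len m) z y * ((`|x - y| <= r)%R%:R * h y)).
  exact: mkerM (mq m) mQ.
apply: (@le_trans _ _ (\int[mu]_z (t * (`|x - z| <= 2 * len m)%R%:R)%:E)%E); last first.
  rewrite nnZ ?(ltW t0)//; last by mfun.
  rewrite int_near; last by rewrite mulr_ge0// ltW.
  by rewrite -EFinM (_ : 2 * (2 * len m) = 4 * len m)//; ring.
apply: ge0_le_integral => //.
- by move=> z _; apply: integral_ge0 => y _; rewrite lee_fin mulr_ge0.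
- by apply: measurable_inner => // z y; rewrite mulr_ge0.
- by mfun.
move=> z _; have [[y [xy zy]]|no] := pselect (exists y, `|x - y| <= r /\ same (len m) z y).
  have xz : `|x - z| <= 2 * len m.
    rewrite -(subrK y x) -addrA (le_trans (ler_normD _ _))// mulrDl mul1r lerD//.
      exact: le_trans xy rl.
    by rewrite distrC; exact: same_norm l0 zy.
  rewrite xz mulr1; apply: (@le_trans _ _ (em m z)%:E); last first.
    rewrite lee_fin (em_same zy); apply: em_le => k km.
    by apply: off_nbhd nx _ km; exact: le_trans xy rl.
  rewrite -(em_fin m z).1; apply: nn_le => [||u]; [exact: mker1 z mk
    |by have := mker1 z (mq m) => ?; mfun|].
  rewrite mulr_ge0//= ler_wpM2l// ler_piMl//.
  by rewrite lern1 leq_b1.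
rewrite (eq_integral (cst 0%E)) ?integral0 ?lee_fin ?mulr_ge0 ?(ltW t0)// => y _.
congr EFin; rewrite /qk; case: (boolP (`|x - y| <= r)) => xy; last by rewrite mul0r mulr0.
case: (boolP (same _ z y)) => zy; last by rewrite mulr0 mul0r.
by case: no; exists y.
Qed.

End stopping.

Section lebesgue_points.
Context {R : realType} {n : nat}.
Hypothesis n0 : (0 < n)%N.
Local Notation V := 'rV[R]_n.
Local Notation mu := (@lebesgue_rV R n).
Implicit Types (x y z : V) (f g h : V -> R) (A : set V) (r e t M : R) (k : nat).

(** The weak type (1,1) bound for the maximal function, stated through the
    exceptional set so that the maximal function itself need not be defined.  The
    first generation must be so coarse that no cell average exceeds [t] there. *)
Lemma weak11 h M t : measurable_fun setT h -> (forall x, 0 <= h x) ->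
  (\int[mu]_x (h x)%:E <= M%:E)%E -> 0 < t ->
  exists W, [/\ measurable W, (mu W <= (4 ^+ n * M / t)%:E)%E &
    forall x, ~ W x -> forall r, 0 < r ->
      (\int[mu]_y ((`|x - y| <= r)%R%:R * h y)%:E <= (t * (8 * r) ^+ n)%:E)%E].
Proof.
move=> mh h0 hM t0; pose s := Num.max 1 (M / t).
have s1 : 1 <= s by rewrite le_max lexx.
have s0 : 0 < s by exact: lt_le_trans s1.
have sMt : M <= t * s by rewrite mulrC -ler_pdivrMr// le_max lexx orbT.
have Mt : M <= t * s ^+ n.
  by apply: le_trans sMt _; rewrite ler_pM2l// ler_eXnr.
exists (nbhd_om 2 s t h); split.
- exact: measurable_nbhd_om.
- exact: mu_nbhd_om.
move=> x Wx r r0; have [sr|rs] := leP s r.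
  apply: (@le_trans _ _ M%:E).
    apply: le_trans hM; apply: nn_le => [||y]; [by mfun|by []|].
    by rewrite mulr_ge0//= ler_piMl// lern1 leq_b1.
  rewrite lee_fin; apply: le_trans Mt _; rewrite ler_pM2l//.
  rewrite ler_pXn2r ?nnegrE ?(ltW s0)//; last by rewrite mulr_ge0// ltW.
  by apply: le_trans sr _; rewrite ler_peMl ?(ltW r0)// ler1n.
have exm : exists m, s * 2 ^- m <= 2 * r.
  exists (Num.bound (s / r)).
  have h1 : s / r < (Num.bound (s / r))%:R by rewrite archi_boundP// divr_ge0// ltW.
  rewrite ler_pdivrMr ?exprn_gt0// mulrAC; move: h1; rewrite ltr_pdivrMr// => /ltW h1.
  apply: le_trans h1 _; rewrite ler_pM2r//.
  rewrite -natrX -natrM ler_nat; apply: leq_trans (ltnW (ltn_expl _ (ltnSn 1))) _.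
  by rewrite leq_pmull.
case: (ex_minnP exm) => m hm mmin.
have rl : r <= s * 2 ^- m.
  case: m hm mmin => [|m] hm mmin; first by rewrite expr0 invr1 mulr1 ltW.
  rewrite leNgt; apply/negP => lt.
  suff /mmin : s * 2 ^- m <= 2 * r by rewrite ltnn.
  have : s * 2 ^- m = 2 * (s * 2 ^- m.+1).
    by rewrite exprS; field; rewrite expf_neq0.
  by move=> ->; rewrite ler_pM2l// ltW.
have := nbhd_avg (ltn0Sn 1) s0 t0 mh h0 hM Wx (ltW r0) rl.
move=> /le_trans; apply; rewrite lee_fin ler_pM2l//.
rewrite ler_pXn2r ?nnegrE ?mulr_ge0 ?(ltW r0) ?invr_ge0 ?(ltW s0)//.
by rewrite /len (_ : 8 * r = 4 * (2 * r)) ?ler_pM2l//; ring.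
Qed.

Lemma negligible_small (D : set V) :
  (forall e, 0 < e -> exists A, [/\ measurable A, (mu A <= e%:E)%E &
     exists2 N, mu.-negligible N & D `<=` N `|` A]) -> mu.-negligible D.
Proof.
move=> H.
have /choice[A AP] k : exists A, [/\ measurable A, (mu A <= (k.+1%:R^-1)%:E)%E &
     exists2 N, mu.-negligible N & D `<=` N `|` A] by apply: H; rewrite invr_gt0.
have /choice[N NP] k : exists N, mu.-negligible N /\ D `<=` N `|` A k.
  by have [_ _ [N ? ?]] := AP k; exists N.
have mA : measurable (\bigcap_k A k) by apply: bigcap_measurable => // k _; case: (AP k).
apply: (@negligibleS _ _ _ mu ((\bigcup_k N k) `|` \bigcap_k A k)).
  move=> x Dx; have [[k Nx]|no] := pselect (exists k, N k x); first by left; exists k.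
  right => k _; case: ((NP k).2 x Dx) => // Nx; exfalso; apply: no; by exists k.
apply: negligibleU; first by apply: negligible_bigcup => k; exact: (NP k).1.
apply/negligibleP => //; apply/eqP; rewrite eq_le measure_ge0 andbT.
apply/lee_addgt0Pr => e e0; rewrite add0e.
pose k := Num.bound e^-1.
have ke : k.+1%:R^-1 <= e.
  rewrite -[leRHS]invrK lef_pV2 ?posrE ?invr_gt0//.
  by rewrite (le_trans (ltW (archi_boundP _)))// ?invr_ge0 ?(ltW e0)// ler_nat.
have [mAk Ak _] := AP k.
apply: (@le_trans _ _ (mu (A k))).
  by apply: le_measure; rewrite ?inE//; exact: bigcap_inf.
by apply: le_trans Ak _; rewrite lee_fin.
Qed.

(** Lebesgue points, with cubes in place of balls. *)
Definition leb f x := forall e, 0 < e -> exists2 d, 0 < d &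
  forall r, 0 < r -> r < d ->
    (\int[mu]_y ((`|x - y| <= r)%R%:R * `|f y - f x|)%:E <= (e * r ^+ n)%:E)%E.
Definition ae_leb f := \forall x \ae mu, leb f x.

Lemma leb_le f g (F : V -> R) (a b : R) x : measurable_fun setT f -> measurable_fun setT g ->
  measurable_fun setT F -> 0 < a -> 0 < b ->
  (forall y, `|F y - F x| <= a * `|f y - f x| + b * `|g y - g x|) ->
  leb f x -> leb g x -> leb F x.
Proof.
move=> mf mg mF a0 b0 FE lf lg e e0.
have e2 : 0 < e / 2 by rewrite divr_gt0.
have [d1 d10 h1] := lf (e / 2 / a) (divr_gt0 e2 a0).
have [d2 d20 h2] := lg (e / 2 / b) (divr_gt0 e2 b0).
exists (Num.min d1 d2); first by rewrite lt_min d10.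
move=> r r0; rewrite lt_min => /andP[r1 r2].
have H1 := h1 r r0 r1; have H2 := h2 r r0 r2.
apply: (@le_trans _ _ (\int[mu]_y (a * ((`|x - y| <= r)%R%:R * `|f y - f x|) +
   b * ((`|x - y| <= r)%R%:R * `|g y - g x|))%:E)%E).
  apply: nn_le => [||y]; [by mfun|by mfun|].
  rewrite mulr_ge0//= !(mulrCA _ (_ <= _)%R%:R) -mulrDr ler_wpM2l//.
rewrite nnD; [|by mfun|by mfun|by move=> y; rewrite mulr_ge0 ?(ltW a0)// mulr_ge0
  |by move=> y; rewrite mulr_ge0 ?(ltW b0)// mulr_ge0].
rewrite (nnZ _ (ltW a0)); [|by mfun|by move=> y; rewrite mulr_ge0].
rewrite (nnZ _ (ltW b0)); [|by mfun|by move=> y; rewrite mulr_ge0].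
have a0' : (0 <= a%:E)%E by rewrite lee_fin ltW.
have b0' : (0 <= b%:E)%E by rewrite lee_fin ltW.
apply: le_trans (leeD (lee_wpmul2l a0' H1) (lee_wpmul2l b0' H2)) _.
rewrite -!EFinM -EFinD lee_fin (_ : _ + _ = e * r ^+ n)//.
by field; rewrite !gt_eqF.
Qed.

Lemma leb_const (c : R) x : leb (fun=> c) x.
Proof.
move=> e e0; exists 1 => // r r0 _; rewrite (eq_integral (cst 0%E)) => [|y _].
  by rewrite integral0 lee_fin mulr_ge0 ?exprn_ge0 ?ltW.
by rewrite subrr normr0 mulr0.
Qed.

Lemma leb_loc f g x d : 0 < d -> (forall y, `|x - y| <= d -> f y = g y) ->
  leb f x -> leb g x.
Proof.
move=> d0 fg lf e e0; have [d1 d10 h1] := lf e e0.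
exists (Num.min d d1); first by rewrite lt_min d0.
move=> r r0; rewrite lt_min => /andP[rd r1]; have := h1 r r0 r1.
rewrite (eq_integral (fun y => ((`|x - y| <= r)%R%:R * `|g y - g x|)%:E))// => y _.
have [xy|] := leP `|x - y| r; last by rewrite !mul0r.
by rewrite !fg// ?subrr ?normr0 ?(ltW d0)// (le_trans xy (ltW rd)).
Qed.

(** The property passes to limits in mean, by the weak type bound. *)
Lemma ae_leb_lim f : measurable_fun setT f ->
  (forall k e, 0 < e -> exists g, [/\ measurable_fun setT g, ae_leb g &
    (\int[mu]_x ((`|x| <= k%:R)%R%:R * `|f x - g x|)%:E <= e%:E)%E]) -> ae_leb f.
Proof.
move=> mf H.
pose D k := [set x | `|x| < k%:R /\ ~ exists2 d, 0 < d & forall r, 0 < r -> r < d ->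
    (\int[mu]_y ((`|x - y| <= r)%R%:R * `|f y - f x|)%:E <= (k.+1%:R^-1 * r ^+ n)%:E)%E].
suff ND k : mu.-negligible (D k).
  have : mu.-negligible (\bigcup_k D k) by exact: negligible_bigcup.
  apply: negligibleS => x /= nl; apply: contrapT => nD; apply: nl => e e0.
  pose k := (Num.bound e^-1 + Num.bound `|x|)%N.
  have ke : k.+1%:R^-1 <= e.
    rewrite -[leRHS]invrK lef_pV2 ?posrE ?invr_gt0//.
    rewrite (le_trans (ltW (archi_boundP _)))// ?invr_ge0 ?(ltW e0)// ler_nat.
    by rewrite leqW// leq_addr.
  have xk : `|x| < k%:R.
    by apply: lt_le_trans (archi_boundP (normr_ge0 x)) _; rewrite ler_nat leq_addl.
  have : ~ D k x by move=> Dx; apply: nD; exists k.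
  move=> /not_andP[//|/contrapT[d d0 hd]]; exists d => // r r0 rd; apply: le_trans (hd r r0 rd) _.
  by rewrite lee_fin ler_pM2r ?exprn_gt0.
pose c : R := k.+1%:R^-1; have c0 : 0 < c by rewrite /c invr_gt0.
rewrite /D -/c {D}.
pose t := c / (3 * 8 ^+ n).
have t0 : 0 < t by rewrite divr_gt0// mulr_gt0// exprn_gt0.
apply: negligible_small => e e0.
pose d := e * t / (2 * 4 ^+ n).
have d0 : 0 < d by rewrite divr_gt0 ?mulr_gt0 ?exprn_gt0.
have [g [mg lg fg]] := H k d d0.
pose h x := (`|x| <= k%:R)%R%:R * `|f x - g x|.
have mh : measurable_fun setT h by rewrite /h; mfun.
have h0 x : 0 <= h x by rewrite mulr_ge0.
have [W [mW Wd WP]] := weak11 mh h0 fg t0.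
pose G := [set x | t <= h x].
have mG : measurable G.
  have mb : measurable_fun setT (fun x => t <= h x) by mfun.
  rewrite (_ : G = setT `&` (fun x => t <= h x) @^-1` [set true]); first exact: mb.
  by apply/seteqP; split => y //= [].
have G1 : (mu G <= (d / t)%:E)%E.
  rewrite -(@lee_pmul2l _ t%:E)// -EFinM (_ : t * (d / t) = d); last first.
    by field; rewrite gt_eqF.
  apply: le_trans fg; apply: (@markov_ge _ _ _ mu G t (fun x => (h x)%:E)) => //.
  by mfun.
exists (W `|` G); split; first exact: measurableU.
  apply: le_trans (measureU2 _ mW mG) _; apply: le_trans (leeD Wd G1) _.
  rewrite -EFinD lee_fin /d.
  have p4 : 1 <= 4 ^+ n :> R by rewrite exprn_ege1// ler1n.
  have p40 : 0 < 4 ^+ n :> R by exact: lt_le_trans p4.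
  rewrite (_ : _ + _ = e * (2^-1 + (2 * 4 ^+ n)^-1)); last by field; rewrite !gt_eqF.
  rewrite ger_pMr// -lerBrDl (_ : 1 - 2^-1 = 2^-1); last by field.
  by rewrite lef_pV2 ?posrE ?mulr_gt0// ler_pMr.
exists [set x | ~ leb g x]; first exact: lg.
move=> x [xk Dx]; have [lx|] := pselect (leb g x); last by left.
right; apply: contrapT => /not_orP[nW nG]; apply: Dx.
have c3 : 0 < c / 3 by rewrite divr_gt0.
have [d1 d10 h1] := lx (c / 3) c3.
exists (Num.min d1 (k%:R - `|x|)); first by rewrite lt_min d10 subr_gt0.
move=> r r0; rewrite lt_min => /andP[rd rk].
have fgx : `|f x - g x| <= t.
  by rewrite ltW// ltNge; apply/negP => hx; apply: nG; rewrite /G/= /h (ltW xk) mul1r.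
have hE y : (`|x - y| <= r)%R%:R * `|f y - g y| = (`|x - y| <= r)%R%:R * h y.
  have [xy|] := leP `|x - y| r; last by rewrite !mul0r.
  rewrite /h (_ : (`|y| <= k%:R) = true) ?mul1r//.
  rewrite -(subrK x y) (le_trans (ler_normD _ _))// -lerBrDr distrC.
  by apply: le_trans xy (ltW rk).
have p8 : 0 < 8 ^+ n :> R by rewrite exprn_gt0.
have p24 : (2 : R) ^+ n <= 8 ^+ n by rewrite ler_pXn2r ?nnegrE// ler_nat.
apply: (@le_trans _ _ (\int[mu]_y ((`|x - y| <= r)%R%:R * `|f y - g y| +
    ((`|x - y| <= r)%R%:R * `|g y - g x| + t * (`|x - y| <= r)%R%:R))%:E)%E).
  apply: nn_le => [||y]; [by mfun|by mfun|]; rewrite mulr_ge0//=.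
  rewrite [t * _]mulrC -!mulrDr ler_wpM2l//.
  have -> : f y - f x = (f y - g y) + (g y - g x) - (f x - g x) by ring.
  apply: le_trans (ler_normB _ _) _; rewrite [leRHS]addrA; apply: lerD fgx; exact: ler_normD.
under eq_integral do rewrite hE.
rewrite nnD; [|by mfun|by mfun|by move=> y; rewrite mulr_ge0
  |by move=> y; rewrite addr_ge0// mulr_ge0 ?(ltW t0)].
rewrite nnD; [|by mfun|by mfun|by move=> y; rewrite mulr_ge0
  |by move=> y; rewrite mulr_ge0 ?(ltW t0)].
rewrite (nnZ _ (ltW t0)); [|by mfun|by []]; rewrite (int_near _ (ltW r0)).
apply: le_trans (leeD (WP x nW r r0) (leeD (h1 r r0 rd) (lexx _))) _.
rewrite -EFinM -!EFinD lee_fin !exprMn.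
have rn : 0 < r ^+ n by rewrite exprn_gt0.
have tE : t * (8 ^+ n * r ^+ n) = c / 3 * r ^+ n by rewrite /t; field; rewrite gt_eqF.
rewrite tE; apply: (@le_trans _ _ (c / 3 * r ^+ n + (c / 3 * r ^+ n + c / 3 * r ^+ n))).
  rewrite !lerD2l -tE ler_pM2l// ler_pM2r//.
by rewrite le_eqVlt; apply/orP; left; apply/eqP; field.
Qed.

Lemma small_of_cvg0 (u : nat -> \bar R) e : u @ \oo --> 0%E -> 0 < e ->
  exists N, (u N <= e%:E)%E.
Proof.
move=> u0 e0.
have : \forall N \near \oo, (u N < e%:E)%E.
  have nb0 : nbhs (0 : \bar R)%E [set y | (y < e%:E)%E]; last exact: u0 nb0.
  apply: open_nbhs_nbhs; split; first exact: open_ereal_lt_ereal.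
  by rewrite /= lte_fin.
by move=> [N _ HN]; exists N; exact/ltW/HN/leqnn.
Qed.

Lemma indic_cases (A : set V) x : \1_A x = 1 :> R /\ A x \/ \1_A x = 0 :> R /\ ~ A x.
Proof.
rewrite indicE; case: (pselect (A x)) => Ax; [left|right]; split => //.
- by rewrite mem_set.
- by rewrite memNset.
Qed.

Lemma ae_leb_indicU (A B : set V) : measurable A -> measurable B ->
  ae_leb (\1_A : V -> R) -> ae_leb (\1_B : V -> R) -> ae_leb (\1_(A `|` B) : V -> R).
Proof.
move=> mA mB; apply: filterS2 => x lA lB.
apply: (leb_le (measurable_indic mA) (measurable_indic mB) _ ltr01 ltr01 _ lA lB) => [|y].
  exact: measurable_indic (measurableU _ _ mA mB).
rewrite !mul1r.
have [[-> A1]|[-> A1]] := indic_cases A x; have [[-> A2]|[-> A2]] := indic_cases A y;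
have [[-> B1]|[-> B1]] := indic_cases B x; have [[-> B2]|[-> B2]] := indic_cases B y;
have [[-> U1]|[-> U1]] := indic_cases (A `|` B) x;
have [[-> U2]|[-> U2]] := indic_cases (A `|` B) y;
rewrite ?subrr ?subr0 ?sub0r ?normrN ?normr1 ?normr0 ?add0r ?addr0 ?lerDl ?lerDr ?lexx//;
exfalso; move: U1 U2; rewrite /setU/=; tauto.
Qed.

(** The sets whose indicator has this property form a sigma-algebra containing the
    coordinate half-spaces; a countable union is a limit in mean of finite unions. *)
Lemma ae_leb_indic (S : set V) : measurable S -> ae_leb (\1_S : V -> R).
Proof.
move: S; pose GG := [set A : set V | measurable A /\ ae_leb (\1_A : V -> R)].
suff H : (measurable : set (set V)) `<=` GG by move=> S /H[].
have GC (A : set V) : GG A -> GG (~` A).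
  move=> [mA lA]; split; first exact: measurableC.
  apply: filterS lA => x lA.
  have mC : measurable_fun setT (\1_(~` A) : V -> R).
    exact: measurable_indic (measurableC mA).
  have m1 : measurable_fun setT (\1_A : V -> R) by exact: measurable_indic.
  apply: (leb_le m1 m1 mC ltr01 ltr01 _ lA lA) => y.
  rewrite !mul1r; apply: (@le_trans _ _ `|\1_A y - \1_A x|); last by rewrite lerDl.
  have [[-> A1]|[-> A1]] := indic_cases A x; have [[-> A2]|[-> A2]] := indic_cases A y;
  have [[-> C1]|[-> C1]] := indic_cases (~` A) x;
  have [[-> C2]|[-> C2]] := indic_cases (~` A) y;
  rewrite ?subrr ?subr0 ?sub0r ?normrN ?normr1 ?normr0 ?lexx// ?ler01//;
  exfalso; move: C1 C2; rewrite /setC/=; tauto.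
have GU (A B : set V) : GG A -> GG B -> GG (A `|` B).
  by move=> [mA lA] [mB lB]; split; [exact: measurableU|exact: ae_leb_indicU].
have G0 : GG set0.
  by split => //; apply: aeW => x; rewrite indic0; exact: leb_const.
have Gray (i : 'I_n) (a : R) : GG [set x : V | a < x ord0 i].
  have mray : measurable [set x : V | a < x ord0 i].
    have mb : measurable_fun setT (fun x : V => a < x ord0 i) by mfun.
    rewrite (_ : [set x | _] = setT `&` (fun x : V => a < x ord0 i) @^-1` [set true]).
      exact: mb.
    by apply/seteqP; split => y //= [].
  split => //.
  have loc x : x ord0 i != a -> leb (\1_[set x : V | a < x ord0 i] : V -> R) x.
    move=> xa; pose d := `|x ord0 i - a| / 2.
    have xa0 : 0 < `|x ord0 i - a| by rewrite normr_gt0 subr_eq0.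
    have d0 : 0 < d by rewrite divr_gt0.
    apply: (leb_loc d0 _ (leb_const (\1_[set x : V | a < x ord0 i] x) x)) => y xy.
    have yx : `|x ord0 i - y ord0 i| <= d.
      by apply: le_trans xy; have := rVnorm_coord (x - y) i; rewrite !mxE.
    have dd : `|x ord0 i - a| = 2 * d by rewrite /d; field.
    suff E : (a < x ord0 i) = (a < y ord0 i).
      have [[-> /= A1]|[-> /= A1]] := indic_cases [set x : V | a < x ord0 i] x;
      have [[-> /= A2]|[-> /= A2]] := indic_cases [set x : V | a < x ord0 i] y => //;
      by move: A1 A2; rewrite E.
    move: yx dd xa0; rewrite /d; move: (x ord0 i) (y ord0 i) xa => u v uv.
    rewrite ler_norml; have [ua|ua] := leP a u => /andP[h1 h2] dd xa0.
      have au : a < u by rewrite lt_neqAle eq_sym uv.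
      rewrite au; apply/esym; move: h1 h2 xa0; rewrite ger0_norm ?subr_ge0//; lra.
    have au : (a < u) = false by apply/negbTE; rewrite -leNgt ltW.
    rewrite au; apply/esym/negbTE; rewrite -leNgt.
    by move: h1 h2 xa0; rewrite ltr0_norm ?subr_lt0//; lra.
  have N0 : mu.-negligible [set x : V | x ord0 i = a].
    have -> : [set x : V | x ord0 i = a] = \bigcup_k
        [set x : V | forall j, (if j == i then [set a] else `[- k%:R, k%:R]%classic) (x ord0 j)].
      apply/seteqP; split => x /=.
        move=> xa; exists (Num.bound `|x|) => // j; case: eqP => [->//|_] /=.
        rewrite in_itv/= -ler_norml; apply: le_trans (rVnorm_coord x j) _.
        by rewrite ltW// archi_boundP.
      by move=> [k _ /(_ i)]; rewrite eqxx.
    apply: negligible_bigcup => k.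
    pose S (j : 'I_n) : set R := if j == i then [set a] else `[- k%:R, k%:R]%classic.
    have mS j : measurable (S j : set (measurableTypeR R)).
      by rewrite /S; case: eqP => _; [exact: measurable_set1|exact: measurable_itv].
    have [mB BE] := lebesgue_box mS.
    apply/negligibleP => //; rewrite [LHS]BE (bigD1 i)//= {1}/S eqxx.
    by rewrite lebesgue_measure_set1 mul0e.
  by apply: negligibleS N0 => x /= nl; apply: contrapT => /eqP xa; apply: nl; exact: loc.
have Gcup (F : nat -> set V) : (forall k, GG (F k)) -> GG (\bigcup_k F k).
  move=> GF; have mF : measurable (\bigcup_k F k).
    by apply: bigcup_measurable => k _; exact: (GF k).1.
  split => //; apply: ae_leb_lim; first exact: measurable_indic.
  move=> k e e0; pose Q := [set x : V | `|0 - x| <= k%:R].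
  have mQ : measurable Q by exact: measurable_normB_le.
  pose U N := \big[setU/set0]_(i < N) F i.
  have GGU N : GG (U N).
    by elim: N => [|N IH]; rewrite /U ?big_ord0// big_ord_recr; exact: GU.
  pose D N := (Q `&` \bigcup_k F k) `\` U N.
  have mD N : measurable (D N).
    by apply: measurableD; [exact: measurableI|exact: (GGU N).1].
  have D0 : \bigcap_N D N = set0.
    apply/seteqP; split => // x Dx; have [[_ [j _ Fj]] _] := Dx 0%N I.
    have [_] := Dx j.+1 I; apply; rewrite /U big_ord_recr; by right.
  have : mu \o D @ \oo --> mu (\bigcap_N D N).
    apply: nonincreasing_cvg_mu => //.
    - apply: (@le_lt_trans _ _ (mu Q)); last by rewrite lebesgue_normB_le// ltry.
      by apply: le_measure; rewrite ?inE// => x [[]].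
    - by rewrite D0.
    - move=> N N' NN'; apply/subsetPset => x [Qx nU]; split => // UN; apply: nU.
      move: UN; rewrite /U -!bigcup_mkord => -[j /= jN Fj]; exists j => //=.
      exact: leq_trans jN NN'.
  rewrite D0 measure0 => /small_of_cvg0/(_ e0)[N DN].
  exists (\1_(U N)); split; [exact: measurable_indic (GGU N).1|exact: (GGU N).2|].
  apply: le_trans DN; rewrite le_eqVlt; apply/orP; left; apply/eqP.
  rewrite /= -(setIT (D N)) -integral_indic//; apply: eq_integral => x _; congr EFin.
  have UF : U N x -> (\bigcup_k F k) x.
    by rewrite /U -bigcup_mkord => -[j _ Fj]; exists j.
  have QE : (`|x| <= k%:R) = (x \in Q).
    by apply/idP/idP; rewrite inE /Q/= sub0r normrN.
  rewrite QE -[(x \in Q)%:R]/(\1_Q x).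
  have [[-> A1]|[-> A1]] := indic_cases Q x; have [[-> A2]|[-> A2]] := indic_cases (U N) x;
  have [[-> C1]|[-> C1]] := indic_cases (\bigcup_k F k) x;
  have [[-> C2]|[-> C2]] := indic_cases (D N) x;
  rewrite ?subrr ?subr0 ?sub0r ?normrN ?normr1 ?normr0 ?mulr0 ?mul0r ?mul1r//;
  exfalso; move: C1 C2 UF; rewrite /D/setD/setI/=; tauto.
have sG : sigma_algebra setT GG.
  by split => // A GA; rewrite setTD; exact: GC.
pose coors := fun (i : 'I_n) (x : 'rV[R]_n) => x ord0 i : measurableTypeR R.
have Gpre (i : 'I_n) (C : set (measurableTypeR R)) : measurable C -> GG (coors i @^-1` C).
  move=> mC; have {}mC : (RGenOInfty.G (R := R)).-sigma.-measurable C.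
    by rewrite -RGenOInfty.measurableE.
  move: mC.
  suff : <<s RGenOInfty.G (R := R) >> `<=` [set C | GG (coors i @^-1` C)] by move=> H /H.
  apply: smallest_sub; first split => /=.
  - by rewrite preimage_set0.
  - by move=> A GA; rewrite setTD preimage_setC; exact: GC.
  - by move=> F GF; rewrite preimage_bigcup; exact: Gcup.
  move=> _ [a ->] /=; have := Gray i a; congr GG.
  by apply/seteqP; split => x /=; rewrite in_itv/= andbT.
apply: smallest_sub => //.
apply: (big_ind (fun X => X `<=` GG)) => [//|X Y hX hY A [/hX|/hY]//|i _ A [C mC <-]].
by rewrite setTI; exact: Gpre.
Qed.

Definition locint f := measurable_fun setT f /\
  forall r, (\int[mu]_x ((`|x| <= r)%R%:R * `|f x|)%:E < +oo)%E.

Lemma ae_leb_sum (I : eqType) (s : seq I) (c : I -> R) (F : I -> set V) :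
  (forall i, i \in s -> measurable (F i)) ->
  ae_leb (fun x => \sum_(i <- s) c i * \1_(F i) x : R).
Proof.
elim: s => [|i s IH] mF.
  by apply: aeW => x; under eq_fun do rewrite big_nil; exact: leb_const.
have mi : measurable (F i) by apply: mF; rewrite mem_head.
have ms j : j \in s -> measurable (F j) by move=> js; apply: mF; rewrite in_cons js orbT.
have m1 : measurable_fun setT (\1_(F i) : V -> R) by exact: measurable_indic.
have m2 : measurable_fun setT (fun x => \sum_(i <- s) c i * \1_(F i) x : R).
  rewrite (_ : (fun x => _) = fun x =>
     \sum_(i <- s) (c i * (if i \in s then \1_(F i) x else 0))); last first.
    by apply/funext => x; rewrite !big_seq; apply: eq_bigr => j ->.
  apply: measurable_sum => j; apply: measurable_funM => //.
  by case: (boolP (j \in s)) => [/ms mj|_]; [exact: measurable_indic|exact: measurable_cst].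
have a0 : 0 < `|c i| + 1 by rewrite ltr_wpDl.
apply: filterS2 (ae_leb_indic mi) (IH ms) => x l1 l2.
apply: (leb_le m1 m2 _ a0 ltr01 _ l1 l2) => [|y].
  by under eq_fun do rewrite big_cons; apply: measurable_funD => //; mfun.
rewrite !big_cons mul1r opprD addrACA -mulrBr; apply: le_trans (ler_normD _ _) _.
by rewrite lerD2r normrM ler_wpM2r// lerDl.
Qed.

Import HBSimple.

(** Lebesgue's differentiation theorem. *)
Lemma locint_leb f : locint f -> ae_leb f.
Proof.
move=> [mf lf]; apply: ae_leb_lim => // k e e0.
pose F x := (`|x| <= k%:R)%R%:R * f x.
have mF : measurable_fun setT F by rewrite /F; mfun.
have iF : mu.-integrable setT (EFin \o F).
  apply/integrableP; split; first exact/measurable_EFinP.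
  apply: le_lt_trans (lf k%:R); rewrite le_eqVlt; apply/orP; left; apply/eqP.
  by apply: eq_integral => x _ /=; rewrite /F normrM ger0_norm.
have [g [ig _ /small_of_cvg0/(_ e0)[N Ng]]] := approximation_sfun_integrable measurableT iF.
pose G : V -> R := fun x => g N x.
have mG : measurable_fun setT G by exact: measurable_funP.
exists G; split => //.
  have -> : G = fun x => \sum_(y <- finmap.enum_fset (fset_set (range (g N))))
      y * \1_(g N @^-1` [set y]) x.
    apply/funext => x; rewrite /G fimfunE fsbig_finite//=.
  by apply: ae_leb_sum => y _; rewrite -[X in measurable X]setTI; exact: mG.
apply: le_trans Ng; apply: nn_le => [||x]; [by mfun|by mfun|].
rewrite mulr_ge0//= /F /G; case: (boolP (`|x| <= k%:R)) => _; first by rewrite !mul1r.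
by rewrite !mul0r.
Qed.

End lebesgue_points.

(** * A maximal inequality for almost orthogonal series *)

Section finite_sums.
Context {R : realType}.
Implicit Types (a w : nat -> R) (F : nat -> nat -> R).

Lemma sum_sqr_le N a w W : (forall k, 0 < w k) -> 0 < W -> \sum_(k < N) w k <= W ->
  (\sum_(k < N) a k) ^+ 2 <= W * \sum_(k < N) (w k)^-1 * a k ^+ 2.
Proof.
move=> w0 W0 wW; set S := \sum_(k < N) a k; set Q := \sum_(k < N) (w k)^-1 * a k ^+ 2.
pose t := S / W.
have : 0 <= \sum_(k < N) (w k)^-1 * (a k - t * w k) ^+ 2.
  by apply: sumr_ge0 => k _; rewrite mulr_ge0 ?sqr_ge0// invr_ge0 ltW.
have -> : \sum_(k < N) (w k)^-1 * (a k - t * w k) ^+ 2 =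
    Q - 2 * t * S + t ^+ 2 * \sum_(k < N) w k.
  rewrite /Q /S !mulr_sumr -sumrB -big_split /=; apply: eq_bigr => k _.
  by field; rewrite gt_eqF.
have h : t ^+ 2 * \sum_(k < N) w k <= t ^+ 2 * W by rewrite ler_wpM2l// sqr_ge0.
have -> : S = t * W by rewrite /t; field; rewrite gt_eqF.
move=> h2; have h3 : t ^+ 2 * W <= Q by nra.
rewrite (_ : (t * W) ^+ 2 = W * (t ^+ 2 * W)) ?ler_pM2l//; ring.
Qed.

Lemma double_sum_le N F : (forall k l, 0 <= F k l) ->
  \sum_(k < N) \sum_(l < N) F k l <=
  \sum_(d < N) \sum_(k < N - d) (F k (k + d)%N + F (k + d)%N k).
Proof.
move=> F0; elim: N => [|N IH]; first by rewrite !big_ord0.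
rewrite big_ord_recr /=.
under eq_bigr do rewrite big_ord_recr /=.
rewrite big_split /= big_ord_recr /=.
rewrite (eq_bigr (fun d : 'I_N.+1 => \sum_(k < N - d) (F k (k + d)%N + F (k + d)%N k) +
    (F (N - d)%N N + F N (N - d)%N))); last first.
  move=> [d dN] _; rewrite /= subSn// big_ord_recr /=; congr (_ + (F _ _ + F _ _)) => //.
  - by rewrite subnK.
  - by rewrite subnK.
rewrite big_split /= big_ord_recr /= subnn big_ord0 addr0 -addrA.
apply: lerD IH _.
have rev (f : nat -> R) : \sum_(d < N.+1) f (N - d)%N = \sum_(d < N.+1) f d.
  rewrite [RHS](reindex_inj rev_ord_inj) /=; apply: eq_bigr => d _.
  by rewrite subSS.
rewrite big_split /= (rev (fun j => F j N)) (rev (F N)) !big_ord_recr /=.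
have := F0 N N; lra.
Qed.

Lemma sum_shift_le N i a : (forall k, 0 <= a k) ->
  \sum_(k < N) a (k + i)%N <= \sum_(k < i + N) a k.
Proof.
move=> a0; rewrite big_split_ord /= -[leLHS]add0r lerD ?sumr_ge0//.
by apply: ler_sum => k _; rewrite addnC.
Qed.

Lemma geo2_le N : \sum_(d < N) (2 : R) ^- d <= 2.
Proof.
suff : \sum_(d < N) (2 : R) ^- d = 2 - 2 * 2 ^- N.
  by move=> ->; rewrite lerBlDr lerDl mulr_ge0// invr_ge0 exprn_ge0.
elim: N => [|N IH]; first by rewrite big_ord0 expr0 invr1 mulr1 subrr.
rewrite big_ord_recr /= IH exprS; field; by rewrite expf_neq0.
Qed.

Lemma geo2_half_le N : \sum_(d < N) (2 : R) ^- (d./2) <= 4.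
Proof.
have h m : \sum_(d < m.*2) (2 : R) ^- (d./2) = 2 * \sum_(d < m) 2 ^- d.
  elim: m => [|m IH]; first by rewrite !big_ord0 mulr0.
  rewrite doubleS !big_ord_recr /= IH doubleK uphalf_double; ring.
have [m Nm] : exists m, (N <= m.*2)%N by exists N; rewrite -addnn leq_addr.
apply: (@le_trans _ _ (\sum_(d < m.*2) (2 : R) ^- (d./2))).
  rewrite -(subnKC Nm) big_split_ord /= lerDl; apply: sumr_ge0 => i _.
  by rewrite invr_ge0 exprn_ge0.
by rewrite h; have := geo2_le m; lra.
Qed.

End finite_sums.

Lemma mu_bigcup_le {d} {T : measurableType d} {R : realType}
    (mu : {measure set T -> \bar R}) (D : nat -> set T) c :
  (forall N, measurable (D N)) -> (forall N N', (N <= N')%N -> D N `<=` D N') ->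
  (forall N, (mu (D N) <= c)%E) -> (mu (\bigcup_N D N) <= c)%E.
Proof.
move=> mD nd Dc; have ndD : nondecreasing_seq D by move=> N N' NN'; exact/subsetPset/nd.
have cvgD := @nondecreasing_cvg_mu _ _ _ mu D mD (bigcup_measurable (fun k _ => mD k)) ndD.
rewrite -(cvg_lim _ cvgD)//; apply: lime_le; first by apply/cvg_ex; eexists; exact: cvgD.
by near=> N; exact: Dc.
Unshelve. all: by end_near. Qed.

Section maximal.
Context {R : realType} {n : nat}.
Hypothesis n0 : (0 < n)%N.
Local Notation V := 'rV[R]_n.
Local Notation mu := (@lebesgue_rV R n).
Local Notation L2 := (L2 mu).
Local Notation dot := (dot mu).
Local Notation N2 := (N2 mu).
Implicit Types (x y : V) (F G : V -> R) (e t : R) (i j k N : nat).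
Variable L0 : nat.
Hypothesis L0E : L0%:R = 2 ^+ 8 :> R.
Local Notation P := (avg_op L0).
Local Notation sc := (sc L0).

Variables (r : nat -> V -> R) (e : R).
Hypothesis Lr : forall k, L2 (r k).
Hypothesis r1 : forall N, \sum_(k < N) N2 (r k) <= e.
Hypothesis r2 : forall i N, \sum_(k < N) N2 (P k (r (k + i)%N)) <= e * 2 ^- (2 * i).
Hypothesis r3 : forall i N,
  \sum_(k < N) N2 (fun x => r k x - P (k + i) (r k) x) <= e * 2 ^- (2 * i).

Let e0 : 0 <= e. Proof. by have := r1 0; rewrite big_ord0. Qed.
Let p2 d : 0 < (2 : R) ^- d. Proof. by rewrite invr_gt0 exprn_gt0. Qed.
Let LP k F : L2 F -> L2 (P k F). Proof. exact: L2_P. Qed.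

(** The average at a scale half-way between the two indices is inserted: it is close
    to the identity on the coarser piece and small on the finer one. *)
Lemma sum_dot_le d N : \sum_(k < N) `|dot (r k) (r (k + d)%N)| <= 2 * e * 2 ^- (d./2).
Proof.
set h := d./2; pose m k := (k + h)%N.
have hd : (h <= d)%N by rewrite /h -{2}(odd_double_half d) -addnn addnA leq_addl.
have hd2 : (h <= d - h)%N by rewrite leq_subRL// addnn /h -{2}(odd_double_half d) leq_addl.
have md k : (k + d)%N = (m k + (d - h))%N by rewrite /m -addnA subnKC.
have bd k : `|dot (r k) (r (k + d)%N)| <=
    (2 ^+ h * N2 (fun x => r k x - P (m k) (r k) x) + 2 ^- h * N2 (r (k + d)%N)) / 2 +
    (2 ^- h * N2 (r k) + 2 ^+ h * N2 (P (m k) (r (m k + (d - h))%N))) / 2.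
  have LQ : L2 (fun x => r k x - P (m k) (r k) x) by apply: L2B => //; exact: LP.
  have -> : dot (r k) (r (k + d)%N) =
      dot (fun x => r k x - P (m k) (r k) x) (r (k + d)%N) + dot (r k) (P (m k) (r (k + d)%N)).
    rewrite (dotBl (Lr k) (LP _ (Lr k)) (Lr _)).
    by rewrite (adjoint_pk (sc_gt0 L0E _) (Lr k) (Lr _)) subrK.
  apply: le_trans (ler_normD _ _) _; apply: lerD.
    by have := dot_le LQ (Lr (k + d)%N) (exprn_gt0 h (ltr0n R 2)).
  have := dot_le (Lr k) (LP (m k) (Lr (k + d)%N)) (p2 h).
  by rewrite invrK md.
apply: (@le_trans _ _ (\sum_(k < N) _)); first by apply: ler_sum => k _; exact: bd.
rewrite big_split /= -!mulr_suml !big_split /= -!mulr_sumr.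
have q3 := r3 h N.
have q2 : \sum_(k < N) N2 (P (m k) (r (m k + (d - h))%N)) <= e * 2 ^- (2 * h).
  apply: (@le_trans _ _ (e * 2 ^- (2 * (d - h)))); last first.
    rewrite ler_wpM2l// lef_pV2 ?posrE ?exprn_gt0// ler_weXn2l ?ler1n//.
    by rewrite leq_mul2l hd2 orbT.
  apply: le_trans (r2 (d - h) (h + N)).
  rewrite big_split_ord /= -[leLHS]add0r lerD//.
    by apply: sumr_ge0 => i _; exact: N2_ge0.
  by apply: ler_sum => i _; rewrite /m addnC.
have q1 := r1 N.
have q1' : \sum_(k < N) N2 (r (k + d)%N) <= e.
  exact: le_trans (sum_shift_le N d (fun k => N2_ge0 mu (r k))) (r1 (d + N)%N).
have hh : 2 ^+ h * (e * 2 ^- (2 * h)) = e * 2 ^- h.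
  by rewrite mul2n -addnn exprD; field; rewrite expf_neq0.
have c2 : 0 <= (2 : R) ^+ h by rewrite exprn_ge0.
have := ler_wpM2l c2 q3; have := ler_wpM2l c2 q2; rewrite hh.
have := ler_wpM2l (ltW (p2 h)) q1; have := ler_wpM2l (ltW (p2 h)) q1'.
lra.
Qed.

Let U N x := \sum_(k < N) r k x.

Let LU N : L2 (U N).
Proof. by apply: L2_sum => k _; exact: Lr. Qed.

Lemma N2_partial_sum N : N2 (U N) <= 16 * e.
Proof.
have -> : N2 (U N) = \sum_(k < N) \sum_(l < N) dot (r k) (r l).
  rewrite {1}/N2 {1}/U dot_suml//; apply: eq_bigr => k _.
  by rewrite dotC dot_suml//; apply: eq_bigr => l _; rewrite dotC.
apply: (@le_trans _ _ (\sum_(k < N) \sum_(l < N) `|dot (r k) (r l)|)).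
  by apply: ler_sum => k _; apply: ler_sum => l _; exact: ler_norm.
apply: le_trans (@double_sum_le _ N (fun k l => `|dot (r k) (r l)|) _) _ => //.
apply: (@le_trans _ _ (\sum_(d < N) 4 * e * 2 ^- (d./2))); last first.
  by rewrite -mulr_sumr; have := @geo2_half_le R N; have := e0; nra.
apply: ler_sum => d _; rewrite big_split /=.
have := sum_dot_le d (N - d); under [X in _ + X <= _]eq_bigr do rewrite dotC.
lra.
Qed.

Let G N k x := if (k < N)%N then r k x - P N (r k) x else P N (r k) x.

Let LG N k : L2 (G N k).
Proof. by rewrite /G; case: (k < N)%N; [apply: L2B => //; exact: LP|exact: LP]. Qed.

Let w N k : R := 2 ^- ((N - k) + (k - N)).
Let H N0 x := \sum_(N < N0.+1) \sum_(k < N0.+1) (w N k)^-1 * G N k x ^+ 2.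

(** A partial sum of [r] is compared with the average at scale [N] of the full sum:
    the error collects [r k - P N (r k)] for [k < N] and [P N (r k)] for larger [k], each
    of which decays geometrically in [|N - k|]. *)
Lemma partial_sum_le N0 N x : (N <= N0)%N ->
  (P N (U N0.+1) x - U N x) ^+ 2 <= 3 * H N0 x.
Proof.
move=> NN0.
have -> : P N (U N0.+1) x - U N x =
    \sum_(k < N0.+1) (if (k < N)%N then - G N k x else G N k x).
  rewrite /avg_op (op_sum _ _ (lkern_pk (sc_gt0 L0E N)))//.
  rewrite /U -(subnKC (leqW NN0)) !big_split_ord /= addrAC; congr (_ + _).
    by rewrite -sumrB; apply: eq_bigr => k _; rewrite /G ltn_ord opprB.
  by apply: eq_bigr => k _; rewrite /G ltnNge leq_addr.
have h := @sum_sqr_le R N0.+1 (fun k => if (k < N)%N then - G N k x else G N k x) (w N) 3.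
apply: le_trans (h _ _ _) _; [by move=> k; exact: p2|by []|exact: geo_dist|].
rewrite ler_pM2l// /H [leRHS](bigD1 (Ordinal (NN0 : (N < N0.+1)%N)))//=.
rewrite -[leLHS]addr0 lerD//.
  apply: ler_sum => k _; rewrite ler_wpM2l ?invr_ge0 ?(ltW (p2 _))//.
  by case: (k < N)%N; rewrite ?sqrrN.
apply: sumr_ge0 => i _; apply: sumr_ge0 => k _.
by rewrite mulr_ge0 ?sqr_ge0// invr_ge0 (ltW (p2 _)).
Qed.

Let measurable_H N0 : measurable_fun setT (H N0).
Proof.
apply: measurable_sum => N; apply: measurable_sum => k.
by have [mG _] := LG N k; mfun.
Qed.

Lemma int_H N0 : (\int[mu]_x (H N0 x)%:E <= (4 * e)%:E)%E.
Proof.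
pose T (N k : nat) := (w N k)^-1 * N2 (G N k).
have T0 N k : 0 <= T N k by rewrite mulr_ge0 ?N2_ge0// invr_ge0 (ltW (p2 _)).
have -> : (\int[mu]_x (H N0 x)%:E = (\sum_(N < N0.+1) \sum_(k < N0.+1) T N k)%:E)%E.
  rewrite /H; under eq_integral do rewrite -sumEFin.
  rewrite ge0_integral_sum//; last 2 first.
  - move=> N; apply/measurable_EFinP; apply: measurable_sum => k.
    by have [mG _] := LG N k; mfun.
  - move=> N x _; rewrite lee_fin; apply: sumr_ge0 => k _.
    by rewrite mulr_ge0 ?sqr_ge0// invr_ge0 (ltW (p2 _)).
  rewrite -sumEFin; apply: eq_bigr => N _.
  under eq_integral do rewrite -sumEFin.
  rewrite ge0_integral_sum//; last 2 first.
  - by move=> k; have [mG _] := LG N k; mfun.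
  - by move=> k x _; rewrite lee_fin mulr_ge0 ?sqr_ge0// invr_ge0 (ltW (p2 _)).
  rewrite -sumEFin; apply: eq_bigr => k _; have [mG _] := LG N k.
  rewrite nnZ//; [|by rewrite invr_ge0 (ltW (p2 _))|by mfun|by move=> x; exact: sqr_ge0].
  by rewrite -(N2E (LG N k)) -EFinM.
rewrite lee_fin; apply: le_trans (@double_sum_le _ N0.+1 T T0) _.
apply: (@le_trans _ _ (\sum_(d < N0.+1) 2 * e * 2 ^- d)); last first.
  by rewrite -mulr_sumr; have := @geo2_le R N0.+1; have := e0; nra.
apply: ler_sum => d _; rewrite big_split /= /T.
have c2 : 0 <= (2 : R) ^+ d by rewrite exprn_ge0.
have hh : 2 ^+ d * (e * 2 ^- (2 * d)) = e * 2 ^- d.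
  by rewrite mul2n -addnn exprD; field; rewrite expf_neq0.
have wd k : (w k (k + d))^-1 = 2 ^+ d /\ (w (k + d) k)^-1 = 2 ^+ d.
  rewrite /w !invrK addKn (_ : (k - (k + d) = 0)%N) ?addn0//.
  by apply/eqP; rewrite subn_eq0 leq_addr.
have h1 : \sum_(k < N0.+1 - d) (w k (k + d)%N)^-1 * N2 (G k (k + d)%N) <= e * 2 ^- d.
  rewrite -hh; apply: le_trans (ler_wpM2l c2 (r2 d (N0.+1 - d))).
  rewrite mulr_sumr; apply: ler_sum => k _; rewrite (wd k).1 ler_wpM2l//.
  by rewrite /G ltnNge leq_addr.
have h2 : \sum_(k < N0.+1 - d) (w (k + d)%N k)^-1 * N2 (G (k + d)%N k) <= e * 2 ^- d.
  case: d => [[|d] dN] /= in c2 hh wd h1 *.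
    by apply: le_trans h1; apply: ler_sum => k _; rewrite !addn0.
  rewrite -hh; apply: le_trans (ler_wpM2l c2 (r3 d.+1 (N0.+1 - d.+1))).
  rewrite mulr_sumr; apply: ler_sum => k _; rewrite (wd k).2 ler_wpM2l//.
  by rewrite /G addnS ltnS leq_addr.
by apply: le_trans (lerD h1 h2) _; rewrite -[2 * e * _]mulrA mulr_natl mulr2n.
Qed.

Definition Cmax : R := 64 * (4 ^+ n) ^+ 2 + 192.

(** The averages of the full sum are controlled by the weak type (1,1) bound applied
    to its square, the errors by the square function [H]. *)
Lemma max_finite N0 t : 0 < t -> exists W, [/\ measurable W,
  (mu W <= (Cmax * e / t ^+ 2)%:E)%E &
  forall x, ~ W x -> forall N, (N <= N0)%N -> `|\sum_(k < N) r k x| <= t].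
Proof.
move=> t0; have LU' := LU N0.+1; have [mU _] := LU'.
pose s := t ^+ 2 / (4 * 4 ^+ n); pose tau := t ^+ 2 / 48.
have p4 : 0 < 4 ^+ n :> R by rewrite exprn_gt0.
have t2 : 0 < t ^+ 2 by rewrite exprn_gt0.
have s0 : 0 < s by rewrite divr_gt0// mulr_gt0.
have tau0 : 0 < tau by rewrite divr_gt0.
have mU2 : measurable_fun setT (fun x => U N0.+1 x ^+ 2) by mfun.
have iU : (\int[mu]_x (U N0.+1 x ^+ 2)%:E <= (16 * e)%:E)%E.
  by rewrite -N2E// lee_fin N2_partial_sum.
have [W [mW We WP]] := weak11 n0 mU2 (fun x => sqr_ge0 _) iU s0.
pose D := [set x | tau <= H N0 x].
have mD : measurable D.
  have mb : measurable_fun setT (fun x => tau <= H N0 x) by have := measurable_H N0 => ?; mfun.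
  rewrite (_ : D = setT `&` (fun x => tau <= H N0 x) @^-1` [set true]); first exact: mb.
  by apply/seteqP; split => y //= [].
have De : (mu D <= (4 * e / tau)%:E)%E.
  rewrite -(@lee_pmul2l _ tau%:E)// -EFinM (_ : tau * (4 * e / tau) = 4 * e); last first.
    by field; rewrite gt_eqF.
  apply: le_trans (int_H N0); apply: (@markov_ge _ _ _ mu D tau (fun x => (H N0 x)%:E)) => //.
    by have := measurable_H N0 => ?; mfun.
  move=> x; rewrite lee_fin; apply: sumr_ge0 => N _; apply: sumr_ge0 => k _.
  by rewrite mulr_ge0 ?sqr_ge0// invr_ge0 (ltW (p2 _)).
exists (W `|` D); split; first exact: measurableU.
  apply: le_trans (measureU2 _ mW mD) _; apply: le_trans (leeD We De) _.
  rewrite -EFinD lee_fin /Cmax /s /tau le_eqVlt; apply/orP; left; apply/eqP.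
  by field; rewrite !gt_eqF.
move=> x /not_orP[nW nD] N NN0; set S := \sum_(k < N) r k x.
have r0 := sc_gt0 L0E N; set rr := (sc N : R) in r0.
have dS : (P N (U N0.+1) x - S) ^+ 2 <= (t / 4) ^+ 2.
  apply: le_trans (partial_sum_le x NN0) _.
  have : H N0 x < tau by rewrite ltNge; apply/negP.
  by rewrite /tau expr_div_n => /ltW; lra.
have dP : P N (U N0.+1) x ^+ 2 <= (t / 2) ^+ 2.
  have c0 : 0 <= (2 * rr) ^- n by rewrite invr_ge0 exprn_ge0// mulr_ge0// ltW.
  have c1 : 0 < (2 * rr) ^+ n by rewrite exprn_gt0// mulr_gt0.
  have h := @sqr_integral_le _ V R mu (pk rr x) (U N0.+1) (fun y => `|x - y| <= rr)
    ((2 * rr) ^- n) ((2 * rr) ^+ n).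
  have {}h : ((P N (U N0.+1) x ^+ 2)%:E <= ((2 * rr) ^- n ^+ 2 * (2 * rr) ^+ n)%:E *
      \int[mu]_y (U N0.+1 y ^+ 2 * (`|x - y| <= rr)%R%:R)%:E)%E.
    apply: h => //.
    - by apply: mker1; case: (lkern_pk (n := n) r0).
    - by mfun.
    - by move=> y; rewrite /pk ger0_norm// mulr_ge0.
    - by rewrite int_near// ltW.
  rewrite -lee_fin; apply: le_trans h _.
  have h2 := WP x nW rr r0.
  rewrite (eq_integral (fun y => ((`|x - y| <= rr)%R%:R * U N0.+1 y ^+ 2)%:E)); last first.
    by move=> y _; rewrite mulrC.
  have c2 : (0 <= ((2 * rr) ^- n ^+ 2 * (2 * rr) ^+ n)%:E)%E.
    by rewrite lee_fin mulr_ge0 ?sqr_ge0// ltW.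
  apply: le_trans (lee_wpmul2l c2 h2) _; rewrite -EFinM lee_fin.
  rewrite le_eqVlt; apply/orP; left; apply/eqP.
  rewrite (_ : 8 * rr = 4 * (2 * rr)); last by ring.
  rewrite (exprMn _ 4 (2 * rr)) /s; move: c1 p4; move: ((2 * rr) ^+ n) (4 ^+ n) => z z4 c1 p4.
  by field; rewrite !gt_eqF.
have t4 : 0 <= t / 4 by rewrite divr_ge0// ltW.
have t2' : 0 <= t / 2 by rewrite divr_ge0// ltW.
have : `|P N (U N0.+1) x - S| <= t / 4.
  by apply: ler_of_sqr => //; rewrite real_normK ?num_real.
have : `|P N (U N0.+1) x| <= t / 2.
  by apply: ler_of_sqr => //; rewrite real_normK ?num_real.
move: (P N _ x) => z; rewrite !ler_norml => /andP[h1 h2] /andP[h3 h4]; lra.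
Qed.

(** Monotone passage to infinitely many partial sums: the bound does not depend on
    the number of terms. *)
Lemma max_series t : 0 < t -> exists W, [/\ measurable W,
  (mu W <= (Cmax * e / t ^+ 2)%:E)%E &
  forall x, ~ W x -> forall N, `|\sum_(k < N) r k x| <= t].
Proof.
move=> t0; pose S N x := \sum_(k < N) r k x.
have mS N : measurable_fun setT (S N) by have [] := LU N.
pose D N := \bigcup_(k in [set k | (k <= N)%N]) [set x | t < `|S k x|].
have mD1 k : measurable [set x | t < `|S k x|].
  have mb : measurable_fun setT (fun x => t < `|S k x|) by have := mS k => ?; mfun.
  rewrite (_ : [set x | _] = setT `&` (fun x => t < `|S k x|) @^-1` [set true]).
    exact: mb.
  by apply/seteqP; split => y //= [].
have mD N : measurable (D N) by apply: bigcup_measurable => k _.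
exists (\bigcup_N D N); split; first exact: bigcup_measurable.
  apply: mu_bigcup_le => // [N N' NN' x [k /= kN h]|N].
    by exists k => //=; exact: leq_trans kN NN'.
  have [W [mW We WP]] := max_finite N t0.
  apply: le_trans We; apply: le_measure; rewrite ?inE// => x.
  move=> -[k /= kN]; rewrite ltNge => /negP h.
  by apply: contrapT => nW; apply: h; apply: WP nW _ _.
move=> x nD N; rewrite leNgt; apply/negP => h; apply: nD; exists N => //.
by exists N => /=.
Qed.

End maximal.

(** * Convergence of the truncated integrals along the scales *)

Section tails.
Context {R : realType} {n : nat}.
Hypothesis n0 : (0 < n)%N.
Local Notation V := 'rV[R]_n.
Local Notation mu := (@lebesgue_rV R n).
Local Notation L2 := (L2 mu).
Local Notation dot := (dot mu).
Local Notation N2 := (N2 mu).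
Implicit Types (x y : V) (F G K g : V -> R) (C l M e t d : R) (i j k m N : nat).
Variable L0 : nat.
Hypothesis L0E : L0%:R = 2 ^+ 8 :> R.
Local Notation A := (shell_op L0).
Local Notation P := (avg_op L0).
Local Notation E := (cell_op L0).
Local Notation sc := (sc L0).
Local Notation CM := (@CM R n L0).
Local Notation CQ := (@CQ R n L0).
Local Notation kap := (@kap R).

Lemma tail_small (u : nat -> R) c : (forall m, 0 <= u m) ->
  (forall N, \sum_(m < N) u m <= c) -> forall d, 0 < d ->
  exists k0, forall N, \sum_(m < N) (k0 <= m)%N%:R * u m <= d.
Proof.
move=> u0 uc d d0.
pose S := [set s | exists N, s = \sum_(m < N) u m].
have supS : has_sup S.
  by split; [exists (\sum_(m < 0) u m), 0|exists c => _ [N ->]].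
have [_ [k0 ->] hM] := sup_adherent d0 supS.
exists k0 => N.
have [NM|/ltnW MN] := leqP N k0.
  rewrite big1 ?ltW// => m _; rewrite leqNgt (leq_trans (ltn_ord m) NM).
  by rewrite mul0r.
have [N' ->] : exists N', N = (k0 + N')%N by exists (N - k0)%N; rewrite subnKC.
rewrite big_split_ord /= big1 ?add0r; last first.
  by move=> m _; rewrite leqNgt ltn_ord mul0r.
under eq_bigr do rewrite leq_addr mul1r.
have : \sum_(m < k0 + N') u m <= sup S by apply: sup_ubound; [exact: supS.2|exists (k0 + N')%N].
by rewrite big_split_ord /=; move: hM; lra.
Qed.

Lemma N2_0 : N2 (fun=> 0) = 0.
Proof.
rewrite /N2 /dot (eq_integral (cst 0%E)) => [|x _]; last by rewrite mulr0.
by rewrite integral0.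
Qed.

Let p2 k : 0 < (2 : R) ^- k. Proof. by rewrite invr_gt0 exprn_gt0. Qed.

Let min_le (a b x e : R) i : 0 < e -> 0 < b -> a <= e ^+ 2 / b ->
  x <= a -> x <= b * 2 ^- (4 * i) -> x <= e * 2 ^- (2 * i).
Proof.
move=> e0 b0 ab xa xb; set q := (2 : R) ^- (2 * i).
have q0 : 0 < q by exact: p2.
have qE : (2 : R) ^- (4 * i) = q ^+ 2.
  by rewrite /q exprVn -exprM; congr (_ ^- _); lia.
rewrite qE in xb; have [h|h] := leP (b * q) e.
  by apply: le_trans xb _; rewrite expr2 mulrA ler_pM2r.
apply: le_trans xa _; apply: le_trans ab _; rewrite ler_pdivrMr// expr2 -!mulrA ler_pM2l//.
by rewrite [q * b]mulrC ltW.
Qed.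

(** The maximal inequality applied to the tail of the series, whose square function
    is the tail of a convergent series. *)
Lemma good_tail M K g : czk M K -> L2 g -> forall t d, 0 < t -> 0 < d ->
  exists k0 W, [/\ measurable W, (mu W <= d%:E)%E &
   forall x, ~ W x -> forall N, `|\sum_(k < N) (k0 <= k)%N%:R * A K k g x| <= t].
Proof.
move=> cK Lg t d t0 d0; have M1 : 0 <= M by case: cK.
have CM1 : 1 <= CM M by exact: CM_ge1.
have CM0 : 0 < CM M by exact: lt_le_trans CM1.
have CQ1 : 1 <= CQ M by exact: CQ_ge1.
have CQ0 : 0 < CQ M by exact: lt_le_trans CQ1.
have Cm0 : 0 < @Cmax R n by rewrite /Cmax addr_gt0// mulr_gt0// !exprn_gt0.
pose e := d * t ^+ 2 / @Cmax R n.
have e0 : 0 < e by rewrite divr_gt0// mulr_gt0// exprn_gt0.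
pose b := CQ M * N2 g + 1.
have b0 : 0 < b by rewrite ltr_wpDl// mulr_ge0 ?N2_ge0// ltW.
pose dd := Num.min e (e ^+ 2 / b / (2 * CM M)).
have dd0 : 0 < dd by rewrite lt_min e0/= !divr_gt0 ?exprn_gt0// mulr_gt0.
have [k0 tl] := @tail_small (fun k => N2 (A K k g)) _ (fun k => N2_ge0 mu _)
  (fun N => square_A L0E N cK Lg) dd dd0.
pose r k x := (k0 <= k)%N%:R * A K k g x.
have LA k : L2 (A K k g) by exact: (L2_A L0E _ cK).
have Lr k : L2 (r k) by exact: L2Z.
have rE k : r k = A K k g \/ r k = fun=> 0.
  by rewrite /r; case: (k0 <= k)%N; [left|right]; apply/funext => x; rewrite ?mul1r ?mul0r.
have N2r k : N2 (r k) = (k0 <= k)%N%:R * N2 (A K k g).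
  by rewrite /r N2Z//; case: (k0 <= k)%N; rewrite ?expr1n ?expr0n.
have rd N : \sum_(k < N) N2 (r k) <= dd by under eq_bigr do rewrite N2r; exact: tl.
have ddb : 2 * CM M * dd <= e ^+ 2 / b.
  rewrite mulrC -ler_pdivlMr ?mulr_gt0//.
  by rewrite /dd ge_min lexx orbT.
have [|i N|i N|W [mW We WP]] := @max_series R n n0 L0 L0E r e Lr _ _ _ t t0.
- by move=> N; apply: le_trans (rd N) _; rewrite /dd ge_min lexx.
- apply: (min_le e0 b0 ddb).
    apply: (@le_trans _ _ (\sum_(k < N) CM M * N2 (r (k + i)%N))).
      by apply: ler_sum => k _; exact: N2_P_le.
    rewrite -mulr_sumr; have Sd : \sum_(k < N) N2 (r (k + i)%N) <= dd.
      exact: le_trans (sum_shift_le N i (fun k => N2_ge0 mu (r k))) (rd (i + N)%N).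
    by have := ler_wpM2l (ltW CM0) Sd; have := mulr_ge0 (ltW CM0) (ltW dd0); lra.
  apply: (@le_trans _ _ (\sum_(k < N) N2 (P k (A K (k + i) g)))).
    apply: ler_sum => k _; case: (rE (k + i)%N) => ->; first exact: lexx.
    apply: le_trans (N2_P_le L0E k M1 (L2_0 mu)) _.
    by rewrite N2_0 mulr0 N2_ge0.
  apply: le_trans (square_P_A L0E i N cK Lg) _; rewrite /b mulrAC ler_pM2r//.
  by rewrite lerDl.
- apply: (min_le e0 b0 ddb).
    apply: (@le_trans _ _ (\sum_(k < N) 2 * CM M * N2 (r k))).
      by apply: ler_sum => k _; exact: N2_sub_P_le.
    by rewrite -mulr_sumr ler_pM2l ?mulr_gt0//.
  apply: (@le_trans _ _ (\sum_(k < N) N2 (fun x => A K k g x - P (k + i) (A K k g) x))).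
    apply: ler_sum => k _; case: (rE k) => ->; first exact: lexx.
    apply: le_trans (N2_sub_P_le L0E (k + i)%N M1 (L2_0 mu)) _.
    by rewrite N2_0 mulr0 N2_ge0.
  apply: le_trans (square_sub_P L0E i N cK Lg) _; rewrite /b mulrAC ler_pM2r//.
  by rewrite lerDl.
exists k0, W; split => //; apply: le_trans We _; rewrite lee_fin /e.
rewrite le_eqVlt; apply/orP; left; apply/eqP; field; rewrite !gt_eqF//.
Qed.

(** The pieces [A_k] of functions with no mean on the cells of scale [k + j]
    are small in [j], which makes their series summable over [j] later on. *)
Lemma bad_max M K j (G : nat -> V -> R) s t : czk M K -> (forall k, L2 (G k)) ->
  (forall N, \sum_(k < N) N2 (G k) <= s) -> 0 < t ->
  exists W, [/\ measurable W,
   (mu W <= (@Cmax R n * (2 * CM M ^+ 2 * 2 ^- (4 * j) * s) / t ^+ 2)%:E)%E &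
   forall x, ~ W x -> forall N,
     `|\sum_(k < N) A K k (fun y => G k y - E (k + j) (G k) y) x| <= t].
Proof.
move=> cK LG Gs t0; have M1 : 0 <= M by case: cK.
have CM1 : 1 <= CM M by exact: CM_ge1.
have CM0 : 0 < CM M by exact: lt_le_trans CM1.
have CMM : CM M <= CM M ^+ 2 by rewrite expr2 ler_peMl// ltW.
pose H k y := G k y - E (k + j) (G k) y; pose r k := A K k (H k).
have LH k : L2 (H k) by apply: L2B => //; exact: (L2_E L0E).
have Lr k : L2 (r k) by exact: (L2_A L0E _ cK).
have NG k : 0 <= N2 (G k) by exact: N2_ge0.
have r0 k : N2 (r k) <= CM M * 2 ^- (8 * j) * N2 (G k).
  by rewrite -kap2; exact: (A_sub_E L0E).
have H0 k : N2 (H k) <= 2 * CM M * N2 (G k) by exact: (N2_sub_E_le L0E).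
pose e := 2 * CM M ^+ 2 * 2 ^- (4 * j) * s.
have sum_e h i N (x : nat -> R) :
    (forall k, x k <= 2 * CM M ^+ 2 * 2 ^- (8 * i) * N2 (G (k + h)%N)) ->
    (forall k, x k <= 2 * CM M ^+ 2 * 2 ^- (8 * j) * N2 (G (k + h)%N)) ->
    \sum_(k < N) x k <= e * 2 ^- (2 * i).
  move=> x1 x2.
  have Gh : \sum_(k < N) N2 (G (k + h)%N) <= s.
    exact: le_trans (sum_shift_le N h (fun k => N2_ge0 mu (G k))) (Gs (h + N)%N).
  apply: (@le_trans _ _ (\sum_(k < N) 2 * CM M ^+ 2 * 2 ^- (4 * j) * 2 ^- (2 * i) * N2 (G (k + h)%N))).
    apply: ler_sum => k _.
    have aux q : (4 * j + 2 * i <= 8 * q)%N -> x k <= 2 * CM M ^+ 2 * 2 ^- (8 * q) * N2 (G (k + h)%N) ->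
        x k <= 2 * CM M ^+ 2 * 2 ^- (4 * j) * 2 ^- (2 * i) * N2 (G (k + h)%N).
      move=> hq /le_trans; apply; rewrite ler_wpM2r// -[leRHS]mulrA ler_wpM2l//.
        by rewrite mulr_ge0// sqr_ge0.
      by rewrite -invfM -exprD lef_pV2 ?posrE ?exprn_gt0// ler_weXn2l// ler1n.
    have [ij|ij] := leqP i j; [apply: (aux j)|apply: (aux i)] => //; lia.
  rewrite -mulr_sumr /e mulrAC ler_wpM2r ?(ltW (p2 _))// ler_wpM2l ?Gh//.
  by apply: mulr_ge0 (ltW (p2 _)); rewrite mulr_ge0// sqr_ge0.
have s0 : 0 <= s by have := Gs 0; rewrite big_ord0.
have C2 (y z : R) : 0 <= z -> y <= CM M * z -> y <= 2 * CM M ^+ 2 * z.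
  move=> z0 yz; apply: le_trans yz _; rewrite ler_wpM2r//.
  by have := sqr_ge0 (CM M); move: CMM; lra.
have le8 q : (2 : R) ^- (8 * q) <= 1 by rewrite invf_le1 ?exprn_gt0// exprn_ege1// ler1n.
have pG q k : 0 <= 2 ^- (8 * q) * N2 (G k) by rewrite mulr_ge0// ltW.
have rj k : N2 (r k) <= CM M * (2 ^- (8 * j) * N2 (G k)) by rewrite mulrA.
have [|i N|i N|W [mW We WP]] := @max_series R n n0 L0 L0E r e Lr _ _ _ t t0.
- move=> N; have := sum_e 0 0 N (fun k => N2 (r k)).
  rewrite !muln0 expr0 invr1 !mulr1; apply => k; rewrite addn0.
    apply: C2; first by [].
    apply: le_trans (rj k) _; rewrite ler_pM2l// -[leRHS]mul1r ler_wpM2r//.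
  by rewrite -mulrA; apply: C2; [exact: pG|exact: rj].
- apply: (sum_e i i N (fun k => N2 (P k (r (k + i)%N)))) => k.
    apply: le_trans (P_A_le L0E k i cK (LH (k + i)%N)) _; rewrite kap2.
    apply: le_trans (ler_wpM2l _ (H0 (k + i)%N)) _; first by rewrite mulr_ge0 ?(ltW CM0)// ltW.
    by rewrite le_eqVlt; apply/orP; left; apply/eqP; ring.
  apply: le_trans (N2_P_le L0E k M1 (Lr (k + i)%N)) _.
  apply: le_trans (ler_wpM2l (ltW CM0) (rj _)) _.
  have := mulr_ge0 (sqr_ge0 (CM M)) (pG j (k + i)%N).
  rewrite -[2 * CM M ^+ 2 * _ * _]mulrA; set z := 2 ^- _ * _ => z0.
  by rewrite mulrA -expr2 -[2 * _ * z]mulrA; lra.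
- apply: (sum_e 0 i N (fun k => N2 (fun x => r k x - P (k + i) (r k) x))) => k; rewrite addn0.
    apply: le_trans (sub_P_A_le L0E k i cK (LH k)) _; rewrite kap2.
    apply: le_trans (ler_wpM2l _ (H0 k)) _; first by rewrite mulr_ge0 ?(ltW CM0)// ltW.
    by rewrite le_eqVlt; apply/orP; left; apply/eqP; ring.
  apply: le_trans (N2_sub_P_le L0E (k + i)%N M1 (Lr k)) _.
  have c2 : 0 <= 2 * CM M by rewrite mulr_ge0// ltW.
  apply: le_trans (ler_wpM2l c2 (rj _)) _.
  by rewrite le_eqVlt; apply/orP; left; apply/eqP; ring.
by exists W.
Qed.

End tails.

(** * Averaging operators on integrable functions *)

Section L1_theory.
Context {d : measure_display} {T : measurableType d} {R : realType}.
Variable mu : {sigma_finite_measure set T -> \bar R}.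
Implicit Types (f g : T -> R).

Definition L1 f := measurable_fun setT f /\ (\int[mu]_x `|f x|%:E < +oo)%E.
Definition N1 f : R := fine (\int[mu]_x `|f x|%:E).

Lemma L1_int f : L1 f -> mu.-integrable setT (fun x => (f x)%:E).
Proof. by move=> [mf fo]; apply/integrableP; split; [exact/measurable_EFinP|]. Qed.

Lemma N1E f : L1 f -> (N1 f)%:E = (\int[mu]_x `|f x|%:E)%E.
Proof.
move=> [mf fo]; rewrite fineK// ge0_fin_numE//.
by apply: integral_ge0 => x _; rewrite lee_fin.
Qed.

Lemma N1_ge0 f : 0 <= N1 f.
Proof. by apply: fine_ge0; apply: integral_ge0 => x _; rewrite lee_fin. Qed.

Lemma L1_le f (g : T -> R) c : measurable_fun setT f -> measurable_fun setT g ->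
  (forall x, `|f x| <= g x) -> (\int[mu]_x (g x)%:E <= c%:E)%E -> L1 f /\ N1 f <= c.
Proof.
move=> mf mg fg gc.
have h : (\int[mu]_x `|f x|%:E <= c%:E)%E.
  by apply: le_trans gc; apply: nn_le => [||x]; [mfun|mfun|rewrite normr_ge0/=].
have Lf : L1 f by split => //; exact: le_lt_trans h (ltry _).
by split => //; rewrite -lee_fin N1E.
Qed.

Lemma L1_dom f g : measurable_fun setT f -> L1 g -> (forall x, `|f x| <= `|g x|) ->
  L1 f /\ N1 f <= N1 g.
Proof.
move=> mf Lg fg; have [mg _] := Lg.
by apply: (@L1_le f (fun x => `|g x|)) => //; [mfun|rewrite N1E].
Qed.

Lemma L1D f g : L1 f -> L1 g -> L1 (fun x => f x + g x) /\ N1 (fun x => f x + g x) <= N1 f + N1 g.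
Proof.
move=> Lf Lg; have [mf _] := Lf; have [mg _] := Lg.
apply: (@L1_le _ (fun x => `|f x| + `|g x|)) => [||x|]; [by mfun|by mfun|exact: ler_normD|].
rewrite nnD; [|by mfun|by mfun|by []|by []].
by rewrite -!N1E.
Qed.

Lemma N1Z c f : L1 f -> L1 (fun x => c * f x) /\ N1 (fun x => c * f x) <= `|c| * N1 f.
Proof.
move=> Lf; have [mf _] := Lf.
apply: (@L1_le _ (fun x => `|c| * `|f x|)) => [||x|]; [by mfun|by mfun|by rewrite normrM|].
by rewrite nnZ//; [rewrite -N1E// -EFinM|mfun].
Qed.

Lemma L1N f : L1 f -> L1 (fun x => - f x) /\ N1 (fun x => - f x) = N1 f.
Proof.
move=> [mf fo]; rewrite /L1 /N1; under eq_integral do rewrite normrN; do !split => //.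
rewrite (_ : (fun x => - f x) = (fun x => -1 * f x)); first by mfun.
by apply/funext => x; rewrite mulN1r.
Qed.

Lemma L1B f g : L1 f -> L1 g -> L1 (fun x => f x - g x) /\ N1 (fun x => f x - g x) <= N1 f + N1 g.
Proof. by move=> Lf Lg; have [LN <-] := L1N Lg; exact: L1D. Qed.

Lemma L1_0 : L1 (fun=> 0).
Proof.
split; first exact: measurable_cst.
rewrite (eq_integral (cst 0%E)) => [|x _]; last by rewrite normr0.
by rewrite integral0 ltry.
Qed.

Lemma L1_sum N (F : nat -> T -> R) : (forall i, L1 (F i)) ->
  L1 (fun x => \sum_(i < N) F i x).
Proof.
move=> LF; elim: N => [|N IH].
  by under eq_fun do rewrite big_ord0; exact: L1_0.
by under eq_fun do rewrite big_ord_recr /=; exact: (L1D IH (LF N)).1.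
Qed.

Lemma fine_integralD f g : mu.-integrable setT (fun x => (f x)%:E) ->
  mu.-integrable setT (fun x => (g x)%:E) ->
  fine (\int[mu]_x (f x + g x)%:E) = fine (\int[mu]_x (f x)%:E) + fine (\int[mu]_x (g x)%:E).
Proof.
move=> fi gi; under eq_integral do rewrite EFinD.
by rewrite integralD// fineD// integrable_fin_num.
Qed.

End L1_theory.

Section op_L1.
Context {R : realType} {n : nat}.
Local Notation V := 'rV[R]_n.
Local Notation mu := (@lebesgue_rV R n).
Local Notation L1 := (L1 mu).
Local Notation N1 := (N1 mu).
Implicit Types (x y : V) (F G : V -> R) (a : V -> V -> R) (C l : R).

Lemma lkern_le C l a x y : lkern C l a -> `|a x y| <= C * l ^- n.
Proof.
move=> [_ l0 C0 aP]; apply: le_trans (aP x y) _; rewrite ler_piMr//.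
  by rewrite mulr_ge0// invr_ge0 exprn_ge0// ltW.
by rewrite lern1 leq_b1.
Qed.

Lemma op_L1 C l a F x : lkern C l a -> L1 F -> L1 (fun y => a x y * F y).
Proof.
move=> ka LF; have [mF _] := LF; have [ma l0 C0 _] := ka; have max := mker1 x ma.
have c0 : 0 <= C * l ^- n by rewrite mulr_ge0// invr_ge0 exprn_ge0// ltW.
have [LZ _] := N1Z (C * l ^- n) LF.
apply: (L1_dom _ LZ _).1 => [|y]; first by mfun.
by rewrite normrM [leRHS]normrM (ger0_norm c0) ler_wpM2r//; exact: lkern_le ka.
Qed.

Lemma op_D1 C l a F G x : lkern C l a -> L1 F -> L1 G ->
  op a (fun y => F y + G y) x = op a F x + op a G x.
Proof.
move=> ka LF LG; rewrite /op; under eq_integral do rewrite mulrDr.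
by apply: fine_integralD; apply: L1_int; exact: op_L1 ka _.
Qed.

Lemma op_Z1 C l a (c : R) F x : lkern C l a -> L1 F ->
  op a (fun y => c * F y) x = c * op a F x.
Proof.
move=> ka LF; rewrite /op fine_integralZ; last by apply: L1_int; exact: op_L1 ka _.
by congr fine; apply: eq_integral => y _; rewrite mulrCA.
Qed.

Lemma op_sum1 C l a N (F : nat -> V -> R) x : lkern C l a -> (forall i, L1 (F i)) ->
  op a (fun y => \sum_(i < N) F i y) x = \sum_(i < N) op a (F i) x.
Proof.
move=> ka LF; elim: N => [|N IH].
  rewrite big_ord0 /op (eq_integral (cst 0%E)) ?integral0// => y _.
  by rewrite big_ord0 mulr0.
under eq_fun do rewrite big_ord_recr /=.
by rewrite (op_D1 x ka (L1_sum N LF) (LF N)) big_ord_recr /= IH.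
Qed.

Lemma abs_op_le a F x : measurable_fun setT (a x) -> measurable_fun setT F ->
  (`|op a F x|%:E <= \int[mu]_y (`|a x y| * `|F y|)%:E)%E.
Proof.
move=> ma mF; have := @le_abse_integral _ _ _ mu setT (fun y => (a x y * F y)%:E) measurableT.
have -> : (\int[mu]_y `|(a x y * F y)%:E| = \int[mu]_y (`|a x y| * `|F y|)%:E)%E.
  by apply: eq_integral => y _ /=; rewrite normrM.
move=> /(_ _)/le_trans h; rewrite /op; case E: (\int[mu]_y (a x y * F y)%:E)%E h => [r||] h /=.
- by apply: (h _ _ (lexx _)); mfun.
- by rewrite normr0; apply: integral_ge0 => y _; rewrite lee_fin mulr_ge0.
- by rewrite normr0; apply: integral_ge0 => y _; rewrite lee_fin mulr_ge0.
Qed.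

Lemma mker_swap a : mker a -> mker (fun x y => a y x).
Proof.
move=> ma; have mS : measurable_fun setT (fun p : V * V => (p.2, p.1)) by mfun.
exact: (measurableT_comp ma mS).
Qed.

Lemma op_norm1 C l a F : lkern C l a -> L1 F ->
  L1 (op a F) /\ N1 (op a F) <= C * 2 ^+ n * N1 F.
Proof.
move=> ka LF; have [mF _] := LF; have [ma l0 C0 aP] := ka.
have mop := measurable_op ma mF.
have ma' : measurable_fun setT (fun p : V * V => a p.1 p.2) := ma.
have mk : mker (fun x y => `|a x y| * `|F y|) by rewrite /mker; mfun.
have k0 x y : 0 <= `|a x y| * `|F y| by rewrite mulr_ge0.
have c0 : 0 <= C * l ^- n by rewrite mulr_ge0// invr_ge0 exprn_ge0// ltW.
have h : (\int[mu]_x `|op a F x|%:E <= (C * 2 ^+ n * N1 F)%:E)%E.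
  apply: (@le_trans _ _ (\int[mu]_x \int[mu]_y (`|a x y| * `|F y|)%:E)%E).
    apply: ge0_le_integral => //.
    - by mfun.
    - exact: measurable_inner.
    - by move=> x _; apply: abs_op_le => //; exact: mker1.
  rewrite tonelli// EFinM N1E// -nnZ//; [|by rewrite mulr_ge0|by mfun].
  apply: ge0_le_integral => //.
  - by move=> y _; apply: integral_ge0 => x _; rewrite lee_fin.
  - by apply: (measurable_inner (a := fun y x => `|a x y| * `|F y|)) => //; exact: (mker_swap mk).
  - by mfun.
  move=> y _; have may := mker2 y ma.
  rewrite (eq_integral (fun x => (`|F y| * `|a x y|)%:E)) => [|x _]; last by rewrite mulrC.
  rewrite nnZ//; last by mfun.
  rewrite [in leRHS]mulrC EFinM; apply: lee_wpmul2l; first by rewrite lee_fin.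
  apply: (@le_trans _ _ (\int[mu]_x (C * l ^- n * (`|x - y| <= l)%R%:R)%:E)%E).
    by apply: nn_le => [||x]; [by mfun|by mfun|rewrite normr_ge0/=].
  rewrite nnZ//; last by mfun.
  rewrite (int_near2 _ (ltW l0)) -EFinM lee_fin exprMn.
  by rewrite le_eqVlt; apply/orP; left; apply/eqP; field; rewrite expf_neq0// gt_eqF.
split; first by split => //; exact: le_lt_trans h (ltry _).
by rewrite -lee_fin N1E//; split => //; exact: le_lt_trans h (ltry _).
Qed.

(** Dominated convergence for eventually stationary sequences. *)
Lemma op_lim C l a (Fs : nat -> V -> R) F x : lkern C l a -> L1 F ->
  (forall N, measurable_fun setT (Fs N)) -> (forall N y, `|Fs N y| <= `|F y|) ->
  (forall y, exists N0, forall N, (N0 <= N)%N -> Fs N y = F y) ->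
  op a (Fs N) x @[N --> \oo] --> op a F x.
Proof.
move=> ka LF mFs FsF FsE; have [ma l0 C0 aP] := ka; have max := mker1 x ma.
have [mF _] := LF; have La := op_L1 x ka LF.
have ia : mu.-integrable setT (fun y => `|a x y * F y|%:E).
  have [mop fo] := La; apply/integrableP; split; first by mfun.
  by under eq_integral do rewrite /= normr_id.
have m1 N : measurable_fun setT (fun y => (a x y * Fs N y)%:E) by have := mFs N => ?; mfun.
have m2 : measurable_fun setT (fun y => (a x y * F y)%:E) by mfun.
have c1 : {ae mu, forall y, setT y -> (a x y * Fs N y)%:E @[N --> \oo] --> (a x y * F y)%:E}.
  apply: aeW => y _; have [N0 FE] := FsE y.
  apply: cvg_near_cst; near=> N; rewrite FE//; near: N; exact: nbhs_infty_ge.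
have d1 : {ae mu, forall y, forall N, setT y ->
    (`|(a x y * Fs N y)%:E| <= `|a x y * F y|%:E)%E}.
  by apply: aeW => y N _; rewrite lee_fin !normrM ler_wpM2l.
have [_ _ h] := dominated_convergence measurableT m1 m2 c1 ia d1.
rewrite /op; apply: (@fine_cvg _ _ _ _ (fun N => \int[mu]_y (a x y * Fs N y)%:E)%E).
rewrite fineK; first exact: h.
by apply: integrable_fin_num => //; exact: L1_int La.
Unshelve. all: by end_near. Qed.

End op_L1.

(** * The Calderon-Zygmund decomposition *)

Section geometric.
Context {R : realType}.

Lemma geo_le (q : R) N : 0 <= q < 1 -> \sum_(j < N) q ^+ j <= (1 - q)^-1.
Proof.
move=> /andP[q0 q1]; have q1' : 0 < 1 - q by rewrite subr_gt0.
have e : \sum_(j < N) q ^+ j = (1 - q ^+ N) / (1 - q).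
  elim: N => [|N IH]; first by rewrite big_ord0 expr0 subrr mul0r.
  by rewrite big_ord_recr /= IH exprS; field; rewrite gt_eqF.
by rewrite e ler_piMl ?invr_ge0 ?(ltW q1')// lerBlDr lerDl exprn_ge0.
Qed.

Lemma pow4 j : (2 : R) ^- (4 * j) = 2 ^- j * 2 ^- j * 2 ^- j * 2 ^- j.
Proof. by rewrite -!invfM -!exprD; congr (_ ^- _); lia. Qed.

Lemma lim_norm_le (u : nat -> R) (l c : R) : u @ \oo --> l -> (forall N, `|u N| <= c) ->
  `|l| <= c.
Proof.
move=> ul uc; apply: (@closed_cvg _ _ \oo _ (fun N => `|u N|) (fun y => y <= c)).
- exact: closed_le.
- by apply: nearW.
- exact: cvg_norm.
Qed.

(** Above the height [c] a power larger than 1 gains a power of the height. *)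
Lemma large_le (p y c : R) : 1 < p -> 0 < c -> 0 <= y -> c < y ->
  y <= y `^ p / c `^ (p - 1).
Proof.
move=> p1 c0 y0 cy; have yp : 0 < y by exact: lt_trans cy.
rewrite ler_pdivlMr ?powR_gt0//.
have -> : y `^ p = y * y `^ (p - 1).
  rewrite -{2}(powRr1 y0) -powRD ?subrKC//.
  by apply/implyP => _; rewrite gt_eqF.
rewrite ler_pM2l//; apply: ge0_ler_powR; rewrite ?nnegrE ?(ltW c0) ?(ltW cy)//.
by rewrite subr_ge0 ltW.
Qed.

End geometric.

Section calderon_zygmund.
Context {R : realType} {n : nat}.
Hypothesis n0 : (0 < n)%N.
Local Notation V := 'rV[R]_n.
Local Notation mu := (@lebesgue_rV R n).
Local Notation L2 := (L2 mu).
Local Notation N2 := (N2 mu).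
Local Notation L1 := (L1 mu).
Local Notation N1 := (N1 mu).
Implicit Types (x y : V) (t e : R) (i j k m N J : nat).
Variable L0 : nat.
Hypothesis L0E : L0%:R = 2 ^+ 8 :> R.
Local Notation A := (shell_op L0).
Local Notation E := (cell_op L0).
Local Notation sc := (sc L0).
Local Notation CM := (@CM R n L0).
Let B := (L0 ^ 3)%N.

Variables (p lam M : R) (f K : V -> R).
Hypotheses (p1 : 1 < p) (lam0 : 0 < lam) (cK : czk M K).
Hypotheses (Lf : L1 f) (Lfp : L1 (fun x => `|f x| `^ p)) (Mlam : N1 f <= lam).

Let h x := `|f x|.
Let mf : measurable_fun setT f. Proof. by case: Lf. Qed.
Let mh : measurable_fun setT h. Proof. by rewrite /h; mfun. Qed.
Let h0 x : 0 <= h x. Proof. exact: normr_ge0. Qed.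
Let hM : (\int[mu]_x (h x)%:E <= (N1 f)%:E)%E. Proof. by rewrite N1E. Qed.
Let Mt : N1 f <= lam * 1 ^+ n. Proof. by rewrite expr1n mulr1. Qed.
Let B0 : (0 < B)%N.
Proof. by have := BR_gt0 L0E; rewrite ltr0n. Qed.
Let M0 : 0 <= M. Proof. by case: cK. Qed.

Local Notation om := (om B 1 lam h).
Local Notation em := (em B 1 h).
Let lenE m : len B 1 m = sc m :> R. Proof. by rewrite /len mul1r. Qed.
Let emE m : em m = E m h. Proof. by rewrite /em lenE. Qed.

(** The neighbourhood of the stopping cells, which is discarded. *)
Definition cz_set : set V := nbhd_om B 1 lam h.

Lemma measurable_cz_set : measurable cz_set.
Proof. exact: (measurable_nbhd_om lam B0 ltr01 mh). Qed.

Lemma mu_cz_set : (mu cz_set <= (4 ^+ n * N1 f / lam)%:E)%E.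
Proof. exact: (mu_nbhd_om B0 ltr01 lam0 mh h0 hM Mt). Qed.

Let mo m : measurable_fun setT (om m).
Proof. exact: (measurable_om lam B0 ltr01 mh m). Qed.

Let osame m x y : same (sc m) x y -> om m x = om m y.
Proof. by rewrite -lenE; exact: (om_same lam h B0 ltr01). Qed.

Let ka k : lkern (M * B%:R ^+ n) (sc k) (sk K (sc k / B%:R) (sc k)).
Proof. exact: (lkern_A L0E k cK). Qed.
Let ke k : lkern 1 (sc k) (qk (sc k) : V -> V -> R).
Proof. exact: lkern_qk (sc_gt0 L0E k). Qed.

(** [Gm m] is the part of [f] on the cells of scale [m] where the average of
    [|f|] first exceeds [lam]; the cell averages are removed from it in [Bm m]. *)
Let Gm m x := (om m x)%:R * f x.
Let Bm m x := Gm m x - E m (Gm m) x.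

Let LG m : L1 (Gm m).
Proof.
have := mo m => mom; apply: (L1_dom _ Lf _).1 => [|x]; first by rewrite /Gm; mfun.
by rewrite /Gm normrM ler_piMl// ger0_norm ?ler0n// lern1 leq_b1.
Qed.

Let LE m F : L1 F -> L1 (E m F).
Proof. by move=> LF; exact: (op_norm1 (ke m) LF).1. Qed.

Let LB m : L1 (Bm m). Proof. exact: (L1B (LG m) (LE m (LG m))).1. Qed.

Let EGm m x : `|E m (Gm m) x| <= (om m x)%:R * em m x.
Proof.
have [LGm _] := LG m; have [mk _ _ _] := ke m.
rewrite -lee_fin; apply: le_trans (abs_op_le (mker1 x mk) LGm) _.
rewrite EFinM; have := em_fin B0 ltr01 mh h0 hM m x; rewrite lenE => -[<- _].
have q0 y : 0 <= qk (sc m) x y :> R.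
  by rewrite /qk mulr_ge0// invr_ge0 exprn_ge0// ltW// (sc_gt0 L0E).
have mkx := mker1 x mk.
rewrite -nnZ//; [|by mfun|by move=> y; rewrite mulr_ge0].
have := mo m => mom.
apply: nn_le => [||y]; [by mfun|by mfun|].
rewrite mulr_ge0//= ger0_norm// /Gm normrM (ger0_norm (ler0n _ _)) mulrCA /qk -/(h y).
case: (boolP (same _ x y)) => [/osame->//|_]; by rewrite mulr0 !mul0r !mulr0.
Qed.

Let Bm0 m x : ~~ om m x -> Bm m x = 0.
Proof.
move=> /negbTE o; have := EGm m x; rewrite /Bm /Gm o !mul0r sub0r normr_le0 => /eqP ->.
by rewrite oppr0.
Qed.

Let int_om_em m : (\int[mu]_x ((om m x)%:R * em m x)%:E = \int[mu]_x ((om m x)%:R * h x)%:E)%E.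
Proof.
rewrite -(int_em B0 ltr01 (mo m) (fun x y => @om_same _ _ _ _ lam h B0 ltr01 m x y) mh h0).
apply: eq_integral => x _; have [mk _ _ _] := ke m; have mkx := mker1 x mk.
rewrite EFinM; have := em_fin B0 ltr01 mh h0 hM m x => -[<- _]; rewrite lenE.
rewrite -nnZ//; last first.
- by move=> y; rewrite mulr_ge0// /qk mulr_ge0// invr_ge0 exprn_ge0// ltW// (sc_gt0 L0E).
- by mfun.
by apply: eq_integral => y _; congr EFin; ring.
Qed.

Let bN N x := \sum_(m < N) Bm m x.

Let b_ex x : exists i, forall N, (i <= N)%N -> bN N x = bN i x.
Proof.
have [[m om1]|no] := pselect (exists m, om m x).
  exists m.+1 => N mN; rewrite /bN -(subnKC mN) big_split_ord /= [X in _ + X]big1 ?addr0// => i _.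
  apply: Bm0; apply/negP => oi; have := om_disj om1 oi => mE.
  by have := leq_addr i m.+1; rewrite -mE ltnn.
exists 0%N => N _; rewrite /bN big_ord0 big1// => m _.
by apply: Bm0; apply/negP => o; apply: no; exists m.
Qed.

(* The sum of the bad parts is stationary at each point, because the sets [om m] are
   disjoint. *)
Let ix x : nat := proj1_sig (cid (b_ex x)).
Let b x := bN (ix x) x.

Let bE x N : (ix x <= N)%N -> bN N x = b x.
Proof. exact: (proj2_sig (cid (b_ex x))). Qed.

Let bN_cases N x : bN N x = 0 \/ exists2 m, om m x & bN N x = Bm m x /\ (m < N)%N.
Proof.
have [[m oM]|no] := pselect (exists m : 'I_N, om m x).
  right; exists m => //; rewrite /bN (bigD1 m)//= big1 ?addr0// => i im.
  apply: Bm0; apply/negP => oi; case/eqP: im; apply/val_inj.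
  exact: om_disj oi oM.
left; rewrite /bN big1// => m _; apply: Bm0; apply/negP => o; apply: no; by exists m.
Qed.

Let bB m x : om m x -> b x = Bm m x.
Proof.
move=> o; rewrite -(bE (leq_maxl (ix x) m.+1)); set N := maxn _ _.
have mN : (m < N)%N by rewrite /N leq_max ltnSn orbT.
rewrite /bN (bigD1 (Ordinal mN))//= big1 ?addr0// => i im.
apply: Bm0; apply/negP => oi; case/eqP: im; apply/val_inj.
exact: om_disj oi o.
Qed.

Let b0 x : (forall m, ~~ om m x) -> b x = 0.
Proof. by move=> no; rewrite /b /bN big1// => m _; exact: Bm0. Qed.

Let bN_b N x : `|bN N x| <= `|b x|.
Proof.
case: (bN_cases N x) => [->|[m o [-> _]]]; first by rewrite normr0.
by rewrite (bB o).
Qed.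

Let mbN N : measurable_fun setT (bN N).
Proof. by apply: measurable_sum => m; case: (LB m). Qed.

Let mb : measurable_fun setT b.
Proof.
apply: (@measurable_fun_cvg _ _ R setT bN b) => // x _.
apply: cvg_near_cst; near=> N; apply: bE; near: N; exact: nbhs_infty_ge.
Unshelve. all: by end_near. Qed.

Let N1B m : ((N1 (Bm m))%:E <= 2%:E * \int[mu]_x ((om m x)%:R * h x)%:E)%E.
Proof.
have me : measurable_fun setT (em m) by rewrite emE; case: (LE m Lf) => _ _; apply: measurable_op => //; case: (ke m).
have em0 x : 0 <= em m x by case: (em_fin B0 ltr01 mh h0 hM m x).
have := mo m => mom; have [mB _] := LB m.
rewrite N1E//; apply: (@le_trans _ _ (\int[mu]_x ((om m x)%:R * h x + (om m x)%:R * em m x)%:E)%E).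
  apply: nn_le => [||x]; [by mfun|by mfun|]; rewrite normr_ge0/=.
  apply: le_trans (ler_normB _ _) _; apply: lerD (EGm m x).
  by rewrite /Gm normrM ger0_norm.
rewrite nnD; [|by mfun|by mfun|by move=> x; rewrite mulr_ge0|by move=> x; rewrite mulr_ge0].
by rewrite int_om_em -mule2n muleC -mule_natr.
Qed.

Let Lb : L1 b.
Proof.
split; first exact: mb.
apply: (@le_lt_trans _ _ (2%:E * (N1 f)%:E)%E); last by rewrite -EFinM ltry.
have mB m : measurable_fun setT (fun x => `|Bm m x|%:E) by have [mB _] := LB m; mfun.
apply: (@le_trans _ _ (\int[mu]_x \sum_(m <oo) `|Bm m x|%:E)%E).
  apply: ge0_le_integral => //.
  - by have := mb => ?; mfun.
  - by apply: ge0_emeasurable_sum => // m x _ _; rewrite lee_fin.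
  - move=> x _; apply: (@le_trans _ _ (\sum_(0 <= m < ix x) `|Bm m x|%:E)%E).
      by rewrite big_mkord sumEFin lee_fin; exact: ler_norm_sum.
    by apply: nneseries_lim_ge => m _ _; rewrite lee_fin.
rewrite integral_nneseries//; apply: nneseries_le_bound => [m|N].
  by apply: integral_ge0 => x _; rewrite lee_fin.
apply: (@le_trans _ _ (\sum_(m < N) 2%:E * \int[mu]_x ((om m x)%:R * h x)%:E)%E).
  by apply: lee_sum => m _; rewrite -N1E; [exact: N1B|exact: LB].
rewrite -ge0_sume_distrr; last first.
  by move=> m _; apply: integral_ge0 => x _; rewrite lee_fin mulr_ge0.
apply: lee_wpmul2l; first by rewrite lee_fin.
by rewrite N1E//; exact: om_sum.
Qed.

Let g x := f x - b x.

Let Lg : L1 g. Proof. exact: (L1B Lf Lb).1. Qed.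

Lemma sc_small e : 0 < e -> exists m, sc m < e :> R.
Proof.
move=> e0; pose m := Num.bound e^-1; exists m.
apply: le_lt_trans (sc_le_kap L0E m) _.
have h1 : e^-1 < m%:R by rewrite archi_boundP// invr_ge0 ltW.
have m0 : 0 < m%:R :> R by apply: lt_trans h1; rewrite invr_gt0.
apply: (@le_lt_trans _ _ m%:R^-1); last by rewrite -[ltRHS]invrK ltf_pV2 ?posrE ?invr_gt0.
rewrite kap2 lef_pV2 ?posrE ?exprn_gt0// -natrX ler_nat.
by apply: leq_trans (ltnW (ltn_expl m (ltnSn 1))) _; rewrite leq_exp2l// leq_pmull.
Qed.

(** At a Lebesgue point the function is the limit of its cell averages. *)
Lemma no_om_le x : leb h x -> (forall m, ~~ om m x) -> h x <= lam.
Proof.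
move=> lh no; apply/ler_addgt0Pr => e e0; have [d d0 hd] := lh e e0.
have [m md] := sc_small d0; have s0 := sc_gt0 L0E m : 0 < sc m :> R.
have hr := hd _ s0 md; have [mk _ _ _] := ke m; have mkx := mker1 x mk.
have c0 : 0 <= (sc m : R) ^- n by rewrite invr_ge0 exprn_ge0// ltW.
have q0 y : 0 <= qk (sc m) x y :> R by rewrite /qk mulr_ge0.
have := int_qk x s0 => qx.
rewrite -lee_fin; have -> : (h x)%:E = (\int[mu]_y (h x * qk (sc m) x y)%:E)%E.
  by rewrite nnZ// qx mule1.
apply: (@le_trans _ _ (\int[mu]_y (qk (sc m) x y * h y + qk (sc m) x y * `|h y - h x|)%:E)%E).
  apply: nn_le => [||y]; [by mfun|by mfun|].
  rewrite mulr_ge0//= mulrC -mulrDr ler_wpM2l// -lerBlDl.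
  by rewrite distrC ler_norm.
rewrite nnD; [|by mfun|by mfun|by move=> y; rewrite mulr_ge0|by move=> y; rewrite mulr_ge0].
rewrite EFinD; apply: leeD.
  have := em_fin B0 ltr01 mh h0 hM m x; rewrite lenE => -[-> _]; rewrite lee_fin.
  exact: em_le.
apply: (@le_trans _ _ (\int[mu]_y ((sc m) ^- n * ((`|x - y| <= sc m)%R%:R * `|h y - h x|))%:E)%E).
  apply: nn_le => [||y]; [by mfun|by mfun|].
  rewrite mulr_ge0//= mulrA ler_wpM2r// /qk ler_wpM2l//.
  by case: (boolP (same _ x y)) => [/(same_norm s0)->|].
rewrite nnZ//; last by mfun.
have c0' : (0 <= ((sc m : R) ^- n)%:E)%E by rewrite lee_fin.
apply: le_trans (lee_wpmul2l c0' hr) _; rewrite -EFinM lee_fin mulrCA mulVf ?mulr1//.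
by rewrite expf_neq0// gt_eqF.
Qed.

Let Lg2 : L2 g.
Proof.
have [mg _] := Lg; pose c := B%:R ^+ n * lam.
have c0 : 0 <= c by rewrite mulr_ge0 ?exprn_ge0// ltW.
have lc : lam <= c by rewrite ler_peMl ?(ltW lam0)// exprn_ege1// ler1n.
have lh : ae_leb h.
  apply: (locint_leb n0); split; first exact: mh.
  move=> r; apply: le_lt_trans (ltry (N1 f)); apply: le_trans hM.
  apply: nn_le => [||x]; [by mfun|by mfun|]; rewrite mulr_ge0//=.
  by rewrite (ger0_norm (h0 x)) ler_piMl// lern1 leq_b1.
have gc : {ae mu, forall x, `|g x| <= c}.
  apply: filterS lh => x lx; have [[m o]|no] := pselect (exists m, om m x).
    rewrite /g (bB o) /Bm /Gm o mul1r subKr; apply: le_trans (EGm m x) _; rewrite o mul1r.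
    by have := om_bounds B0 ltr01 mh h0 hM Mt o => /andP[_].
  have no' m : ~~ om m x by apply/negP => o; apply: no; exists m.
  by rewrite /g (b0 no') subr0; apply: le_trans lc; exact: no_om_le.
apply: (L2_le (c := c * N1 g) _ _).1; first exact: mg.
rewrite EFinM N1E// -nnZ//; last by mfun.
apply: ae_ge0_le_integral => //.
- by move=> x _; rewrite lee_fin sqr_ge0.
- by mfun.
- by move=> x _; rewrite lee_fin mulr_ge0.
- by mfun.
apply: filterS gc => x gx _; rewrite lee_fin -real_normK ?num_real// expr2.
by rewrite ler_wpM2r.
Qed.

Let F x := h x + h x `^ p.

Let mhp : measurable_fun setT (fun x => h x `^ p). Proof. by case: Lfp. Qed.
Let hp0 x : 0 <= h x `^ p. Proof. exact: powR_ge0. Qed.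
Let F0 x : 0 <= F x. Proof. by rewrite addr_ge0. Qed.
Let mF : measurable_fun setT F. Proof. by have := mhp => ?; have := mh => ?; rewrite /F; mfun. Qed.

Let LF : L1 F.
Proof.
apply: (L1D _ Lfp).1; apply: (L1_dom mh Lf _).1 => x; by rewrite /h normr_id.
Qed.

Let u m : R := fine (\int[mu]_x ((om m x)%:R * F x)%:E).

Let uE m : (\int[mu]_x ((om m x)%:R * F x)%:E)%E = (u m)%:E.
Proof.
have mom := mo m; have := mF => mF'.
have [Lo _] : L1 (fun x => (om m x)%:R * F x) /\ N1 (fun x => (om m x)%:R * F x) <= N1 F.
  apply: L1_dom LF _ => [|x]; first by mfun.
  by rewrite normrM ler_piMl// ger0_norm// lern1 leq_b1.
by rewrite /u fineK//; apply: integrable_fin_num => //; exact: L1_int Lo.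
Qed.

Let u0 m : 0 <= u m.
Proof. by apply: fine_ge0; apply: integral_ge0 => x _; rewrite lee_fin mulr_ge0. Qed.

Let u_sum N : \sum_(m < N) u m <= N1 F.
Proof.
rewrite -lee_fin -sumEFin N1E; last exact: LF.
under eq_bigr do rewrite -uE.
apply: le_trans (om_sum lam B0 ltr01 mh N mF F0) _.
by rewrite le_eqVlt; apply/orP; left; apply/eqP; apply: eq_integral => x _; rewrite ger0_norm.
Qed.

Let q : R := (2 `^ (p - 1))^-1.
Let c1 : R := M * B%:R ^+ n * 2 ^+ n * (1 + 1 * 2 ^+ n).
Let c2 : R := c1 * (lam `^ (p - 1))^-1 * (1 - q)^-1.
Let c3 : R := 2 * (@Cmax R n * (2 * CM M ^+ 2) * lam).

Section cutoff.
Variables (k0 : nat) (dd : R).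
Hypothesis u_tail : forall N, \sum_(m < N) (k0 <= m)%N%:R * u m <= dd.

Let ck k : R := (k0 <= k)%N%:R.
Let lv j : R := 2 ^+ j * lam.
Let Gs k j x := ck k * ((om (k + j) x)%:R * ((`|f x| <= lv j)%R%:R * f x)).
Let Gl k j x := ck k * ((om (k + j) x)%:R * ((lv j < `|f x|)%R%:R * f x)).

Let lv0 j : 0 < lv j. Proof. by rewrite mulr_gt0// exprn_gt0. Qed.

Let ck01 k : ck k = 0 \/ ck k = 1 /\ forall j, (k0 <= k + j)%N.
Proof.
by rewrite /ck; case: leqP => h1; [right|left] => //; split=> // j; exact: leq_trans h1 (leq_addr _ _).
Qed.

Let mGs k j : measurable_fun setT (Gs k j).
Proof. by have := mo (k + j) => ?; have := mf => ?; rewrite /Gs; mfun. Qed.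

Let mGl k j : measurable_fun setT (Gl k j).
Proof. by have := mo (k + j) => ?; have := mf => ?; rewrite /Gl; mfun. Qed.

Let int_ck k j (c : R) : 0 <= c ->
  (\int[mu]_x (c * (ck k * ((om (k + j) x)%:R * F x)))%:E <=
   (c * ((k0 <= k + j)%N%:R * u (k + j)%N))%:E)%E.
Proof.
move=> c0; have mom := mo (k + j); have := mF => mF'.
have ck0 : 0 <= ck k by rewrite /ck.
rewrite nnZ//; [|by mfun|by move=> x; rewrite mulr_ge0// mulr_ge0].
rewrite EFinM; apply: lee_wpmul2l; first by rewrite lee_fin.
rewrite nnZ//; [|by mfun|by move=> x; rewrite mulr_ge0].
rewrite uE -EFinM lee_fin; case: (ck01 k) => [->|[-> ->//]].
by rewrite mul0r mulr_ge0.
Qed.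

Let LGs k j : L2 (Gs k j) /\ N2 (Gs k j) <= lv j * ((k0 <= k + j)%N%:R * u (k + j)%N).
Proof.
apply: L2_le; first exact: mGs.
apply: le_trans (int_ck k j (ltW (lv0 j))); have mG := mGs k j.
have mom := mo (k + j); have := mF => mF'.
apply: nn_le => [||x]; [by mfun|by rewrite /ck; mfun|].
rewrite sqr_ge0/= /Gs; case: (ck01 k) => [->|[-> _]]; first by rewrite !mul0r expr0n/= mulr0.
rewrite !mul1r; case: (om _ x); last by rewrite !mul0r expr0n/= mulr0.
rewrite !mul1r; have lx := lv0 j; case: (boolP (`|f x| <= lv j)) => fx; last first.
  by rewrite mul0r expr0n/= mulr_ge0// ltW.
rewrite mul1r -real_normK ?num_real// expr2 ler_pM// /F lerDl//.
Qed.

Let LGl k j : L1 (Gl k j) /\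
  N1 (Gl k j) <= (lv j `^ (p - 1))^-1 * ((k0 <= k + j)%N%:R * u (k + j)%N).
Proof.
have c0 : 0 <= (lv j `^ (p - 1))^-1 by rewrite invr_ge0 powR_ge0.
have mom := mo (k + j); have := mF => mF'.
apply: (L1_le (mGl k j) _ _ (int_ck k j c0)) => [|x]; first by rewrite /ck; mfun.
rewrite /Gl; case: (ck01 k) => [->|[-> _]]; first by rewrite !mul0r normr0 mulr0.
rewrite !mul1r; case: (om _ x); last by rewrite !mul0r normr0 mulr0.
rewrite !mul1r; case: (boolP (lv j < `|f x|)) => fx; last by rewrite mul0r normr0 mulr_ge0.
rewrite mul1r mulrC; apply: le_trans (large_le p1 (lv0 j) (normr_ge0 _) fx) _.
by rewrite ler_wpM2r// /F lerDr.
Qed.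

Let q01 : 0 <= q < 1.
Proof.
have h1 : 1 < 2 `^ (p - 1) :> R.
  have p10 : 0 < p - 1 by rewrite subr_gt0.
  have := gt0_ltr_powR p10 (_ : 1 \in Num.nneg) (_ : 2 \in Num.nneg) (ltr1n R 2).
  by rewrite powR1 !nnegrE; apply.
by rewrite /q invr_ge0 powR_ge0/= invf_lt1// (lt_trans ltr01).
Qed.

Let lv_powR j : (lv j `^ (p - 1))^-1 = q ^+ j * (lam `^ (p - 1))^-1.
Proof.
rewrite /lv powRM ?exprn_ge0 ?(ltW lam0)// invfM; congr (_ * _).
by rewrite /q exprVn -powR_mulrn// powRAC powR_mulrn// powR_ge0.
Qed.

Let ll k j := A K k (fun y => Gl k j y - E (k + j) (Gl k j) y).

Let c1_ge0 : 0 <= c1.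
Proof. by rewrite /c1 !mulr_ge0// addr_ge0// mul1r. Qed.

Let Lll k j : L1 (ll k j) /\ N1 (ll k j) <= c1 * N1 (Gl k j).
Proof.
have [LG' _] := LGl k j; have [LEG hE] := op_norm1 (ke (k + j)) LG'.
have [LD hD] := L1B LG' LEG; have [LA hA] := op_norm1 (ka k) LD.
split => //; apply: le_trans hA _; rewrite /c1 -[leRHS]mulrA ler_wpM2l//.
  by rewrite !mulr_ge0.
by apply: le_trans hD _; rewrite mulrDl mul1r lerD2l.
Qed.

Let sum_tail N j : \sum_(k < N) (k0 <= k + j)%N%:R * u (k + j)%N <= dd.
Proof.
apply: le_trans (u_tail (j + N)%N).
exact: (@sum_shift_le R N j (fun m => (k0 <= m)%N%:R * u m) (fun m => mulr_ge0 (ler0n _ _) (u0 m))).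
Qed.

Let Y J x := \sum_(j < J) \sum_(k < J) `|ll k j x|.

Let dd0 : 0 <= dd. Proof. by have := u_tail 0; rewrite big_ord0. Qed.

Let mll k j : measurable_fun setT (ll k j). Proof. by case: (Lll k j) => -[]. Qed.

Let mY J : measurable_fun setT (Y J).
Proof.
by apply: measurable_sum => j; apply: measurable_sum => k; have := mll k j => ?; mfun.
Qed.

Let int_Y J : (\int[mu]_x (Y J x)%:E <= (c2 * dd)%:E)%E.
Proof.
have -> : (\int[mu]_x (Y J x)%:E = (\sum_(j < J) \sum_(k < J) N1 (ll k j))%:E)%E.
  rewrite /Y; under eq_integral do rewrite -sumEFin.
  rewrite ge0_integral_sum//; last 2 first.
  - move=> j; apply/measurable_EFinP; apply: measurable_sum => k.
    by have := mll k j => ?; mfun.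
  - by move=> j x _; rewrite lee_fin; apply: sumr_ge0.
  rewrite -sumEFin; apply: eq_bigr => j _.
  under eq_integral do rewrite -sumEFin.
  rewrite ge0_integral_sum//; last by move=> k; have := mll k j => ?; mfun.
  by rewrite -sumEFin; apply: eq_bigr => k _; rewrite N1E//; case: (Lll k j).
rewrite lee_fin; apply: (@le_trans _ _ (\sum_(j < J) c1 * (lam `^ (p - 1))^-1 * dd * q ^+ j)).
  apply: ler_sum => j _; apply: (@le_trans _ _ (\sum_(k < J) c1 *
      ((lv j `^ (p - 1))^-1 * ((k0 <= k + j)%N%:R * u (k + j)%N)))).
    apply: ler_sum => k _; apply: le_trans (Lll k j).2 _.
    by rewrite ler_wpM2l//; exact: (LGl k j).2.
  rewrite -mulr_sumr -mulr_sumr lv_powR.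
  rewrite (_ : c1 * _ * dd * _ = c1 * (q ^+ j * (lam `^ (p - 1))^-1 * dd)); last first.
    by move: c1 => z; ring.
  apply: ler_wpM2l c1_ge0 _ _ _; apply: ler_wpM2l; last exact: sum_tail.
  by rewrite mulr_ge0 ?invr_ge0 ?powR_ge0// exprn_ge0//; case/andP: q01.
rewrite -mulr_sumr /c2 [leRHS]mulrAC ler_wpM2l ?geo_le//.
by rewrite !mulr_ge0// invr_ge0 powR_ge0.
Qed.

Let cB k j x : ck k * A K k (Bm (k + j)) x =
  A K k (fun y => Gs k j y - E (k + j) (Gs k j) y) x + ll k j x.
Proof.
have Ls : L1 (Gs k j).
  apply: (L1_dom (mGs k j) Lf _).1 => y; rewrite /Gs !normrM.
  have n01 (c : nat) : (c <= 1)%N -> `|c%:R| <= 1 :> R by move=> c1'; rewrite ger0_norm// lern1.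
  rewrite !mulrA ler_piMl// !mulr_ile1 ?mulr_ge0 ?normr_ge0// ?n01 ?leq_b1//.
have [Ll _] := LGl k j.
have LEs := LE (k + j) Ls; have LEl := LE (k + j) Ll.
rewrite /ll -(op_D1 x (ka k) (L1B Ls LEs).1 (L1B Ll LEl).1).
rewrite -(op_Z1 (ck k) x (ka k) (LB (k + j))).
congr (op _ _ x); apply/funext => y; rewrite addrACA -opprD.
rewrite -(op_D1 y (ke (k + j)) Ls Ll) /Bm mulrBr.
rewrite -(op_Z1 (ck k) y (ke (k + j)) (LG (k + j))).
have -> : (fun z => Gs k j z + Gl k j z) = (fun z => ck k * Gm (k + j) z).
  apply/funext => z; rewrite /Gs /Gl /Gm -!mulrDr -mulrDl.
  by case: (leP `|f z| (lv j)) => _; rewrite ?addr0 ?add0r mul1r.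
congr (_ - _); rewrite /Gs /Gl /Gm -!mulrDr -mulrDl.
by case: (leP `|f y| (lv j)) => _; rewrite ?addr0 ?add0r mul1r.
Qed.

Let A_far k m x : ~ cz_set x -> (m <= k)%N -> A K k (Bm m) x = 0.
Proof.
move=> nx mk; rewrite /shell_op /op (eq_integral (cst 0%E)) ?integral0// => y _.
rewrite /sk; case: (boolP (_ < _ <= _)) => [/andP[_ h1]|_]; last by rewrite mulr0 mul0r.
rewrite Bm0 ?mulr0//; apply: (off_nbhd B0 ltr01 mh nx _ mk).
by rewrite lenE; apply: le_trans h1; exact: norm_le_enorm.
Qed.

Let cvg_sum_ord N (v : nat -> nat -> R) (l : nat -> R) :
  (forall k, v k J @[J --> \oo] --> l k) ->
  \sum_(k < N) v k J @[J --> \oo] --> \sum_(k < N) l k.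
Proof.
move=> vl; elim: N => [|N IH].
  by under eq_fun do rewrite big_ord0; rewrite big_ord0; exact: cvg_cst.
under eq_fun do rewrite big_ord_recr /=; rewrite big_ord_recr /=.
exact: cvgD.
Qed.

(** Each bad piece is split at height [2 ^ j lam] according to its distance [j] to the
    shell piece: below, the gain in [j] pays for the height and the maximal
    inequality applies; above, the sum of the masses converges because [p > 1]. *)
Lemma bad_tail_cutoff t : 0 < t -> exists W, [/\ measurable W,
  (mu W <= ((c3 / t ^+ 2 + c2 / t) * dd)%:E)%E &
  forall x, ~ W x -> ~ cz_set x -> forall N,
    `|\sum_(k < N) ck k * A K k b x| <= 3 * t].
Proof.
move=> t0; have t2 : 0 < t ^+ 2 by rewrite exprn_gt0.
pose rs k j := A K k (fun y => Gs k j y - E (k + j) (Gs k j) y).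
have p2 j : 0 < (2 : R) ^- j by rewrite invr_gt0 exprn_gt0.
have Cm0 : 0 < @Cmax R n by rewrite /Cmax addr_gt0// mulr_gt0// !exprn_gt0.
have HW j : exists W, [/\ measurable W, (mu W <= (c3 / 2 / t ^+ 2 * dd * 2 ^- j)%:E)%E &
    forall x, ~ W x -> forall N, `|\sum_(k < N) rs k j x| <= t * 2 ^- j].
  have tj : 0 < t * 2 ^- j by rewrite mulr_gt0.
  have sG N : \sum_(k < N) N2 (Gs k j) <= lv j * dd.
    apply: (@le_trans _ _ (\sum_(k < N) lv j * ((k0 <= k + j)%N%:R * u (k + j)%N))).
      by apply: ler_sum => k _; exact: (LGs k j).2.
    by rewrite -mulr_sumr ler_pM2l ?sum_tail//; exact: lv0.
  have [W [mW We WP]] := @bad_max R n n0 L0 L0E M K j (fun k => Gs k j) _ _ cK (fun k => (LGs k j).1) sG tj.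
  exists W; split => //; apply: le_trans We _; rewrite lee_fin /c3 /lv.
  have e2 : (2 : R) ^- (4 * j) = 2 ^- j * 2 ^- j * 2 ^- j * 2 ^- j.
    exact: pow4.
  rewrite e2 exprMn; set z := (2 : R) ^+ j.
  have z0 : z != 0 by rewrite expf_neq0.
  rewrite le_eqVlt; apply/orP; left; apply/eqP; field.
  by rewrite z0 gt_eqF.
have /choice[W WP] := HW.
pose D J := [set x | t < Y J x].
have mD J : measurable (D J).
  have mbb : measurable_fun setT (fun x => t < Y J x) by have := mY J => ?; mfun.
  rewrite (_ : D J = setT `&` (fun x => t < Y J x) @^-1` [set true]); first exact: mbb.
  by apply/seteqP; split => y //= [].
have mW : measurable (\bigcup_j W j) by apply: bigcup_measurable => j _; case: (WP j).
have Y0 J x : 0 <= Y J x by apply: sumr_ge0 => j _; apply: sumr_ge0.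
have YS J J' x : (J <= J')%N -> Y J x <= Y J' x.
  move=> JJ; rewrite /Y -(subnKC JJ) big_split_ord /= -[leLHS]addr0 lerD//; last first.
    by apply: sumr_ge0 => j _; apply: sumr_ge0.
  apply: ler_sum => j _; rewrite big_split_ord /= lerDl; exact: sumr_ge0.
exists (\bigcup_j W j `|` \bigcup_J D J); split.
- by apply: measurableU => //; exact: bigcup_measurable.
- apply: le_trans (measureU2 _ mW (bigcup_measurable (fun J _ => mD J))) _.
  rewrite mulrDl EFinD; apply: leeD.
    have mWj j : measurable (W j) by case: (WP j).
    apply: le_trans (generalized_Boole_inequality mu mWj mW) _.
    apply: nneseries_le_bound => // N.
    apply: (@le_trans _ _ (\sum_(j < N) (c3 / 2 / t ^+ 2 * dd * 2 ^- j)%:E)%E).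
      by apply: lee_sum => j _; case: (WP j).
    rewrite sumEFin lee_fin -mulr_sumr.
    have c30 : 0 <= c3 / 2 / t ^+ 2 * dd.
      have h3 : 0 <= c3.
        rewrite /c3; apply: mulr_ge0 => //; apply: mulr_ge0 (ltW lam0).
        by apply: mulr_ge0 (ltW Cm0) _; rewrite mulr_ge0// sqr_ge0.
      by apply: mulr_ge0 dd0; rewrite !divr_ge0// sqr_ge0.
    apply: le_trans (ler_wpM2l c30 (geo2_le N)) _.
    by rewrite le_eqVlt; apply/orP; left; apply/eqP; field; rewrite gt_eqF.
  apply: mu_bigcup_le => // [J J' JJ x DJ|J]; first exact: lt_le_trans DJ (YS _ _ _ JJ).
  rewrite -(@lee_pmul2l _ t%:E)// -EFinM (_ : t * (c2 / t * dd) = c2 * dd); last first.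
    by field; rewrite gt_eqF.
  apply: le_trans (int_Y J); apply: (@markov_ge _ _ _ mu (D J) t (fun x => (Y J x)%:E)) => //.
  - by have := mY J => ?; mfun.
  - by move=> x; rewrite lee_fin.
  - by move=> x /ltW.
move=> x /not_orP[nW nD] nx N.
have bound J : `|\sum_(k < N) \sum_(j < J) ck k * A K k (Bm (k + j)) x| <= 3 * t.
  under eq_bigr do under eq_bigr do rewrite cB.
  rewrite exchange_big /=; under eq_bigr do rewrite big_split /=.
  rewrite big_split /=; apply: le_trans (ler_normD _ _) _.
  rewrite (_ : 3 * t = t * 2 + t); last by ring.
  apply: lerD.
    apply: le_trans (ler_norm_sum _ _ _) _.
    apply: (@le_trans _ _ (\sum_(j < J) t * 2 ^- j)).
      apply: ler_sum => j _; have [_ _ WPj] := WP j; apply: WPj => Wx; apply: nW.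
      by exists j.
    by rewrite -mulr_sumr ler_pM2l// geo2_le.
  have YJ : Y (maxn J N) x <= t.
    by rewrite leNgt; apply/negP => DJ; apply: nD; exists (maxn J N).
  apply: le_trans YJ; apply: le_trans (ler_norm_sum _ _ _) _.
  rewrite /Y -(subnKC (leq_maxl J N)) [leRHS]big_split_ord /= -[leLHS]addr0 lerD//; last first.
    by apply: sumr_ge0 => j _; apply: sumr_ge0.
  apply: ler_sum => j _; apply: le_trans (ler_norm_sum _ _ _) _.
  rewrite subnKC ?leq_maxl// -(subnKC (leq_maxr J N)) [leRHS]big_split_ord /= lerDl.
  exact: sumr_ge0.
apply: lim_norm_le bound.
apply: (@cvg_sum_ord N (fun k J => \sum_(j < J) ck k * A K k (Bm (k + j)) x)
  (fun k => ck k * A K k b x)) => k.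
have -> : (fun J => \sum_(j < J) ck k * A K k (Bm (k + j)) x) =
    (fun J => ck k * A K k (bN (k + J)) x).
  apply/funext => J; rewrite -mulr_sumr; congr (_ * _).
  rewrite [RHS](op_sum1 _ x (ka k) LB) big_split_ord /= [X in _ = X + _]big1 ?add0r//.
  by move=> m _; apply: A_far => //; exact: ltnW.
apply: cvgM; first exact: cvg_cst.
apply: (@op_lim R n _ _ _ (fun J => bN (k + J)) b x (ka k) Lb) => [J|J y|y].
- exact: mbN.
- exact: bN_b.
- exists (ix y) => J iJ; apply: bE; exact: leq_trans iJ (leq_addl _ _).
Qed.

End cutoff.

(** Outside the exceptional set the partial sums oscillate little, except on a
    set as small as desired. *)
Lemma cz_oscillation t d : 0 < t -> 0 < d -> exists k0 W, [/\ measurable W, (mu W <= d%:E)%E &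
  forall x, ~ W x -> ~ cz_set x -> forall N N', (k0 <= N)%N -> (k0 <= N')%N ->
    `|\sum_(k < N) A K k f x - \sum_(k < N') A K k f x| <= t].
Proof.
move=> t0 d0; have t4 : 0 < t / 4 by rewrite divr_gt0.
have t12 : 0 < t / 12 by rewrite divr_gt0.
have d2 : 0 < d / 2 by rewrite divr_gt0.
have [k1 [W1 [mW1 W1d W1P]]] := good_tail n0 L0E cK Lg2 t4 d2.
pose c : R := c3 / (t / 12) ^+ 2 + c2 / (t / 12).
pose dd := d / 2 / (`|c| + 1).
have cn : 0 < `|c| + 1 by rewrite ltr_wpDl.
have dd0 : 0 < dd by rewrite divr_gt0.
have [k2 tl] := tail_small u0 u_sum dd0.
have [W2 [mW2 W2d W2P]] := bad_tail_cutoff tl t12.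
exists (maxn k1 k2), (W1 `|` W2); split; first exact: measurableU.
  apply: le_trans (measureU2 _ mW1 mW2) _; rewrite [d]splitr EFinD; apply: leeD => //.
  apply: le_trans W2d _; rewrite lee_fin /dd mulrCA ger_pMr// ler_pdivrMr// mul1r.
  by rewrite -/c (le_trans (ler_norm c))// lerDl.
move=> x /not_orP[nW1 nW2] nx N N' kN kN'.
have AE k : A K k f x = A K k g x + A K k b x.
  rewrite -(op_D1 x (ka k) Lg Lb); congr (op _ _ x); apply/funext => y.
  by rewrite /g subrK.
have cut (a : nat -> R) k0 m : (k0 <= m)%N ->
    \sum_(k < m) a k = \sum_(k < k0) a k + \sum_(k < m) (k0 <= k)%N%:R * a k.
  move=> km; rewrite -(subnKC km) !big_split_ord /= [X in _ = _ + (X + _)]big1 ?add0r; last first.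
    by move=> k _; rewrite leqNgt ltn_ord mul0r.
  by congr (_ + _); apply: eq_bigr => k _; rewrite leq_addr mul1r.
have osc (a : nat -> R) k0 e : (k0 <= maxn k1 k2)%N ->
    (forall m, `|\sum_(k < m) (k0 <= k)%N%:R * a k| <= e) ->
    `|\sum_(k < N) a k - \sum_(k < N') a k| <= e + e.
  move=> hk he; rewrite (cut a k0 N) ?(cut a k0 N') ?(leq_trans hk)//.
  rewrite opprD addrACA subrr add0r; apply: le_trans (ler_normB _ _) _.
  exact: lerD.
under eq_bigr do rewrite AE; under [X in _ - X]eq_bigr do rewrite AE.
rewrite !big_split /= opprD addrACA; apply: le_trans (ler_normD _ _) _.
have o1 := osc (fun k => A K k g x) _ _ (leq_maxl k1 k2) (W1P x nW1).
have o2 := osc (fun k => A K k b x) _ _ (leq_maxr k1 k2) (W2P x nW2 nx).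
by apply: le_trans (lerD o1 o2) _; lra.
Qed.

End calderon_zygmund.

Section lacunary.
Context {R : realType} {n : nat}.
Hypothesis n0 : (0 < n)%N.
Local Notation V := 'rV[R]_n.
Local Notation mu := (@lebesgue_rV R n).
Variable L0 : nat.
Hypothesis L0E : L0%:R = 2 ^+ 8 :> R.

Lemma cauchy_cvg (S : nat -> R) : (forall j, exists k0, forall N N', (k0 <= N)%N ->
  (k0 <= N')%N -> `|S N - S N'| <= j.+1%:R^-1) -> cvgn S.
Proof.
move=> H; apply/cauchy_cvgP/cauchy_exP => e e0.
pose j := Num.bound e^-1.
have je : j.+1%:R^-1 < e.
  rewrite -[ltRHS]invrK ltf_pV2 ?posrE ?invr_gt0//.
  by apply: lt_le_trans (archi_boundP _) _; rewrite ?invr_ge0 ?(ltW e0)// ler_nat.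
have [k0 k0P] := H j; exists (S k0); exists k0 => // N /= kN.
by rewrite -ball_normE /=; apply: le_lt_trans je; exact: k0P.
Qed.

(** The sequence is Cauchy off sets as small as desired: the exceptional set of the
    decomposition shrinks as its height grows, and the oscillation is small outside it. *)
Theorem lacunary_cvg (p M : R) (f K : V -> R) : 1 < p -> czk M K -> L1 mu f ->
  L1 mu (fun x => `|f x| `^ p) ->
  \forall x \ae mu, cvgn (fun N => \sum_(k < N) shell_op L0 K k f x).
Proof.
move=> p1 cK Lf Lfp.
pose S N x := \sum_(k < N) shell_op L0 K k f x.
pose D j := [set x | ~ exists k0, forall N N', (k0 <= N)%N ->
  (k0 <= N')%N -> `|S N x - S N' x| <= j.+1%:R^-1].
suff ND : mu.-negligible (\bigcup_j D j).
  apply: negligibleS ND => x /= nc; apply: contrapT => nD; apply: nc.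
  by apply: cauchy_cvg => j; apply: contrapT => nj; apply: nD; exists j.
apply: negligible_bigcup => j; apply: negligible_small => e e0.
pose c := 4 ^+ n * N1 mu f; have c0 : 0 <= c by rewrite mulr_ge0 ?N1_ge0// exprn_ge0.
pose lam := N1 mu f + c / e + 1.
have ce0 : 0 <= c / e by rewrite divr_ge0// ltW.
have lam0 : 0 < lam by rewrite ltr_wpDl// addr_ge0// N1_ge0.
have Ml : N1 mu f <= lam by rewrite /lam -addrA lerDl addr_ge0.
have cl : c / e <= lam by rewrite /lam addrAC lerDr addr_ge0// N1_ge0.
exists (cz_set L0 lam f); split.
- exact: (measurable_cz_set L0E lam Lf).
- apply: le_trans (mu_cz_set L0E lam0 Lf Ml) _; rewrite lee_fin -/c.
  by rewrite ler_pdivrMr// mulrC -ler_pdivrMr.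
exists (D j `\` cz_set L0 lam f); last first.
  by move=> x Dx; have [cx|ncx] := pselect (cz_set L0 lam f x); [right|left].
apply: negligible_small => d d0.
have j0 : 0 < j.+1%:R^-1 :> R by rewrite invr_gt0.
have [k0 [W [mW Wd WP]]] := cz_oscillation n0 L0E p1 lam0 cK Lf Lfp Ml j0 d0.
exists W; split => //; exists set0; first exact: negligible_set0.
move=> x [Dx ncx]; right; apply: contrapT => nW; apply: Dx; exists k0 => N N' kN kN'.
exact: WP.
Qed.

End lacunary.

(** * Rough homogeneous kernels *)

Section rough.
Context {R : realType} {n : nat}.
Hypothesis n0 : (0 < n)%N.
Local Notation V := 'rV[R]_n.
Local Notation mu := (@lebesgue_rV R n).
Local Notation sigma := (@sphere_measure R n).
Implicit Types (x y u : V) (f g O : V -> R) (r s t M : R) (m : nat).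

Lemma memLfun d (T : measurableType d) (nu : {measure set T -> \bar R}) (p : \bar R) (f : T -> R) :
  f \in Lfun nu p <-> measurable_fun setT f /\ ('N[nu]_p [EFin \o f] < +oo)%E.
Proof.
split=> [/andP[/set_mem h1 /set_mem h2]//|[h1 h2]].
by apply/andP; split; exact: mem_set.
Qed.

Lemma negligible_0 : mu.-negligible [set (0 : V)].
Proof.
have E : [set (0 : V)] = [set y | `|0 - y| <= 0 :> R].
  apply/seteqP; split => y /=; first by move=> ->; rewrite subr0 normr0.
  by rewrite sub0r normrN normr_le0 => /eqP.
apply/negligibleP; first by rewrite E; exact: measurable_normB_le.
have := lebesgue_normB_le (0 : V) (lexx (0 : R)); rewrite -E mulr0 expr0n.
by rewrite (_ : (n == 0)%N = false)//; case: n n0.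
Qed.

Let ball1 : set V := [set x | 0 < enorm x <= 1].
Let mball1 : measurable ball1. Proof. exact: measurable_punctured_ball. Qed.

Lemma enorm_normalize x : x != 0 -> enorm (normalize x) = 1 /\ normalize x != 0.
Proof.
move=> x0; have e0 : 0 < enorm x by rewrite enorm_gt0.
have E : enorm (normalize x) = 1.
  by rewrite /normalize enormZ ger0_norm ?invr_ge0 ?(ltW e0)// mulVf// gt_eqF.
by split => //; rewrite -enorm_gt0 E.
Qed.

Lemma homogeneous_normalize O x : homogeneous0 O -> x != 0 -> O (normalize x) = O x.
Proof. by move=> hO x0; apply: hO => //; rewrite invr_gt0 enorm_gt0. Qed.

Lemma measurable_unit_sphere : measurable (unit_sphere n : set V).
Proof.
rewrite (_ : unit_sphere n = setT `&` (@enorm R n) @^-1` [set 1]); last by rewrite setTI.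
by apply: measurable_enorm => //; exact: measurable_set1.
Qed.

Lemma ge0_integral_mrestr (E P : set V) (mP : measurable P) (g : V -> \bar R) :
  measurable E -> measurable_fun setT g -> (forall x, (0 <= g x)%E) ->
  (\int[mrestr mu mP]_(x in E) g x = \int[mu]_(x in E `&` P) g x)%E.
Proof.
move=> mE mg g0.
have m0 : mrestr mu mP (E `\` P) = 0%E by rewrite /mrestr setDE -setIA setICl setI0 measure0.
rewrite (ge0_negligible_integral (measurableD mE mP) mE _ _ m0)//; last first.
  exact: measurable_funTS.
have -> : E `\` (E `\` P) = E `&` P by rewrite setDD.
apply: eq_measure_integral => A mA AEP; change (mu (A `&` P) = mu A); by rewrite setIidl// => x /AEP[].
Qed.

Lemma ge0_integral_sphere (g : V -> \bar R) : measurable_fun setT g ->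
  (forall x, (0 <= g x)%E) -> (\int[sigma]_(x in unit_sphere n) g x =
    n%:R%:E * \int[mu]_(x in ball1) g (normalize x))%E.
Proof.
move=> mg g0; have mS := measurable_unit_sphere.
have mgS : measurable_fun (unit_sphere n) g by exact: measurable_funTS.
rewrite /sphere_measure ge0_integral_mscale//; congr (_ * _)%E.
rewrite ge0_integral_pushforward//; last exact: measurable_normalize.
rewrite ge0_integral_mrestr; last 3 first.
- by rewrite -[X in measurable X]setTI; exact: measurable_normalize.
- exact: measurableT_comp mg (@measurable_normalize R n).
- by move=> x; exact: g0.
congr (integral _ _ _); apply/seteqP; split => [x []//|x bx]; split => //.
have /enorm_normalize[] : x != 0 by rewrite -enorm_gt0; case/andP: bx.
by [].
Qed.

Lemma ae_sphere (Q : set V) : (\forall x \ae sigma, Q x) ->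
  \forall x \ae mu, ball1 x -> Q (normalize x).
Proof.
move=> [A [mA A0 QA]].
have mNA : measurable (@normalize R n @^-1` A).
  by rewrite -[X in measurable X]setTI; exact: measurable_normalize.
exists (@normalize R n @^-1` A `&` ball1); split; first exact: measurableI.
  have : (n%:R%:E * mu (@normalize R n @^-1` A `&` ball1) = 0)%E by exact: A0.
  move=> /eqP; rewrite mule_eq0 => /orP[|/eqP//].
  by rewrite eqe pnatr_eq0 -leqn0 leqNgt n0.
move=> x /= /not_implyP[bx nQ]; split => //; exact: QA.
Qed.

(** A cone that is null near the origin is null, by scaling. *)
Lemma null_cone (Z : set V) : (forall t x, 0 < t -> Z (t *: x) -> Z x) -> measurable Z ->
  mu.-negligible (Z `&` [set x | enorm x <= 1]) -> mu.-negligible Z.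
Proof.
move=> cZ mZ N1.
have mb m : measurable [set x : V | enorm x <= m%:R].
  have mbb : measurable_fun setT (fun x : V => enorm x <= m%:R) by mfun.
  rewrite (_ : [set x | _] = setT `&` (fun x : V => enorm x <= m%:R) @^-1` [set true]).
    exact: mbb.
  by apply/seteqP; split => y //= [].
have mZm m : measurable (Z `&` [set x : V | enorm x <= m%:R]) by exact: measurableI.
have {}N1 : mu (Z `&` [set x : V | enorm x <= 1%:R]) = 0%E.
  by apply/negligibleP => //; exact: mZm.
have Nm m : mu.-negligible (Z `&` [set x : V | enorm x <= m.+1%:R]).
  apply/negligibleP => //; apply/eqP; rewrite -measure_le0.
  pose ind k x : \bar R := (\1_(Z `&` [set x : V | enorm x <= k%:R]) x)%:E.
  have mind k : measurable_fun setT (ind k).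
    by apply/measurable_EFinP; exact: measurable_indic.
  have m0 : m.+1%:R != 0 :> R by rewrite pnatr_eq0.
  have h := @integral_affine R n (ind m.+1) m.+1%:R 0 m0 (mind _).
  have : (\int[mu]_x ind m.+1 (m.+1%:R *: x + 0)%R <= \int[mu]_x ind 1%N x)%E.
    apply: ge0_le_integral => //.
    - by move=> x _; rewrite lee_fin.
    - have mm : measurable_fun setT (fun x : V => m.+1%:R *: x + 0) by mfun.
      exact: (measurableT_comp (mind m.+1) mm).
    move=> x _; rewrite /ind lee_fin addr0.
    have [[-> [Zx ex]]|[-> _]] := indic_cases (Z `&` [set x : V | enorm x <= m.+1%:R]) (m.+1%:R *: x).
      have [[-> _]|[_ nZ]] := indic_cases (Z `&` [set x : V | enorm x <= 1%:R]) x; first by [].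
      exfalso; apply: nZ; split; first by apply: cZ Zx; rewrite ltr0n.
      by move: ex; rewrite /= enormZ ger0_norm// -[leRHS]mulr1 ler_pM2l ?ltr0n.
    by [].
  rewrite h /ind !integral_indic// ?setIT//.
  rewrite [X in (_ <= X)%E]N1.
  have c0 : 0 < `|m.+1%:R : R| ^- n by rewrite invr_gt0 exprn_gt0// normr_gt0.
  by rewrite pmule_rle0// lte_fin.
apply: (@negligibleS _ _ _ mu (\bigcup_m (Z `&` [set x : V | enorm x <= m.+1%:R]))).
  move=> x Zx; exists (Num.bound (enorm x)) => //; split => //=.
  by rewrite (le_trans (ltW (archi_boundP (enorm_ge0 x))))// ler_nat.
exact: negligible_bigcup.
Qed.

(** A bounded representative: [O] is cut off where it exceeds its essential
    bound, which happens only on a null cone. *)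
Lemma bounded_representative O : O \in Lfun sigma +oo%E -> homogeneous0 O ->
  exists O' M, [/\ [/\ measurable_fun setT O', 0 < M, forall x, `|O' x| <= M & homogeneous0 O'],
    measurable_fun setT O, O = O' %[ae mu] & O = O' %[ae sigma]].
Proof.
move=> /memLfun[mO fO] hO.
have [M M0 HM] : exists2 M, 0 < M & \forall x \ae sigma, `|O x| <= M.
  move: fO; rewrite unlock; case: ifPn => [s0|s0 _].
    set S := ess_sup _ _ => Soo.
    have S0 : (0 <= S)%E by apply: ess_sup_gee => //; apply: nearW => x; exact: abse_ge0.
    have SE : S = (fine S)%:E by rewrite fineK// ge0_fin_numE.
    exists (fine S + 1); first by rewrite ltr_wpDl// fine_ge0.
    have := ess_sup_ge sigma (abse \o (EFin \o O)); apply: filterS => x /=.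
    by rewrite -/S SE lee_fin => /le_trans; apply; rewrite lerDl.
  exists 1 => //; have sT : sigma [set: V] = 0%E.
    by apply/eqP; rewrite -measure_le0 leNgt.
  by exists setT; split.
pose O' x := (`|O x| <= M)%R%:R * ((0 < enorm x)%R%:R * O x).
have mO' : measurable_fun setT O' by rewrite /O'; mfun.
have O'M x : `|O' x| <= M.
  rewrite /O'; case: (boolP (`|O x| <= M)) => h; last by rewrite mul0r normr0 ltW.
  rewrite mul1r normrM; apply: le_trans h; rewrite ler_piMl// ger0_norm// lern1 leq_b1//.
have hO' : homogeneous0 O'.
  move=> t x t0 x0; rewrite /O' hO// enormZ (gtr0_norm t0).
  by rewrite pmulr_rgt0.
exists O', M; split => //.
- pose Z := [set x : V | (0 < enorm x) && (M < `|O x|)].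
  have mZ : measurable Z.
    have mbb : measurable_fun setT (fun x : V => (0 < enorm x) && (M < `|O x|)) by mfun.
    rewrite (_ : Z = setT `&` (fun x : V => (0 < enorm x) && (M < `|O x|)) @^-1` [set true]).
      exact: mbb.
    by apply/seteqP; split => y //= [].
  have NZ : mu.-negligible Z.
    apply: null_cone => //.
      move=> t x t0 /andP[]; rewrite enormZ gtr0_norm// pmulr_rgt0// => e0.
      by rewrite hO -?enorm_gt0// => h; apply/andP.
    have : \forall x \ae mu, ball1 x -> `|O (normalize x)| <= M.
      exact: (ae_sphere (Q := [set x | `|O x| <= M])).
    apply: negligibleS => x [/andP[e0 Ox] ex].
    have b1 : ball1 x by rewrite /ball1/= e0 ex.
    by move=> /(_ b1); rewrite homogeneous_normalize -?enorm_gt0// leNgt Ox.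
  have : mu.-negligible (Z `|` [set 0]) by apply: negligibleU => //; exact: negligible_0.
  apply: negligibleS => x /= nE; have [->|x0] := eqVneq x 0; first by right.
  left; have e0 : 0 < enorm x by rewrite enorm_gt0.
  rewrite /Z/= e0 /=; rewrite ltNge; apply/negP => h; apply: nE => _.
  by rewrite /O' h e0 !mul1r.
- have Hs : \forall x \ae sigma, 0 < enorm x.
    exists [set 0]; split.
    + have -> : [set (0 : V)] = [set y | `|0 - y| <= 0 :> R].
        apply/seteqP; split => y /=; first by move=> ->; rewrite subr0 normr0.
        by rewrite sub0r normrN normr_le0 => /eqP.
      exact: measurable_normB_le.
    + change (n%:R%:E * mu (@normalize R n @^-1` [set (0 : V)%R] `&` ball1) = 0)%E.
      rewrite (_ : _ `&` _ = set0) ?measure0 ?mule0//.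
      apply/seteqP; split => // x [/= nx /andP[e0 _]].
      have x0 : x != 0 by rewrite -enorm_gt0.
      have [_] := enorm_normalize x0.
      by rewrite nx eqxx.
    + move=> x /= nx; apply/eqP; apply: contrapT => /negP x0; apply: nx.
      by rewrite enorm_gt0.
  by apply: filterS2 HM Hs => x h e0 _; rewrite /O' h e0 !mul1r.
Qed.

Lemma integral_ball_0 O M : measurable_fun setT O -> 0 < M -> (forall x, `|O x| <= M) ->
  homogeneous0 O -> (\int[sigma]_(x in unit_sphere n) (O x)%:E = 0)%E ->
  fine (\int[mu]_u (O u * (0 < enorm u <= 1)%R%:R)%:E) = 0.
Proof.
move=> mO M0 OM hO; rewrite integralE.
have mE : measurable_fun setT (fun x => (O x)%:E) by mfun.
have mp := measurable_funepos mE; have mn := measurable_funeneg mE.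
rewrite !ge0_integral_sphere//.
have hp (g : V -> \bar R) : (g = (fun x => (O x)%:E)^\+ \/ g = (fun x => (O x)%:E)^\-)%E ->
    measurable_fun setT g ->
    (\int[mu]_(x in ball1) g (normalize x) =
     \int[mu]_x (g x * (0 < enorm x <= 1)%R%:R%:E))%E.
  move=> gE mg; rewrite integral_mkcond; apply: eq_integral => x _.
  rewrite /patch; case: ifPn => [|/negP]; rewrite inE /ball1/=.
    move=> h; rewrite h mule1; case/andP: h => e0 _.
    by case: gE => ->; rewrite !(funeposE, funenegE) homogeneous_normalize// -enorm_gt0.
  by move=> /negP/negbTE ->; rewrite mule0.
rewrite (hp _ (or_introl erefl) mp) (hp _ (or_intror erefl) mn).
set f := fun u => O u * (0 < enorm u <= 1)%R%:R.
have If : mu.-integrable setT (fun u => (f u)%:E).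
  apply: (integrable_ball (x := 0) (b := M) (r := 1)) => //.
  - exact: ltW.
  - by rewrite /f; mfun.
  move=> u; rewrite /f normrM sub0r normrN.
  case: (boolP (0 < enorm u <= 1)) => [/andP[_ h]|_]; last by rewrite normr0 mulr0 mulr_ge0// ltW.
  by rewrite (le_trans (norm_le_enorm u) h) normr1 !mulr1.
have fp : (\int[mu]_x ((fun x => (O x)%:E)^\+ x * (0 < enorm x <= 1)%R%:R%:E) =
    \int[mu]_x (fun x => (f x)%:E)^\+ x)%E.
  apply: eq_integral => x _; rewrite !funeposE /f; case: (_ < _ <= _).
    by rewrite mule1 mulr1.
  by rewrite mule0 mulr0 maxxx.
have fn : (\int[mu]_x ((fun x => (O x)%:E)^\- x * (0 < enorm x <= 1)%R%:R%:E) =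
    \int[mu]_x (fun x => (f x)%:E)^\- x)%E.
  apply: eq_integral => x _; rewrite !funenegE /f; case: (_ < _ <= _).
    by rewrite mule1 mulr1.
  by rewrite mule0 mulr0 oppe0 maxxx.
rewrite fp fn [in X in _ -> X]integralE.
have := integrable_fin_num measurableT If.
have Ip := integrable_fin_num measurableT (integrable_funepos measurableT If).
have In := integrable_fin_num measurableT (integrable_funeneg measurableT If).
rewrite -(fineK Ip) -(fineK In) => _; rewrite -!EFinM -!EFinB /= => -[].
rewrite -mulrBr => /eqP; rewrite mulf_eq0 => /orP[|/eqP//].
by rewrite pnatr_eq0 -leqn0 leqNgt n0.
Qed.

(** With mean zero on the sphere, the kernel integrates to zero over every
    shell: the integral over [1 < |u| <= s] is additive in [log s] and quadratic
    in [s - 1] near [1]. *)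
Lemma shell_mean_zero O M r s : measurable_fun setT O -> 0 < M ->
  (forall x, `|O x| <= M) -> homogeneous0 O ->
  fine (\int[mu]_u (O u * (0 < enorm u <= 1)%R%:R)%:E) = 0 -> 0 < r ->
  fine (\int[mu]_u (O u / enorm u ^+ n * (r < enorm u <= s)%R%:R)%:E) = 0.
Proof.
move=> mO M0 OM hO O1 r0.
pose K u := O u / enorm u ^+ n.
have mK : measurable_fun setT K.
  rewrite (_ : K = fun u => O u * enorm u `^ (- n%:R)); first by mfun.
  by apply/funext => u; rewrite /K powRN powR_mulrn ?enorm_ge0.
pose I a b := fine (\int[mu]_u (K u * (a < enorm u <= b)%R%:R)%:E).
have int_sh (f : V -> R) a b c : measurable_fun setT f -> 0 <= c ->
    (forall u, a < enorm u <= b -> `|f u| <= c) ->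
    mu.-integrable setT (fun u => (f u * (a < enorm u <= b)%R%:R)%:E).
  move=> mf c0 fc; apply: (integrable_ball (x := 0) (b := c) (r := `|b|)) => //.
    by mfun.
  move=> u; rewrite normrM sub0r normrN.
  case: (boolP (a < enorm u <= b)) => [h|_]; last by rewrite normr0 mulr0 mulr_ge0.
  rewrite (_ : (`|u| <= `|b|) = true) ?normr1 ?mulr1; first exact: fc.
  by case/andP: h => _ h; apply: le_trans (norm_le_enorm u) (le_trans h (ler_norm b)).
have Kb a u : 0 < a -> a < enorm u -> `|K u| <= M / a ^+ n.
  move=> a0 au; rewrite /K normrM normfV normrX (ger0_norm (enorm_ge0 u)).
  rewrite ler_pM// ?invr_ge0 ?exprn_ge0 ?enorm_ge0// lef_pV2 ?posrE ?exprn_gt0 ?(lt_trans a0 au)//.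
  by rewrite ler_pXn2r ?nnegrE ?(ltW a0) ?enorm_ge0 ?(ltW au).
have IK a b : 0 < a -> mu.-integrable setT (fun u => (K u * (a < enorm u <= b)%R%:R)%:E).
  move=> a0; apply: (int_sh K a b (M / a ^+ n)) => //.
    by rewrite divr_ge0 ?exprn_ge0 ?(ltW a0) ?(ltW M0).
  by move=> u /andP[h _]; exact: Kb.
have Iadd a b c : 0 < a -> a <= b -> b <= c -> I a c = I a b + I b c.
  move=> a0 ab bc; rewrite /I -fine_integralD; [|exact: IK|exact: IK (lt_le_trans a0 ab)].
  congr fine; apply: eq_integral => u _; rewrite -mulrDr -natrD; congr (_ * _%:R)%:E.
  have [h|h] := leP (enorm u) b.
    by rewrite (le_trans h bc) !andbT addn0.
  by rewrite (le_lt_trans ab h) andbF.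
have Iscale c a b : 0 < c -> 0 < a -> I (c * a) (c * b) = I a b.
  move=> c0 a0; pose f a b u : \bar R := (K u * (a < enorm u <= b)%R%:R)%:E.
  have mff : measurable_fun setT (f (c * a) (c * b)) by rewrite /f; mfun.
  have := @integral_affine R n (f (c * a) (c * b)) c 0 (lt0r_neq0 c0) mff.
  rewrite (gtr0_norm c0) => h.
  have c1 : 0 < c ^- n by rewrite invr_gt0 exprn_gt0.
  have h2 : (\int[mu]_x f (c * a)%R (c * b)%R (c *: x + 0)%R = \int[mu]_x ((c ^- n)%:E * f a b x))%E.
    have f0 u0 : u0 = 0 -> K u0 = 0.
      move=> ->; rewrite /K; have -> : enorm (0 : V) = 0.
        by apply/eqP; rewrite eq_le enorm_ge0 leNgt enorm_gt0 eqxx.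
      by rewrite expr0n (_ : (n == 0)%N = false) ?invr0 ?mulr0//; case: n n0.
    apply: eq_integral => x _; rewrite /f -EFinM addr0 enormZ (gtr0_norm c0).
    rewrite ltr_pM2l// ler_pM2l// mulrA; congr (_ * _)%:E.
    have [->|x0] := eqVneq x 0; first by rewrite scaler0 f0// mulr0.
    by rewrite /K hO// enormZ (gtr0_norm c0) exprMn invfM mulrCA.
  have : ((c ^- n)%:E * \int[mu]_x f (c * a)%R (c * b)%R x = \int[mu]_x ((c ^- n)%:E * f a b x))%E.
    by rewrite -h h2.
  have fin (X : \bar R) : fine ((c ^- n)%:E * X)%E = c ^- n * fine X.
    case: X => [y||] //=; by rewrite ?gt0_muley ?gt0_muleNy ?mulr0// lte_fin.
  move=> /(congr1 fine); rewrite fin => e1.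
  have e2 := fine_integralZ (c ^- n) (IK a b a0).
  move: e1; rewrite [X in _ = fine X](eq_integral
    (fun x => (c ^- n * (K x * (a < enorm x <= b)%R%:R))%:E)) => [|x _]; last by rewrite /f EFinM.
  by rewrite -e2 => /(mulfI (lt0r_neq0 c1)).
pose J t := I 1 t.
have Jpow t m : 1 <= t -> J (t ^+ m) = m%:R * J t.
  move=> t1; have t0 : 0 < t by exact: lt_le_trans t1.
  elim: m => [|m IH].
    rewrite expr0 mul0r /J /I (eq_integral (cst 0%E)) ?integral0// => u _.
    by rewrite (_ : (1 < enorm u <= 1) = false) ?mulr0//; case: ltP => //= h; rewrite leNgt h.
  have tm : 1 <= t ^+ m by rewrite exprn_ege1.
  rewrite /J (Iadd 1 (t ^+ m))//; last by rewrite exprS ler_peMl// ltW// exprn_gt0.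
  rewrite -/(J (t ^+ m)) IH -[X in I X _]mulr1 exprSr Iscale ?exprn_gt0//.
  by rewrite -/(J t) -natr1 mulrDl mul1r.
pose C := M * n%:R * (2 ^+ n * @cP R n); have C0 : 0 <= C.
  by rewrite /C !mulr_ge0 ?(ltW M0)// /cP ?mulr_ge0.
have Jsmall t : 1 <= t <= 2 -> `|J t| <= C * (t - 1) ^+ 2.
  move=> /andP[t1 t2]; have t0 : 0 < t by exact: lt_le_trans t1.
  pose k u := (1 < enorm u <= t)%R%:R : R.
  have IO : mu.-integrable setT (fun u => (O u * (1 < enorm u <= t)%R%:R)%:E).
    exact: (int_sh O 1 t M mO (ltW M0) (fun u _ => OM u)).
  have shE (x y : R) : 0 < x -> x <= y -> fine (\int[mu]_u (O u * (x < enorm u <= y)%R%:R)%:E) = 0.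
    move=> x0 xy; have y0 := lt_le_trans x0 xy.
    pose Ph z := fine (\int[mu]_u (O u * (0 < enorm u <= z)%R%:R)%:E).
    have Phi z : mu.-integrable setT (fun u => (O u * (0 < enorm u <= z)%R%:R)%:E).
      exact: (int_sh O 0 z M mO (ltW M0) (fun u _ => OM u)).
    have Ph0 z : 0 < z -> Ph z = 0.
      move=> z0; pose f u : \bar R := (O u * (0 < enorm u <= z)%R%:R)%:E.
      have mff : measurable_fun setT f by rewrite /f; mfun.
      have := @integral_affine R n f z 0 (lt0r_neq0 z0) mff; rewrite (gtr0_norm z0).
      rewrite (eq_integral (fun u => (O u * (0 < enorm u <= 1)%R%:R)%:E)) => [|u _]; last first.
        rewrite /f addr0 enormZ (gtr0_norm z0) pmulr_rgt0//.
        have -> : (z * enorm u <= z) = (enorm u <= 1) by rewrite -[X in _ <= X]mulr1 ler_pM2l.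
        have [->|u0] := eqVneq u 0; last by rewrite hO.
        by rewrite scaler0.
      move=> /(congr1 fine); rewrite O1; have z1 : 0 < z ^- n by rewrite invr_gt0 exprn_gt0.
      rewrite /f -(fineK (integrable_fin_num measurableT (Phi z))) -EFinM /= => /esym/eqP.
      by rewrite mulf_eq0 (gt_eqF z1) => /eqP.
    have Ixy : mu.-integrable setT (fun u => (O u * (x < enorm u <= y)%R%:R)%:E).
      exact: (int_sh O x y M mO (ltW M0) (fun u _ => OM u)).
    have : Ph y = Ph x + fine (\int[mu]_u (O u * (x < enorm u <= y)%R%:R)%:E).
      rewrite /Ph -fine_integralD//; congr fine; apply: eq_integral => u _.
      rewrite -mulrDr -natrD; congr (_ * _%:R)%:E.
      have [h|h] := leP (enorm u) x; first by rewrite (le_trans h xy) !andbT addn0.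
      by rewrite (lt_trans x0 h) andbF.
    by rewrite !Ph0// add0r => <-.
  pose H u := (K u - O u) * (1 < enorm u <= t)%R%:R.
  pose c := M * (n%:R * (t - 1)).
  have tp m : 1 - t ^- m <= m%:R * (t - 1).
    elim: m => [|m IH]; first by rewrite expr0 invr1 subrr mul0r.
    have h1 : t ^- m.+1 = t ^- m * t^-1 by rewrite exprSr invfM.
    have h2 : t ^- m <= 1 by rewrite invf_le1 ?exprn_gt0// exprn_ege1.
    have h3 : 0 <= 1 - t^-1 by rewrite subr_ge0 invf_le1.
    have h4 : 1 - t^-1 <= t - 1.
      have -> : 1 - t^-1 = (t - 1) / t by field; rewrite gt_eqF.
      by rewrite ler_pdivrMr// ler_peMr// subr_ge0.
    have h5 : t ^- m * (1 - t^-1) <= t - 1.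
      by apply: le_trans h4; rewrite ler_piMl.
    rewrite h1 -natr1 mulrDl mul1r; move: IH h5; move: (t ^- m) (t^-1) => z1 z2; lra.
  have Hc u : 1 < enorm u <= t -> `|K u - O u| <= c.
    move=> /andP[u1 ut]; rewrite /K -[X in _ - X]mulr1 -mulrBr normrM ler_pM//.
    have e0 : 0 < enorm u by exact: lt_trans u1.
    have e1 : (enorm u ^+ n)^-1 <= 1 by rewrite invf_le1 ?exprn_gt0// exprn_ege1// ltW.
    rewrite distrC ger0_norm ?subr_ge0//; apply: le_trans (tp n).
    rewrite lerD2l lerN2 lef_pV2 ?posrE ?exprn_gt0// ler_pXn2r ?nnegrE ?(ltW t0) ?(ltW e0)//.
  have c0 : 0 <= c by rewrite /c mulr_ge0 ?(ltW M0)// mulr_ge0// subr_ge0.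
  have mH : measurable_fun setT (fun u => K u - O u) by mfun.
  have IH : mu.-integrable setT (fun u => (H u)%:E) by exact: (int_sh _ 1 t c mH c0 Hc).
  have JE : J t = fine (\int[mu]_u (H u)%:E).
    rewrite -[RHS]addr0 -(shE 1 t ltr01 t1) -fine_integralD//; congr fine.
    by apply: eq_integral => u _; rewrite /H -mulrDl subrK.
  have finH := integrable_fin_num measurableT IH.
  rewrite JE -lee_fin.
  have -> : (`|fine (\int[mu]_u (H u)%:E)|%:E = `|\int[mu]_u (H u)%:E|)%E.
    by rewrite -{2}(fineK finH).
  have mHE : measurable_fun setT (fun u => (H u)%:E) by rewrite /H; mfun.
  apply: le_trans (le_abse_integral mu measurableT mHE) _.
  apply: (@le_trans _ _ (\int[mu]_u (c * (1 < enorm (0 - u) <= t * 1)%R%:R)%:E)%E).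
    apply: nn_le => [||u]; [by rewrite /H; mfun|by mfun|]; rewrite normr_ge0/= /H.
    rewrite sub0r enormN mulr1 normrM.
    case: (boolP (1 < enorm u <= t)) => h; last by rewrite normr0 !mulr0.
    by rewrite normr1 !mulr1 Hc.
  rewrite nnZ//; last by mfun.
  have sh := @int_shell R n 1 t 0 ltr01 (introT andP (conj t1 t2)).
  have c0' : (0 <= c%:E)%E by rewrite lee_fin.
  apply: le_trans (lee_wpmul2l c0' sh) _; rewrite -EFinM lee_fin expr1n mul1r /c /C.
  by rewrite le_eqVlt; apply/orP; left; apply/eqP; move: (@cP R n) => z; ring.
have bern t m : 1 <= t -> 1 + m%:R * (t - 1) <= t ^+ m.
  move=> t1; elim: m => [|m IH]; first by rewrite mul0r addr0 expr0.
  have t0 : 0 <= t - 1 by rewrite subr_ge0.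
  rewrite exprS; apply: (@le_trans _ _ (t * (1 + m%:R * (t - 1)))); last first.
    by rewrite ler_wpM2l// (le_trans ler01).
  have : 0 <= (t - 1) * (m%:R * (t - 1)) by rewrite mulr_ge0// mulr_ge0.
  by rewrite -natr1; move: (m%:R : R) => k; lra.
have J0 z : 1 <= z -> J z = 0.
  move=> z1; apply/eqP; rewrite -normr_eq0 eq_le normr_ge0 andbT leNgt; apply/negP => jp.
  pose D := C * (z - 1) ^+ 2; have D0 : 0 <= D by rewrite mulr_ge0 ?sqr_ge0.
  pose m := (Num.bound z + Num.bound (D / `|J z|)).+1.
  have m0 : 0 < m%:R :> R by rewrite ltr0n.
  have zm : z <= m%:R.
    apply: le_trans (ltW (archi_boundP (le_trans ler01 z1))) _.
    by rewrite ler_nat leqW// leq_addr.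
  have Dm : D < `|J z| * m%:R.
    rewrite mulrC -ltr_pdivrMr//; apply: lt_le_trans (archi_boundP _) _.
      by rewrite divr_ge0// ltW.
    by rewrite ler_nat leqW// leq_addl.
  pose t := z `^ (m%:R)^-1.
  have z0 : 0 < z by exact: lt_le_trans z1.
  have tm : t ^+ m = z.
    by rewrite -powR_mulrn ?powR_ge0// /t -powRrM mulVf ?gt_eqF// powRr1// ltW.
  have t1 : 1 <= t.
    rewrite leNgt; apply/negP => tl.
    have : t ^+ m < 1 by apply: exprn_ilt1 => //; exact: powR_ge0.
    by rewrite tm ltNge z1.
  have tz : m%:R * (t - 1) <= z - 1 by rewrite lerBrDl -tm; exact: bern.
  have t2 : t <= 2.
    have : m%:R * (t - 1) <= m%:R * 1 by apply: le_trans tz _; rewrite mulr1; apply: le_trans zm; rewrite gerBl.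
    by rewrite ler_pM2l// lerBlDr.
  have := Jsmall t (introT andP (conj t1 t2)).
  have JE : `|J z| = m%:R * `|J t| by rewrite -{1}tm Jpow// normrM ger0_norm.
  have t0 : 0 <= t - 1 by rewrite subr_ge0.
  have sq : (m%:R * (t - 1)) ^+ 2 <= (z - 1) ^+ 2.
    by rewrite ler_pXn2r ?nnegrE ?mulr_ge0// subr_ge0.
  have := ler_wpM2l C0 sq; rewrite -/D exprMn => h1 h2.
  have h3 : m%:R * (m%:R * `|J t|) <= m%:R ^+ 2 * (C * (t - 1) ^+ 2).
    by rewrite mulrA -expr2 ler_pM2l// exprn_gt0.
  move: Dm; rewrite JE mulrC ltNge => /negP; apply; apply: le_trans h3 _.
  by rewrite mulrCA.
have [rs|sr] := leP r s; last first.
  rewrite (eq_integral (cst 0%E)) ?integral0// => u _.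
  rewrite (_ : (r < enorm u <= s) = false) ?mulr0//.
  by apply/negP => /andP[h1 h2]; move: (lt_trans (lt_le_trans h1 h2) sr); rewrite ltxx.
have := J0 (s / r); rewrite ler_pdivlMr// mul1r => /(_ rs).
by rewrite /J -(Iscale r) ?mulr1// mulrCA divff ?gt_eqF// mulr1.
Qed.

End rough.

(** * Existence of principal values *)

Section principal_value.
Context {R : realType} {n : nat}.
Hypothesis n0 : (0 < n)%N.
Local Notation V := 'rV[R]_n.
Local Notation mu := (@lebesgue_rV R n).
Local Notation L1 := (L1 mu).
Implicit Types (x y u : V) (f F K : V -> R) (r s t e M p : R) (k m N : nat).

Lemma Rint_set (Q : V -> bool) f :
  Rintegral mu [set y | Q y] f = fine (\int[mu]_y (f y * (Q y)%:R)%:E).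
Proof.
rewrite /Rintegral integral_mkcond; congr fine; apply: eq_integral => y _.
rewrite /patch; case: ifPn => [|/negP]; rewrite inE /=.
  by move=> ->; rewrite mulr1.
by move=> /negP/negbTE ->; rewrite mulr0.
Qed.

Lemma integrable_set (Q : V -> bool) f : measurable_fun setT Q -> measurable_fun setT f ->
  mu.-integrable [set y | Q y] (EFin \o f) <->
  mu.-integrable setT (fun y => (f y * (Q y)%:R)%:E).
Proof.
move=> mQ mf; have mS : measurable [set y | Q y].
  rewrite (_ : [set y | _] = setT `&` Q @^-1` [set true]); first exact: mQ.
  by apply/seteqP; split => y //= [].
have E : (\int[mu]_(y in [set y | Q y]) `|(f y)%:E| =
    \int[mu]_y `|(f y * (Q y)%:R)%:E|)%E.
  rewrite integral_mkcond; apply: eq_integral => y _.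
  rewrite /patch; case: ifPn => [|/negP]; rewrite inE /=.
    by move=> ->; rewrite mulr1.
  by move=> /negP/negbTE ->; rewrite mulr0 normr0.
split=> /integrableP[m1 h1]; apply/integrableP; split.
- by mfun.
- by rewrite -E.
- by apply: measurable_funTS; mfun.
- by rewrite E.
Qed.

Definition tau K F x e : R :=
  fine (\int[mu]_y (K (x - y) * F y * (e < enorm (x - y))%R%:R)%:E).

Variables (K : V -> R) (M : R).
Hypothesis cK : czk M K.

Let mK : measurable_fun setT K. Proof. by case: cK. Qed.
Let M0 : 0 <= M. Proof. by case: cK. Qed.

Let Kle x y e : 0 < e -> e < enorm (x - y) -> `|K (x - y)| <= M / e ^+ n.
Proof.
move=> e0 h; have d0 := lt_trans e0 h; case: cK => _ _ Kb _ _.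
apply: le_trans (Kb _ _) _; first by rewrite -enorm_gt0.
rewrite ler_wpM2l// lef_pV2 ?posrE ?exprn_gt0//.
by rewrite ler_pXn2r ?nnegrE ?(ltW e0) ?(ltW d0) ?(ltW h).
Qed.

Let intF F x e : 0 < e -> L1 F ->
  mu.-integrable setT (fun y => (K (x - y) * F y * (e < enorm (x - y))%R%:R)%:E).
Proof.
move=> e0 LF; have [mF _] := LF; have c0 : 0 <= M / e ^+ n by rewrite divr_ge0// exprn_ge0// ltW.
have [LZ _] := N1Z (M / e ^+ n) LF.
apply: (L1_int (L1_dom _ LZ _).1); first by have := mK => ?; mfun.
move=> y; rewrite [leRHS]normrM (ger0_norm c0) normrM normrM (ger0_norm (ler0n _ _)).
case: (boolP (e < enorm (x - y))) => h; last by rewrite mulr0 mulr_ge0.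
by rewrite mulr1 ler_wpM2r//; exact: Kle.
Qed.

Let shell_arith (a b c s e : R) : 0 <= a -> 0 <= c -> 0 < e -> 0 < b -> 0 <= s -> s / b < e ->
  a / e ^+ n * (c * s ^+ n) <= a * b ^+ n * c.
Proof.
move=> a0 c0 e0 b0 s0 h.
have hs : s ^+ n <= (b * e) ^+ n.
  rewrite lerXn2r ?nnegrE//; first by rewrite mulr_ge0// ltW.
  by move: h; rewrite ltr_pdivrMr// mulrC => /ltW.
apply: (@le_trans _ _ (a / e ^+ n * (c * (b * e) ^+ n))).
  by rewrite ler_wpM2l ?divr_ge0 ?exprn_ge0 ?(ltW e0)// ler_wpM2l.
by rewrite exprMn le_eqVlt; apply/orP; left; apply/eqP; field; rewrite expf_neq0// gt_eqF.
Qed.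

Variable L0 : nat.
Hypothesis L0E : L0%:R = 2 ^+ 8 :> R.
Local Notation A := (shell_op L0).
Local Notation sc := (@sc R L0).

Let tau_split F x a b : 0 < a -> a <= b -> L1 F ->
  tau K F x a = tau K F x b + op (sk K a b) F x.
Proof.
move=> a0 ab LF; have b0 := lt_le_trans a0 ab.
rewrite /tau /op -fine_integralD; first last.
- have := lkern_sk cK a0 ab => lk; exact: L1_int (op_L1 x lk LF).
- exact: intF.
congr fine; apply: eq_integral => y _; congr EFin; rewrite /sk.
have [h|h] := leP (enorm (x - y)) b; first by rewrite andbT mulr0 add0r; ring.
by rewrite (le_lt_trans ab h) /= mulr0 mul0r addr0.
Qed.

Let tau_sc F x N : L1 F -> tau K F x (sc N) = tau K F x (sc 0) + \sum_(k < N) A K k F x.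
Proof.
move=> LF; elim: N => [|N IH]; first by rewrite big_ord0 addr0.
have sE : sc N.+1 = sc N / (L0 ^ 3)%:R by rewrite /sc exprSr invfM.
have s0 := sc_gt0 L0E N : 0 < sc N :> R; have s1 := sc_gt0 L0E N.+1 : 0 < sc N.+1 :> R.
have ss : sc N.+1 <= sc N :> R.
  by rewrite -addn1 (scD _ N 1) ler_piMr ?(ltW s0)// (sc_le1 L0E).
rewrite big_ord_recr /= addrA -IH (tau_split x s1 ss LF).
by rewrite /shell_op sE.
Qed.

Let small_shell F x N e c : L1 F -> 0 < e -> sc N.+1 < e -> e <= sc N -> 0 <= c ->
  (\int[mu]_y ((`|x - y| <= sc N)%R%:R * `|F y - F x|)%:E <= (c * sc N ^+ n)%:E)%E ->
  `|tau K F x e - tau K F x (sc N)| <= M * (L0 ^ 3)%:R ^+ n * c.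
Proof.
move=> LF e0 s1 es c0 hc; have [mF _] := LF; have B0 := BR_gt0 L0E.
have s0 := sc_gt0 L0E N : 0 < sc N :> R.
rewrite (tau_split x e0 es LF) addrAC subrr add0r.
have lk := lkern_sk cK e0 es; have mks := mker_sk e (sc N) cK; have mkx := mker1 x mks.
have I1 := L1_int (op_L1 x lk LF).
have I2 : mu.-integrable setT (fun y => (- F x * sk K e (sc N) x y)%:E).
  have : mu.-integrable setT (fun y => (sk K e (sc N) x y)%:E) by exact: lkern_int1 lk.
  move=> /(integrableZl measurableT (- F x)); congr (_.-integrable _ _).
have -> : op (sk K e (sc N)) F x =
    fine (\int[mu]_y (sk K e (sc N) x y * (F y - F x))%:E).
  rewrite -[LHS]addr0 -(mulr0 (- F x)) -(int_sk (n := n) (sc N) x cK e0).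
  rewrite (fine_integralZ (- F x)) ?(lkern_int1 x lk)// /op -fine_integralD//.
  by congr fine; apply: eq_integral => y _; congr EFin; ring.
have I3 : mu.-integrable setT (fun y => (sk K e (sc N) x y * (F y - F x))%:E).
  have := integrableD measurableT I1 I2; congr (_.-integrable _ _).
  by apply/funext => y /=; rewrite -EFinD; congr EFin; ring.
have fin := integrable_fin_num measurableT I3.
rewrite -lee_fin.
have -> : (`|fine (\int[mu]_y (sk K e (sc N) x y * (F y - F x))%:E)|%:E =
    `|\int[mu]_y (sk K e (sc N) x y * (F y - F x))%:E|)%E by rewrite -{2}(fineK fin).
apply: le_trans (le_abse_integral mu measurableT _) _; first by mfun.
have ce : 0 <= M / e ^+ n by rewrite divr_ge0// exprn_ge0// ltW.
apply: (@le_trans _ _ ((M / e ^+ n)%:E *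
    \int[mu]_y ((`|x - y| <= sc N)%R%:R * `|F y - F x|)%:E)%E).
  rewrite -nnZ//; last by mfun.
  apply: nn_le => [||y]; [by mfun|by mfun|]; rewrite normr_ge0/= normrM mulrA ler_wpM2r//.
  rewrite /sk normrM (ger0_norm (ler0n _ _)).
  case: (boolP (e < enorm (x - y) <= sc N)) => [/andP[h1 h2]|_]; last by rewrite mulr0 mulr_ge0.
  by rewrite (le_trans (norm_le_enorm _) h2) !mulr1; exact: Kle.
have ce' : (0 <= (M / e ^+ n)%:E)%E by rewrite lee_fin.
apply: le_trans (lee_wpmul2l ce' hc) _; rewrite -EFinM lee_fin.
apply: shell_arith => //; first exact: ltW.
by move: s1; rewrite /sc exprSr invfM.
Qed.

Let sc_anti N m : (N <= m)%N -> sc m <= sc N :> R.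
Proof.
move=> h; rewrite -(subnKC h) scD ler_piMr ?(ltW (sc_gt0 L0E N))//; exact: sc_le1 L0E _.
Qed.

(** Between two consecutive scales the truncated integral differs from the one at the
    coarser scale by a shell integral, which is small at a Lebesgue point because
    the shell has mean zero. *)
Lemma tau_cvg F x : L1 F -> leb F x -> cvgn (fun N => \sum_(k < N) A K k F x) ->
  cvg (tau K F x e @[e --> 0^'+]).
Proof.
move=> LF lF cS; set l := lim _ in cS.
have Sl : (fun N => tau K F x (sc N)) @ \oo --> tau K F x (sc 0) + l.
  rewrite (_ : (fun N => _) = (fun N => tau K F x (sc 0) + \sum_(k < N) A K k F x)).
    by apply: cvgD => //; exact: cvg_cst.
  by apply/funext => N; exact: tau_sc.
apply/cvg_ex; exists (tau K F x (sc 0) + l); apply/cvgrPdist_le => eps eps0.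
have B0 := BR_gt0 L0E; set D := M * (L0 ^ 3)%:R ^+ n.
have D0 : 0 <= D by rewrite mulr_ge0// exprn_ge0// ltW.
have e1 : 0 < eps / 2 / (D + 1) by rewrite !divr_gt0// ltr_wpDl.
have [d d0 hd] := lF _ e1.
have [N1 hN1] := sc_small L0E d0.
have eps2 : 0 < eps / 2 by rewrite divr_gt0.
move/cvgrPdist_le : Sl => /(_ _ eps2)[N2 _ hN2].
near=> e.
have e0 : 0 < e by near: e; exact: nbhs_right_gt.
have eN : e < sc (maxn N1 N2) by near: e; apply: nbhs_right_lt; exact: sc_gt0.
have [m0 hm0] := sc_small L0E e0.
have exm : exists m, sc m < e by exists m0.
case: (ex_minnP exm) => m hm minm.
have Nm : (maxn N1 N2 < m)%N.
  rewrite ltnNge; apply/negP => h; have := lt_trans hm eN.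
  by rewrite ltNge sc_anti.
case: m => // N in hm minm Nm *.
have eN' : e <= sc N by rewrite leNgt; apply/negP => /minm; rewrite ltnn.
have Nge : (maxn N1 N2 <= N)%N by [].
have sd : sc N < d.
  by apply: le_lt_trans hN1; apply: sc_anti; apply: leq_trans Nge; exact: leq_maxl.
have hs := small_shell LF e0 hm eN' (ltW e1) (hd _ (sc_gt0 L0E N) sd).
have hN : `|tau K F x (sc 0) + l - tau K F x (sc N)| <= eps / 2.
  by apply: hN2 => /=; apply: leq_trans Nge; exact: leq_maxr.
have -> : tau K F x (sc 0) + l - tau K F x e =
  (tau K F x (sc 0) + l - tau K F x (sc N)) - (tau K F x e - tau K F x (sc N)) by ring.
apply: le_trans (ler_normB _ _) _; rewrite [leRHS](splitr eps); apply: lerD => //.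
apply: le_trans hs _; rewrite -/D mulrA ler_pdivrMr ?ltr_wpDl// mulrC ler_wpM2l ?(ltW eps2)//.
by rewrite lerDl.
Unshelve. all: by end_near. Qed.

End principal_value.

Section local_principal_value.
Context {R : realType} {n : nat}.
Hypothesis n0 : (0 < n)%N.
Local Notation V := 'rV[R]_n.
Local Notation mu := (@lebesgue_rV R n).
Local Notation L1 := (L1 mu).
Implicit Types (x y u : V) (f F K : V -> R) (r s t e M p : R) (k m N : nat).

Lemma le_powR_loc p t : 1 < p -> 0 <= t -> t <= 1 + t `^ p.
Proof.
move=> p1 t0; have [h|h] := leP t 1; first by apply: (le_trans h); rewrite lerDl powR_ge0.
apply: le_trans (_ : t `^ p <= _); last by rewrite lerDr.
by rewrite -{1}(powRr1 t0) ler_powR ?(ltW p1)// ltW.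
Qed.

Definition loc_pow p f := measurable_fun setT f /\
  forall r, (\int[mu]_x ((`|x| <= r)%R%:R * `|f x| `^ p)%:E < +oo)%E.

Lemma loc_pow_locint p f : 1 < p -> loc_pow p f -> locint f.
Proof.
move=> p1 [mf hf]; split=> // r; have [r0|r0] := ltP r 0.
  rewrite (_ : (fun x : V => _) = fun=> 0%E) ?integral0//; apply/funext => x.
  by rewrite leNgt (lt_le_trans r0)// mul0r.
have mI : measurable_fun setT (fun x : V => (`|x| <= r)%R%:R : R) by mfun.
apply: le_lt_trans (_ : _ <= \int[mu]_x ((`|x| <= r)%R%:R)%:E +
    \int[mu]_x ((`|x| <= r)%R%:R * `|f x| `^ p)%:E)%E _.
  rewrite -nnD//; try (by mfun); try (by move=> x; rewrite mulr_ge0// powR_ge0).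
  apply: nn_le => [||x]; [by mfun|by mfun|]; rewrite mulr_ge0//=.
  by case: (`|x| <= r); rewrite ?mul1r ?mul0r ?addr0// le_powR_loc.
have := int_near (0 : V) r0.
under eq_integral => y _ do rewrite sub0r normrN.
by move=> ->; rewrite lte_add_pinfty// ltry.
Qed.

Lemma truncation_L1 p f k : 1 < p -> loc_pow p f ->
  let F := fun y => f y * (`|y| <= k%:R)%R%:R in L1 F /\ L1 (fun x => `|F x| `^ p).
Proof.
move=> p1 lf F; have [mf hf] := lf; have [_ hf1] := loc_pow_locint p1 lf.
have mF : measurable_fun setT F by rewrite /F; mfun.
split; split=> //; try by mfun.
  rewrite (eq_integral (fun x => ((`|x| <= k%:R)%R%:R * `|f x|)%:E)) => [|x _]; first exact: hf1.
  by rewrite /F normrM mulrC (ger0_norm (ler0n _ _)).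
rewrite (eq_integral (fun x => ((`|x| <= k%:R)%R%:R * `|f x| `^ p)%:E)) => [|x _]; first exact: hf.
rewrite /F ger0_norm ?powR_ge0//; congr EFin.
case: (`|x| <= k%:R); rewrite ?mulr1 ?mul1r// mulr0 normr0 mul0r powR0//.
by rewrite gt_eqF// (lt_trans _ p1).
Qed.

(** Near a given ball only the restriction of [f] to a larger ball contributes to the
    limit, and this restriction is integrable together with its [p]-th power. *)
Theorem pv_exists p M K f : 1 < p -> czk M K -> loc_pow p f ->
  (\forall x \ae mu, forall e, 0 < e ->
    mu.-integrable setT (fun y => (K (x - y) * f y * (e < enorm (x - y))%R%:R)%:E)) ->
  \forall x \ae mu, cvg (tau K f x e @[e --> 0^'+]).
Proof.
move=> p1 cK lf tails; have [mf _] := lf.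
have [L0 L0E] : exists L0, L0%:R = 2 ^+ 8 :> R by exists (2 ^ 8)%N; rewrite natrX.
pose F k y := f y * (`|y| <= k%:R)%R%:R.
have mF k : measurable_fun setT (F k) by rewrite /F; mfun.
have mK : measurable_fun setT K by case: cK.
have : \forall x \ae mu, forall k, cvg (tau K (F k) x e @[e --> 0^'+]).
  apply/ae_foralln => k; have [LF LFp] := truncation_L1 k p1 lf.
  have lF : locint (F k).
    split=> // r; apply: le_lt_trans LF.2; apply: nn_le => [||x]; [by mfun|by mfun|].
    rewrite mulr_ge0//=; case: (_ <= r); rewrite ?mul1r ?mul0r//.
  have := locint_leb n0 lF; have := lacunary_cvg n0 L0E p1 cK LF LFp.
  by apply: filterS2 => x h1 h2; exact: (tau_cvg n0 cK L0E LF h2 h1).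
move: tails; apply: filterS2 => x tx cx.
have [k kx] : exists k : nat, `|x| + 1 < k%:R by exists (Num.truncn (`|x| + 1)).+1; exact: truncnS_gt.
pose G y := K (x - y) * (f y - F k y).
have Gtail y e : e < 1 -> G y = G y * (e < enorm (x - y))%R%:R.
  move=> e1; rewrite /G /F; have [h|h] := leP `|y| k%:R; first by rewrite mulr1 subrr !(mulr0, mul0r).
  suff -> : e < enorm (x - y) by rewrite mulr1.
  apply: lt_le_trans e1 _; apply: le_trans (norm_le_enorm _).
  rewrite distrC -(lerD2r `|x|) addrC; apply: ltW; apply: lt_le_trans kx _.
  by apply: le_trans (ltW h) _; rewrite -{1}(subrK x y) ler_normD.
have iG : mu.-integrable setT (fun y => (G y)%:E).
  have h2 : (0 : R) < 2^-1 by [].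
  have ti := tx _ h2; apply: (le_integrable measurableT _ _ ti); first by rewrite /G; mfun.
  move=> y _; rewrite (Gtail y 2^-1); last by rewrite invf_lt1// ltr1n.
  rewrite /= lee_fin /G !normrM ler_wpM2r// ler_wpM2l// /F.
  by case: (`|y| <= k%:R); rewrite ?mulr1 ?mulr0 ?subrr ?subr0 ?normr0.
have tauE e : 0 < e -> e < 1 -> tau K f x e = tau K (F k) x e + fine (\int[mu]_y (G y)%:E).
  move=> e0 e1; rewrite /tau -fine_integralD//.
    congr fine; apply: eq_integral => y _; congr EFin; rewrite (Gtail y _ e1) /G; ring.
  apply: (le_integrable measurableT _ _ (tx _ e0)); first by mfun.
  move=> y _; rewrite /= lee_fin !normrM ler_wpM2r// ler_wpM2l// /F.
  by case: (`|y| <= k%:R); rewrite ?normr1 ?mulr1 ?normr0 ?mulr0 ?normr_ge0 ?lexx.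
have [l cl] := (cvg_ex _).1 (cx k).
apply/cvg_ex; exists (l + fine (\int[mu]_y (G y)%:E)).
apply: cvg_trans (cvgD cl (cvg_cst (fine (\int[mu]_y (G y)%:E)))).
apply: near_eq_cvg; near=> e.
have e0 : 0 < e by near: e; exact: nbhs_right_gt.
have e1 : e < 1 by near: e; exact: nbhs_right_lt.
by rewrite /= (tauE _ e0 e1).
Unshelve. all: by end_near. Qed.

End local_principal_value.

(** * The Riesz potential *)

Module Riesz.

Section real_powers.
Context {R : realType}.
Implicit Types (a b e s t y : R).

Lemma powR_le_neg a b e : 0 < a -> a <= b -> e <= 0 -> b `^ e <= a `^ e.
Proof.
move=> a0 ab e0; have b0 := lt_le_trans a0 ab.
rewrite -(opprK e) (powRN b (- e)) (powRN a (- e)) lef_pV2 ?posrE ?powR_gt0//.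
by apply: ge0_ler_powR; rewrite ?nnegrE ?oppr_ge0 ?(ltW a0) ?(ltW b0).
Qed.

Lemma powRV a e : 0 <= a -> a^-1 `^ e = a `^ (- e).
Proof. by move=> a0; rewrite -(powR_inv1 a0) -powRrM mulN1r. Qed.

Lemma powR_exp a e k : 0 <= a -> (a ^+ k) `^ e = (a `^ e) ^+ k.
Proof. by move=> a0; rewrite -(powR_mulrn _ a0) -(powR_mulrn _ (powR_ge0 _ _)) -!powRrM mulrC. Qed.

Lemma powRD_pos a s t : 0 < a -> a `^ (s + t) = a `^ s * a `^ t.
Proof. by move=> a0; rewrite powRD//; apply/implyP => _; rewrite gt_eqF. Qed.

Lemma powR_pred p y : 1 < p -> 0 <= y -> y `^ (p - 1) * y = y `^ p.
Proof.
move=> p1 y0; rewrite -{2}(powRr1 y0) -powRD ?subrK//.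
by rewrite gt_eqF// (lt_trans _ p1).
Qed.

Lemma near_scale b t : 0 < t -> t <= b -> exists k, b * 2^-1 ^+ k / 2 < t <= b * 2^-1 ^+ k.
Proof.
move=> t0 tb; have b0 := lt_le_trans t0 tb.
have ex : exists k, b * 2^-1 ^+ k / 2 < t.
  exists (Num.truncn (b / t)).+1; set m := (Num.truncn _).+1.
  have h : b / t < m%:R by exact: truncnS_gt.
  have h2 : (m%:R : R) <= 2 ^+ m by rewrite -natrX ler_nat ltnW// ltn_expl.
  rewrite exprVn -mulrA -invfM -exprSr ltr_pdivrMr ?exprn_gt0// mulrC -ltr_pdivrMr//.
  apply: lt_le_trans h _; apply: le_trans h2 _.
  by rewrite exprS ler_peMl ?exprn_ge0// ler1n.
case: (ex_minnP ex) => k hk min; exists k; rewrite hk /=.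
case: k hk min => [|k] hk min; first by rewrite expr0 mulr1.
by rewrite exprSr mulrA leNgt; apply/negP => /min; rewrite ltnn.
Qed.

Lemma far_scale b t : 0 < b -> b < t -> exists k, 2 * b * 2 ^+ k / 2 < t <= 2 * b * 2 ^+ k.
Proof.
move=> b0 bt.
have ex : exists k, t <= 2 * b * 2 ^+ k.
  exists (Num.truncn (t / b)).+1; set m := (Num.truncn _).+1.
  have h : t / b < m%:R by exact: truncnS_gt.
  have h2 : (m%:R : R) <= 2 ^+ m by rewrite -natrX ler_nat ltnW// ltn_expl.
  move: h; rewrite ltr_pdivrMr// => h; apply: le_trans (ltW h) _.
  rewrite mulrC -mulrA mulrCA ler_wpM2l ?(ltW b0)//.
  by apply: le_trans h2 _; rewrite ler_peMl ?exprn_ge0// ler1n.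
case: (ex_minnP ex) => k hk min; exists k; rewrite hk andbT.
case: k hk min => [|k] hk min; first by rewrite expr0 mulr1 mulrAC divff ?mul1r// pnatr_eq0.
rewrite exprSr -!mulrA divff ?mulr1 ?pnatr_eq0// mulrA ltNge; apply/negP => /min; by rewrite ltnn.
Qed.

(** The levels grow geometrically, so the sum is comparable with its last term;
    the induction bounds it by the telescoping quantity [min (a 2^N) (2 y) ^ s]. *)
Lemma level_sum a s y N : 0 < a -> 0 < s -> 0 <= y ->
  \sum_(k < N) (a * 2 ^+ k) `^ s * (a * 2 ^+ k < y)%R%:R <= (2 * y) `^ s / (2 `^ s - 1).
Proof.
move=> a0 s0 y0; set u := 2 `^ s - 1.
have u0 : 0 < u.
  have h1 : 1 = 1 `^ s :> R by rewrite powR1.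
  rewrite subr_gt0 [ltLHS]h1; apply: gt0_ltr_powR => //; rewrite ?nnegrE// ltr1n//.
have y2 : 0 <= 2 * y by rewrite mulr_ge0.
have mono b c : 0 <= b -> b <= c -> b `^ s <= c `^ s.
  by move=> h1 h2; apply: ge0_ler_powR; rewrite ?nnegrE ?(ltW s0)//; apply: le_trans h2.
suff H : \sum_(k < N) (a * 2 ^+ k) `^ s * (a * 2 ^+ k < y)%R%:R <=
    (Num.min (a * 2 ^+ N) (2 * y)) `^ s / u.
  apply: le_trans H _; rewrite ler_pM2r ?invr_gt0//; apply: mono; last by rewrite ge_min lexx orbT.
  by rewrite le_min y2 mulr_ge0 ?exprn_ge0 ?(ltW a0).
elim: N => [|N IH]; first by rewrite big_ord0 divr_ge0 ?powR_ge0 ?(ltW u0).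
rewrite big_ord_recr /=; set t := a * 2 ^+ N in IH *.
have t0 : 0 < t by rewrite mulr_gt0 ?exprn_gt0.
have -> : a * 2 ^+ N.+1 = 2 * t by rewrite exprS mulrCA.
have [ty|yt] := ltP t y; last first.
  rewrite mulr0 addr0; apply: le_trans IH _; rewrite ler_pM2r ?invr_gt0//.
  apply: mono; first by rewrite le_min y2 (ltW t0).
  by rewrite le_min !ge_min lexx orbT andbT; apply/orP; left; rewrite ler_peMl ?(ltW t0)// ler1n.
have ty2 : t <= 2 * y by apply: le_trans (ltW ty) _; rewrite ler_peMl// ler1n.
have -> : Num.min (2 * t) (2 * y) = 2 * t by apply/min_idPl; rewrite ler_pM2l ?(ltW ty).
rewrite (min_idPl ty2) in IH; rewrite mulr1 powRM ?(ltW t0)//.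
apply: (@le_trans _ _ (t `^ s / u + t `^ s)); first by rewrite lerD2r.
by rewrite le_eqVlt; apply/orP; left; apply/eqP; rewrite /u; field; rewrite gt_eqF.
Qed.

End real_powers.

Section levels.
Context {R : realType} {n : nat}.
Hypothesis n0 : (0 < n)%N.
Local Notation V := 'rV[R]_n.
Local Notation mu := (@lebesgue_rV R n).
Implicit Types (x y u : V) (f G : V -> R) (r s t e p c : R) (k m N : nat).

(** A pointwise cover by countably many functions stands in for a countable
    decomposition of the domain. *)
Lemma series_cover (g : V -> R) (F : nat -> V -> R) B :
  measurable_fun setT g -> (forall y, 0 <= g y) ->
  (forall k, measurable_fun setT (F k)) -> (forall k y, 0 <= F k y) ->
  (\forall y \ae mu, exists k, g y <= F k y) ->
  (forall N, (\sum_(k < N) \int[mu]_y (F k y)%:E <= B)%E) -> (\int[mu]_y (g y)%:E <= B)%E.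
Proof.
move=> mg g0 mF F0 cov hB.
have F0' k y : (0 <= (F k y)%:E)%E by rewrite lee_fin.
have mFE k : measurable_fun setT (fun y => (F k y)%:E) by have := mF k => ?; mfun.
apply: (@le_trans _ _ (\int[mu]_y (\sum_(0 <= k <oo) (F k y)%:E))%E).
  apply: ae_ge0_le_integral; first exact: measurableT.
  - by move=> y _; rewrite lee_fin.
  - by mfun.
  - by move=> y _; apply: nneseries_ge0 => k _ _; exact: F0'.
  - apply: ge0_emeasurable_sum => [k y _ _|k _]; [exact: F0'|exact: mFE].
  apply: filterS cov => y [k gk] _.
  apply: (@le_trans _ _ (F k y)%:E); first by rewrite lee_fin.
  apply: le_trans (nneseries_lim_ge k.+1 _); last by move=> ? _ _; exact: F0'.
  rewrite big_nat_recr//= leeDr// sume_ge0// => ? _; exact: F0'.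
rewrite integral_nneseries//; apply: nneseries_le_bound => [k|N]; last exact: hB.
by apply: integral_ge0 => y _; exact: F0'.
Qed.

Lemma int_balls G B : measurable_fun setT G -> (forall x, 0 <= G x) ->
  (forall k, (\int[mu]_x ((`|x| <= k%:R)%R%:R * G x)%:E <= B)%E) -> (\int[mu]_x (G x)%:E <= B)%E.
Proof.
move=> mG G0 hB; pose g k x := ((`|x| <= k%:R)%R%:R * G x)%:E.
have mg k : measurable_fun setT (g k) by rewrite /g; mfun.
have g0 k x : setT x -> (0 <= g k x)%E by rewrite lee_fin mulr_ge0.
have gi x : setT x -> {homo g^~ x : a b / (a <= b)%N >-> (a <= b)%E}.
  move=> _ a b ab; rewrite lee_fin ler_wpM2r//.
  case: (boolP (`|x| <= a%:R)) => // h; suff -> : `|x| <= b%:R by [].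
  by apply: le_trans h _; rewrite ler_nat.
have gl x : limn (g^~ x) = (G x)%:E.
  apply: cvg_lim => //; apply: cvg_near_cst; near=> k; rewrite /g.
  suff -> : `|x| <= k%:R by rewrite mul1r.
  near: k; exists (Num.truncn `|x|).+1 => // k /= hk; apply: le_trans (ltW (truncnS_gt _)) _.
  by rewrite ler_nat.
have h := @cvg_monotone_convergence _ _ _ mu _ measurableT _ mg g0 gi.
have -> : (\int[mu]_x (G x)%:E = \int[mu]_x limn (g^~ x))%E.
  by apply: eq_integral => x _; rewrite gl.
rewrite -(cvg_lim _ h)//; apply: lime_le; first by apply/cvg_ex; eexists; exact: h.
by apply: nearW => k; exact: hB.
Unshelve. all: by end_near. Qed.

Section strong.
Variables (p c S : R) (f G : V -> R).
Hypotheses (p1 : 1 < p) (c0 : 0 < c) (mf : measurable_fun setT f).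
Hypothesis hS : (\int[mu]_x (`|f x| `^ p)%:E <= S%:E)%E.
Let lv t := fun x => (t < `|f x|)%R%:R * `|f x|.

Let mlv t : measurable_fun setT (lv t). Proof. by rewrite /lv; mfun. Qed.
Let lv0 t x : 0 <= lv t x. Proof. by rewrite mulr_ge0. Qed.

Let lv_le t : 0 < t -> (\int[mu]_x (lv t x)%:E <= (S / t `^ (p - 1))%:E)%E.
Proof.
move=> t0; have i0 : 0 <= (t `^ (p - 1))^-1 by rewrite invr_ge0 powR_ge0.
apply: (@le_trans _ _ (((t `^ (p - 1))^-1)%:E * \int[mu]_x (`|f x| `^ p)%:E)%E); last first.
  by rewrite [leRHS]EFinM [leRHS]muleC; apply: lee_wpmul2l.
rewrite -nnZ//; last by mfun.
apply: nn_le => [||x]; [exact: mlv|by mfun|]; rewrite lv0 /= /lv.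
have [h|h] := ltP t `|f x|; last by rewrite mul0r mulr_ge0 ?powR_ge0.
by rewrite mul1r mulrC; exact: large_le.
Qed.

(** Chebyshev's inequality, deduced from the weak type bound at height [t]. *)
Lemma level_small t (W : set V) : 0 < t ->
  (mu W <= (c / t)%:E * \int[mu]_x (lv t x)%:E)%E -> (mu W <= (c * S / t `^ p)%:E)%E.
Proof.
move=> t0 h; apply: le_trans h _.
have ct : (0 <= (c / t)%:E)%E by rewrite lee_fin divr_ge0 ?(ltW c0) ?(ltW t0).
apply: le_trans (lee_wpmul2l ct (lv_le t0)) _; rewrite -EFinM lee_fin.
rewrite -(powR_pred p1 (ltW t0)) le_eqVlt; apply/orP; left; apply/eqP; field.
by rewrite gt_eqF//= gt_eqF// powR_gt0.
Qed.

Let S0 : 0 <= S.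
Proof.
by rewrite -lee_fin; apply: le_trans hS; apply: integral_ge0 => x _; rewrite lee_fin powR_ge0.
Qed.

Lemma level_level e : 0 < e -> exists2 m, 0 < m & forall t, m <= t -> c * S / t `^ p <= e.
Proof.
move=> e0; exists (c * S / e + 1).
  by rewrite ltr_wpDl// divr_ge0 ?mulr_ge0 ?(ltW c0) ?(ltW e0).
move=> t ht; have q0 : 0 <= c * S / e by rewrite divr_ge0 ?mulr_ge0 ?(ltW c0) ?(ltW e0).
have t1 : 1 <= t by apply: le_trans ht; rewrite lerDr.
have t0 : 0 < t by exact: lt_le_trans ltr01 t1.
rewrite ler_pdivrMr ?powR_gt0// [leRHS]mulrC -ler_pdivrMr//.
apply: le_trans (_ : t <= _); first by apply: le_trans ht; rewrite lerDl.
by rewrite -{1}(powRr1 (ltW t0)) ler_powR// ltW.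
Qed.

Hypotheses (mG : measurable_fun setT G) (G0 : forall x, 0 <= G x).
Hypothesis hW : forall t, 0 < t -> exists W, [/\ measurable W,
  (mu W <= (c / t)%:E * \int[mu]_x (lv t x)%:E)%E & forall x, ~ W x -> G x <= c * t `^ p].

Let D := c * c * 2 `^ p * (2 `^ (p - 1) / (2 `^ (p - 1) - 1)).

Let strong_ball r a : 0 < r -> 0 < a ->
  (\int[mu]_x ((`|x| <= r)%R%:R * G x)%:E <= (c * a `^ p * (2 * r) ^+ n + D * S)%:E)%E.
Proof.
move=> r0 a0.
have ex k : exists W, [/\ measurable W, (mu W <= (c / (a * 2 ^+ k))%:E * \int[mu]_x (lv (a * 2 ^+ k) x)%:E)%E &
   forall x, ~ W x -> G x <= c * (a * 2 ^+ k) `^ p].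
  by apply: hW; rewrite mulr_gt0 ?exprn_gt0.
have [w hw] := choice ex.
have mw k : measurable (w k) by case: (hw k).
have lk0 k : 0 < a * 2 ^+ k by rewrite mulr_gt0 ?exprn_gt0.
pose F k x : R := if k is j.+1 then c * (a * 2 ^+ j.+1) `^ p * \1_(w j) x
  else c * a `^ p * (`|x| <= r)%R%:R.
(* A point that lies in some but not all of the [w k], off the first one, leaves
   them between two consecutive levels. *)
have null : mu.-negligible (\bigcap_k w k).
  apply: negligible_small => e e0; have [m m0 hm] := level_level e0.
  exists (w (Num.truncn (m / a)).+1); split; [exact: mw| |].
    case: (hw (Num.truncn (m / a)).+1) => _ h _; apply: le_trans (level_small (lk0 _) h) _.
    rewrite lee_fin; apply: hm; rewrite -ler_pdivrMl// mulrC.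
    apply: le_trans (ltW (truncnS_gt _)) _.
    by rewrite -natrX ler_nat ltnW// ltn_expl.
  by exists set0; [exact: negligible_set0|move=> x hx; right; exact: hx].
apply: (@series_cover _ F).
- by mfun.
- by move=> x; rewrite mulr_ge0.
- case=> [|j]; rewrite /F; first by mfun.
  apply: measurable_funM; first by mfun.
  exact: measurable_indic.
- case=> [|j] x; rewrite /F mulr_ge0// mulr_ge0 ?powR_ge0 ?(ltW c0)//.
- apply: negligibleS null => x /= nx; apply: contrapT => nw; apply: nx.
  have [xr|xr] := leP `|x| r; last first.
    by exists 0%N; rewrite mul0r /F mulr_ge0// mulr_ge0 ?powR_ge0 ?(ltW c0).
  have exk : exists k, ~~ `[< w k x >].
    apply: contrapT => h; apply: nw => k _; apply: contrapT => h2; apply: h.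
    by exists k; apply/negP => /asboolP.
  case: (ex_minnP exk) => k /asboolPn hk min.
  have Gk : G x <= c * (a * 2 ^+ k) `^ p by case: (hw k) => _ _; apply.
  exists k; rewrite mul1r /F; case: k hk min Gk => [|k] hk min Gk.
    by rewrite xr mulr1; rewrite expr0 mulr1 in Gk.
  suff -> : \1_(w k) x = 1 :> R by rewrite mulr1.
  rewrite indicE mem_set//; apply: contrapT => h.
  by move/asboolPn: h => /min; rewrite ltnn.
- move=> N; apply: (@le_trans _ _ (\sum_(k < N.+1) \int[mu]_y (F k y)%:E)%E).
    rewrite big_ord_recr /= leeDl//; apply: integral_ge0 => x _; rewrite lee_fin /F.
    by case: N => [|N]; rewrite mulr_ge0// mulr_ge0 ?powR_ge0 ?(ltW c0).
  rewrite big_ord_recl /= EFinD; apply: leeD.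
    rewrite nnZ ?mulr_ge0 ?powR_ge0 ?(ltW c0)//; last by mfun.
    have := int_near (0 : V) (ltW r0); under eq_integral => y _ do rewrite sub0r normrN.
    by move=> ->; rewrite -EFinM.
  pose H k x := c * c * 2 `^ p * ((a * 2 ^+ k) `^ (p - 1) * lv (a * 2 ^+ k) x).
  have cc : 0 <= c * c * 2 `^ p by rewrite !mulr_ge0 ?powR_ge0 ?(ltW c0).
  have mH k : measurable_fun setT (H k) by have := mlv (a * 2 ^+ k) => ?; rewrite /H; mfun.
  have H0 k x : 0 <= H k x by rewrite !mulr_ge0 ?powR_ge0 ?(ltW c0) ?lv0.
  apply: (@le_trans _ _ (\sum_(k < N) \int[mu]_x (H k x)%:E)%E).
    apply: lee_sum => k _; rewrite /F /= /bump /= ?add0n nnZ; first last.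
    - by move=> x; rewrite indicE.
    - exact: measurable_indic.
    - by rewrite mulr_ge0 ?powR_ge0 ?(ltW c0).
    rewrite integral_indic// setIT.
    have cp : (0 <= (c * (a * 2 ^+ k.+1) `^ p)%:E)%E by rewrite lee_fin mulr_ge0 ?powR_ge0 ?(ltW c0).
    case: (hw k) => _ h _; apply: le_trans (lee_wpmul2l cp h) _.
    rewrite muleA -EFinM nnZ//; first last.
    - by move=> x; rewrite mulr_ge0 ?powR_ge0 ?lv0.
    - by have := mlv (a * 2 ^+ k) => ?; mfun.
    rewrite nnZ ?powR_ge0//.
    rewrite muleA -EFinM le_eqVlt; apply/orP; left; apply/eqP; congr (_%:E * _)%E.
    have -> : a * 2 ^+ k.+1 = 2 * (a * 2 ^+ k) by rewrite exprS mulrCA.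
    rewrite (@powRM _ 2) ?(ltW (lk0 k))// -(powR_pred p1 (ltW (lk0 k))); field.
    by rewrite expf_neq0 ?pnatr_eq0//= gt_eqF.
  rewrite -ge0_integral_sum//; [|by move=> k; have := mH k => ?; mfun|by move=> k x _; rewrite lee_fin].
  have D0 : 0 <= D.
    rewrite /D mulr_ge0// divr_ge0 ?powR_ge0// subr_ge0 {1}(_ : 1 = 1 `^ (p - 1)); last by rewrite powR1.
    by apply: ge0_ler_powR; rewrite ?nnegrE ?subr_ge0 ?(ltW p1) ?ler1n.
  apply: (@le_trans _ _ (D%:E * \int[mu]_x (`|f x| `^ p)%:E)%E); last first.
    by rewrite [leRHS]EFinM; apply: lee_wpmul2l.
  rewrite -nnZ//; last by mfun.
  rewrite (eq_integral (fun x => (\sum_(k < N) H k x)%:E)) => [|x _]; last by rewrite sumEFin.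
  apply: nn_le => [||x]; [by apply: measurable_sum => k|by mfun|].
  apply/andP; split; first by rewrite sumr_ge0.
  rewrite /H -mulr_sumr /D -[leRHS]mulrA ler_wpM2l//.
  have p10 : 0 < p - 1 by rewrite subr_gt0.
  have := level_sum N a0 p10 (normr_ge0 (f x)); rewrite powRM// => hs.
  rewrite -(powR_pred p1 (normr_ge0 (f x))).
  rewrite [leRHS](_ : _ = 2 `^ (p - 1) * `|f x| `^ (p - 1) / (2 `^ (p - 1) - 1) * `|f x|); last by ring.
  apply: le_trans (ler_wpM2r (normr_ge0 (f x)) hs); rewrite mulr_suml.
  by apply: ler_sum => k _; rewrite /lv mulrA.
Qed.

(** Marcinkiewicz interpolation in the form needed here: [G] is at most [c t^p] off a set
    whose measure is controlled by the part of [f] above the height [t]. *)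
Lemma strong_of_levels : (\int[mu]_x (G x)%:E <= (D * S)%:E)%E.
Proof.
apply: int_balls => // k; apply/lee_addgt0Pr => e e0.
apply: (@le_trans _ _ (\int[mu]_x ((`|x| <= k.+1%:R)%R%:R * G x)%:E)%E).
  apply: nn_le => [||x]; [by mfun|by mfun|]; rewrite mulr_ge0//= ler_wpM2r//.
  case: (boolP (`|x| <= k%:R)) => // h; suff -> : `|x| <= k.+1%:R by [].
  by apply: le_trans h _; rewrite ler_nat.
have p0 : 0 < p by apply: lt_trans p1.
(* The lowest level is chosen to contribute exactly [e] on the ball. *)
set Z := c * (2 * k.+1%:R) ^+ n; have Z0 : 0 < Z by rewrite mulr_gt0 ?exprn_gt0 ?mulr_gt0.
have a0 : 0 < (e / Z) `^ p^-1 by apply: powR_gt0; exact: divr_gt0.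
apply: le_trans (strong_ball (ltr0Sn _ _) a0) _; rewrite -EFinD lee_fin addrC lerD2l.
rewrite -powRrM mulVf ?gt_eqF// powRr1 ?divr_ge0 ?(ltW e0) ?(ltW Z0)//.
rewrite le_eqVlt; apply/orP; left; apply/eqP; rewrite -/Z.
have -> : c * (e / Z) * (2 * k.+1%:R) ^+ n = Z * (e / Z) by rewrite /Z; ring.
by rewrite mulrC divfK// gt_eqF.
Qed.

End strong.
End levels.

Section riesz.
Context {R : realType} {n : nat}.
Hypothesis n0 : (0 < n)%N.
Local Notation V := 'rV[R]_n.
Local Notation mu := (@lebesgue_rV R n).
Implicit Types (x y u : V) (f h : V -> R) (r s t e p q c A B N : R) (k m : nat).
Variable gam : R.
Hypothesis gam0n : 0 < gam < n%:R.

(** The Riesz kernel for the sup norm, which dominates the Euclidean one. *)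
Definition rk x y : R := `|x - y| `^ (gam - n%:R).

Lemma rk_ge0 x y : 0 <= rk x y. Proof. exact: powR_ge0. Qed.

Lemma mker_rk : mker rk. Proof. by rewrite /mker /rk; mfun. Qed.

Lemma measurable_rk x : measurable_fun setT (rk x).
Proof. exact: mker1 mker_rk. Qed.

Lemma rk_diag x : rk x x = 0.
Proof.
rewrite /rk subrr normr0 powR0// subr_eq0 lt_eqF//; by case/andP: gam0n.
Qed.

Definition riesz f x : \bar R := \int[mu]_y (rk x y * `|f y|)%:E.

(** Summation over annuli, inwards for [t = 1/2] and outwards for [t = 2]. *)
Lemma dyadic A s r t h (D : V -> bool) x : measurable_fun setT h -> (forall y, 0 <= h y) ->
  measurable_fun setT D -> 0 <= A -> 0 < r -> 0 < t -> t `^ (gam - n%:R + s) < 1 ->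
  (forall b, 0 < b -> (\int[mu]_y ((`|x - y| <= b)%R%:R * h y)%:E <= (A * b `^ s)%:E)%E) ->
  (forall y, D y -> 0 < `|x - y| -> exists k, r * t ^+ k / 2 < `|x - y| <= r * t ^+ k) ->
  (\int[mu]_y (rk x y * ((D y)%:R * h y))%:E <=
    (A * 2 `^ (n%:R - gam) * r `^ (gam - n%:R + s) / (1 - t `^ (gam - n%:R + s)))%:E)%E.
Proof.
move=> mh h0 mD A0 r0 t0 q1 hA hD; set w := gam - n%:R + s in q1 *.
have mrk := measurable_rk x; set q := t `^ w in q1 *.
have b0 k : 0 < r * t ^+ k by rewrite mulr_gt0 ?exprn_gt0.
pose F k y := (r * t ^+ k / 2) `^ (gam - n%:R) * ((`|x - y| <= r * t ^+ k)%R%:R * h y).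
apply: (@series_cover _ _ _ F).
- by mfun.
- by move=> y; rewrite !mulr_ge0 ?rk_ge0.
- by move=> k; rewrite /F; mfun.
- by move=> k y; rewrite /F !mulr_ge0 ?powR_ge0.
- apply: aeW => y; have [xy|xy] := eqVneq x y.
    by exists 0%N; rewrite xy rk_diag mul0r /F !mulr_ge0 ?powR_ge0.
  have d0 : 0 < `|x - y| by rewrite normr_gt0 subr_eq0.
  have [Dy|Dy] := boolP (D y); last by exists 0%N; rewrite mul0r mulr0 /F !mulr_ge0 ?powR_ge0.
  have [k /andP[h1 h2]] := hD y Dy d0; exists k; rewrite /F h2 ler_wpM2r ?mulr_ge0//.
  apply: powR_le_neg (ltW h1) _; first by rewrite divr_gt0.
  by rewrite subr_le0 ltW//; case/andP: gam0n.
have Ck k : (r * t ^+ k / 2) `^ (gam - n%:R) * (A * (r * t ^+ k) `^ s) =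
    A * 2 `^ (n%:R - gam) * r `^ w * q ^+ k.
  rewrite powRM ?(ltW (b0 k))// powRV// opprB /q -(powR_exp _ _ (ltW t0)).
  rewrite -[RHS]mulrA -powRM ?(ltW r0) ?exprn_ge0 ?(ltW t0)// /w (powRD_pos (gam - n%:R) s (b0 k)); ring.
have c0 : 0 <= A * 2 `^ (n%:R - gam) * r `^ w by rewrite !mulr_ge0 ?powR_ge0.
move=> N; apply: (@le_trans _ _ (\sum_(k < N) (A * 2 `^ (n%:R - gam) * r `^ w * q ^+ k)%:E)%E).
  apply: lee_sum => k _; rewrite -Ck /F nnZ ?powR_ge0//; first last.
  - by move=> y; rewrite mulr_ge0.
  - by mfun.
  have e0 : (0 <= ((r * t ^+ k / 2) `^ (gam - n%:R))%:E)%E by rewrite lee_fin powR_ge0.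
  by rewrite [leRHS]EFinM; apply: lee_wpmul2l => //; apply: hA.
rewrite sumEFin lee_fin -mulr_sumr ler_wpM2l//.
by apply: geo_le; rewrite q1 powR_ge0.
Qed.

Lemma half_powR e : 0 < e -> (2^-1 : R) `^ e < 1.
Proof.
move=> e0; have h1 : 1 = 1 `^ e :> R by rewrite powR1.
by rewrite [ltRHS]h1; apply: gt0_ltr_powR => //; rewrite ?nnegrE// invf_lt1// ltr1n.
Qed.

Lemma riesz_near : exists2 C, 0 < C & forall f x t r, measurable_fun setT f -> 0 < t -> 0 < r ->
  (forall b, 0 < b -> (\int[mu]_y ((`|x - y| <= b)%R%:R * `|f y|)%:E <= (t * b ^+ n)%:E)%E) ->
  (\int[mu]_y (rk x y * ((`|x - y| <= r)%R%:R * `|f y|))%:E <= (C * (t * r `^ gam))%:E)%E.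
Proof.
have [g0 gn] := andP gam0n; have h1 := half_powR g0.
exists (2 `^ (n%:R - gam) / (1 - 2^-1 `^ gam)).
  by rewrite divr_gt0 ?powR_gt0// subr_gt0.
move=> f x t r mf t0 r0 hb.
have wE : gam - n%:R + n%:R = gam by rewrite subrK.
have := @dyadic t n%:R r 2^-1 (fun y => `|f y|) (fun y => `|x - y| <= r) x.
rewrite wE => H; apply: (@le_trans _ _ (t * 2 `^ (n%:R - gam) * r `^ gam / (1 - 2^-1 `^ gam))%:E).
  apply: H => //; [by mfun|by mfun|exact: ltW| |].
    by move=> b b0; rewrite powR_mulrn ?(ltW b0)//; exact: hb.
  by move=> y h d0; exact: near_scale.
by rewrite lee_fin le_eqVlt; apply/orP; left; apply/eqP; ring.
Qed.

(** Without suprema, the Morrey condition composes with pointwise estimates. *)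
Definition mor p lam N f := forall x r, 0 < r ->
  (\int[mu]_y ((`|x - y| <= r)%R%:R * `|f y| `^ p)%:E <= (N `^ p * (2 * r) `^ (n%:R + lam * p))%:E)%E.

Lemma le_young p c (y : R) : 1 < p -> 0 < c -> 0 <= y -> y <= c + y `^ p / c `^ (p - 1).
Proof.
move=> p1 c0 y0; have [h|h] := ltP c y.
  by apply: le_trans (large_le p1 c0 y0 h) _; rewrite lerDr ltW.
by apply: le_trans h _; rewrite lerDl divr_ge0 ?powR_ge0.
Qed.

(** Hoelder's inequality on a cube, by Young's inequality at the optimal height. *)
Lemma mor_avg p lam N f x r : 1 < p -> measurable_fun setT f -> 0 < N -> mor p lam N f -> 0 < r ->
  (\int[mu]_y ((`|x - y| <= r)%R%:R * `|f y|)%:E <= (2 * N * (2 * r) `^ (n%:R + lam))%:E)%E.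
Proof.
move=> p1 mf N0 hf r0; have b0 : 0 < 2 * r by rewrite mulr_gt0.
set c := N * (2 * r) `^ lam; have c0 : 0 < c by rewrite mulr_gt0 ?powR_gt0.
have i0 : 0 <= (c `^ (p - 1))^-1 by rewrite invr_ge0 powR_ge0.
apply: (@le_trans _ _ (c%:E * \int[mu]_y (`|x - y| <= r)%R%:R%:E +
   ((c `^ (p - 1))^-1)%:E * \int[mu]_y ((`|x - y| <= r)%R%:R * `|f y| `^ p)%:E)%E).
  rewrite -nnZ ?(ltW c0)//; [|by mfun]; rewrite -nnZ//; [|by mfun].
  rewrite -nnD; [|by mfun|by mfun|by move=> y; rewrite mulr_ge0 ?(ltW c0)|
    by move=> y; rewrite !mulr_ge0 ?powR_ge0].
  apply: nn_le => [||y]; [by mfun|by mfun|]; rewrite mulr_ge0//=.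
  case: (`|x - y| <= r); last by rewrite !mul0r !mulr0 addr0.
  rewrite !mul1r mulr1 [X in _ + X]mulrC; exact: le_young.
rewrite int_near ?(ltW r0)//.
apply: (@le_trans _ _ ((c * (2 * r) ^+ n)%:E + (c `^ (p - 1))^-1%:E * (N `^ p * (2 * r) `^ (n%:R + lam * p))%:E)%E).
  by rewrite EFinM; apply: leeD => //; apply: lee_wpmul2l; [rewrite lee_fin|exact: hf].
rewrite -EFinM -EFinD lee_fin le_eqVlt; apply/orP; left; apply/eqP.
have -> : N `^ p * (2 * r) `^ (n%:R + lam * p) = c `^ p * (2 * r) ^+ n.
  by rewrite /c (@powRM _ N) ?(ltW N0) ?powR_ge0// -powRrM (powRD_pos _ _ b0) powR_mulrn ?(ltW b0)//; ring.
rewrite -(powR_pred p1 (ltW c0)) (powRD_pos _ _ b0) powR_mulrn ?(ltW b0)//.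
have -> : 2 * N * ((2 * r) ^+ n * (2 * r) `^ lam) = 2 * c * (2 * r) ^+ n by rewrite /c; ring.
by field; rewrite gt_eqF ?powR_gt0.
Qed.

Lemma riesz_far lam : gam + lam < 0 -> exists2 C, 0 < C & forall p N f x r, 1 < p ->
  measurable_fun setT f -> 0 < N -> mor p lam N f -> 0 < r ->
  (\int[mu]_y (rk x y * ((r < `|x - y|)%R%:R * `|f y|))%:E <= (C * (N * r `^ (gam + lam)))%:E)%E.
Proof.
move=> gl; set s := n%:R + lam; have wE : gam - n%:R + s = gam + lam by rewrite /s; ring.
have q1 : 2 `^ (gam + lam) < 1 :> R.
  rewrite -(opprK (gam + lam)) -powRV// half_powR//; by rewrite oppr_gt0.
exists (2 * 2 `^ s * 2 `^ (n%:R - gam) * 2 `^ (gam + lam) / (1 - 2 `^ (gam + lam))).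
  by rewrite divr_gt0 ?subr_gt0// !mulr_gt0 ?powR_gt0.
move=> p N f x r p1 mf N0 hf r0.
have := @dyadic (2 * N * 2 `^ s) s (2 * r) 2 (fun y => `|f y|) (fun y => r < `|x - y|) x.
rewrite wE => H; apply: le_trans (H _ _ _ _ _ _ _ _ _) _ => //.
- by mfun.
- by mfun.
- by rewrite !mulr_ge0 ?powR_ge0 ?(ltW N0).
- by rewrite mulr_gt0.
- move=> b b0; apply: le_trans (mor_avg x p1 mf N0 hf b0) _.
  by rewrite lee_fin -/s (@powRM _ 2 b) ?(ltW b0)// -!mulrA.
- by move=> y h d0; exact: far_scale.
rewrite lee_fin (@powRM _ 2 r) ?(ltW r0)// le_eqVlt; apply/orP; left; apply/eqP; ring.
Qed.

Lemma riesz_split f x r : measurable_fun setT f -> riesz f x =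
  (\int[mu]_y (rk x y * ((`|x - y| <= r)%R%:R * `|f y|))%:E +
   \int[mu]_y (rk x y * ((r < `|x - y|)%R%:R * `|f y|))%:E)%E.
Proof.
move=> mf; have mrk := measurable_rk x; rewrite -nnD.
- apply: eq_integral => y _; congr EFin; rewrite -mulrDr -mulrDl.
  by have [h|h] := leP `|x - y| r; rewrite ?addr0 ?add0r mul1r.
- by mfun.
- by mfun.
- by move=> y; rewrite !mulr_ge0 ?rk_ge0.
- by move=> y; rewrite !mulr_ge0 ?rk_ge0.
Qed.

Lemma riesz_ge0 f x : (0 <= riesz f x)%E.
Proof. by apply: integral_ge0 => y _; rewrite lee_fin mulr_ge0 ?rk_ge0. Qed.

Lemma mker_riesz f : measurable_fun setT f -> mker (fun x y => rk x y * `|f y|).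
Proof. by move=> mf; apply: mkerM; [exact: mker_rk|mfun]. Qed.

(** The radius balances the near part, bounded by the height [t], and the far part,
    bounded by the norm [N]. *)
Lemma hls_powers p q (N t : R) : 0 < p -> 0 < q -> q^-1 = p^-1 - gam / n%:R -> 0 < N -> 0 < t ->
  let r := (N / t) `^ (p / n%:R) in
  N * r `^ (gam - n%:R / p) = t * r `^ gam /\ (t * r `^ gam) `^ q = N `^ (q - p) * t `^ p.
Proof.
move=> p0 q0 hq N0 t0 r; have [g0 gn] := andP gam0n; have nR : 0 < n%:R :> R by exact: lt_trans gn.
have Nt : 0 < N / t by rewrite divr_gt0.
have r0 : 0 < r by apply: powR_gt0.
have E1 : r `^ (- (n%:R / p)) = t / N.
  rewrite -powRrM (_ : p / n%:R * - (n%:R / p) = - 1); last by field; rewrite !gt_eqF.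
  by rewrite powR_inv1 ?(ltW Nt)// invf_div.
split.
  by rewrite (powRD_pos _ _ r0) E1; field; rewrite gt_eqF.
rewrite powRM ?(ltW t0) ?powR_ge0// -!powRrM.
have -> : p / n%:R * (gam * q) = q - p.
  have -> : gam = (p^-1 - q^-1) * n%:R by rewrite hq; field; rewrite !gt_eqF.
  by field; rewrite !gt_eqF.
rewrite powRM ?(ltW N0) ?invr_ge0 ?(ltW t0)// powRV ?(ltW t0)// opprB.
rewrite mulrCA -(powRD_pos _ _ t0); congr (_ * _ `^ _); ring.
Qed.

(** Hedberg's inequality at every height [t], then interpolation. *)
Theorem hls p q : 1 < p -> 0 < q -> q^-1 = p^-1 - gam / n%:R -> exists2 C, 0 < C &
  forall N f, 0 < N -> measurable_fun setT f -> (\int[mu]_x (`|f x| `^ p)%:E <= (N `^ p)%:E)%E ->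
  (\forall x \ae mu, (riesz f x < +oo)%E) /\
  (\int[mu]_x (fine (riesz f x) `^ q)%:E <= (C * N `^ q)%:E)%E.
Proof.
move=> p1 q0 hq; have p0 : 0 < p by exact: lt_trans p1.
have [g0 gn] := andP gam0n; have nR : 0 < n%:R :> R by exact: lt_trans gn.
have gl : gam + - (n%:R / p) < 0.
  have -> : gam + - (n%:R / p) = - (n%:R / q) by rewrite hq; field; rewrite !gt_eqF.
  by rewrite oppr_lt0 divr_gt0.
have [C1 C10 near] := riesz_near; have [C2 C20 far] := riesz_far gl.
pose K := C1 * (2 * 8 ^+ n) + C2; have K0 : 0 < K by rewrite addr_gt0// mulr_gt0// mulr_gt0// exprn_gt0.
pose c := 4 ^+ n + K `^ q.
have c0 : 0 < c by rewrite addr_gt0// ?exprn_gt0// powR_gt0.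
exists (c * c * 2 `^ p * (2 `^ (p - 1) / (2 `^ (p - 1) - 1))).
  rewrite !mulr_gt0 ?powR_gt0// invr_gt0 subr_gt0 {1}(_ : 1 = 1 `^ (p - 1)); last by rewrite powR1.
  by apply: gt0_ltr_powR; rewrite ?subr_gt0 ?nnegrE// ltr1n.
move=> N f N0 mf hN; have Np := powR_gt0 p N0.
have mor_f : mor p (- (n%:R / p)) N f.
  move=> x r r0; have -> : n%:R + - (n%:R / p) * p = 0 by field; rewrite gt_eqF.
  rewrite powRr0 mulr1; apply: le_trans hN; apply: nn_le => [||y]; [by mfun|by mfun|].
  by rewrite mulr_ge0 ?powR_ge0//=; case: (`|x - y| <= r); rewrite ?mul1r ?mul0r ?powR_ge0.
have lev t : 0 < t -> exists W, [/\ measurable W,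
   (mu W <= (c / t)%:E * \int[mu]_x ((t < `|f x|)%R%:R * `|f x|)%:E)%E &
   forall x, ~ W x -> (riesz f x <= (K * (t * (N / t) `^ (p / n%:R) `^ gam))%:E)%E].
  move=> t0; pose h x := (t < `|f x|)%R%:R * `|f x|.
  have mh : measurable_fun setT h by rewrite /h; mfun.
  have h0 x : 0 <= h x by rewrite mulr_ge0.
  have hfin : (\int[mu]_x (h x)%:E \is a fin_num)%E.
    rewrite ge0_fin_numE; last by apply: integral_ge0 => x _; rewrite lee_fin.
    apply: (@le_lt_trans _ _ ((t `^ (p - 1))^-1%:E * \int[mu]_x (`|f x| `^ p)%:E)%E).
      rewrite -nnZ ?invr_ge0 ?powR_ge0//; [|by mfun].
      apply: nn_le => [||x]; [exact: mh|by mfun|]; rewrite h0 /= /h.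
      have [hh|hh] := ltP t `|f x|; last by rewrite mul0r mulr_ge0 ?invr_ge0 ?powR_ge0.
      by rewrite mul1r mulrC; exact: large_le.
    apply: le_lt_trans (_ : (_ <= ((t `^ (p - 1))^-1 * N `^ p)%:E)%E) (ltry _).
    by rewrite EFinM; apply: lee_wpmul2l; rewrite ?lee_fin ?invr_ge0 ?powR_ge0.
  have hM : (\int[mu]_x (h x)%:E <= (fine (\int[mu]_x (h x)%:E))%:E)%E by rewrite fineK.
  have [W [mW muW offW]] := weak11 n0 mh h0 hM t0.
  exists W; split => //.
    apply: le_trans muW _; rewrite -[in leRHS](fineK hfin) -EFinM lee_fin.
    have -> : 4 ^+ n * fine (\int[mu]_x (h x)%:E) / t = 4 ^+ n * (fine (\int[mu]_x (h x)%:E) / t) by ring.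
    have -> : c / t * fine (\int[mu]_x (h x)%:E) = c * (fine (\int[mu]_x (h x)%:E) / t) by ring.
    rewrite ler_wpM2r//; last by rewrite /c lerDl powR_ge0.
    by rewrite divr_ge0 ?(ltW t0)// fine_ge0//; apply: integral_ge0 => x _; rewrite lee_fin.
  move=> x xW; set r := (N / t) `^ (p / n%:R).
  have r0 : 0 < r by apply: powR_gt0; exact: divr_gt0.
  have t1 : 0 < 2 * 8 ^+ n * t by rewrite !mulr_gt0 ?exprn_gt0.
  have avg b : 0 < b -> (\int[mu]_y ((`|x - y| <= b)%R%:R * `|f y|)%:E <= (2 * 8 ^+ n * t * b ^+ n)%:E)%E.
    move=> b0; apply: (@le_trans _ _ (t%:E * \int[mu]_y (`|x - y| <= b)%R%:R%:E +
        \int[mu]_y ((`|x - y| <= b)%R%:R * h y)%:E)%E).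
      rewrite -nnZ ?(ltW t0)//; [|by mfun].
      rewrite -nnD; [|by mfun|by mfun|by move=> y; rewrite mulr_ge0 ?(ltW t0)|by move=> y; rewrite mulr_ge0].
      apply: nn_le => [||y]; [by mfun|by mfun|]; rewrite mulr_ge0//=.
      case: (`|x - y| <= b); rewrite ?mul0r ?mulr0 ?addr0// !mul1r mulr1 /h.
      by have [hh|hh] := ltP t `|f y|; rewrite ?mul1r ?mul0r ?addr0// lerDr ltW.
    rewrite int_near ?(ltW b0)//; apply: le_trans (leeD (lexx _) (offW x xW b b0)) _.
    rewrite -EFinM -EFinD lee_fin !exprMn.
    have -> : 2 * 8 ^+ n * t * b ^+ n = t * (8 ^+ n * b ^+ n) + t * (8 ^+ n * b ^+ n) by ring.
    rewrite lerD2r ler_wpM2l ?(ltW t0)// ler_wpM2r ?exprn_ge0 ?(ltW b0)// lerXn2r ?nnegrE//.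
    by rewrite ler_nat.
  rewrite (riesz_split x r mf).
  apply: le_trans (leeD (near f x _ r mf t1 r0 avg) (far p N f x r p1 mf N0 mor_f r0)) _.
  have [-> _] := hls_powers p0 q0 hq N0 t0; rewrite -EFinD lee_fin -/r.
  by rewrite le_eqVlt; apply/orP; left; apply/eqP; rewrite /K; ring.
have fin_ae : \forall x \ae mu, (riesz f x < +oo)%E.
  apply: negligible_small => e e0.
  have [m m0 hm] := level_level p1 c0 hN e0.
  have [W [mW muW offW]] := lev m m0; exists W; split => //.
    by apply: le_trans (level_small p1 c0 mf hN m0 muW) _; rewrite lee_fin; exact: hm.
  exists set0; first exact: negligible_set0.
  move=> x /= hx; right; apply: contrapT => xW; apply: hx.
  exact: le_lt_trans (offW x xW) (ltry _).
split=> //; have Nqp := powR_gt0 (q - p) N0.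
have mr : measurable_fun setT (fun x => fine (riesz f x)).
  by apply: measurable_fine_integral; exact: mker_riesz.
pose G x := (N `^ (q - p))^-1 * fine (riesz f x) `^ q.
have G0 x : 0 <= G x by rewrite mulr_ge0 ?invr_ge0 ?powR_ge0.
have mG : measurable_fun setT G by rewrite /G; mfun.
have := @strong_of_levels _ _ p c (N `^ p) f G p1 c0 mf hN mG G0.
move=> H; have {}H := H _.
have -> : (\int[mu]_x (fine (riesz f x) `^ q)%:E = (N `^ (q - p))%:E * \int[mu]_x (G x)%:E)%E.
  rewrite -nnZ ?(ltW Nqp)//; apply: eq_integral => x _; congr EFin.
  by rewrite /G mulrA mulfV ?mul1r// gt_eqF.
have N00 : (0 <= (N `^ (q - p))%:E)%E by rewrite lee_fin ltW.
apply: le_trans (lee_wpmul2l N00 (H _)) _.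
  move=> t t0; have [W [mW muW offW]] := lev t t0; exists W; split => // x xW.
  have [_ hp] := hls_powers p0 q0 hq N0 t0.
  rewrite /G mulrC ler_pdivrMr//; set b := t * _ in hp.
  have b0 : 0 <= b by rewrite mulr_ge0 ?powR_ge0 ?(ltW t0).
  apply: (@le_trans _ _ ((K * b) `^ q)).
    apply: ge0_ler_powR; rewrite ?nnegrE ?(ltW q0) ?fine_ge0 ?riesz_ge0 ?(mulr_ge0 (ltW K0) b0)//.
    rewrite -lee_fin fineK; first exact: offW.
    by rewrite ge0_fin_numE ?riesz_ge0//; exact: le_lt_trans (offW x xW) (ltry _).
  rewrite powRM ?(ltW K0)// hp mulrCA mulrC; rewrite ler_wpM2r ?(ltW Nqp)//.
  rewrite ler_wpM2r ?powR_ge0// /c lerDr exprn_ge0//.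
rewrite -EFinM lee_fin le_eqVlt; apply/orP; left; apply/eqP.
rewrite mulrCA; congr (_ * _); rewrite -(powRD_pos _ _ N0) subrK//.
Qed.

End riesz.

End Riesz.
Import Riesz.

(** * Morrey norms *)

Section morrey_norms.
Context {R : realType} {n : nat}.
Hypothesis n0 : (0 < n)%N.
Local Notation V := 'rV[R]_n.
Local Notation mu := (@lebesgue_rV R n).
Implicit Types (x y u c : V) (f g h : V -> R) (r s t e p q A B N lam : R) (k m : nat).

Lemma powR_le_inv p (a b : R) : 0 < p -> 0 <= a -> 0 <= b -> (a `^ p <= b `^ p) = (a <= b).
Proof.
move=> p0 a0 b0; apply/idP/idP => h; last by apply: ge0_ler_powR; rewrite ?nnegrE ?(ltW p0).
have K t : 0 <= t -> t = (t `^ p) `^ p^-1.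
  by move=> t0; rewrite -powRrM mulfV ?gt_eqF// powRr1.
rewrite (K a a0) (K b b0); apply: ge0_ler_powR; rewrite ?nnegrE ?powR_ge0//.
by rewrite invr_ge0 ltW.
Qed.

Lemma int_cube (F : V -> \bar R) c r : 0 < r ->
  (\int[mu]_(y in cube c r) F y = \int[mu]_y ((`|c - y| <= r)%R%:R%:E * F y))%E.
Proof.
move=> r0; rewrite integral_mkcond cubeE ?(ltW r0)//; apply: eq_integral => y _.
rewrite /patch; case: ifPn => [|/negP]; rewrite inE /=.
  by move=> ->; rewrite mul1e.
by move=> /negP/negbTE ->; rewrite mul0e.
Qed.

Lemma morrey_norm_le p lam N f : 0 < p -> 0 <= N ->
  (morrey_norm p lam f <= N%:E)%E <-> mor p lam N f.
Proof.
move=> p0 N0.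
have H c r : 0 < r -> ((((volume (cube c r) `^ (lam / n%:R))^-1)%:E *
         (((volume (cube c r))^-1)%:E *
          \int[mu]_(y in cube c r) (`|f y| `^ p)%:E) `^ p^-1)%E <= N%:E)%E <->
   (\int[mu]_y ((`|c - y| <= r)%R%:R * `|f y| `^ p)%:E <= (N `^ p * (2 * r) `^ (n%:R + lam * p))%:E)%E.
  move=> r0; have b0 : 0 < 2 * r by rewrite mulr_gt0.
  rewrite int_cube// volume_cube ?(ltW r0)//.
  set I := (\int[mu]_y (_ * _))%E.
  have I0 : (0 <= I)%E.
    by apply: integral_ge0 => y _; rewrite -EFinM lee_fin mulr_ge0 ?powR_ge0.
  have v0 : 0 < (2 * r) ^+ n by rewrite exprn_gt0.
  have vlam : ((2 * r) ^+ n) `^ (lam / n%:R) = (2 * r) `^ lam.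
    rewrite -powR_mulrn ?(ltW b0)// -powRrM; congr (_ `^ _); field.
    by rewrite pnatr_eq0 -lt0n.
  rewrite vlam; have w0 := powR_gt0 lam b0.
  case: I I0 => [a| |] //; rewrite ?lee_fin => I0; last first.
    rewrite mulry gtr0_sg ?invr_gt0// mul1e poweRyr ?invr_neq0 ?gt_eqF//.
    by rewrite mulry gtr0_sg ?invr_gt0// mul1e.
  have va : 0 <= ((2 * r) ^+ n)^-1 * a by rewrite mulr_ge0// invr_ge0 ltW.
  rewrite [X in X <= N]mulrC ler_pdivrMr//.
  rewrite -(@powR_le_inv p) ?powR_ge0 ?mulr_ge0 ?(ltW w0)//.
  rewrite -powRrM mulVf ?gt_eqF// powRr1// (@powRM _ N) ?(ltW w0)// -powRrM.
  rewrite (powRD_pos _ _ b0) powR_mulrn ?(ltW b0)//.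
  suff -> : ((2 * r) ^- n * a <= N `^ p * (2 * r) `^ (lam * p)) =
    (a <= N `^ p * ((2 * r) ^+ n * (2 * r) `^ (lam * p))) by [].
  by rewrite mulrC ler_pdivrMr// -mulrA; congr (_ <= _ * _); rewrite mulrC.
split=> [h c r r0|h].
  apply/(H c r r0); apply: le_trans h; apply: ereal_sup_ubound.
  by exists c, r.
by apply: ge_ereal_sup => z [c [r [r0 ->]]]; apply/(H c r r0); exact: h.
Qed.

Lemma Lnorm_le p N f : 0 < p -> 0 <= N -> measurable_fun setT f ->
  ('N[mu]_(p%:E)[EFin \o f] <= N%:E)%E <-> (\int[mu]_x (`|f x| `^ p)%:E <= (N `^ p)%:E)%E.
Proof.
move=> p0 N0 mf; have pn : p != 0 by rewrite gt_eqF.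
have <- : ('N[mu]_(p%:E)[EFin \o f] `^ p)%E = (\int[mu]_x (`|f x| `^ p)%:E)%E.
  by rewrite poweR_Lnorm//; apply: eq_integral => x _.
have := Lnorm_ge0 mu p%:E (EFin \o f); case: ('N[mu]_(p%:E)[EFin \o f])%E => [a| |] //.
  by rewrite lee_fin => a0; rewrite poweR_EFin !lee_fin powR_le_inv.
by move=> _; rewrite poweRyr.
Qed.

(** For the exponent [- n / p] the power of the radius disappears. *)
Lemma mor_Lp p N f : 0 < p -> measurable_fun setT f ->
  mor p (- (n%:R / p)) N f <-> (\int[mu]_x (`|f x| `^ p)%:E <= (N `^ p)%:E)%E.
Proof.
move=> p0 mf; have eE : n%:R + - (n%:R / p) * p = 0 by field; rewrite gt_eqF.
split=> [h|h x r r0].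
  apply: (int_balls (G := fun x => `|f x| `^ p)) => [|x|k]; [by mfun|exact: powR_ge0|].
  have k0 : 0 < k.+1%:R :> R by [].
  have := h 0 k.+1%:R k0; rewrite eE powRr0 mulr1; apply: le_trans.
  apply: nn_le => [||y]; [by mfun|by mfun|]; rewrite mulr_ge0 ?powR_ge0//= sub0r normrN ler_wpM2r ?powR_ge0//.
  have [hh|//] := leP `|y| k%:R; suff -> : `|y| <= k.+1%:R by [].
  by apply: le_trans hh _; rewrite ler_nat.
rewrite eE powRr0 mulr1; apply: le_trans h; apply: nn_le => [||y]; [by mfun|by mfun|].
by rewrite mulr_ge0 ?powR_ge0//=; case: (`|x - y| <= r); rewrite ?mul1r ?mul0r ?powR_ge0.
Qed.

Lemma powRD_le (a b q : R) : 0 < q -> 0 <= a -> 0 <= b -> (a + b) `^ q <= 2 `^ q * (a `^ q + b `^ q).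
Proof.
move=> q0 a0 b0.
have H (s t : R) : 0 <= s -> s <= t -> (s + t) `^ q <= 2 `^ q * t `^ q.
  move=> s0 st; have t0 := le_trans s0 st.
  rewrite -powRM//; apply: ge0_ler_powR; rewrite ?nnegrE ?addr_ge0 ?mulr_ge0 ?(ltW q0)//.
  by rewrite mulr_natl mulr2n lerD2r.
have [h|h] := leP a b.
  by apply: le_trans (H _ _ a0 h) _; rewrite ler_wpM2l ?powR_ge0// lerDr powR_ge0.
rewrite addrC; apply: le_trans (H _ _ b0 (ltW h)) _.
by rewrite ler_wpM2l ?powR_ge0// lerDl powR_ge0.
Qed.

Variable gam : R.
Hypothesis gam0n : 0 < gam < n%:R.
Local Notation riesz := (@riesz R n gam).
Local Notation rk := (@rk R n gam).

(** On a cube, the potential of the part of [f] in the tripled cube is bounded from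
    [L^p] to [L^q]; the remaining part is bounded pointwise. *)
Theorem riesz_mor p q lam : 1 < p -> 0 < q -> q^-1 = p^-1 - gam / n%:R -> gam + lam < 0 ->
  exists2 C, 0 < C & forall N f, 0 < N -> measurable_fun setT f -> mor p lam N f ->
  (\forall x \ae mu, (riesz f x < +oo)%E) /\ mor q (gam + lam) (C * N) (fun x => fine (riesz f x)).
Proof.
move=> p1 q0 hq gl; have p0 : 0 < p by exact: lt_trans p1.
have [g0 gn] := andP gam0n; have nR : 0 < n%:R :> R by exact: lt_trans gn.
have [C1 C10 hlsC] := hls n0 gam0n p1 q0 hq.
have [C2 C20 far] := riesz_far gam0n gl.
pose e := n%:R / p + lam; pose D := 2 `^ q * (C1 * 3 `^ (e * q) + C2 `^ q).
have D0 : 0 < D by rewrite mulr_gt0 ?powR_gt0// addr_gt0 ?mulr_gt0 ?powR_gt0.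
exists (D `^ q^-1); first exact: powR_gt0.
move=> N f N0 mf hf.
have loc c r : 0 < r -> let f1 y := f y * (`|c - y| <= 3 * r)%R%:R in
   [/\ measurable_fun setT f1, (\int[mu]_x (`|f1 x| `^ p)%:E <= ((N * (2 * (3 * r)) `^ e) `^ p)%:E)%E &
   forall x, `|c - x| <= r -> (riesz f x <= riesz f1 x + (C2 * (N * (2 * r) `^ (gam + lam)))%:E)%E].
  move=> r0 f1; have mf1 : measurable_fun setT f1 by rewrite /f1; mfun.
  have r3 : 0 < 3 * r by rewrite mulr_gt0.
  have b0 : 0 < 2 * (3 * r) by rewrite mulr_gt0.
  have r2 : 0 < 2 * r by rewrite mulr_gt0.
  split=> //.
    have := hf c _ r3; have -> : N `^ p * (2 * (3 * r)) `^ (n%:R + lam * p) = (N * (2 * (3 * r)) `^ e) `^ p.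
      rewrite (@powRM _ N) ?(ltW N0) ?powR_ge0// -powRrM; congr (_ * _ `^ _); rewrite /e; field.
      by rewrite gt_eqF.
    apply: le_trans; rewrite le_eqVlt; apply/orP; left; apply/eqP; apply: eq_integral => y _; congr EFin.
    rewrite /f1; case: (`|c - y| <= 3 * r); rewrite ?mulr1 ?mul1r// mulr0 normr0 mul0r powR0//.
    by rewrite gt_eqF.
  move=> x xr; have mrk := @measurable_rk R n gam x.
  apply: le_trans (leeD (lexx _) (far p N f x (2 * r) p1 mf N0 hf r2)).
  rewrite /Riesz.riesz -nnD; first last.
  - by move=> y; rewrite !mulr_ge0 ?rk_ge0.
  - by move=> y; rewrite !mulr_ge0 ?rk_ge0.
  - by mfun.
  - by mfun.
  apply: nn_le => [||y]; [by mfun|by mfun|]; rewrite mulr_ge0 ?rk_ge0//= -mulrDr ler_wpM2l ?rk_ge0//.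
  rewrite /f1 normrM (ger0_norm (ler0n _ _)).
  have [h|h] := leP `|c - y| (3 * r); first by rewrite mulr1 lerDl mulr_ge0.
  suff -> : 2 * r < `|x - y| by rewrite mul1r lerDr mulr_ge0.
  (* A point of the cube is at distance more than [2 r] from the outside of the
     tripled cube. *)
  rewrite -(ltrD2l r); apply: lt_le_trans (_ : `|c - y| <= _).
    by apply: le_lt_trans h; rewrite le_eqVlt; apply/orP; left; apply/eqP; ring.
  apply: le_trans (lerD xr (lexx _)); apply: le_trans (ler_normD _ _).
  by rewrite addrA subrK.
have fin_ae : \forall x \ae mu, (riesz f x < +oo)%E.
  have : \forall x \ae mu, forall k, `|x| <= k.+1%:R -> (riesz f x < +oo)%E.
    apply/ae_foralln => k; have k0 : 0 < k.+1%:R :> R by [].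
    have [mf1 h1 hx] := loc 0 _ k0.
    have A0 : 0 < N * (2 * (3 * k.+1%:R)) `^ e by rewrite mulr_gt0 ?powR_gt0 ?mulr_gt0.
    have [ff _] := hlsC _ _ A0 mf1 h1; apply: filterS ff => x fx xk.
    have xk' : `|0 - x| <= k.+1%:R by rewrite sub0r normrN.
    by apply: le_lt_trans (hx x xk') _; rewrite lte_add_pinfty// ltry.
  apply: filterS => x h; apply: (h (Num.truncn `|x|)); exact/ltW/truncnS_gt.
split=> // c r r0; have [mf1 h1 hx] := loc c r r0; set f1 := (fun y => _) in mf1 h1 hx.
have b0 : 0 < 2 * r by rewrite mulr_gt0.
have A0 : 0 < N * (2 * (3 * r)) `^ e by rewrite mulr_gt0 ?powR_gt0 ?mulr_gt0.
have [ff hi] := hlsC _ _ A0 mf1 h1.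
set T := C2 * (N * (2 * r) `^ (gam + lam)) in hx.
have T0 : 0 <= T by rewrite !mulr_ge0 ?powR_ge0 ?(ltW C20) ?(ltW N0).
have mJ F : measurable_fun setT F -> measurable_fun setT (fun x => fine (riesz F x)).
  by move=> mF; apply: measurable_fine_integral; exact: mker_riesz.
have mJ1 := mJ _ mf1; have mJf := mJ _ mf.
apply: (@le_trans _ _ (\int[mu]_y (2 `^ q * (fine (riesz f1 y) `^ q + (`|c - y| <= r)%R%:R * T `^ q))%:E)%E).
  apply: ae_ge0_le_integral; first exact: measurableT.
  - by move=> y _; rewrite lee_fin mulr_ge0 ?powR_ge0.
  - by mfun.
  - by move=> y _; rewrite lee_fin mulr_ge0 ?powR_ge0// addr_ge0 ?powR_ge0// mulr_ge0 ?powR_ge0.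
  - by mfun.
  apply: filterS ff => y fy _; rewrite lee_fin.
  have [h|h] := leP `|c - y| r; last by rewrite mul0r mulr_ge0 ?powR_ge0// addr_ge0 ?powR_ge0// mul0r.
  have f10 : 0 <= fine (riesz f1 y) by rewrite fine_ge0 ?riesz_ge0.
  rewrite !mul1r; apply: le_trans (powRD_le q0 f10 T0).
  have f0 : 0 <= fine (riesz f y) by rewrite fine_ge0 ?riesz_ge0.
  rewrite powR_le_inv ?normr_ge0 ?addr_ge0// ger0_norm//.
  have E1 : (riesz f1 y \is a fin_num)%E by rewrite ge0_fin_numE ?riesz_ge0.
  have hh := hx y h; rewrite -(fineK E1) -EFinD in hh.
  rewrite -lee_fin fineK// ge0_fin_numE ?riesz_ge0//; exact: le_lt_trans hh (ltry _).
rewrite nnZ ?powR_ge0//; first last.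
- by move=> y; rewrite addr_ge0 ?mulr_ge0 ?powR_ge0.
- by mfun.
rewrite nnD; first last.
- by move=> y; rewrite mulr_ge0 ?powR_ge0.
- by move=> y; rewrite powR_ge0.
- by mfun.
- by mfun.
have E2 : (\int[mu]_y ((`|c - y| <= r)%R%:R * T `^ q)%:E = (T `^ q * (2 * r) ^+ n)%:E)%E.
  under eq_integral do rewrite mulrC.
  rewrite nnZ ?powR_ge0//; last by mfun.
  by rewrite int_near ?(ltW r0).
have q2 : (0 <= (2 `^ q)%:E :> \bar R)%E by rewrite lee_fin powR_ge0.
rewrite E2; apply: le_trans (lee_wpmul2l q2 (leeD hi (lexx _))) _.
rewrite -EFinD -EFinM lee_fin (@powRM _ (D `^ q^-1) N) ?powR_ge0 ?(ltW N0)// -powRrM mulVf ?gt_eqF// powRr1 ?(ltW D0)//.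
rewrite le_eqVlt; apply/orP; left; apply/eqP.
have eq1 : e * q = n%:R + (gam + lam) * q.
  have -> : e = n%:R * (q^-1 + gam / n%:R) + lam by rewrite hq /e; field; rewrite !gt_eqF.
  by field; rewrite !gt_eqF.
rewrite /T (@powRM _ C2) ?mulr_ge0 ?powR_ge0 ?(ltW C20) ?(ltW N0)//.
rewrite !(@powRM _ N) ?powR_ge0 ?(ltW N0)// -!powRrM -eq1 /D.
have -> : 2 * (3 * r) = 3 * (2 * r) by ring.
rewrite (@powRM _ 3) ?(ltW b0)//.
have -> : (2 * r) `^ (e * q) = (2 * r) `^ ((gam + lam) * q) * (2 * r) ^+ n.
  by rewrite eq1 addrC (powRD_pos _ _ b0) powR_mulrn ?(ltW b0).
by ring.
Qed.

End morrey_norms.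

(** * Measurability of open sets *)

Section open_sets.
Context {R : realType} {n : nat}.
Hypothesis n0 : (0 < n)%N.
Local Notation V := 'rV[R]_n.
Local Notation mu := (@lebesgue_rV R n).
Implicit Types (x y u c : V) (f g h : V -> R) (S U : set V).

Lemma measurable_cells (l : R) S : 0 < l -> (forall x y, S x -> same l x y -> S y) -> measurable S.
Proof.
move=> l0 hS; pose idx x : {ffun 'I_n -> int} := [ffun i => Num.floor (x ord0 i / l)].
have E : S = \bigcup_t [set y | S y /\ idx y = t].
  by apply/seteqP; split=> [y Sy|y [t _ []//]]; exists (idx y).
rewrite E; apply: countable_bigcupT_measurable => [|t]; first exact: countableP.
have [[x [Sx xt]]|no] := pselect (exists x, S x /\ idx x = t).
  have idxP y : (idx y = idx x) <-> same l x y.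
    split=> [h|/forallP h].
      apply/forallP => i; have := congr1 (fun f : {ffun 'I_n -> int} => f i) h.
      by rewrite !ffunE /cell_index => ->.
    apply/ffunP => i; rewrite !ffunE; apply/esym/eqP.
    by have := h i; rewrite /cell_index eqr_int.
  rewrite (_ : [set y | _] = setT `&` (same l x) @^-1` [set true]).
    by apply: measurable_same.
  apply/seteqP; split=> [y [Sy yt]|y [_ /= h]].
    by split=> //=; apply/idxP; rewrite yt.
  by split; [exact: hS h|rewrite -xt; apply/idxP].
rewrite (_ : [set y | _] = set0); first exact: measurable0.
by apply/seteqP; split=> // y /= h; apply: no; exists y.
Qed.

(** An open set is the union of the grid cells it contains. *)
Lemma measurable_open U : open U -> measurable U.
Proof.
move=> oU; pose l k : R := k.+1%:R^-1.
have l0 k : 0 < l k by rewrite invr_gt0.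
have -> : U = \bigcup_k [set x | forall y, same (l k) x y -> U y].
  apply/seteqP; split=> [x Ux|x [k _ /= h]]; last by apply: h; exact: same_refl.
  have /nbhs_normP[e /= e0 he] : nbhs x U by move: oU; rewrite openE; apply.
  have [k hk] : exists k, l k < e.
    exists (Num.truncn e^-1); rewrite /l invf_plt ?posrE//; exact: truncnS_gt.
  exists k => // y h; apply: he => /=; apply: le_lt_trans hk; exact: same_norm.
apply: bigcup_measurable => k _; apply: (measurable_cells (l0 k)) => x y /= h xy z yz.
by apply: h; rewrite (same_eq _ xy).
Qed.

Lemma measurable_open_rays f : (forall a, open [set x | a < f x]) -> measurable_fun setT f.
Proof.
move=> h; apply: (measurability _ (RGenOInfty.measurableE R)).
move=> /= _ [_ [a ->]] <-; rewrite setTI; apply: measurable_open.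
rewrite (_ : _ @^-1` _ = [set x | a < f x]) //.
by apply/seteqP; split=> x /=; rewrite in_itv /= andbT.
Qed.

Lemma holder_sup_norm (b C : R) h : 0 < b -> (forall x y, `|h x - h y| <= C * enorm (x - y) `^ b) ->
  exists2 C', 0 <= C' & forall x y, `|h x - h y| <= C' * `|x - y| `^ b.
Proof.
move=> b0 hC; exists (`|C| * n%:R `^ b); first by rewrite mulr_ge0 ?powR_ge0.
move=> x y; apply: le_trans (hC x y) _; rewrite -mulrA -powRM//.
apply: (@le_trans _ _ (`|C| * enorm (x - y) `^ b)); first by rewrite ler_wpM2r ?powR_ge0// ler_norm.
rewrite ler_wpM2l//; apply: ge0_ler_powR; rewrite ?nnegrE ?enorm_ge0 ?mulr_ge0 ?(ltW b0)//.
exact: enorm_le_norm.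
Qed.

Lemma measurable_holder (b C : R) h : 0 < b -> 0 <= C ->
  (forall x y, `|h x - h y| <= C * `|x - y| `^ b) -> measurable_fun setT h.
Proof.
move=> b0 C0 hC; apply: measurable_open_rays => a; rewrite openE => x /= ax.
apply: (proj2 (nbhs_normP x _)); set e := (h x - a) / (C + 1).
have C1 : 0 < C + 1 by rewrite ltr_wpDl.
have e0 : 0 < e by rewrite divr_gt0// subr_gt0.
exists (e `^ b^-1) => [|y /= xy]; first exact: powR_gt0.
have xe : `|x - y| `^ b < e.
  have -> : e = (e `^ b^-1) `^ b by rewrite -powRrM mulVf ?gt_eqF// powRr1 ?(ltW e0).
  by apply: gt0_ltr_powR; rewrite ?nnegrE ?powR_ge0.
have h1 : h x - h y <= C * `|x - y| `^ b by apply: le_trans (hC x y); exact: ler_norm.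
have h2 : C * `|x - y| `^ b <= C * e by rewrite ler_wpM2l// ltW.
have h3 : (C + 1) * e = h x - a by rewrite /e mulrC divfK// gt_eqF.
have : h x - h y < h x - a.
  by apply: le_lt_trans h1 _; apply: le_lt_trans h2 _; rewrite -h3 ltr_pM2r// ltrDl.
by rewrite ltrD2l ltrN2.
Qed.

(** Removal of the singularity, by dominated convergence along sequences of radii. *)
Lemma cut_lim (g c : V -> R) : L1 mu g -> measurable_fun setT c -> (forall y, 0 <= c y) ->
  (forall y, c y = 0 -> g y = 0) ->
  fine (\int[mu]_y (g y * (e < c y)%R%:R)%:E) @[e --> 0^'+] --> fine (\int[mu]_y (g y)%:E).
Proof.
move=> Lg mc c0 gc; have [mg _] := Lg; apply/cvg_at_rightP => u [u0 ul].
have m1 k : measurable_fun setT (fun y => (g y * (u k < c y)%R%:R)%:E) by mfun.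
have m2 : measurable_fun setT (fun y => (g y)%:E) by mfun.
have c1 : {ae mu, forall y, setT y -> (g y * (u N < c y)%R%:R)%:E @[N --> \oo] --> (g y)%:E}.
  apply: aeW => y _; apply: cvg_near_cst; have [cy|cy] := eqVneq (c y) 0.
    by apply: nearW => k; rewrite (gc y cy) mul0r.
  have cy0 : 0 < c y by rewrite lt_neqAle eq_sym cy c0.
  near=> k; suff -> : u k < c y by rewrite mulr1.
  near: k; exact: (cvgr_lt _ ul).
have ia : mu.-integrable setT (fun y => `|g y|%:E) by apply: L1_int; apply: (L1_dom _ Lg _).1 => [|y]; [by mfun|rewrite normr_id].
have d1 : {ae mu, forall y, forall N, setT y ->
    (`|(g y * (u N < c y)%R%:R)%:E| <= `|g y|%:E)%E}.
  by apply: aeW => y N _; rewrite lee_fin normrM ler_piMr// ger0_norm// lern1 leq_b1.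
have [_ _ h] := dominated_convergence measurableT m1 m2 c1 ia d1.
apply: (@fine_cvg _ _ _ _ (fun N => \int[mu]_y (g y * (u N < c y)%R%:R)%:E)%E).
rewrite fineK; first exact: h.
by apply: integrable_fin_num => //; exact: L1_int Lg.
Unshelve. all: by end_near. Qed.

End open_sets.

(** * Boundedness of the commutator with a Hoelder function *)

Section sufficiency.
Context {R : realType} {n : nat}.
Hypothesis n0 : (0 < n)%N.
Local Notation V := 'rV[R]_n.
Local Notation mu := (@lebesgue_rV R n).
Implicit Types (x y u c : V) (f g : V -> R) (r s t e N : R).
Variables (alpha beta p q lam M Cb : R) (O h : V -> R).
Hypotheses (alpha0 : 0 <= alpha) (beta0 : 0 < beta) (abn : alpha + beta < n%:R).
Hypotheses (p1 : 1 < p) (q0 : 0 < q) (hpq : q^-1 = p^-1 - (alpha + beta) / n%:R).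
Hypothesis abl : alpha + beta + lam < 0.
Hypotheses (mO : measurable_fun setT O) (M0 : 0 < M) (OM : forall x, `|O x| <= M).
Hypothesis hom : homogeneous0 O.
Hypothesis mean0 : alpha = 0 ->
  fine (\int[mu]_u (O u * (0 < enorm u <= 1)%R%:R)%:E) = 0.
Hypotheses (Cb0 : 0 <= Cb) (hol : forall x y, `|h x - h y| <= Cb * `|x - y| `^ beta).

Local Notation gam := (alpha + beta).
Let p0 : 0 < p. Proof. exact: lt_trans p1. Qed.
Let nR : 0 < n%:R :> R. Proof. by rewrite ltr0n. Qed.
Let gam0n : 0 < gam < n%:R. Proof. by rewrite ltr_wpDl. Qed.
Let mh : measurable_fun setT h. Proof. exact: measurable_holder hol. Qed.
Let alphan : alpha < n%:R. Proof. by apply: lt_trans abn; rewrite ltrDl. Qed.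

Let K u : R := O u / enorm u `^ (n%:R - alpha).
Let mK : measurable_fun setT K.
Proof.
rewrite (_ : K = fun u => O u * enorm u `^ (- (n%:R - alpha))); first by mfun.
by apply/funext => u; rewrite powRN.
Qed.

Let enorm_powR_le u s : s <= 0 -> u != 0 -> enorm u `^ s <= `|u| `^ s.
Proof. by move=> s0 u0; apply: powR_le_neg => //; [rewrite normr_gt0|exact: norm_le_enorm]. Qed.

Let K_le u : `|K u| <= M * `|u| `^ (alpha - n%:R).
Proof.
have [->|u0] := eqVneq u 0.
  rewrite /K (_ : enorm 0 = 0); last by rewrite -(scale0r (0 : V)) enormZ normr0 mul0r.
  by rewrite powR0 ?invr0 ?mulr0 ?normr0 ?mulr_ge0 ?powR_ge0 ?(ltW M0)// subr_eq0 gt_eqF.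
rewrite /K -powRN opprB normrM (ger0_norm (powR_ge0 _ _)).
by apply: ler_pM; rewrite ?normr_ge0 ?powR_ge0 ?OM//; apply: enorm_powR_le; rewrite ?subr_le0 ?(ltW alphan).
Qed.

Let G f x y : R := (h x - h y) * (K (x - y) * f y).
Let T f x y : R := K (x - y) * f y.

Let mG f : measurable_fun setT f -> mker (G f).
Proof. by move=> mf; rewrite /mker /G; have := mK; have := mh => ? ?; mfun. Qed.
Let mT f x : measurable_fun setT f -> measurable_fun setT (T f x).
Proof.
move=> mf; apply: measurable_funM; last exact: mf.
have ms : measurable_fun setT (fun y : V => x - y) by mfun.
exact: (measurableT_comp mK ms).
Qed.

Let G_le f x y : `|G f x y| <= Cb * M * (rk gam x y * `|f y|).
Proof.
rewrite /G normrM (normrM (K _)) mulrA (mulrA (Cb * M)) ler_wpM2r//.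
apply: (@le_trans _ _ ((Cb * `|x - y| `^ beta) * (M * `|x - y| `^ (alpha - n%:R)))).
  by apply: ler_pM => //; exact: K_le.
have [xy|xy] := eqVneq x y.
  by rewrite xy subrr normr0 powR0 ?gt_eqF// mulr0 mul0r !mulr_ge0 ?(ltW M0)// rk_ge0.
have d0 : 0 < `|x - y| by rewrite normr_gt0 subr_eq0.
rewrite /rk le_eqVlt; apply/orP; left; apply/eqP.
have -> : gam - n%:R = beta + (alpha - n%:R) by ring.
by rewrite (powRD_pos beta (alpha - n%:R) d0); ring.
Qed.

Let riesz_L1 a (c : R) f x (g : V -> R) : 0 <= c -> measurable_fun setT f -> (riesz a f x < +oo)%E ->
  measurable_fun setT g -> (forall y, `|g y| <= c * (rk a x y * `|f y|)) -> L1 mu g.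
Proof.
move=> c0 mf hf mg gle; have mrk := @measurable_rk R n a x.
have L : L1 mu (fun y => rk a x y * `|f y|).
  split; first by mfun.
  rewrite (eq_integral (fun y => (rk a x y * `|f y|)%:E)) => [|y _]; first exact: hf.
  by rewrite ger0_norm// mulr_ge0 ?rk_ge0.
apply: (L1_dom mg (N1Z c L).1 _).1 => y; apply: le_trans (gle y) _.
by rewrite [leRHS]ger0_norm// !mulr_ge0 ?rk_ge0.
Qed.

Let G_L1 f x : measurable_fun setT f -> (riesz gam f x < +oo)%E -> L1 mu (G f x).
Proof.
move=> mf hf; have CM : 0 <= Cb * M by rewrite mulr_ge0 ?(ltW M0).
apply: (riesz_L1 CM mf hf); first by apply: mker1; exact: mG.
exact: G_le.
Qed.

Let GT f x y : h x * T f x y - G f x y = T (h \* f) x y.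
Proof. by rewrite /T /G /=; ring. Qed.

Let g f x : R := fine (\int[mu]_y (G f x y)%:E).

Let case_pos N f : 0 < alpha -> 0 < N -> measurable_fun setT f -> mor p lam N f ->
  (\forall x \ae mu, (riesz gam f x < +oo)%E) ->
  \forall x \ae mu, (T_defined alpha O f x /\ T_defined alpha O (h \* f) x) /\
    commutator h alpha O f x = g f x.
Proof.
move=> a0 N0 mf hf fin.
have gn : 0 < alpha < n%:R by rewrite a0 alphan.
have qi : 0 < p^-1 - alpha / n%:R.
  have -> : p^-1 - alpha / n%:R = q^-1 + beta / n%:R by rewrite hpq; field; rewrite !gt_eqF.
  by rewrite addr_gt0 ?invr_gt0// divr_gt0.
have q'0 : 0 < (p^-1 - alpha / n%:R)^-1 by rewrite invr_gt0.
have al : alpha + lam < 0 by apply: lt_trans abl; rewrite ltrD2r ltrDl.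
have [C C0 HC] := riesz_mor n0 gn p1 q'0 (invrK _) al.
have [fa _] := HC N f N0 mf hf.
move: fa fin; apply: filterS2 => x fa fg.
have LT : L1 mu (T f x).
  apply: (riesz_L1 (ltW M0) mf fa (mT x mf)) => y.
  rewrite /T normrM mulrA ler_wpM2r//; exact: K_le.
have LG := G_L1 mf fg.
have LZ := (N1Z (h x) LT).1; have LB := (L1B LZ LG).1.
have LhT : L1 mu (T (h \* f) x) by rewrite (_ : T (h \* f) x = fun y => h x * T f x y - G f x y)//; apply/funext => y; rewrite GT.
have an0 : (alpha == 0) = false by rewrite gt_eqF.
rewrite /T_defined /commutator /T_op an0; split; first by split; exact: L1_int.
rewrite /Rintegral -[fine (\int[mu]_(_ in _) (integrand _ _ f _ _)%:E)]/(fine (\int[mu]_y (T f x y)%:E)).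
rewrite -[fine (\int[mu]_(_ in _) (integrand _ _ (h \* f) _ _)%:E)]/(fine (\int[mu]_y (T (h \* f) x y)%:E)).
rewrite (fine_integralZ (h x))//; last exact: L1_int.
have -> : fine (\int[mu]_y (h x * T f x y)%:E) = fine (\int[mu]_y (T (h \* f) x y)%:E) + g f x.
  rewrite /g -fine_integralD; [|exact: L1_int|exact: L1_int].
  by congr fine; apply: eq_integral => y _; rewrite -GT subrK.
by rewrite addrAC subrr add0r.
Qed.

Let case_zero N f : alpha = 0 -> 0 < N -> measurable_fun setT f -> mor p lam N f ->
  (\forall x \ae mu, (riesz gam f x < +oo)%E) ->
  \forall x \ae mu, (T_defined alpha O f x /\ T_defined alpha O (h \* f) x) /\
    commutator h alpha O f x = g f x.
Proof.
move=> a0 N0 mf hf fin.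
have KE u : K u = O u / enorm u ^+ n by rewrite /K a0 subr0 powR_mulrn ?enorm_ge0.
have cK : czk M K.
  split; [exact: mK|exact: ltW|move=> u u0|move=> t u t0 u0|move=> r s r0].
  - have e0 : 0 <= enorm u ^- n by rewrite invr_ge0 exprn_ge0 ?enorm_ge0.
    by rewrite KE normrM (ger0_norm e0) ler_wpM2r.
  - rewrite !KE enormZ (gtr0_norm t0) hom// exprMn invfM; ring.
  - under eq_integral do rewrite KE.
    exact: (shell_mean_zero n0 s mO M0 OM hom (mean0 a0) r0).
have lf : loc_pow p f.
  split=> // r; have [r0|r0] := ltP 0 r; last first.
    apply: le_lt_trans (_ : _ <= \int[mu]_y ((`|0 - y| <= 1)%R%:R * `|f y| `^ p)%:E)%E _.
      apply: nn_le => [||y]; [by mfun|by mfun|]; rewrite mulr_ge0 ?powR_ge0//= ler_wpM2r ?powR_ge0//.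
      rewrite sub0r normrN; have [hh|//] := leP `|y| r.
      by rewrite (le_trans hh (le_trans r0 ler01)).
    by apply: le_lt_trans (hf 0 1 ltr01) _; rewrite ltry.
  apply: le_lt_trans (_ : _ <= \int[mu]_y ((`|0 - y| <= r)%R%:R * `|f y| `^ p)%:E)%E _.
    by apply: nn_le => [||y]; [by mfun|by mfun|]; rewrite mulr_ge0 ?powR_ge0//= sub0r normrN.
  by apply: le_lt_trans (hf 0 r r0) _; rewrite ltry.
have tail x e : (riesz gam f x < +oo)%E -> 0 < e -> L1 mu (fun y => T f x y * (e < enorm (x - y))%R%:R).
  move=> fx e0; have c0 : 0 <= M * e `^ (- gam) by rewrite mulr_ge0 ?powR_ge0 ?(ltW M0).
  apply: (riesz_L1 c0 mf fx); first by have := mT x mf => ?; mfun.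
  move=> y; have [he|he] := ltP e (enorm (x - y)); last by rewrite mulr0 normr0 mulr_ge0// mulr_ge0 ?rk_ge0.
  have d0 : 0 < enorm (x - y) by exact: lt_trans he.
  have xy : x - y != 0 by rewrite -enorm_gt0.
  rewrite mulr1 /T normrM (mulrA (M * _)) ler_wpM2r// KE normrM.
  rewrite -mulrA; apply: ler_pM => //; rewrite ger0_norm; last by rewrite invr_ge0 exprn_ge0 ?enorm_ge0.
  (* Away from the diagonal the kernel of order 0 is dominated by the one of order
     [gam]. *)
  have -> : (enorm (x - y) ^+ n)^-1 = enorm (x - y) `^ (- gam) * enorm (x - y) `^ (gam - n%:R).
    by rewrite -(powRD_pos _ _ d0) addrA addNr add0r powRN powR_mulrn ?enorm_ge0.
  apply: ler_pM; rewrite ?powR_ge0//.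
    by apply: powR_le_neg => //; [exact: ltW|rewrite oppr_le0 ltW//; case/andP: gam0n].
  by apply: enorm_powR_le => //; rewrite subr_le0 ltW//; case/andP: gam0n.
have tl : \forall x \ae mu, forall e, 0 < e ->
    mu.-integrable setT (fun y => (K (x - y) * f y * (e < enorm (x - y))%R%:R)%:E).
  by apply: filterS fin => x fx e e0; exact: L1_int (tail x e fx e0).
have := pv_exists n0 p1 cK lf tl.
move: fin; apply: filterS2 => x fx cx.
have LG := G_L1 mf fx.
have men e : measurable_fun setT (fun y => e < enorm (x - y)) by mfun.
have LGc e : L1 mu (fun y => G f x y * (e < enorm (x - y))%R%:R).
  have [mg _] := LG; apply: (L1_dom _ LG _).1 => [|y]; first by mfun.
  by rewrite normrM ler_piMr// ger0_norm// lern1 leq_b1.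
have tail2 e : 0 < e -> L1 mu (fun y => T (h \* f) x y * (e < enorm (x - y))%R%:R).
  move=> e0; have := (L1B (N1Z (h x) (tail x e fx e0)).1 (LGc e)).1.
  by congr L1; apply/funext => y; rewrite -GT; ring.
have trE F e : T_truncated alpha O F x e = tau K F x e by rewrite /T_truncated Rint_set.
have tauE e : 0 < e -> tau K (h \* f) x e =
    h x * tau K f x e - fine (\int[mu]_y (G f x y * (e < enorm (x - y))%R%:R)%:E).
  move=> e0; rewrite /tau (fine_integralZ (h x)); last exact: L1_int (tail x e fx e0).
  have -> : fine (\int[mu]_y (h x * (K (x - y) * f y * (e < enorm (x - y))%R%:R))%:E) =
      fine (\int[mu]_y (T (h \* f) x y * (e < enorm (x - y))%R%:R)%:E) +
      fine (\int[mu]_y (G f x y * (e < enorm (x - y))%R%:R)%:E).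
    rewrite -fine_integralD; [|exact: L1_int (tail2 e e0)|exact: L1_int (LGc e)].
    congr fine; apply: eq_integral => y _; congr EFin.
    have := GT f x y; rewrite /T => <-; ring.
  by rewrite addrK.
have cut := cut_lim LG (_ : measurable_fun setT (fun y => enorm (x - y))) _ _.
have {}cut := cut ltac:(by mfun) (fun y => enorm_ge0 _).
have Gdiag y : enorm (x - y) = 0 -> G f x y = 0.
  move=> e0; have /negbFE : (x - y != 0) = false by rewrite -enorm_gt0 e0 ltxx.
  by rewrite subr_eq0 => /eqP ->; rewrite /G subrr mul0r.
have {}cut := cut Gdiag; have [l cl] := (cvg_ex _).1 cx.
have cl2 : tau K (h \* f) x e @[e --> 0^'+] --> h x * l - g f x.
  apply: cvg_trans (cvgB (cvgM (cvg_cst (h x)) cl) cut).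
  apply: near_eq_cvg; near=> e; have e0 : 0 < e by near: e; exact: nbhs_right_gt.
  by rewrite /= (tauE e e0).
have trl F (z : R) : tau K F x e @[e --> 0^'+] --> z -> T_truncated alpha O F x e @[e --> 0^'+] --> z.
  by rewrite (_ : T_truncated alpha O F x = tau K F x)//; apply/funext => e; exact: trE.
have an0 : (alpha == 0) = true by rewrite a0 eqxx.
rewrite /T_defined /commutator /T_op an0; split.
  split; split.
  - move=> e e0; apply/(integrable_set (men e) (mT x mf)); exact: L1_int (tail x e fx e0).
  - by apply/cvg_ex; exists l; exact: trl.
  - move=> e e0; apply/(integrable_set (men e) (mT x _)); first by apply: measurable_funM.
    exact: L1_int (tail2 e e0).
  - by apply/cvg_ex; exists (h x * l - g f x); exact: trl.
rewrite (cvg_lim _ (trl _ _ cl))// (cvg_lim _ (trl _ _ cl2))//.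
by rewrite opprB addrCA subrr addr0.
Unshelve. all: by end_near. Qed.

(** For [alpha = 0] the principal value of [h f] exists because it differs from [h x]
    times that of [f] by a dominated integral.  The level at which [f] satisfies the
    Morrey condition is requantified in the conclusion, for one and the same [g]. *)
Theorem commutator_bound : exists2 C, 0 < C & forall N f, 0 < N -> measurable_fun setT f ->
  mor p lam N f ->
  (\forall x \ae mu, T_defined alpha O f x /\ T_defined alpha O (h \* f) x) /\
  exists g, [/\ measurable_fun setT g, commutator h alpha O f = g %[ae mu] &
    forall N, 0 < N -> mor p lam N f -> mor q (gam + lam) (C * N) g].
Proof.
have [C C0 HC] := riesz_mor n0 gam0n p1 q0 hpq abl.
pose D := Cb * M + 1; have D0 : 0 < D by rewrite ltr_wpDl// mulr_ge0 ?(ltW M0).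
exists (D * C); first exact: mulr_gt0.
move=> N f N0 mf hf; have [fin _] := HC N f N0 mf hf.
have main : \forall x \ae mu, (T_defined alpha O f x /\ T_defined alpha O (h \* f) x) /\
    commutator h alpha O f x = g f x.
  move: alpha0; rewrite le_eqVlt => /orP[/eqP a0|a0]; [exact: case_zero (esym a0) N0 mf hf fin|exact: case_pos a0 N0 mf hf fin].
split; first by apply: filterS main => x [].
have mg : measurable_fun setT (g f) by apply: measurable_fine_integral; exact: mG.
exists (g f); split => //; first by apply: filterS main => x [].
move=> N' N'0 hf' c r r0; have [_ hJ] := HC N' f N'0 mf hf'.
have mJ : measurable_fun setT (fun x => fine (riesz gam f x)).
  by apply: measurable_fine_integral; exact: mker_riesz.
apply: (@le_trans _ _ ((D `^ q)%:E * \int[mu]_y ((`|c - y| <= r)%R%:R * `|fine (riesz gam f y)| `^ q)%:E)%E); last first.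
  have Dq : (0 <= (D `^ q)%:E)%E by rewrite lee_fin powR_ge0.
  apply: le_trans (lee_wpmul2l Dq (hJ c r r0)) _; rewrite -EFinM lee_fin.
  by rewrite -(mulrA D) (@powRM _ D) ?mulrA ?(ltW D0)// mulr_ge0 ?(ltW C0) ?(ltW N'0).
rewrite -nnZ ?powR_ge0//; [|by mfun]; apply: ae_ge0_le_integral; first exact: measurableT.
- by move=> y _; rewrite lee_fin mulr_ge0 ?powR_ge0.
- by mfun.
- by move=> y _; rewrite lee_fin mulr_ge0 ?powR_ge0// mulr_ge0 ?powR_ge0.
- by mfun.
apply: filterS fin => y fy _; rewrite lee_fin mulrCA ler_wpM2l// -powRM ?(ltW D0)//.
rewrite powR_le_inv ?mulr_ge0 ?(ltW D0)//.
have f0 : 0 <= fine (riesz gam f y) by rewrite fine_ge0 ?riesz_ge0.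
rewrite (ger0_norm f0); have E : (riesz gam f y \is a fin_num)%E by rewrite ge0_fin_numE ?riesz_ge0.
have LG := G_L1 mf fy; have mGy := mker1 y (mG mf).
rewrite -lee_fin; apply: (@le_trans _ _ (\int[mu]_z `|G f y z|%:E)%E).
  have fin' := integrable_fin_num measurableT (L1_int LG).
  rewrite (_ : `|g f y|%:E = `|\int[mu]_z (G f y z)%:E|)%E; last by rewrite -(fineK fin').
  apply: le_trans (le_abse_integral mu measurableT _) _; first by mfun.
  exact: lexx.
rewrite EFinM (fineK E) -nnZ ?(ltW D0)//; first last.
- by move=> z; rewrite mulr_ge0 ?rk_ge0.
- by have := @measurable_rk R n gam y => ?; mfun.
apply: nn_le => [||z]; [by mfun|by have := @measurable_rk R n gam y => ?; mfun|].
rewrite normr_ge0 /=; apply: le_trans (G_le f y z) _; rewrite ler_wpM2r ?mulr_ge0 ?rk_ge0//.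
by rewrite /D lerDl.
Qed.

End sufficiency.

(** * From mean oscillation to Hoelder continuity *)

Lemma norm_sub_le (R : realType) (a b c : R) : a <= b + c -> b <= a + c -> `|a - b| <= c.
Proof. by move=> h1 h2; apply/ler_normlP; split; lra. Qed.

Section campanato.
Context {R : realType} {n : nat}.
Hypothesis n0 : (0 < n)%N.
Local Notation V := 'rV[R]_n.
Local Notation mu := (@lebesgue_rV R n).
Implicit Types (x y z u : V) (r s t e m : R).
Variables (b : V -> R) (beta C : R).
Hypotheses (lb : locint b) (beta01 : 0 < beta < 1) (C0 : 0 < C).
Hypothesis osc : forall z r, 0 < r -> exists m,
  (\int[mu]_y ((`|z - y| <= r)%R%:R * `|b y - m|)%:E <= (C * r `^ (n%:R + beta))%:E)%E.

Let b0 : 0 < beta. Proof. by case/andP: beta01. Qed.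
Let mb : measurable_fun setT b. Proof. by case: lb. Qed.

Lemma powR_subadd (s t : R) : 0 <= s -> 0 <= t -> (s + t) `^ beta <= s `^ beta + t `^ beta.
Proof.
move=> s0 t0; have [st|st] := eqVneq (s + t) 0.
  by rewrite st powR0 ?gt_eqF// addr_ge0 ?powR_ge0.
have p0 : 0 < s + t by rewrite lt_neqAle eq_sym st addr_ge0.
have H (u : R) : 0 <= u <= 1 -> u <= u `^ beta.
  move=> /andP[u0 u1]; have [->|un] := eqVneq u 0; first exact: powR_ge0.
  have up : 0 < u by rewrite lt_neqAle eq_sym un.
  rewrite -{1}(powRr1 u0).
  have [_ bl] := andP beta01.
  have -> : u = (u^-1)^-1 by rewrite invrK.
  rewrite !(@powRV _ u^-1) ?invr_ge0// !powRN lef_pV2 ?posrE ?powR_gt0 ?invr_gt0//.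
  have iu : 1 <= u^-1 by rewrite -[leLHS]invr1 lef_pV2 ?posrE.
  by apply: ler_powR => //; exact: ltW.
have i0 : 0 <= (s + t)^-1 by rewrite invr_ge0 ltW.
have E w : 0 <= w -> w `^ beta = (s + t) `^ beta * (w / (s + t)) `^ beta.
  by move=> w0; rewrite -powRM ?divr_ge0 ?(ltW p0)//; congr (_ `^ _); rewrite mulrC divfK ?gt_eqF.
rewrite (E s s0) (E t t0) -mulrDr -{1}[X in X <= _]mulr1 ler_wpM2l ?powR_ge0//.
have -> : 1 = s / (s + t) + t / (s + t) by rewrite -mulrDl divff.
apply: lerD; apply: H; rewrite divr_ge0 ?(ltW p0)//= ler_pdivrMr// mul1r ?lerDl// lerDr//.
Qed.

Lemma powR_triangle (c : R) x y z : 0 <= c ->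
  c * `|x - z| `^ beta <= c * `|x - y| `^ beta + c * `|y - z| `^ beta.
Proof.
move=> c0; rewrite -mulrDr; apply: ler_wpM2l => //.
apply: le_trans (powR_subadd (normr_ge0 _) (normr_ge0 _)).
apply: ge0_ler_powR; rewrite ?nnegrE ?addr_ge0 ?(ltW b0)//.
by have -> : x - z = (x - y) + (y - z); [rewrite addrA subrK|exact: ler_normD].
Qed.

Let cmp z z' r r' m m' (c c' : R) : 0 < r -> (forall y, `|z - y| <= r -> `|z' - y| <= r') ->
  (\int[mu]_y ((`|z - y| <= r)%R%:R * `|b y - m|)%:E <= c%:E)%E ->
  (\int[mu]_y ((`|z' - y| <= r')%R%:R * `|b y - m'|)%:E <= c'%:E)%E ->
  `|m - m'| * (2 * r) ^+ n <= c + c'.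
Proof.
move=> r0 sub h1 h2; rewrite -lee_fin EFinM -(int_near z (ltW r0)) -nnZ//; last by mfun.
apply: le_trans (leeD h1 h2); rewrite -nnD//; first last.
- by mfun.
- by mfun.
apply: nn_le => [||y]; [by mfun|by mfun|]; rewrite mulr_ge0//=.
have [h|h] := leP `|z - y| r; last by rewrite mulr0 mul0r add0r mulr_ge0.
rewrite (sub y h) !mul1r mulr1.
have -> : m - m' = - (b y - m) + (b y - m') by ring.
by apply: le_trans (ler_normD _ _) _; rewrite normrN.
Qed.

Let split_p (t : R) : 0 < t -> t `^ (n%:R + beta) = t ^+ n * t `^ beta.
Proof. by move=> t0; rewrite (powRD_pos _ _ t0) powR_mulrn ?(ltW t0). Qed.

Let D1 := C * (1 + 2 `^ (n%:R + beta)).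
Let D10 : 0 < D1. Proof. by rewrite mulr_gt0// addr_gt0// powR_gt0. Qed.

Let cmp2 z z' r m m' : 0 < r -> (forall y, `|z - y| <= r -> `|z' - y| <= 2 * r) ->
  (\int[mu]_y ((`|z - y| <= r)%R%:R * `|b y - m|)%:E <= (C * r `^ (n%:R + beta))%:E)%E ->
  (\int[mu]_y ((`|z' - y| <= 2 * r)%R%:R * `|b y - m'|)%:E <= (C * (2 * r) `^ (n%:R + beta))%:E)%E ->
  `|m - m'| <= D1 * r `^ beta.
Proof.
move=> r0 sub h1 h2; have := cmp r0 sub h1 h2.
rewrite (@powRM _ 2) ?(ltW r0)// (split_p r0).
rewrite (_ : C * (r ^+ n * _) + _ = D1 * r `^ beta * r ^+ n); last by rewrite /D1; ring.
move=> h; have rn : 0 < r ^+ n by rewrite exprn_gt0.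
rewrite -(ler_pM2r rn); apply: le_trans h; rewrite ler_wpM2l//.
by rewrite lerXn2r ?nnegrE ?mulr_ge0 ?(ltW r0)// ler_peMl ?ler1n// ltW.
Qed.

Let q1 : 0 <= (2^-1 : R) `^ beta < 1. Proof. by rewrite powR_ge0 half_powR. Qed.

(** Telescoping over the radii [r / 2^k]; at a Lebesgue point the constants tend to
    the value of [b]. *)
Lemma leb_osc x r m : leb b x -> 0 < r ->
  (\int[mu]_y ((`|x - y| <= r)%R%:R * `|b y - m|)%:E <= (C * r `^ (n%:R + beta))%:E)%E ->
  `|b x - m| <= D1 / (1 - 2^-1 `^ beta) * r `^ beta.
Proof.
move=> lx r0 hm; pose h k := r * 2^-1 ^+ k; have h0 k : 0 < h k by rewrite mulr_gt0 ?exprn_gt0.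
have hS k : h k = 2 * h k.+1.
  by rewrite /h exprS mulrCA (mulrA 2) divff ?mul1r// pnatr_eq0.
have [w' hw'] := choice (fun k => osc x (h0 k)).
(* The first constant is the given one, so that the sum starts at [m]. *)
pose w k := if k is 0%N then m else w' k.
have hw k : (\int[mu]_y ((`|x - y| <= h k)%R%:R * `|b y - w k|)%:E <= (C * h k `^ (n%:R + beta))%:E)%E.
  by case: k => [|k]; [rewrite /h expr0 mulr1; exact: hm|exact: hw'].
have rb := powR_ge0 r beta.
have tele N : `|w 0%N - w N| <= D1 * r `^ beta * \sum_(k < N) (2^-1 `^ beta) ^+ k.
  elim: N => [|N IH]; first by rewrite big_ord0 mulr0 subrr normr0.
  rewrite big_ord_recr /= mulrDr; have -> : w 0%N - w N.+1 = (w 0%N - w N) + (w N - w N.+1) by ring.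
  apply: le_trans (ler_normD _ _) _; apply: lerD => //; rewrite distrC.
  have H := cmp2 (h0 N.+1) _ (hw N.+1); have := hw N; rewrite hS => hN.
  apply: le_trans (H _ _ _ hN) _.
    by move=> y hy; apply: le_trans hy _; rewrite ler_peMl ?ler1n// ltW.
  rewrite -mulrA ler_wpM2l ?(ltW D10)// /h powRM ?(ltW r0) ?exprn_ge0// powR_exp// exprS.
  rewrite ler_wpM2l//; case/andP: q1 => q0 q2; by rewrite ler_piMl ?exprn_ge0// ltW.
have fin e : 0 < e -> exists N, `|b x - w N| <= e.
  move=> e0; have e2 : 0 < e / 2 by rewrite divr_gt0.
  have [d d0 hd] := lx _ e2; have C1 : 0 < C + 1 by rewrite addr_gt0.
  set c := e / 2 / (C + 1); have c0 : 0 < c by rewrite divr_gt0.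
  set dd := Num.min (Num.min d (c `^ beta^-1)) r.
  have dd0 : 0 < dd by rewrite !lt_min d0 powR_gt0.
  have ddr : dd <= r by rewrite ge_min lexx orbT.
  have [k0 /andP[hk _]] := near_scale dd0 ddr.
  exists k0.+1; have p0 := h0 k0.+1.
  have : h k0.+1 < dd by rewrite /h exprSr mulrA.
  rewrite !lt_min => /andP[/andP[l1 l2] _].
  have H := cmp p0 (fun y hy => hy) (hd _ p0 l1) (hw k0.+1).
  have rn : 0 < h k0.+1 ^+ n by rewrite exprn_gt0.
  rewrite -(ler_pM2r rn); apply: (@le_trans _ _ (`|b x - w k0.+1| * (2 * h k0.+1) ^+ n)).
    rewrite ler_wpM2l//; apply: lerXn2r; rewrite ?nnegrE ?mulr_ge0 ?(ltW p0) ?(ltW r0)//.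
    by rewrite ler_peMl ?ler1n// ltW.
  apply: le_trans H _; rewrite (split_p p0).
  have hB : h k0.+1 `^ beta <= c.
    have -> : c = (c `^ beta^-1) `^ beta by rewrite -powRrM mulVf ?gt_eqF// powRr1 ?(ltW c0).
    by apply: ge0_ler_powR; rewrite ?nnegrE ?powR_ge0 ?(ltW b0) ?(ltW p0) ?(ltW l2).
  have CB : C * h k0.+1 `^ beta <= e / 2.
    apply: (@le_trans _ _ ((C + 1) * c)).
      by apply: ler_pM; rewrite ?powR_ge0 ?(ltW C0)// lerDl.
    by rewrite /c mulrC divfK// gt_eqF.
  rewrite [leLHS](_ : _ = (e / 2 + C * h k0.+1 `^ beta) * h k0.+1 ^+ n); last by ring.
  by rewrite ler_wpM2r ?(ltW rn)// [leRHS](splitr e) lerD2l.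
apply/ler_addgt0Pr => e e0; have [N hN] := fin e e0.
have -> : b x - m = (b x - w N) - (w 0%N - w N) by rewrite /w /=; ring.
apply: le_trans (ler_normB _ _) _; rewrite addrC; apply: lerD => //.
apply: le_trans (tele N) _; rewrite [leRHS]mulrAC ler_wpM2l ?(mulr_ge0 (ltW D10) rb)//.
exact: geo_le.
Qed.

Let D2 := D1 / (1 - 2^-1 `^ beta).
Let D20 : 0 < D2. Proof. by rewrite divr_gt0// subr_gt0; case/andP: q1. Qed.
Let H := D2 * 2 `^ beta + D1 + D2.

(** The constant of the cube of radius [2 |x - y|] around [x] is compared with that of
    the smaller cube around [y], which it contains. *)
Lemma leb_holder x y : leb b x -> leb b y -> `|b x - b y| <= H * `|x - y| `^ beta.
Proof.
move=> lx ly; have [->|xy] := eqVneq x y.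
  by rewrite !subrr !normr0 powR0 ?gt_eqF// mulr0.
set r := `|x - y|; have r0 : 0 < r by rewrite normr_gt0 subr_eq0.
have r2 : 0 < 2 * r by rewrite mulr_gt0.
have [m hm] := osc x r2; have [m' hm'] := osc y r0.
have h1 := leb_osc lx r2 hm; have h2 := leb_osc ly r0 hm'.
have h3 : `|m' - m| <= D1 * r `^ beta.
  apply: (cmp2 r0 _ hm' hm) => z yz; have -> : x - z = (x - y) + (y - z) by rewrite addrA subrK.
  by apply: le_trans (ler_normD _ _) _; rewrite mulr2n mulrDl mul1r lerD.
have -> : b x - b y = (b x - m) + (- (m' - m) + - (b y - m')) by ring.
apply: le_trans (ler_normD _ _) _.
rewrite (_ : H * _ = D2 * (2 * r) `^ beta + (D1 * r `^ beta + D2 * r `^ beta)); last first.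
  by rewrite (@powRM _ 2) ?(ltW r0)// /H; ring.
apply: lerD => //; apply: le_trans (ler_normD _ _) _; rewrite !normrN; exact: lerD.
Qed.

(** McShane's extension of the restriction to the Lebesgue points. *)
Theorem campanato_Lip : Lip beta b.
Proof.
pose S := [set x | leb b x]; have aeS : \forall x \ae mu, S x by exact: locint_leb.
have [x0 Sx0] : exists x, S x.
  apply: contrapT => no; case: aeS => N [mN N0 sub].
  have : (mu [set y : V | `|(0 : V) - y| <= 1]%R <= mu N)%E.
    apply: le_measure; rewrite ?inE//; [exact: measurable_normB_le|].
    by move=> y _; apply: sub => Sy; apply: no; exists y.
  rewrite lebesgue_normB_le// N0 lee_fin leNgt exprn_gt0// mulr1//.
have H0 : 0 <= H.
  rewrite /H; apply: addr_ge0; last exact: ltW.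
  by apply: addr_ge0; [apply: mulr_ge0; [exact: ltW|exact: powR_ge0]|exact: ltW].
have [Hc [Hc0 hH]] : exists c : R, 0 <= c /\ forall x y, leb b x -> leb b y -> `|b x - b y| <= c * `|x - y| `^ beta.
  by exists H; split => //; exact: leb_holder.
pose T x := [set t | exists2 y, S y & t = b y + Hc * `|x - y| `^ beta].
have low x t : T x t -> b x0 - Hc * `|x0 - x| `^ beta <= t.
  move=> [y Sy ->]; have h := hH _ _ Sx0 Sy; rewrite lerBlDr.
  have h1 : b x0 <= b y + Hc * `|x0 - y| `^ beta.
    by rewrite -lerBlDl; apply: le_trans (ler_norm _) h.
  by apply: (le_trans h1); rewrite -(addrA (b y)) lerD2l [leRHS]addrC; exact: powR_triangle.
have infT x : has_inf (T x).
  split; first by exists (b x0 + Hc * `|x - x0| `^ beta), x0.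
  by exists (b x0 - Hc * `|x0 - x| `^ beta) => t; exact: low.
pose g x := inf (T x).
have gle x y : g x <= g y + Hc * `|x - y| `^ beta.
  rewrite -lerBlDr; apply: lb_le_inf; first by case: (infT y).
  move=> t [z Sz ->]; rewrite lerBlDr.
  apply: (@le_trans _ _ (b z + Hc * `|x - z| `^ beta)).
    by apply: inf_lbound; [case: (infT x)|exists z].
  by rewrite -(addrA (b z)) lerD2l [leRHS]addrC; exact: powR_triangle.
exists g.
  exists Hc => x y; have hn : Hc * `|x - y| `^ beta <= Hc * enorm (x - y) `^ beta.
    by rewrite ler_wpM2l//; apply: ge0_ler_powR; rewrite ?nnegrE ?enorm_ge0 ?(ltW b0)// norm_le_enorm.
  apply: (le_trans _ hn); have h1 := gle x y; have h2 := gle y x.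
  by rewrite (distrC y x) in h2; exact: norm_sub_le h1 h2.
apply: filterS aeS => x Sx _; apply/eqP; rewrite eq_le; apply/andP; split.
  apply: lb_le_inf; first by case: (infT x).
  move=> t [y Sy ->]; rewrite -lerBlDl; apply: le_trans (ler_norm _) _; exact: hH.
apply: inf_lbound; first by case: (infT x).
by exists x => //; rewrite subrr normr0 powR0 ?gt_eqF// mulr0 addr0.
Qed.

End campanato.

(** * Lower bounds for the commutator *)

Section necessity.
Context {R : realType} {n : nat}.
Hypothesis n0 : (0 < n)%N.
Local Notation V := 'rV[R]_n.
Local Notation mu := (@lebesgue_rV R n).
Implicit Types (x y z u : V) (r s t e m : R) (F : V -> bool).

Lemma median_arith (a c v : R) : a + c = v -> a < v / 2 -> v / 2 <= c. Proof. lra. Qed.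

(** The infimum of the levels below which [b] keeps half of the cube is within [e] of
    one such level and of a level that is not. *)
Lemma median (b : V -> R) z r e : locint b -> 0 < r -> 0 < e -> exists m,
  (((2 * r) ^+ n / 2)%:E <= \int[mu]_y (((`|z - y| <= r) && (b y <= m + e))%R%:R)%:E)%E /\
  (((2 * r) ^+ n / 2)%:E <= \int[mu]_y (((`|z - y| <= r) && (m - e < b y))%R%:R)%:E)%E.
Proof.
move=> [mb hb] r0 e0; set v := (2 * r) ^+ n; have v0 : 0 < v by rewrite exprn_gt0// mulr_gt0.
pose A t := fine (\int[mu]_y (((`|z - y| <= r) && (b y <= t))%R%:R)%:E).
pose A' t := fine (\int[mu]_y (((`|z - y| <= r) && (t < b y))%R%:R)%:E).
have Lz : L1 mu (fun y => (`|z - y| <= r)%R%:R).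
  split; first by mfun.
  rewrite (eq_integral (fun y => ((`|z - y| <= r)%R%:R)%:E)) => [|y _]; last by rewrite ger0_norm.
  by rewrite int_near ?(ltW r0)// ltry.
have Lsub (Q : V -> bool) : measurable_fun setT Q -> L1 mu (fun y => ((`|z - y| <= r) && Q y)%:R).
  move=> mQ; apply: (L1_dom _ Lz _).1; first by mfun.
  by move=> y; rewrite !ger0_norm// ler_nat; case: (`|z - y| <= r); case: (Q y).
have LA t : L1 mu (fun y => ((`|z - y| <= r) && (b y <= t))%R%:R) by apply: Lsub; mfun.
have LA' t : L1 mu (fun y => ((`|z - y| <= r) && (t < b y))%R%:R) by apply: Lsub; mfun.
have AE t : (A t)%:E = (\int[mu]_y (((`|z - y| <= r) && (b y <= t))%R%:R)%:E)%E.
  by rewrite /A fineK//; apply: integrable_fin_num => //; exact: L1_int.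
have AE' t : (A' t)%:E = (\int[mu]_y (((`|z - y| <= r) && (t < b y))%R%:R)%:E)%E.
  by rewrite /A' fineK//; apply: integrable_fin_num => //; exact: L1_int.
have AA t : A t + A' t = v.
  apply/eqP; rewrite -eqe EFinD AE AE' -nnD//; [|by mfun|by mfun].
  rewrite -(int_near z (ltW r0)); apply/eqP; apply: eq_integral => y _; congr EFin.
  by case: (`|z - y| <= r) => //=; rewrite ?addr0//; have [h|h] := leP (b y) t; rewrite ?addr0 ?add0r.
have Amono s t : s <= t -> A s <= A t.
  move=> st; rewrite -lee_fin !AE; apply: nn_le => [||y]; [by mfun|by mfun|].
  rewrite ler0n ler_nat; case: (`|z - y| <= r) => //=.
  by have [h|//] := leP (b y) s; rewrite (le_trans h st).
have [B [B0 hB]] : exists B, 0 <= B /\ (\int[mu]_y ((`|z - y| <= r)%R%:R * `|b y|)%:E <= B%:E)%E.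
  have h : (\int[mu]_y ((`|z - y| <= r)%R%:R * `|b y|)%:E < +oo)%E.
    apply: le_lt_trans (hb (r + `|z|)); apply: nn_le => [||y]; [by mfun|by mfun|].
    rewrite mulr_ge0//= ler_wpM2r//; have [hh|//] := leP `|z - y| r.
    suff -> : `|y| <= r + `|z| by [].
    rewrite -{1}(subKr z y); apply: le_trans (ler_normB _ _) _; by rewrite addrC lerD2r.
  have h0 : (0 <= \int[mu]_y ((`|z - y| <= r)%R%:R * `|b y|)%:E)%E.
    by apply: integral_ge0 => y _; rewrite lee_fin mulr_ge0.
  exists (fine (\int[mu]_y ((`|z - y| <= r)%R%:R * `|b y|)%:E)); rewrite fine_ge0//; split => //.
  by rewrite fineK// ge0_fin_numE.
have che t (Q : V -> bool) : measurable_fun setT Q -> 0 < t -> (forall y, Q y -> t <= `|b y|) ->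
    (\int[mu]_y (((`|z - y| <= r) && Q y)%R%:R)%:E <= (B / t)%:E)%E.
  move=> mQ t0 hQ; apply: (@le_trans _ _ ((t^-1)%:E * \int[mu]_y ((`|z - y| <= r)%R%:R * `|b y|)%:E)%E).
    rewrite -nnZ ?invr_ge0 ?(ltW t0)//; last by mfun.
    apply: nn_le => [||y]; [by mfun|by mfun|]; rewrite ler0n /=.
    case: (`|z - y| <= r); last by rewrite mul0r mulr0.
    rewrite /= mul1r mulrC ler_pdivlMr//; case: (boolP (Q y)) => [h|_]; rewrite ?mul1r ?mul0r//; exact: hQ.
  by rewrite [leRHS]EFinM [leRHS]muleC; apply: lee_wpmul2l; rewrite ?lee_fin ?invr_ge0 ?(ltW t0).
(* By Chebyshev's inequality [|b| < t0] on more than half of the cube. *)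
pose t0 := (2 * B + 1) / v * 2; have t00 : 0 < t0 by rewrite mulr_gt0// divr_gt0// ltr_wpDl// mulr_ge0.
have Bt : B / t0 < v / 2.
  rewrite ltr_pdivrMr// /t0 [ltRHS](_ : _ = 2 * B + 1); last by field; rewrite gt_eqF.
  by clear -B0; lra.
pose S := [set t | v / 2 <= A t].
have St : S t0.
  rewrite /S /=; have : A' t0 <= B / t0.
    rewrite -lee_fin AE'; apply: che => //; [by mfun|move=> y h].
    by apply: le_trans (ler_norm _); exact: ltW.
  by move=> h; apply: (median_arith _ (le_lt_trans h Bt)); rewrite addrC.
have lbS : lbound S (- t0).
  move=> t St'; rewrite leNgt; apply/negP => tt; move: St'; rewrite /S /= leNgt => /negP; apply.
  apply: le_lt_trans Bt; rewrite -lee_fin AE; apply: che => //; [by mfun|move=> y h].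
  rewrite -normrN; apply: le_trans (ler_norm _); rewrite lerNr.
  by apply: le_trans h _; exact: ltW.
have infS : has_inf S by split; [exists t0|exists (- t0)].
exists (inf S); split.
  have [t St1 t1] := inf_adherent e0 infS.
  by rewrite -AE lee_fin; apply: le_trans St1 _; apply: Amono; exact: ltW.
rewrite -AE' lee_fin.
have nS : A (inf S - e) < v / 2.
  rewrite ltNge; apply/negP => h; have : inf S <= inf S - e by apply: inf_lbound => //; case: infS.
  by rewrite lerBrDl gerDr leNgt e0.
exact: median_arith (AA _) nS.
Qed.

Lemma signed_lower (phi : V -> R) F s t : `|s| = 1 -> measurable_fun setT F -> L1 mu phi ->
  L1 mu (fun y => (F y)%:R) -> (forall y, t * (F y)%:R <= s * phi y) ->
  t * fine (\int[mu]_y ((F y)%:R)%:E) <= `|fine (\int[mu]_y (phi y)%:E)|.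
Proof.
move=> s1 mF Lp LF h.
have Lt := (N1Z t LF).1; have Ls := (N1Z s Lp).1.
rewrite (fine_integralZ t); last exact: L1_int.
apply: (@le_trans _ _ (fine (\int[mu]_y (s * phi y)%:E))).
  apply: fine_le; [apply: integrable_fin_num => //; exact: L1_int|apply: integrable_fin_num => //; exact: L1_int|].
  by apply: le_integral => //; [exact: L1_int|exact: L1_int|move=> y _; rewrite lee_fin].
rewrite -fine_integralZ; last exact: L1_int.
by apply: le_trans (ler_norm _) _; rewrite normrM s1 mul1r.
Qed.

Let sub_arith (a m e : R) : a - m <= - e -> 0 <= m - e - a. Proof. lra. Qed.

Let low_arith (a m e X Y : R) : m - e - a <= Y -> 0 <= X -> - (a - m) <= e + (X + Y).
Proof. lra. Qed.

Let high_arith (a m e X Y : R) : a - (m + e) <= X -> 0 <= Y -> a - m <= e + (X + Y).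
Proof. lra. Qed.

Variables (alpha : R) (O b : V -> R).
Hypotheses (mO : measurable_fun setT O) (lb : locint b).
Let K u : R := O u / enorm u `^ (n%:R - alpha).

Let mK : measurable_fun setT K.
Proof.
rewrite (_ : K = fun u => O u * enorm u `^ (- (n%:R - alpha))); first by mfun.
by apply/funext => u; rewrite powRN.
Qed.

Let mb : measurable_fun setT b. Proof. by case: lb. Qed.

Lemma ball_indic_L1 z r F : 0 <= r -> measurable_fun setT F -> (forall y, F y -> `|z - y| <= r) ->
  L1 mu (fun y => (F y)%:R).
Proof.
move=> r0 mF Fr; split; first by mfun.
apply: le_lt_trans (_ : (_ <= ((2 * r) ^+ n)%:E)%E) (ltry _); rewrite -(int_near z r0).
apply: nn_le => [||y]; [by mfun|by mfun|]; rewrite normr_ge0 /= ger0_norm// ler_nat.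
by case: (boolP (F y)) => // h; rewrite (Fr y h).
Qed.

(** At a distance from the support the truncated integrals are eventually constant. *)
Lemma commutator_away z r x F (e B : R) : 0 < r -> measurable_fun setT F ->
  (forall y, F y -> `|z - y| <= r) -> 0 < e -> 0 <= B ->
  (forall y, F y -> e < enorm (x - y) /\ `|K (x - y)| <= B) ->
  L1 mu (fun y => (b x - b y) * (K (x - y) * (F y)%:R)) /\
  commutator b alpha O (fun y => (F y)%:R) x =
    fine (\int[mu]_y ((b x - b y) * (K (x - y) * (F y)%:R))%:E).
Proof.
move=> r0 mF Fr e0 B0 hF.
have mKx : measurable_fun setT (fun y => K (x - y)) by apply: (measurableT_comp mK); mfun.
have LF := ball_indic_L1 (ltW r0) mF Fr.
have Kb y : `|K (x - y) * (F y)%:R| <= B * (F y)%:R.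
  rewrite normrM (ger0_norm (ler0n _ _)); case: (boolP (F y)) => [h|_]; last by rewrite !mulr0.
  by rewrite !mulr1; case: (hF y h).
have LB := (N1Z B LF).1.
have LK : L1 mu (fun y => K (x - y) * (F y)%:R).
  apply: (L1_dom _ LB _).1 => [|y]; first by mfun.
  by rewrite [leRHS]ger0_norm ?mulr_ge0.
have LbF : L1 mu (fun y => b y * (F y)%:R).
  split; first by mfun.
  apply: le_lt_trans (lb.2 (r + `|z|)); apply: nn_le => [||y]; [by mfun|by mfun|].
  rewrite normr_ge0 /= normrM mulrC (ger0_norm (ler0n _ _)) ler_wpM2r//.
  case: (boolP (F y)) => // h; suff -> : `|y| <= r + `|z| by [].
  rewrite -{1}(subKr z y); apply: le_trans (ler_normB _ _) _; by rewrite addrC lerD2r Fr.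
have LbK : L1 mu (fun y => K (x - y) * (b y * (F y)%:R)).
  apply: (L1_dom _ (N1Z B LbF).1 _).1 => [|y]; first by mfun.
  have -> : K (x - y) * (b y * (F y)%:R) = b y * (K (x - y) * (F y)%:R) by ring.
  rewrite normrM [leRHS]normrM (ger0_norm B0) (normrM (b y)) (ger0_norm (ler0n _ _)) mulrCA ler_wpM2l//.
have LG : L1 mu (fun y => (b x - b y) * (K (x - y) * (F y)%:R)).
  have := (L1B (N1Z (b x) LK).1 LbK).1; congr L1; apply/funext => y; ring.
split=> //.
have TE (f : V -> R) : L1 mu (fun y => K (x - y) * f y) -> (forall y, ~~ F y -> f y = 0) ->
    T_op alpha O f x = fine (\int[mu]_y (K (x - y) * f y)%:E).
  move=> Lf f0; rewrite /T_op; case: ifPn => [/eqP a0|_]; last by rewrite /Rintegral.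
  apply: cvg_lim => //; apply: cvg_near_cst; near=> t.
  have te : t < e by near: t; exact: nbhs_right_lt.
  rewrite /T_truncated Rint_set; congr fine; apply: eq_integral => y _; congr EFin.
  have [h|h] := boolP (F y); last by rewrite /integrand f0// !mulr0 mul0r.
  have [he _] := hF y h; rewrite /integrand /K a0 (lt_trans te he) mulr1//.
rewrite /commutator TE//; last by move=> y /negbTE ->.
rewrite TE//; last by move=> y /negbTE h; rewrite /= h mulr0.
rewrite fine_integralZ; last exact: L1_int.
have -> : fine (\int[mu]_y (b x * (K (x - y) * (F y)%:R))%:E) =
   fine (\int[mu]_y ((b x - b y) * (K (x - y) * (F y)%:R))%:E) +
   fine (\int[mu]_y (K (x - y) * (b y * (F y)%:R))%:E).
  rewrite -fine_integralD; [|exact: L1_int|exact: L1_int].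
  congr fine; apply: eq_integral => y _; congr EFin; ring.
by rewrite addrK.
Unshelve. all: by end_near. Qed.

Variables (beta : R) (x0 : V) (eta c0 C0 sg : R).
Hypotheses (alpha0 : 0 <= alpha < n%:R) (beta01 : 0 < beta < 1) (eta0 : 0 < eta) (c00 : 0 < c0).
Hypothesis sg1 : `|sg| = 1.
Hypothesis cone : forall w, `|w - x0| <= eta ->
  [/\ 1/2 < enorm w, enorm w <= 2 & c0 <= sg * O w <= C0].
Hypothesis homO : homogeneous0 O.
Hypothesis star : exists A : R, forall z r F, 0 < r -> measurable_fun setT F ->
  (forall y, F y -> `|z - y| <= r) -> exists g, [/\ measurable_fun setT g,
    commutator b alpha O (fun y => (F y)%:R) = g %[ae mu] &
    forall z', (\int[mu]_x ((`|z' - x| <= r)%R%:R * `|g x|)%:E <= (A * r `^ (n%:R + alpha + beta))%:E)%E].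

Let L := 2 / eta.
Let L0 : 0 < L. Proof. by rewrite divr_gt0. Qed.
Let na0 : 0 < n%:R - alpha. Proof. by rewrite subr_gt0; case/andP: alpha0. Qed.

Let cone_K z r x y : 0 < r -> `|z - x| <= r -> `|(z - (L * r) *: x0) - y| <= r ->
  [/\ L * r / 2 < enorm (x - y), c0 / (2 * (L * r)) `^ (n%:R - alpha) <= sg * K (x - y) &
      `|K (x - y)| <= C0 / (L * r / 2) `^ (n%:R - alpha)].
Proof.
move=> r0 zx zy; have Lr : 0 < L * r by rewrite mulr_gt0.
set w := (L * r)^-1 *: (x - y).
have xyE : x - y = (L * r) *: w by rewrite /w scalerA divff ?scale1r// gt_eqF.
have hw : `|w - x0| <= eta.
  have -> : w - x0 = (L * r)^-1 *: ((z - (L * r) *: x0 - y) - (z - x)).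
    rewrite /w; have -> : z - (L * r) *: x0 - y - (z - x) = (x - y) - (L * r) *: x0.
      by apply/rowP => i; rewrite !mxE; ring.
    by rewrite [RHS]scalerBr scalerA mulVf ?scale1r// gt_eqF.
  rewrite normrZ gtr0_norm ?invr_gt0// mulrC ler_pdivrMr//.
  apply: le_trans (ler_normB _ _) _; apply: le_trans (lerD zy zx) _.
  have -> : eta * (L * r) = 2 * r by rewrite /L; field; rewrite gt_eqF.
  by rewrite mulr2n mulrDl mul1r.
have [w1 w2 /andP[w3 w4]] := cone hw.
have e1 : 0 < enorm w by apply: lt_trans w1; rewrite divr_gt0.
have wn : w != 0 by rewrite -enorm_gt0.
have eE : enorm (x - y) = L * r * enorm w by rewrite xyE enormZ gtr0_norm.
have ed : L * r / 2 < enorm (x - y) by rewrite eE ltr_pM2l// -div1r.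
have eu : enorm (x - y) <= 2 * (L * r) by rewrite eE mulrC ler_pM2r.
have d0 : 0 < enorm (x - y) by rewrite eE mulr_gt0.
have OE : O (x - y) = O w by rewrite xyE homO.
have i2 : (2 * (L * r)) `^ (n%:R - alpha) >= enorm (x - y) `^ (n%:R - alpha).
  have u2 : 0 <= 2 * (L * r) by apply: mulr_ge0 => //; exact: ltW.
  by apply: ge0_ler_powR; rewrite ?nnegrE ?enorm_ge0 ?(ltW na0) ?u2.
have i1 : (L * r / 2) `^ (n%:R - alpha) <= enorm (x - y) `^ (n%:R - alpha).
  have u2 : 0 <= L * r / 2 by apply: divr_ge0 => //; exact: ltW.
  by apply: ge0_ler_powR; rewrite ?nnegrE ?enorm_ge0 ?(ltW na0) ?u2 ?(ltW ed).
have p1 : 0 < enorm (x - y) `^ (n%:R - alpha) by apply: powR_gt0.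
split=> //.
  rewrite /K OE (mulrA sg); apply: ler_pM; rewrite ?invr_ge0 ?powR_ge0 ?(ltW c00)//.
  have u3 : 0 < 2 * (L * r) by apply: mulr_gt0.
  by rewrite lef_pV2 ?posrE ?p1 ?(powR_gt0 _ u3).
have sO : `|O w| = sg * O w.
  by rewrite -[LHS]mul1r -sg1 -normrM ger0_norm//; apply: le_trans w3; exact: ltW.
rewrite /K OE normrM sO gtr0_norm ?invr_gt0//.
apply: ler_pM; rewrite ?invr_ge0 ?powR_ge0//; first by apply: le_trans w3; exact: ltW.
have u4 : 0 < L * r / 2 by apply: divr_gt0.
by rewrite lef_pV2 ?posrE ?p1 ?(powR_gt0 _ u4).
Qed.

(** The slack of the median is taken equal to [r ^ beta], the size of the bound to be
    proved. *)
Theorem star_osc : exists2 C, 0 < C & forall z r, 0 < r -> exists m,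
  (\int[mu]_y ((`|z - y| <= r)%R%:R * `|b y - m|)%:E <= (C * r `^ (n%:R + beta))%:E)%E.
Proof.
have [A hA] := star; pose A1 := `|A|.
have A10 : 0 <= A1 by exact: normr_ge0.
pose kap := c0 / (2 * L) `^ (n%:R - alpha) * 2 ^+ n.
have kap0 : 0 < kap by rewrite mulr_gt0 ?exprn_gt0// divr_gt0// powR_gt0// mulr_gt0.
exists (2 ^+ n + 2 / kap * (2 * A1)).
  by rewrite ltr_wpDr ?exprn_gt0// !mulr_ge0 ?invr_ge0 ?(ltW kap0).
move=> z r r0; have Lr : 0 < L * r by rewrite mulr_gt0.
(* [z'] is the centre of the cube [P]: [x - y] is then, for [x] and [y] in the two
   cubes, a multiple of a vector at distance at most [eta] from [x0]. *)
set z' := z - (L * r) *: x0; set e := r `^ beta; have e0 : 0 < e by apply: powR_gt0.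
have [m [hm1 hm2]] := median z' lb r0 e0; exists m.
set v := (2 * r) ^+ n in hm1 hm2; have v0 : 0 < v by rewrite exprn_gt0// mulr_gt0.
pose F1 y := (`|z' - y| <= r) && (b y <= m + e).
pose F2 y := (`|z' - y| <= r) && (m - e < b y).
have mF1 : measurable_fun setT F1 by rewrite /F1; mfun.
have mF2 : measurable_fun setT F2 by rewrite /F2; mfun.
have F1r y : F1 y -> `|z' - y| <= r by case/andP.
have F2r y : F2 y -> `|z' - y| <= r by case/andP.
have [g1 [mg1 cg1 hg1]] := hA z' r F1 r0 mF1 F1r.
have [g2 [mg2 cg2 hg2]] := hA z' r F2 r0 mF2 F2r.
pose k := c0 / (2 * (L * r)) `^ (n%:R - alpha).
have k0 : 0 < k by rewrite divr_gt0// powR_gt0// mulr_gt0.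
pose B := C0 / (L * r / 2) `^ (n%:R - alpha).
have low x F s t : `|z - x| <= r -> measurable_fun setT F -> (forall y, F y -> `|z' - y| <= r) ->
    ((v / 2)%:E <= \int[mu]_y ((F y)%:R)%:E)%E -> 0 <= t -> `|s| = 1 ->
    (forall y, F y -> t <= s * (b x - b y)) ->
    t <= 2 / (k * v) * `|commutator b alpha O (fun y => (F y)%:R) x|.
  move=> zx mF Fr hF t0 s1 hb.
  have B0 : 0 <= B.
    have xx : `|x0 - x0| <= eta by rewrite subrr normr0 ltW.
    have [w1 w2 w3] := cone xx.
    rewrite divr_ge0 ?powR_ge0//; case/andP: w3 => w4 w5; apply: le_trans w5.
    by apply: le_trans w4; exact: ltW.
  have hF' y : F y -> L * r / 2 < enorm (x - y) /\ `|K (x - y)| <= B.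
    by move=> /Fr h; have [h1 _ h3] := cone_K r0 zx h.
  have Lr2 : 0 < L * r / 2 by rewrite divr_gt0.
  have [LG ->] := commutator_away r0 mF Fr Lr2 B0 hF'.
  have LF := ball_indic_L1 (ltW r0) mF Fr.
  have ss : `|s * sg| = 1 by rewrite normrM s1 sg1 mulr1.
  have H := @signed_lower _ F (s * sg) (t * k) ss mF LG LF _.
  have kv : 0 < k * v by rewrite mulr_gt0.
  have hv : v / 2 <= fine (\int[mu]_y ((F y)%:R)%:E).
    rewrite -lee_fin fineK//; apply: integrable_fin_num => //; exact: L1_int.
  have H1 : t * k * (v / 2) <= `|fine (\int[mu]_y ((b x - b y) * (K (x - y) * (F y)%:R))%:E)|.
    apply: (@le_trans _ _ (t * k * fine (\int[mu]_y ((F y)%:R)%:E))).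
      by rewrite ler_wpM2l// mulr_ge0// ltW.
    apply: H => y; have [h|h] := boolP (F y); last by rewrite !mulr0.
    have [_ h2 _] := cone_K r0 zx (Fr y h).
    rewrite !mulr1 (_ : s * sg * _ = (s * (b x - b y)) * (sg * K (x - y))); last by ring.
    by apply: ler_pM => //; [exact: ltW|exact: hb].
  have -> : t = 2 / (k * v) * (t * k * (v / 2)) by field; rewrite !gt_eqF.
  by rewrite ler_wpM2l// divr_ge0// ltW.
have pw x : `|z - x| <= r -> `|b x - m| <= e + 2 / (k * v) *
    (`|commutator b alpha O (fun y => (F1 y)%:R) x| + `|commutator b alpha O (fun y => (F2 y)%:R) x|).
  move=> zx; have D0 : 0 <= 2 / (k * v) by rewrite divr_ge0// mulr_ge0 ?(ltW k0) ?(ltW v0).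
  have D1 := mulr_ge0 D0 (normr_ge0 (commutator b alpha O (fun y => (F1 y)%:R) x)).
  have D2 := mulr_ge0 D0 (normr_ge0 (commutator b alpha O (fun y => (F2 y)%:R) x)).
  rewrite mulrDr; have [h|h] := leP (b x - m) (- e).
    have t0 : 0 <= (m - e) - b x by exact: sub_arith.
    have := low x F2 (- 1) _ zx mF2 F2r hm2 t0 (normrN1 _) _.
    move=> H; have {}H : m - e - b x <= 2 / (k * v) * `|commutator b alpha O (fun y => (F2 y)%:R) x|.
      by apply: H => y /andP[_ hy]; rewrite mulN1r opprB lerD2r ltW.
    have e1 := ltW e0; have hn : b x - m <= 0 by apply: le_trans h _; rewrite oppr_le0.
    by rewrite (ler0_norm hn); exact: low_arith.
  have [h2|h2] := leP e (b x - m).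
    have t0 : 0 <= b x - (m + e) by rewrite opprD addrA subr_ge0.
    have H := low x F1 1 _ zx mF1 F1r hm1 t0 (normr1 _) _.
    have {}H : b x - (m + e) <= 2 / (k * v) * `|commutator b alpha O (fun y => (F1 y)%:R) x|.
      by apply: H => y /andP[_ hy]; rewrite mul1r lerD2l lerN2.
    have hn : 0 <= b x - m by apply: le_trans h2; exact: ltW.
    by rewrite (ger0_norm hn); exact: high_arith.
  apply: (@le_trans _ _ e); last by rewrite lerDl addr_ge0.
  by rewrite ler_norml (ltW h) (ltW h2).
have D0 : 0 <= 2 / (k * v) by rewrite divr_ge0// mulr_ge0 ?(ltW k0) ?(ltW v0).
apply: (@le_trans _ _ (e%:E * \int[mu]_y (`|z - y| <= r)%R%:R%:E + (2 / (k * v))%:E *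
   (\int[mu]_y ((`|z - y| <= r)%R%:R * `|g1 y|)%:E + \int[mu]_y ((`|z - y| <= r)%R%:R * `|g2 y|)%:E))%E).
  rewrite -nnD//; [|by mfun|by mfun].
  rewrite -nnZ ?(ltW e0)//; [|by mfun].
  rewrite -nnZ//; last by mfun.
  rewrite -nnD; [|by mfun|by mfun|by move=> y; rewrite mulr_ge0 ?(ltW e0)|by move=> y; rewrite mulr_ge0// addr_ge0 ?mulr_ge0].
  apply: ae_ge0_le_integral; first exact: measurableT.
  - by move=> y _; rewrite lee_fin mulr_ge0.
  - by mfun.
  - move=> y _; rewrite lee_fin; apply: addr_ge0; first by rewrite mulr_ge0 ?(ltW e0).
    by apply: mulr_ge0 => //; apply: addr_ge0; rewrite mulr_ge0.
  - by mfun.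
  move: cg1 cg2; apply: filterS2 => y h1 h2 _; rewrite lee_fin.
  have [h|h] := leP `|z - y| r; last by rewrite !mul0r !mulr0 addr0 mulr0 addr0.
  by rewrite !mul1r mulr1 -(h1 I) -(h2 I); exact: pw.
rewrite int_near ?(ltW r0)//.
have hg (g : V -> R) : (forall z', (\int[mu]_x ((`|z' - x| <= r)%R%:R * `|g x|)%:E <= (A * r `^ (n%:R + alpha + beta))%:E)%E) ->
    (\int[mu]_x ((`|z - x| <= r)%R%:R * `|g x|)%:E <= (A1 * r `^ (n%:R + alpha + beta))%:E)%E.
  by move=> h; apply: le_trans (h z) _; rewrite lee_fin ler_wpM2r ?powR_ge0// ler_norm.
have D0' : (0 <= (2 / (k * v))%:E)%E by rewrite lee_fin.
apply: le_trans (leeD (lexx _) (lee_wpmul2l D0' (leeD (hg _ hg1) (hg _ hg2)))) _.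
set X := A1 * _; apply: (@le_trans _ _ (e * (2 * r) ^+ n + 2 / (k * v) * (X + X))%:E); first exact: lexx.
rewrite lee_fin le_eqVlt; apply/orP; left; apply/eqP; rewrite /X.
have kv : k * v = kap * (r `^ alpha).
  rewrite /k /v /kap.
  have -> : 2 * (L * r) = 2 * L * r by ring.
  have uL : 0 <= 2 * L by apply: mulr_ge0 => //; exact: ltW.
  rewrite (@powRM _ (2 * L)) ?uL ?(ltW r0)// exprMn.
  have -> : r ^+ n = r `^ (n%:R - alpha) * r `^ alpha by rewrite -(powRD_pos _ _ r0) subrK powR_mulrn ?(ltW r0).
  by field; rewrite !gt_eqF ?powR_gt0// mulr_gt0.
have -> : r `^ (n%:R + alpha + beta) = r `^ (n%:R + beta) * r `^ alpha.
  by rewrite -(powRD_pos _ _ r0); congr (_ `^ _); ring.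
have ra : 0 < r `^ alpha by apply: powR_gt0.
rewrite kv /e -(powR_mulrn n) ?mulr_ge0 ?(ltW r0)// (@powRM _ 2) ?(ltW r0)// powR_mulrn//.
rewrite (powRD_pos n%:R beta r0); field.
by rewrite !gt_eqF.
Qed.

End necessity.

(** * Assembling the equivalences *)

Section continuity.
Context {R : realType} {n : nat}.
Hypothesis n0 : (0 < n)%N.
Local Notation V := 'rV[R]_n.
Local Notation mu := (@lebesgue_rV R n).
Implicit Types (x y z w u : V) (f g O : V -> R).

Lemma cvg_enorm x : (fun w : V => enorm w) @ x --> enorm x.
Proof.
have H (s : seq 'I_n) : (fun w : V => \sum_(i <- s) w ord0 i ^+ 2) @ x --> \sum_(i <- s) x ord0 i ^+ 2.
  elim: s => [|i s IH].
    rewrite big_nil (_ : (fun w : V => _) = fun=> 0).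
      by apply: cvg_cst; exact: nbhs_filter.
    by apply/funext => w; rewrite big_nil.
  rewrite big_cons (_ : (fun w : V => _) = fun w : V => w ord0 i * w ord0 i + \sum_(j <- s) w ord0 j ^+ 2).
    have ci : (fun w : V => w ord0 i) @ x --> x ord0 i by exact: coord_continuous.
    rewrite expr2; exact: (@cvgD _ _ _ (nbhs x) (nbhs_filter x) _ _ _ _ (@cvgM _ _ (nbhs x) (nbhs_filter x) _ _ _ _ ci ci) IH).
  by apply/funext => w; rewrite big_cons.
by apply: (cvg_comp _ _ (H _)); exact: sqrt_continuous.
Qed.

Lemma enorm_continuous : continuous (@enorm R n). Proof. exact: cvg_enorm. Qed.

Lemma normalize_continuous x : x != 0 -> (fun w : V => normalize w) @ x --> normalize x.
Proof.
move=> x0; have e0 : enorm x != 0 by rewrite gt_eqF// enorm_gt0.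
have cx : (fun w : V => w) @ x --> x by exact: cvg_id.
have ci : (fun w : V => (enorm w)^-1) @ x --> (enorm x)^-1.
  exact: (@cvgV _ _ (nbhs x) (nbhs_filter x) _ _ e0 (@cvg_enorm x)).
exact: (@cvgZ _ _ _ (nbhs x) (nbhs_filter x) _ _ _ _ ci cx).
Qed.

Lemma near_enorm_gt x (a : R) : a < enorm x -> \forall w \near x, a < enorm w.
Proof. by move=> h; apply: (@cvgr_gt _ _ (nbhs x) (nbhs_filter x) _ _ (@cvg_enorm x) _ h). Qed.

Lemma near_enorm_lt x (a : R) : enorm x < a -> \forall w \near x, enorm w < a.
Proof. by move=> h; apply: (@cvgr_lt _ _ (nbhs x) (nbhs_filter x) _ _ (@cvg_enorm x) _ h). Qed.

Lemma near_normalize x (U : set V) : x != 0 -> nbhs (normalize x) U -> \forall w \near x, w != 0 /\ U (normalize w).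
Proof.
move=> x0 xU; have := normalize_continuous x0 xU.
have : \forall w \near x, 0 < enorm w.
  by apply: near_enorm_gt; rewrite enorm_gt0.
by apply: filterS2 => w w0 wU; split=> //; rewrite -enorm_gt0.
Qed.

Lemma normalize_unit x : enorm x = 1 -> normalize x = x.
Proof. by rewrite /normalize => ->; rewrite invr1 scale1r. Qed.

Lemma unit_neq0 x : enorm x = 1 -> x != 0.
Proof. by move=> h; rewrite -enorm_gt0 h ltr01. Qed.

(** A bound on a relatively open piece of the sphere extends, by homogeneity,
    to a full neighbourhood of one of its points. *)
Lemma cone_bound O U x0 (c C : R) : homogeneous0 O -> open U -> U x0 -> enorm x0 = 1 ->
  0 < c < C \/ c < C < 0 -> (forall x, (U `&` unit_sphere n) x -> c <= O x <= C) ->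
  exists eta c0 C0 sg : R, [/\ 0 < eta, 0 < c0, `|sg| = 1 &
    forall w, `|w - x0| <= eta -> [/\ 1/2 < enorm w, enorm w <= 2 & c0 <= sg * O w <= C0]].
Proof.
move=> hO oU Ux0 e0 cC hU; have x00 := unit_neq0 e0.
have nU : nbhs (normalize x0) U by rewrite normalize_unit//; move: oU; rewrite openE; apply.
have h1 : \forall w \near x0, 1/2 < enorm w.
  by apply: near_enorm_gt; rewrite e0 ltr_pdivrMr// mul1r ltr1n.
have h2 : \forall w \near x0, enorm w < 2.
  by apply: near_enorm_lt; rewrite e0 ltr1n.
have : \forall w \near x0, (w != 0 /\ U (normalize w)) /\ (1/2 < enorm w /\ enorm w < 2).
  have := near_normalize x00 nU; apply: filterS3 h1 h2 => w ? ? ?; by [].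
move=> /nbhs_normP[e /= ep he].
have key w : `|w - x0| <= e / 2 -> [/\ 1/2 < enorm w, enorm w <= 2 & c <= O w <= C].
  move=> hw; have [] := he w; first by rewrite /= distrC; apply: le_lt_trans hw _; rewrite ltr_pdivrMr// ltr_pMr// ltr1n.
  move=> [w0 Uw] [w1 w2]; split=> //; first exact: ltW.
  have [en nn] := enorm_normalize w0.
  by rewrite -(homogeneous_normalize hO w0); exact: hU.
have ep2 : 0 < e / 2 by rewrite divr_gt0.
case: cC => /andP[cp Cp].
  exists (e / 2), c, C, 1; split => // [|w /key[w1 w2 w3]]; first exact: normr1.
  by split => //; rewrite mul1r.
exists (e / 2), (- C), (- c), (- 1); split => // [||w /key[w1 w2 /andP[w3 w4]]].
- by rewrite oppr_gt0.
- by rewrite normrN1.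
- by split => //; rewrite mulN1r !lerN2 w3 w4.
Qed.

Section continuous_on_sphere.
Variable O : V -> R.
Hypotheses (cO : {within unit_sphere n, continuous O}) (hO : homogeneous0 O).

Lemma sphere_near x (P : set R) : enorm x = 1 -> nbhs (O x) P ->
  exists2 U, open U /\ U x & forall y, (U `&` unit_sphere n) y -> P (O y).
Proof.
move=> e1 nP; have := (subspace_continuousP _ _).1 cO x e1 P nP.
rewrite /fmap /within /= nbhsE => -[U [oU Ux] hU].
by exists U => // y [Uy sy]; exact: hU.
Qed.

(** Off the origin the function is continuous, by homogeneity; its value at the
    origin is arbitrary. *)
Lemma measurable_sphere_continuous : measurable_fun setT O.
Proof.
have m0 : measurable [set x : V | x != 0].
  have mb : measurable_fun setT (fun x : V => 0 < enorm x) by mfun.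
  rewrite (_ : [set x | _] = setT `&` (fun x : V => 0 < enorm x) @^-1` [set true]); first exact: mb.
  by apply/seteqP; split=> x /=; rewrite enorm_gt0 => // -[].
apply: (measurability _ (RGenOInfty.measurableE R)) => /= _ [_ [a ->]] <-; rewrite setTI.
have oW : open [set x | x != 0 /\ a < O x].
  rewrite openE => x /= [x0 ax]; have [e1 nx] := enorm_normalize x0.
  have nP : nbhs (O (normalize x)) [set t | a < t].
    by rewrite homogeneous_normalize//; exact: lt_nbhsr.
  have [U [oU Ux] hU] := sphere_near e1 nP.
  have nU : nbhs (normalize x) U by move: oU; rewrite openE; apply.
  apply: (proj2 (nbhs_normP x _)); have /nbhs_normP[e ep he] := near_normalize x0 nU.
  exists e => // w /he[w0 Uw]; split=> //; rewrite -(homogeneous_normalize hO w0).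
  by apply: hU; split=> //; case: (enorm_normalize w0).
have -> : O @^-1` `]a, +oo[ = [set x | x != 0 /\ a < O x] `|`
    (if a < O 0 then ~` [set x | x != 0] else set0).
  apply/seteqP; split=> x /=; rewrite in_itv /= andbT.
    have [->|x0] := eqVneq x 0; last by left.
    by move=> h; right; rewrite h /= eqxx.
  move=> [[]//|]; case: ifPn => //= h /negP; rewrite negbK => /eqP ->; exact: h.
apply: measurableU; first exact: measurable_open.
by case: ifP => _; [exact: measurableC|exact: measurable0].
Qed.

Lemma sphere_compact : compact (unit_sphere n : set V).
Proof.
apply: bounded_closed_compact.
  exists 1; split => // M M1 x /= h.
  by apply: le_trans (ltW M1); rewrite -h; exact: norm_le_enorm.
rewrite (_ : unit_sphere n = (@enorm R n) @^-1` [set 1])//.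
by apply: preimage_closed => [x _|]; [exact: enorm_continuous|exact: closed_eq].
Qed.

Lemma bounded_sphere_continuous : (exists x, unit_sphere n x) -> exists2 M, 0 < M & forall x, `|O x| <= M.
Proof.
move=> ne; have [a _ ha] := EVT_max_rV ne sphere_compact cO.
have [b _ hb] := EVT_min_rV ne sphere_compact cO.
exists (`|O a| + `|O b| + `|O 0| + 1); first by rewrite ltr_wpDl// !addr_ge0.
move=> x; have [->|x0] := eqVneq x 0; first by apply: ler_wpDr => //; rewrite lerDr addr_ge0.
have [e1 _] := enorm_normalize x0; rewrite -(homogeneous_normalize hO x0).
have sx : normalize x \in (unit_sphere n : set V) by rewrite inE.
have h1 := ha _ sx; have h2 := hb _ sx.
have A0 := normr_ge0 (O a); have B0 := normr_ge0 (O b); have Z0 := normr_ge0 (O 0).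
have A1 := ler_norm (O a); have B1 := ler_norm (- O b); rewrite normrN in B1.
move: h1 h2 A0 B0 Z0 A1 B1; set X := O (normalize x); set A := `|O a|; set B := `|O b|; set Z := `|O 0|.
by move=> *; apply/ler_normlP; split; lra.
Qed.

End continuous_on_sphere.

Lemma compact_ball (K : set V) : compact K -> measurable K /\ exists2 r, 0 < r & K `<=` [set y | `|y| <= r].
Proof.
move=> cK; split.
  rewrite -(setCK K); apply: measurableC; apply: measurable_open.
  by apply: closed_openC; exact: compact_closed (@norm_hausdorff _ _) cK.
have [M [Mr hM]] := compact_bounded cK; exists (`|M| + 1); first by rewrite ltr_wpDl.
by move=> y Ky /=; apply: hM Ky; rewrite (le_lt_trans (ler_norm M))// ltrDl.
Qed.

Lemma ball_compact (r : R) : compact [set y : V | `|y| <= r].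
Proof.
apply: bounded_closed_compact.
  exists r; split => [|M M1 x /= h]; [exact: num_real|exact: le_trans (ltW M1)].
rewrite (_ : [set y : V | _] = (fun y : V => `|y|) @^-1` [set t | t <= r])//.
by apply: preimage_closed => [x _|]; [exact: norm_continuous|exact: closed_le].
Qed.

Lemma Lp_loc_locint (b : V -> R) : Lp_loc 1 b -> locint b.
Proof.
move=> [mb hb]; split=> // r; have := hb _ (ball_compact (r := r)).
rewrite integral_mkcond; congr (_ < _)%E; apply: eq_integral => y _.
rewrite /patch; case: ifPn => [|/negP]; rewrite inE /=.
  by move=> ->; rewrite mul1r powRr1.
by move=> /negP/negbTE ->; rewrite mul0r.
Qed.

End continuity.

Section spaces.
Context {R : realType} {n : nat}.
Hypothesis n0 : (0 < n)%N.
Local Notation V := 'rV[R]_n.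
Local Notation mu := (@lebesgue_rV R n).
Implicit Types (f g O b : V -> R) (p q lam nu N alpha : R).

Definition in_mor p lam f := measurable_fun setT f /\ exists2 N, 0 < N & mor p lam N f.

Lemma fin_bound (x : \bar R) : (0 <= x)%E -> (x < +oo)%E -> exists2 N, 0 < N & (x <= N%:E)%E.
Proof.
case: x => [a| |] // a0 _; exists (a + 1); first by rewrite ltr_wpDl.
by rewrite lee_fin lerDl.
Qed.

Lemma in_Lfun p f : 0 < p -> f \in Lfun mu p%:E <-> in_mor p (- (n%:R / p)) f.
Proof.
move=> p0; split=> [/memLfun[mf hf]|[mf [N N0 hN]]].
  split=> //; have [N N0 hN] := fin_bound (Lnorm_ge0 _ _ _) hf; exists N => //.
  by apply/(mor_Lp _ p0 mf)/(Lnorm_le p0 (ltW N0) mf).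
apply/memLfun; split=> //; apply: le_lt_trans (ltry N).
by apply/(Lnorm_le p0 (ltW N0) mf)/(mor_Lp _ p0 mf).
Qed.

Lemma morrey_norm_ge0 p lam f : (0 <= morrey_norm p lam f)%E.
Proof.
apply: (@le_trans _ _ (((volume (cube (0%R : V) 1%R) `^ (lam / n%:R))^-1)%:E *
         (((volume (cube (0%R : V) 1%R))^-1)%:E *
          \int[mu]_(y in cube (0%R : V) 1%R) (`|f y| `^ p)%:E) `^ p^-1)%E).
  apply: mule_ge0; [by rewrite lee_fin invr_ge0 powR_ge0|exact: poweR_ge0].
by apply: ereal_sup_ubound; exists 0, 1.
Qed.

Lemma in_morrey p lam f : 0 < p -> morrey p lam f <-> in_mor p lam f.
Proof.
move=> p0; split=> [[[mf _] hf]|[mf [N N0 hN]]].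
  split=> //; have [N N0 hN] := fin_bound (morrey_norm_ge0 _ _ _) hf; exists N => //.
  by apply/(morrey_norm_le n0 _ _ p0 (ltW N0)).
split; last by apply: le_lt_trans (ltry N); apply/(morrey_norm_le n0 _ _ p0 (ltW N0)).
split=> // K /compact_ball[mK [r r0 Kr]]; apply: le_lt_trans (_ : (_ <= _)%E) _; first last.
- by apply: le_lt_trans (hN 0 r r0) (ltry _).
rewrite integral_mkcond; apply: ge0_le_integral => //.
- by move=> x _; rewrite /patch; case: ifP => // _; rewrite lee_fin powR_ge0.
- by apply/(measurable_restrictT _ mK); apply: measurable_funTS; mfun.
- by mfun.
move=> x _; rewrite /patch; case: ifPn => [|_]; last by rewrite lee_fin mulr_ge0 ?powR_ge0.
by rewrite inE => /Kr /= h; rewrite sub0r normrN h mul1r.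
Qed.

(** The operator bound behind both forms of boundedness: a Morrey estimate at
    every admissible level, for a single representative of the commutator. *)
Definition mor_bounded b alpha O p lam q nu := exists2 C, 0 < C & forall f, in_mor p lam f ->
  (\forall x \ae mu, T_defined alpha O f x /\ T_defined alpha O (b \* f) x) /\
  exists g, [/\ measurable_fun setT g, commutator b alpha O f = g %[ae mu] &
    forall N, 0 < N -> mor p lam N f -> mor q nu (C * N) g].

(** The operator norm is recovered by applying the estimate at levels that decrease
    to the norm, which covers functions of norm 0. *)
Lemma bounded_mor b alpha O p lam q nu (X Y : set (V -> R)) (nX nY : (V -> R) -> \bar R) :
  (forall f, X f <-> in_mor p lam f) -> (forall f, Y f <-> in_mor q nu f) ->
  (forall f, (0 <= nX f)%E) ->
  (forall f N, 0 <= N -> measurable_fun setT f -> (nX f <= N%:E)%E <-> mor p lam N f) ->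
  (forall f N, 0 <= N -> measurable_fun setT f -> (nY f <= N%:E)%E <-> mor q nu N f) ->
  commutator_bounded b alpha O X nX Y nY <-> mor_bounded b alpha O p lam q nu.
Proof.
move=> hX hY nX0 hnX hnY; split=> [[C hC]|[C C0 hC]].
  have C1 : 0 < `|C| + 1 by rewrite ltr_wpDl.
  exists (`|C| + 1) => // f hf; have [ae [g [Yg cg hg]]] := hC f ((hX f).2 hf).
  split=> //; have [mg _] := (hY g).1 Yg; have [mf _] := hf.
  exists g; split=> // N N0 hN; apply/hnY => //; first by rewrite mulr_ge0 ?ltW.
  have hN' : (nX f <= N%:E)%E by apply/(hnX f N (ltW N0) mf).
  apply: le_trans hg _; apply: (@le_trans _ _ ((`|C| + 1)%:E * nX f)%E).
    by apply: lee_wpmul2r => //; rewrite lee_fin (le_trans (ler_norm C))// lerDl.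
  by rewrite EFinM; apply: lee_wpmul2l => //; rewrite lee_fin ltW.
exists C => f Xf; have hf := (hX f).1 Xf; have [mf [N N0 hN]] := hf.
have [ae [g [mg cg hg]]] := hC f hf; split=> //; exists g; split=> //.
  by apply/hY; split=> //; exists (C * N); [exact: mulr_gt0|exact: hg].
have nXN : (nX f <= N%:E)%E by apply/(hnX f N (ltW N0) mf).
have nXfin : (nX f \is a fin_num)%E by rewrite ge0_fin_numE//; exact: le_lt_trans nXN (ltry _).
have a0 : 0 <= fine (nX f) by exact: fine_ge0.
rewrite -(fineK nXfin) -EFinM; apply/lee_addgt0Pr => e e0.
(* The level exceeds the norm by [e / C], so the loss in the bound is [e]. *)
have Np : 0 < fine (nX f) + e / C by rewrite ltr_wpDl// divr_gt0.
rewrite -EFinD (_ : C * fine (nX f) + e = C * (fine (nX f) + e / C)); last by field; rewrite gt_eqF.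
apply/hnY => //; first by rewrite mulr_ge0 ?ltW.
apply: hg => //; apply/(hnX f _ (ltW Np) mf).
by rewrite -(fineK nXfin) lee_fin lerDl divr_ge0 ?ltW.
Qed.

Lemma bounded_Lp b alpha O p q : 0 < p -> 0 < q -> commutator_bounded_Lp b alpha O p q <->
  mor_bounded b alpha O p (- (n%:R / p)) q (- (n%:R / q)).
Proof.
move=> p0 q0; apply: bounded_mor.
- by move=> f; exact: in_Lfun.
- by move=> f; exact: in_Lfun.
- by move=> f; exact: Lnorm_ge0.
- by move=> f N N0 mf; split=> [/(Lnorm_le p0 N0 mf)/(mor_Lp _ p0 mf)|/(mor_Lp _ p0 mf)/(Lnorm_le p0 N0 mf)].
- by move=> f N N0 mf; split=> [/(Lnorm_le q0 N0 mf)/(mor_Lp _ q0 mf)|/(mor_Lp _ q0 mf)/(Lnorm_le q0 N0 mf)].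
Qed.

Lemma bounded_morrey b alpha O p lam q nu : 0 < p -> 0 < q ->
  commutator_bounded_morrey b alpha O p lam q nu <-> mor_bounded b alpha O p lam q nu.
Proof.
move=> p0 q0; apply: bounded_mor.
- by move=> f; exact: in_morrey.
- by move=> f; exact: in_morrey.
- by move=> f; exact: morrey_norm_ge0.
- by move=> f N N0 _; exact: morrey_norm_le.
- by move=> f N N0 _; exact: morrey_norm_le.
Qed.

End spaces.

Section core.
Context {R : realType} {n : nat}.
Hypothesis n0 : (0 < n)%N.
Local Notation V := 'rV[R]_n.
Local Notation mu := (@lebesgue_rV R n).
Implicit Types (x y z : V) (f g O b : V -> R) (F : V -> bool) (r N : R).

Lemma ae_reflect (Q : set V) x : (\forall u \ae mu, Q u) -> \forall y \ae mu, Q (x - y).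
Proof.
move=> [N [mN N0 sub]]; exists [set y | N (x - y)].
have mf : measurable_fun setT (fun y : V => x - y) by mfun.
have mS : measurable [set y | N (x - y)].
  by rewrite (_ : [set y | _] = setT `&` (fun y : V => x - y) @^-1` N); [exact: mf|rewrite setTI].
have m1 : (-1 : R) != 0 by rewrite oppr_eq0 oner_eq0.
split => //; last by move=> y /= h; exact: sub.
have mI : measurable_fun setT (fun y : V => (\1_N y)%:E : \bar R).
  by apply/measurable_EFinP; exact: measurable_indic.
have I0 y : (0 <= (\1_N y)%:E :> \bar R)%E by rewrite lee_fin indicE.
have := @ge0_integral_affine R n _ (-1) x m1 mI I0.
have -> : (\int[mu]_y (\1_N y)%:E = 0)%E by rewrite integral_indic// setIT.
rewrite mule0 => <-.
rewrite -(setIT [set y | _]) -integral_indic//; apply: eq_integral => y _; congr EFin.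
by rewrite !indicE scaleN1r addrC; congr (_%:R); apply/idP/idP; rewrite !inE.
Qed.

Section change.
Variables (alpha : R) (O O' f f' : V -> R) (x : V).
Hypotheses (mO : measurable_fun setT O) (mO' : measurable_fun setT O').
Hypotheses (mf : measurable_fun setT f) (mf' : measurable_fun setT f').
Hypotheses (eO : O = O' %[ae mu]) (ef : f = f' %[ae mu]).

Let mk (P : V -> R) : measurable_fun setT P ->
  measurable_fun setT (fun y => P (x - y) / enorm (x - y) `^ (n%:R - alpha)).
Proof.
move=> mP; rewrite (_ : (fun y => _) = fun y => P (x - y) * enorm (x - y) `^ (- (n%:R - alpha))); first by mfun.
by apply/funext => y; rewrite powRN.
Qed.

Let mi (P g : V -> R) : measurable_fun setT P -> measurable_fun setT g -> measurable_fun setT (integrand alpha P g x).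
Proof. by move=> mP mg; apply: measurable_funM => //; exact: mk. Qed.

Let mS (e : R) : measurable [set y | e < enorm (x - y)].
Proof.
have h : measurable_fun setT (fun y => e < enorm (x - y)) by mfun.
rewrite (_ : [set y | _] = setT `&` (fun y => e < enorm (x - y)) @^-1` [set true]); first exact: h.
by apply/seteqP; split=> y //= [].
Qed.

Let ei : \forall y \ae mu, integrand alpha O f x y = integrand alpha O' f' x y.
Proof.
have := ae_reflect x eO; move: ef; apply: filterS2 => y h1 h2.
by rewrite /integrand (h1 I) (h2 I).
Qed.

Let eint (D : set V) : measurable D ->
  (\int[mu]_(y in D) (integrand alpha O f x y)%:E = \int[mu]_(y in D) (integrand alpha O' f' x y)%:E)%E.
Proof.
move=> mD; apply: ae_eq_integral => //.
- by apply: measurable_funTS; apply/measurable_EFinP; exact: mi.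
- by apply: measurable_funTS; apply/measurable_EFinP; exact: mi.
- by apply: filterS ei => y h _ /=; rewrite h.
Qed.

Let einteg (D : set V) : measurable D ->
  mu.-integrable D (EFin \o integrand alpha O f x) -> mu.-integrable D (EFin \o integrand alpha O' f' x).
Proof.
move=> mD /integrableP[m1 h1]; apply/integrableP; split.
  by apply: measurable_funTS; apply/measurable_EFinP; exact: mi.
rewrite (_ : (\int[mu]_(y in D) _ = \int[mu]_(y in D) `|(EFin \o integrand alpha O f x) y|)%E)//.
apply: ae_eq_integral => //.
- apply: measurable_funTS; apply: measurableT_comp => //; apply/measurable_EFinP; exact: mi.
- by apply: measurable_funTS; apply: measurableT_comp => //; apply/measurable_EFinP; exact: mi.
- by apply: filterS ei => y h _ /=; rewrite h.
Qed.

Let etr : T_truncated alpha O f x = T_truncated alpha O' f' x.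
Proof. by apply/funext => e; rewrite /T_truncated /Rintegral eint. Qed.

Lemma T_op_ae : T_op alpha O f x = T_op alpha O' f' x.
Proof. by rewrite /T_op etr /Rintegral eint. Qed.

Lemma T_defined_ae : T_defined alpha O f x -> T_defined alpha O' f' x.
Proof.
rewrite /T_defined etr; case: ifP => _; last exact: einteg.
by move=> [h1 h2]; split=> // e e0; apply: einteg => //; exact: h1.
Qed.

End change.

(** The lower bound on [lam] is what makes large cubes harmless. *)
Lemma ball_indic_mor p lam z r F : 0 < p -> - (n%:R / p) <= lam < 0 -> 0 < r ->
  measurable_fun setT F -> (forall y, F y -> `|z - y| <= r) ->
  mor p lam ((2 * r) `^ (- lam)) (fun y => (F y)%:R).
Proof.
move=> p0 /andP[l1 l2] r0 mF Fr c s s0; have r2 : 0 < 2 * r by rewrite mulr_gt0.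
have s2 : 0 < 2 * s by rewrite mulr_gt0.
have Fp y : `|(F y)%:R| `^ p = (F y)%:R :> R.
  by rewrite ger0_norm//; case: (F y); rewrite ?powR1// powR0// gt_eqF.
under eq_integral do rewrite Fp.
have bnd d (t : R) : 0 <= t -> (forall y, (`|c - y| <= s) && F y -> `|d - y| <= t) ->
    (\int[mu]_y ((`|c - y| <= s)%R%:R * (F y)%:R)%:E <= ((2 * t) ^+ n)%:E)%E.
  move=> t0 h; rewrite -(int_near d t0); apply: nn_le => [||y]; [by mfun|by mfun|].
  rewrite mulr_ge0//= -natrM mulnb ler_nat.
  by case: (boolP ((`|c - y| <= s) && F y)) => // /h ->.
rewrite -powRrM mulNr.
have lp0 : lam * p <= 0 by rewrite nmulr_rle0 ?ltW.
(* Small cubes are bounded by their own volume, large ones by that of the given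
   cube. *)
have [sr|rs] := leP s r.
  apply: le_trans (bnd c s (ltW s0) _) _; first by move=> y /andP[].
  rewrite lee_fin (powRD_pos _ _ s2) powR_mulrn ?(ltW s2)// mulrCA ler_peMr ?exprn_ge0 ?(ltW s2)//.
  rewrite powRN mulrC -[leLHS](divff (_ : (2 * r) `^ (lam * p) != 0)) ?gt_eqF ?powR_gt0//.
  rewrite ler_wpM2r ?invr_ge0 ?powR_ge0//; apply: powR_le_neg => //.
  by rewrite ler_pM2l.
apply: le_trans (bnd z r (ltW r0) _) _; first by move=> y /andP[_ /Fr].
rewrite lee_fin -powR_mulrn ?(ltW r2)//.
have -> : (2 * r) `^ n%:R = (2 * r) `^ (- (lam * p)) * (2 * r) `^ (n%:R + lam * p).
  by rewrite -(powRD_pos _ _ r2); congr (_ `^ _); ring.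
rewrite ler_wpM2l ?powR_ge0//; apply: ge0_ler_powR; rewrite ?nnegrE ?(ltW r2) ?(ltW s2)//.
  by move: l1; rewrite -(ler_pM2r p0) mulNr divfK ?gt_eqF// => l1; rewrite addrC -lerBlDr sub0r.
by rewrite ler_pM2l// ltW.
Qed.

Variables (alpha beta p q : R) (b O : V -> R).
Hypotheses (hbeta : 0 < beta < 1) (halpha : 0 <= alpha < n%:R) (habn : alpha + beta < n%:R).
Hypotheses (p1 : 1 < p) (q1 : 1 < q) (hpq : q^-1 = p^-1 - (alpha + beta) / n%:R).
Hypotheses (lb : locint b) (mO : measurable_fun setT O).

Let p0 : 0 < p. Proof. exact: lt_trans p1. Qed.
Let q0 : 0 < q. Proof. exact: lt_trans q1. Qed.
Let b0 : 0 < beta. Proof. by case/andP: hbeta. Qed.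
Let a0 : 0 <= alpha. Proof. by case/andP: halpha. Qed.
Let nR : 0 < n%:R :> R. Proof. by rewrite ltr0n. Qed.
Let mb : measurable_fun setT b. Proof. by case: lb. Qed.

(** Changing [b] and [Omega] on null sets changes no integral, for any [x]. *)
Lemma Lip_mor_bounded lam nu O' M : nu = alpha + beta + lam -> alpha + beta + lam < 0 ->
  measurable_fun setT O' -> 0 < M -> (forall x, `|O' x| <= M) -> homogeneous0 O' ->
  O = O' %[ae mu] ->
  (alpha = 0 -> fine (\int[mu]_u (O' u * (0 < enorm u <= 1)%R%:R)%:E) = 0) ->
  Lip beta b -> mor_bounded b alpha O p lam q nu.
Proof.
move=> -> gl mO' M0 OM hO' eO mean [h [Ch holh] ebh].
have [C C0 hC] := holder_sup_norm b0 holh.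
have mh := measurable_holder b0 C0 hC.
have [D D0 hD] := commutator_bound n0 a0 b0 habn p1 q0 hpq gl mO' M0 OM hO' mean C0 hC.
exists D => // f [mf [N N0 hN]]; have [ae [g [mg cg hg]]] := hD N f N0 mf hN.
have ehb : h \* f = b \* f %[ae mu].
  by apply: filterS ebh => x e _ /=; rewrite (e I).
have eO' : O' = O %[ae mu] by apply: filterS eO => x e _; rewrite (e I).
have eff : f = f %[ae mu] by apply: nearW => x _.
have mhf : measurable_fun setT (h \* f) by apply: measurable_funM.
have mbf : measurable_fun setT (b \* f) by apply: measurable_funM.
split.
  apply: filterS ae => x [d1 d2]; split.
    exact: (T_defined_ae mO' mO mf mf eO' eff d1).
  exact: (T_defined_ae mO' mO mhf mbf eO' ehb d2).
exists g; split=> //; move: cg ebh; apply: filterS2 => x cx ex _; rewrite -(cx I) /commutator.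
rewrite (ex I) (T_op_ae alpha x mO' mO mf mf eO' eff).
by rewrite (T_op_ae alpha x mO' mO mhf mbf eO' ehb).
Qed.

(** The level of an indicator is [r ^ (- lam)], which turns the Morrey estimate into
    one that no longer depends on [lam]. *)
Lemma mor_bounded_Lip lam nu eta c0 C0 sg x0 : nu = alpha + beta + lam ->
  - (n%:R / p) <= lam < 0 -> homogeneous0 O -> 0 < eta -> 0 < c0 -> `|sg| = 1 ->
  (forall w, `|w - x0| <= eta -> [/\ 1/2 < enorm w, enorm w <= 2 & c0 <= sg * O w <= C0]) ->
  mor_bounded b alpha O p lam q nu -> Lip beta b.
Proof.
move=> nuE hlam hO eta0 c00 sg1 cone [D D0 hD].
have star : exists A : R, forall z r F, 0 < r -> measurable_fun setT F ->
  (forall y, F y -> `|z - y| <= r) -> exists g, [/\ measurable_fun setT g,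
    commutator b alpha O (fun y => (F y)%:R) = g %[ae mu] &
    forall z', (\int[mu]_x ((`|z' - x| <= r)%R%:R * `|g x|)%:E <= (A * r `^ (n%:R + alpha + beta))%:E)%E].
  exists (2 * D * 2 `^ (n%:R + alpha + beta)) => z r F r0 mF Fr.
  have r2 : 0 < 2 * r by rewrite mulr_gt0.
  have N0 : 0 < (2 * r) `^ (- lam) by apply: powR_gt0.
  have mor_F := ball_indic_mor p0 hlam r0 mF Fr.
  have iF : in_mor p lam (fun y => (F y)%:R) by split; [mfun|exists ((2 * r) `^ (- lam))].
  have [_ [g [mg cg hg]]] := hD _ iF.
  exists g; split=> // z'.
  apply: le_trans (mor_avg z' q1 mg (mulr_gt0 D0 N0) (hg _ N0 mor_F) r0) _.
  rewrite lee_fin le_eqVlt; apply/orP; left; apply/eqP.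
  have -> : 2 * D * 2 `^ (n%:R + alpha + beta) * r `^ (n%:R + alpha + beta) =
      2 * D * (2 * r) `^ (n%:R + alpha + beta) by rewrite powRM ?(ltW r0)// mulrA.
  have -> : n%:R + alpha + beta = - lam + (n%:R + nu) by rewrite nuE; ring.
  by rewrite (powRD_pos (- lam) (n%:R + nu) r2); ring.
have [C Cp osc] := star_osc mO lb halpha eta0 c00 sg1 cone hO star.
exact: campanato_Lip lb hbeta Cp osc.
Qed.

Theorem commutator_equivalence lam nu O' M eta c0 C0 sg x0 :
  nu = alpha + beta + lam -> alpha + beta + lam < 0 -> - (n%:R / p) <= lam < 0 ->
  homogeneous0 O -> 0 < eta -> 0 < c0 -> `|sg| = 1 ->
  (forall w, `|w - x0| <= eta -> [/\ 1/2 < enorm w, enorm w <= 2 & c0 <= sg * O w <= C0]) ->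
  measurable_fun setT O' -> 0 < M -> (forall x, `|O' x| <= M) -> homogeneous0 O' ->
  O = O' %[ae mu] ->
  (alpha = 0 -> fine (\int[mu]_u (O' u * (0 < enorm u <= 1)%R%:R)%:E) = 0) ->
  (Lip beta b <-> commutator_bounded_Lp b alpha O p q) /\
  (commutator_bounded_Lp b alpha O p q <-> commutator_bounded_morrey b alpha O p lam q nu).
Proof.
move=> nuE gl hlam hO eta0 c00 sg1 cone mO' M0 OM hO' eO mean.
have nqE : - (n%:R / q) = alpha + beta + - (n%:R / p).
  by rewrite hpq; field; rewrite !gt_eqF.
have gl2 : alpha + beta + - (n%:R / p) < 0 by rewrite -nqE oppr_lt0 divr_gt0.
have hlam2 : - (n%:R / p) <= - (n%:R / p) < 0 by rewrite lexx oppr_lt0 divr_gt0.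
have LM := @Lip_mor_bounded _ _ O' M nuE gl mO' M0 OM hO' eO mean.
have LP := @Lip_mor_bounded _ _ O' M nqE gl2 mO' M0 OM hO' eO mean.
have ML := mor_bounded_Lip nuE hlam hO eta0 c00 sg1 cone.
have PL := mor_bounded_Lip nqE hlam2 hO eta0 c00 sg1 cone.
have [Lp1 Lp2] := bounded_Lp b alpha O p0 q0.
have [Mo1 Mo2] := bounded_morrey n0 b alpha O lam nu p0 q0.
split; split=> h.
- exact/Lp2/LP.
- exact/PL/Lp1.
- exact/Mo2/LM/PL/Lp1.
- exact/Lp2/LP/ML/Mo1.
Qed.

End core.

Theorem corollary4p19 (R : realType) (n : nat)
    (alpha beta p q lambda nu : R) (b : 'rV[R]_n -> R)
    (hn : (0 < n)%N)
    (hbeta : 0 < beta < 1)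
    (halpha : 0 <= alpha < n%:R)
    (halphabeta : alpha + beta < n%:R)
    (hp : 1 < p) (hq : 1 < q)
    (hpq : q^-1 = p^-1 - (alpha + beta) / n%:R)
    (hlambda : - (n%:R / p) <= lambda < 0)
    (hsum : alpha + beta + lambda < 0)
    (hnu : nu = alpha + beta + lambda)
    (hb : Lp_loc 1 b) :
  (forall Omega : 'rV[R]_n -> R,
    Omega \in Lfun (sphere_measure n) +oo%E ->
    ~ (Omega = cst 0 %[ae sphere_measure n]) ->
    homogeneous0 Omega ->
    (alpha = 0 ->
      (\int[sphere_measure n]_(x in unit_sphere n) (Omega x)%:E = 0)%E) ->
    (exists (E : set 'rV[R]_n) (c C : R),
      [/\ exists2 U : set 'rV[R]_n, open U & E = U `&` unit_sphere n,
          E !=set0,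
          0 < c < C \/ c < C < 0
        & forall x, E x -> c <= Omega x <= C]) ->
    (Lip beta b <-> commutator_bounded_Lp b alpha Omega p q) /\
    (commutator_bounded_Lp b alpha Omega p q <->
     commutator_bounded_morrey b alpha Omega p lambda q nu)) /\
  (forall Omega : 'rV[R]_n -> R,
    {within unit_sphere n, continuous Omega} ->
    (exists2 x, unit_sphere n x & Omega x != 0) ->
    homogeneous0 Omega ->
    (alpha = 0 ->
      (\int[sphere_measure n]_(x in unit_sphere n) (Omega x)%:E = 0)%E) ->
    (Lip beta b <-> commutator_bounded_Lp b alpha Omega p q) /\
    (commutator_bounded_Lp b alpha Omega p q <->
     commutator_bounded_morrey b alpha Omega p lambda q nu)).
Proof.
have lb := Lp_loc_locint hb.
split=> O.
  move=> LO _ hO mean [E [c [C [[U oU EU] [x0 Ex0] cC hE]]]].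
  have [Ux0 sx0] : (U `&` unit_sphere n) x0 by rewrite -EU.
  have hU x : (U `&` unit_sphere n) x -> c <= O x <= C by rewrite -EU; exact: hE.
  have [eta [c0 [C0 [sg [eta0 c00 sg1 cone]]]]] := cone_bound hO oU Ux0 sx0 cC hU.
  case: (bounded_representative hn LO hO) => O1 [M1 [H1 mO eO eOs]]; case: H1 => mO1 M0 OM hO1.
  apply: (commutator_equivalence hn hbeta halpha halphabeta hp hq hpq lb mO hnu hsum hlambda
    hO eta0 c00 sg1 cone mO1 M0 OM hO1 eO) => a0.
  apply: (integral_ball_0 hn mO1 M0 OM hO1).
  rewrite -(mean a0); apply: ae_eq_integral; first exact: measurable_unit_sphere.
  - by apply: measurable_funTS; apply/measurable_EFinP.
  - by apply: measurable_funTS; apply/measurable_EFinP.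
  - by apply: filterS eOs => x h _; rewrite (h I).
move=> cO [x0 sx0 Ox0] hO mean.
have mO := measurable_sphere_continuous cO hO.
have [M M0 OM] := bounded_sphere_continuous cO hO (ex_intro _ x0 sx0).
have [U [oU Ux0] [c [C [cC hU]]]] : exists2 U, open U /\ U x0 & exists c C : R,
    (0 < c < C \/ c < C < 0) /\ (forall x, (U `&` unit_sphere n) x -> c <= O x <= C).
  have [pos|neg] : 0 < O x0 \/ O x0 < 0 by apply/orP; rewrite orbC -neq_lt.
    have nP : nbhs (O x0) [set t | O x0 / 2 < t /\ t < 2 * O x0].
      have h1 : \forall t \near O x0, O x0 / 2 < t by apply: lt_nbhsr; rewrite ltr_pdivrMr// ltr_pMr// ltr1n.
      have h2 : \forall t \near O x0, t < 2 * O x0 by apply: lt_nbhsl; rewrite ltr_pMl// ltr1n.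
      by apply: filterS2 h1 h2 => t; split.
    have [U oU hU] := sphere_near cO sx0 nP; exists U => //; exists (O x0 / 2), (2 * O x0).
    split; first by left; rewrite divr_gt0//=; lra.
    by move=> y /hU[h1 h2]; rewrite (ltW h1) (ltW h2).
  have nP : nbhs (O x0) [set t | 2 * O x0 < t /\ t < O x0 / 2].
    have h1 : \forall t \near O x0, 2 * O x0 < t by apply: lt_nbhsr; lra.
    have h2 : \forall t \near O x0, t < O x0 / 2 by apply: lt_nbhsl; lra.
    by apply: filterS2 h1 h2 => t; split.
  have [U oU hU] := sphere_near cO sx0 nP; exists U => //; exists (2 * O x0), (O x0 / 2).
  split; first by right; apply/andP; split; lra.
  by move=> y /hU[h1 h2]; rewrite (ltW h1) (ltW h2).
have [eta [c0 [C0 [sg [eta0 c00 sg1 cone]]]]] := cone_bound hO oU Ux0 sx0 cC hU.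
have eO : O = O %[ae lebesgue_rV n] by apply: nearW => x _.
apply: (commutator_equivalence hn hbeta halpha halphabeta hp hq hpq lb mO hnu hsum hlambda
  hO eta0 c00 sg1 cone mO M0 OM hO eO) => a0.
by apply: (integral_ball_0 hn mO M0 OM hO); exact: mean.
Qed.
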